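(* Let $T$ be one of the $14$ classes of edge-transitive maps, let $n\ge 1$ be an integer and let $q$ be a prime power. Let $\mathcal{G}(T)$ denote the set of groups isomorphic to $\mathrm{Aut}\,\mathcal{M}$ for some map $\mathcal{M}$ in the class $T$. Then: (1) If $T=1$: $S_n\in\mathcal{G}(T)$ for all $n\ge 1$; $A_n\in\mathcal{G}(T)$ if and only if $n=1,2,5$ or $n\ge 9$; $L_2(q)\in\mathcal{G}(T)$ if and only if $q\ne 3,7,9$. (2) If $T=2,2^*$ or $2^P$: $S_n\in\mathcal{G}(T)$ if and only if $n\ge 2$; $A_n\in\mathcal{G}(T)$ if and only if $n\ge 5$; $L_2(q)\in\mathcal{G}(T)$ if and only if $q\ne 3$. (3) If $T=2\,\mathrm{ex},2^*\mathrm{ex}$ or $2^P\mathrm{ex}$: $S_n\in\mathcal{G}(T)$ if and only if $n\ge 6$; $A_n\in\mathcal{G}(T)$ if and only if $n\ge 8$; $L_2(q)\in\mathcal{G}(T)$ for no $q$. (4) If $T=3$: $S_n\in\mathcal{G}(T)$ if and only if $n\ge 2$; $A_n\in\mathcal{G}(T)$ if and only if $n\ge 5$; $L_2(q)\in\mathcal{G}(T)$ if and only if $q\ne 3$. (5) If $T=4,4^*$ or $4^P$: $S_n\in\mathcal{G}(T)$ if and only if $n\ge 2$; $A_n\in\mathcal{G}(T)$ if and only if $n\ge 4$; $L_2(q)\in\mathcal{G}(T)$ for every $q$. (6) If $T=5,5^*$ or $5^P$: $S_n\in\mathcal{G}(T)$ if and only if $n\ge 6$; $A_n\in\mathcal{G}(T)$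 if and only if $n\ge 7$; $L_2(q)\in\mathcal{G}(T)$ for no $q$.
   Context: Let $\Gamma=\langle R_0,R_1,R_2\mid R_i^2=(R_0R_2)^2=1\rangle$ and $E=\langle R_0,R_2\rangle\cong V_4$. A (connected) map $\mathcal{M}$ (possibly non-orientable, non-compact, or with non-empty boundary) is identified, up to isomorphism, with a transitive permutation representation of $\Gamma$ on a set $\Phi$ of flags, or equivalently with a conjugacy class of subgroups $M\le\Gamma$ (its map subgroups, the stabilisers of flags). Its vertices, edges and faces are the orbits on $\Phi$ of $\langle R_1,R_2\rangle$, $\langle R_0,R_2\rangle$ and $\langle R_0,R_1\rangle$. Its automorphism group $\mathrm{Aut}\,\mathcal{M}$ is the centraliser of $\Gamma$ in $\mathrm{Sym}\,\Phi$; it is isomorphic to $N_\Gamma(M)/M$. The map is edge-transitive if $\mathrm{Aut}\,\mathcal{M}$ is transitive on edges, equivalently $\Gamma=N_\Gamma(M)E$. There are $14$ conjugacy classes of subgroups $N\le\Gamma$ with $\Gamma=NE$, represented by the following subgroups $N(T)$. $N(1)=\Gamma$. Those of index $2$ are determined by which generators $R_i$ they contain: $N(2)$ contains exactly $R_1,R_2$; $N(2^* )$ exactly $R_0,R_1$; $N(2^P)$ exactly $R_1$; $N(2\,\mathrm{ex})$ exactly $R_2$; $N(2^*\mathrm{ex})$ exactly $R_0$; $N(2^P\mathrm{ex})$ none of them. Those of index $4$ are point stabilisers (defined up to conjugacy) in the actions of $\Gamma$ on $\{1,2,3,4\}$ with $R_0\mapsto(12)(34)$, $R_2\mapsto(14)(23)$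 and $R_1\mapsto$: identity for $T=3$; $(14)$ for $T=4$; $(12)$ for $T=4^*$; $(13)$ for $T=4^P$; $(14)(23)$ for $T=5$; $(12)(34)$ for $T=5^*$; $(13)(24)$ for $T=5^P$. An edge-transitive map $\mathcal{M}$ is in class $T$ if $N_\Gamma(M)$ is conjugate to $N(T)$. $S_n$ and $A_n$ are the symmetric and alternating groups of degree $n$, and $L_2(q)=PSL_2(q)$. *)

(* Defs.v *)
From HB Require Import structures.
From mathcomp Require Import all_boot all_order all_algebra all_fingroup.
From mathcomp Require Import all_solvable generic_quotient.
From mathcomp Require Import boolp classical_sets.

Set Implicit Arguments.
Unset Strict Implicit.
Unset Printing Implicit Defensive.

Import GroupScope.
Local Open Scope classical_set_scope.
Local Open Scope group_scope.
Local Open Scope quotient_scope.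

(* Groups given by generators and relators.  The letter (i, false) stands for
   the generator i and (i, true) for its inverse.                             *)
Section Presentation.
Variables (I : choiceType) (rels : set (seq (I * bool))).
Implicit Types u v w : seq (I * bool).

Definition inv_letter (x : I * bool) : I * bool := (x.1, ~~ x.2).
Definition inv_word w := rev (map inv_letter w).

Inductive word_eq : seq (I * bool) -> seq (I * bool) -> Prop :=
| word_eq_refl u : word_eq u u
| word_eq_sym u v : word_eq u v -> word_eq v u
| word_eq_trans v u w : word_eq u v -> word_eq v w -> word_eq u w
| word_eq_cat u u' v v' :
    word_eq u u' -> word_eq v v' -> word_eq (u ++ v) (u' ++ v')
| word_eq_cancel x : word_eq [:: x; inv_letter x] [::]
| word_eq_rel r : rels r -> word_eq r [::].

Definition word_eqb u v := `[< word_eq u v >].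

Lemma word_eqb_equiv : equiv_class_of word_eqb.
Proof.
split=> [u|u v|v u w].
- exact/asboolP/word_eq_refl.
- by apply/asboolP/asboolP; exact: word_eq_sym.
- by move=> /asboolP uv /asboolP vw; apply/asboolP; exact: word_eq_trans uv vw.
Qed.

Canonical word_eq_equiv := EquivRelPack word_eqb_equiv.

Definition presented := {eq_quot word_eqb}.

HB.instance Definition _ := Choice.on presented.

Definition word_class w : presented := \pi_presented w.

Lemma word_classP u v : word_class u = word_class v <-> word_eq u v.
Proof. by split=> [/eqmodP/asboolP | uv]; last exact/eqmodP/asboolP. Qed.

Lemma word_class_repr (x : presented) : word_class (repr x) = x.
Proof. exact: reprK. Qed.

Lemma word_eq_repr w : word_eq (repr (word_class w)) w.
Proof. by apply/word_classP; rewrite word_class_repr. Qed.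

Lemma inv_letterK : involutive inv_letter.
Proof. by case=> i b; rewrite /inv_letter /= negbK. Qed.

Lemma inv_wordK : involutive inv_word.
Proof. by move=> w; rewrite /inv_word map_rev revK mapK //; exact: inv_letterK. Qed.

Lemma word_eq_catV w : word_eq (w ++ inv_word w) [::].
Proof.
elim: w => [|x w IHw]; first exact: word_eq_refl.
rewrite /inv_word /= rev_cons -cats1 catA.
apply: word_eq_trans (word_eq_cancel x).
apply: (@word_eq_cat [:: x] [:: x] _ [:: inv_letter x]).
  exact: word_eq_refl.
apply: (@word_eq_cat _ [::]); first exact: IHw.
exact: word_eq_refl.
Qed.

Lemma word_eq_catVl w : word_eq (inv_word w ++ w) [::].
Proof. by rewrite -{2}[w]inv_wordK; exact: word_eq_catV. Qed.

Definition pres_one : presented := word_class [::].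
Definition pres_mul (x y : presented) := word_class (repr x ++ repr y).
Definition pres_inv (x : presented) := word_class (inv_word (repr x)).

Lemma pres_mulE u v :
  pres_mul (word_class u) (word_class v) = word_class (u ++ v).
Proof. by apply/word_classP/word_eq_cat; exact: word_eq_repr. Qed.

Lemma pres_mulA : associative pres_mul.
Proof.
move=> x y z; rewrite -(word_class_repr x) -(word_class_repr y).
by rewrite -(word_class_repr z) !pres_mulE catA.
Qed.

Lemma pres_mul1 : left_id pres_one pres_mul.
Proof. by move=> x; rewrite -(word_class_repr x) pres_mulE. Qed.

Lemma pres_1mul : right_id pres_one pres_mul.
Proof. by move=> x; rewrite -(word_class_repr x) pres_mulE cats0. Qed.

Lemma pres_mulV : left_inverse pres_one pres_inv pres_mul.
Proof.
move=> x; rewrite -{2}(word_class_repr x) pres_mulE.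
exact/word_classP/word_eq_catVl.
Qed.

Lemma pres_Vmul : right_inverse pres_one pres_inv pres_mul.
Proof.
move=> x; rewrite -{1}(word_class_repr x) pres_mulE.
exact/word_classP/word_eq_catV.
Qed.

HB.instance Definition _ := isGroup.Build presented
  pres_mulA pres_mul1 pres_1mul pres_mulV pres_Vmul.

Definition generator (i : I) : presented := word_class [:: (i, false)].

(* The universal property of the presentation. *)
Section Lift.
Variables (H : groupType) (f : I -> H).

Definition letter_val (x : I * bool) : H := if x.2 then (f x.1)^-1 else f x.1.
Definition word_val w : H := \prod_(x <- w) letter_val x.

Hypothesis f_rels : forall r, rels r -> word_val r = 1.

Lemma word_val_eq u v : word_eq u v -> word_val u = word_val v.
Proof.
elim=> [//|//|{}u {}v w _ -> _ -> //|u1 u2 v1 v2 _ eq_u _ eq_v|[i b]|r /f_rels ->].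
- by rewrite /word_val !big_cat /= -!/(word_val _) eq_u eq_v.
- rewrite /word_val !big_cons big_nil mulg1 /letter_val /=.
  by case: b; rewrite ?mulVg ?mulgV.
- by rewrite /word_val big_nil.
Qed.

Definition pres_lift (x : presented) : H := word_val (repr x).

Lemma pres_liftM : {morph pres_lift : x y / x * y}.
Proof.
move=> x y; rewrite /pres_lift (word_val_eq (word_eq_repr _)).
by rewrite /word_val big_cat.
Qed.

Lemma pres_lift_generator i : pres_lift (generator i) = f i.
Proof.
rewrite /pres_lift (word_val_eq (word_eq_repr _)).
by rewrite /word_val big_seq1.
Qed.

End Lift.

End Presentation.

Section Subgroups.
Variable G : groupType.
Implicit Types (A H : set G) (g : G).

Definition is_subgroup H := H 1 /\ (forall x y, H x -> H y -> H (x * y^-1)).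

Definition gen_subgroup A : set G :=
  [set x | forall H, is_subgroup H -> A `<=` H -> H x].

Definition conj_set H g : set G := [set x ^ g | x in H].

Definition is_conjugate H1 H2 := exists g, conj_set H1 g = H2.

Definition normaliser_of H : set G := [set g | conj_set H g = H].

Definition index2 H :=
  is_subgroup H /\ exists2 g, ~ H g & forall x, H x \/ H (g^-1 * x).

Definition centraliser_of A : set G :=
  [set x | forall a, A a -> commute x a].

End Subgroups.

(* The symmetric group on an arbitrary type; as for {perm T}, permutations
   compose from left to right.                                                *)
Section SymmetricGroup.
Variable X : Type.

Record sym := Sym {
  sym_fun :> X -> X;
  sym_inv : X -> X;
  sym_funK : cancel sym_fun sym_inv;
  sym_invK : cancel sym_inv sym_fun }.

HB.instance Definition _ := gen_eqMixin sym.
HB.instance Definition _ := gen_choiceMixin sym.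

Lemma symP (f g : sym) : f =1 g -> f = g.
Proof.
case: f g => [f f' fK f'K] [g g' gK g'K] /= fg.
have {}fg : f = g by exact/funext.
case: _ / fg in gK g'K *.
have fg' : f' = g' by apply/funext => x; rewrite -[x in RHS]f'K gK.
case: _ / fg' in gK g'K *.
by congr Sym; exact: Prop_irrelevance.
Qed.

Definition sym_one : sym := @Sym id id (fun=> erefl) (fun=> erefl).
Definition sym_mul (f g : sym) :=
  Sym (can_comp (@sym_funK g) (@sym_funK f))
      (can_comp (@sym_invK f) (@sym_invK g)).
Definition sym_V (f : sym) := Sym (@sym_invK f) (@sym_funK f).

Lemma sym_mulA : associative sym_mul. Proof. by move=> f g h; exact: symP. Qed.
Lemma sym_mul1 : left_id sym_one sym_mul. Proof. by move=> f; exact: symP. Qed.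
Lemma sym_1mul : right_id sym_one sym_mul. Proof. by move=> f; exact: symP. Qed.
Lemma sym_mulV : left_inverse sym_one sym_V sym_mul.
Proof. by move=> f; apply: symP => x; exact: sym_invK. Qed.
Lemma sym_Vmul : right_inverse sym_one sym_V sym_mul.
Proof. by move=> f; apply: symP => x; exact: sym_funK. Qed.

HB.instance Definition _ := isGroup.Build sym
  sym_mulA sym_mul1 sym_1mul sym_mulV sym_Vmul.

End SymmetricGroup.

Definition o0 : 'I_3 := @Ordinal 3 0 isT.
Definition o1 : 'I_3 := @Ordinal 3 1 isT.
Definition o2 : 'I_3 := @Ordinal 3 2 isT.

Definition Gamma_rels : set (seq ('I_3 * bool)) :=
  [set w | (exists i, w = [:: (i, false); (i, false)]) \/
           w = [:: (o0, false); (o2, false); (o0, false); (o2, false)]].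

Definition Gamma : groupType := presented Gamma_rels.

Definition R (i : 'I_3) : Gamma := generator Gamma_rels i.

Definition E : set Gamma := gen_subgroup [set R o0; R o2].

(* A map, given by the action of Gamma on its flags.  The generators may have
   fixed points, and the set of flags may be infinite.                        *)
Record gmap := GMap {
  flag : Type;
  map_act : Gamma -> sym flag;
  map_actM : {morph map_act : g h / g * h};
  map_inhabited : inhabited flag;
  map_trans : forall x y : flag, exists g, map_act g x = y }.

Section Maps.
Variable M : gmap.

Definition map_subgroup (x : flag M) : set Gamma := [set g | map_act M g x = x].

Definition edge (x : flag M) : set (flag M) := [set map_act M g x | g in E].

Definition Aut_map : set (sym (flag M)) := centraliser_of (range (map_act M)).

Definition edge_transitive :=
  forall x y : flag M, exists2 f, Aut_map f & [set f z | z in edge x] = edge y.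

End Maps.

(* The suffix s stands for the star of 2*, 2*ex, 4* and 5*. *)
Inductive map_class :=
  | T1 | T2 | T2s | T2P | T2ex | T2sex | T2Pex
  | T3 | T4 | T4s | T4P | T5 | T5s | T5P.

Definition index2_with (A : seq 'I_3) (H : set Gamma) :=
  index2 H /\ forall i, H (R i) <-> i \in A.

(* The point k of {1, 2, 3, 4} is represented by k - 1 in 'I_4. *)
Definition p1 : 'I_4 := @Ordinal 4 0 isT.
Definition p2 : 'I_4 := @Ordinal 4 1 isT.
Definition p3 : 'I_4 := @Ordinal 4 2 isT.
Definition p4 : 'I_4 := @Ordinal 4 3 isT.

Definition stabiliser_with (s1 : 'S_4) (H : set Gamma) :=
  exists rho : Gamma -> 'S_4,
    [/\ {morph rho : g h / g * h},
        rho (R o0) = tperm p1 p2 * tperm p3 p4,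
        rho (R o1) = s1,
        rho (R o2) = tperm p1 p4 * tperm p2 p3 &
        exists x, H = [set g | rho g x = x]].

(* H is one of the (mutually conjugate) choices for the subgroup N(T). *)
Definition represents (T : map_class) : set Gamma -> Prop :=
  match T with
  | T1 => fun H => H = setT
  | T2 => index2_with [:: o1; o2]
  | T2s => index2_with [:: o0; o1]
  | T2P => index2_with [:: o1]
  | T2ex => index2_with [:: o2]
  | T2sex => index2_with [:: o0]
  | T2Pex => index2_with [::]
  | T3 => stabiliser_with 1
  | T4 => stabiliser_with (tperm p1 p4)
  | T4s => stabiliser_with (tperm p1 p2)
  | T4P => stabiliser_with (tperm p1 p3)
  | T5 => stabiliser_with (tperm p1 p4 * tperm p2 p3)
  | T5s => stabiliser_with (tperm p1 p2 * tperm p3 p4)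
  | T5P => stabiliser_with (tperm p1 p3 * tperm p2 p4)
  end.

Definition in_class (T : map_class) (M : gmap) :=
  edge_transitive M /\
  exists (x : flag M) (N : set Gamma),
    represents T N /\ is_conjugate (normaliser_of (map_subgroup x)) N.

Definition isomorphic_to (G K : groupType) (H : set K) :=
  exists phi : G -> K,
    [/\ {morph phi : x y / x * y}, injective phi & range phi = H].

(* Membership of G in the set of groups written G(T). *)
Definition realised (T : map_class) (G : groupType) :=
  exists M : gmap, in_class T M /\ isomorphic_to G (@Aut_map M).

Section PSL2.
Variable F : finFieldType.
Local Open Scope ring_scope.

Definition SL2 : {set {'GL_2[F]}} := [set u | \det (GLval u) == 1]%SET.

Lemma SL2_group_set : group_set SL2.
Proof.
apply/group_setP; split=> [|u v]; rewrite !inE ?GL_1E ?det1 //.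
by rewrite GL_ME det_mulmx => /eqP-> /eqP->; rewrite GRing.mul1r.
Qed.

Canonical SL2_group := Group SL2_group_set.

Definition L2 : finGroupType := subg_of (SL2_group / 'Z(SL2_group))%G.

End PSL2.

Definition Sn (n : nat) : finGroupType := 'S_n.
Definition An (n : nat) : finGroupType := subg_of (Alt_group 'I_n).

(* Main.v *)
From mathcomp Require Import all_boot all_algebra all_fingroup all_solvable all_field.
From mathcomp Require Import generic_quotient ring zify.
From mathcomp Require Import boolp classical_sets.
Require Import Defs.

(** An edge-transitive map in the class [T] with automorphism group [G] is the
    same thing as an epimorphism from [N(T)] onto [G] whose kernel is
    normalised by no element of [Gamma] outside [N(T)]; the flags of the map
    are then the cosets of the kernel ([realisedP]). As [Gamma] is the free
    product of a four-group and a group of order 2, every [N(T)] other than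
    [Gamma] is a free product of groups of order 2 and infinite cyclic groups.
    Those involutions of [E] outside [N(T)] which normalise [N(T)] permute the
    standard generators of these factors up to inversion, and one of them
    normalises the kernel exactly when the images of the generators are
    permuted in the same way by an automorphism of [G] ([twistP]). So [G] is
    realised if and only if it has a generating tuple, with relations as in
    [N(T)], which no automorphism permutes in certain ways: these are the
    conditions [crit1], [crit2], [crit2ex], [crit3], [crit4], [crit5]. There
    are only six of them, because the automorphisms of [Gamma] which permute
    [R0], [R2] and [R0 R2] carry [T], T* and T^P to each other ([frame]).

    Three generating involutions [x], [y], [z] such that [x] commutes with [y]
    and not with [z] serve the classes 1, 2, 3 and 4 at the same time, since
    no automorphism can fix [x] and exchange [y] with [z]. In the symmetric
    and alternating groups such a triple consists of two reflections of a
    regular polygon with almost all points as vertices, and of a product of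
    few transpositions, chosen so that a short word in the group is a 3-cycle;
    the rotation carries this 3-cycle around the polygon, and the 3-cycles
    obtained generate the alternating group ([linked_Alt]). For the classes
    2ex and 5, a product of two transpositions and a cycle [s] of length [n]
    or [n - 1] are used: the order of one of their words changes when [s] is
    replaced by its inverse ([chiral_pair]). In small degrees the generators
    are explicit permutations.

    In [L_2(q)] the triple consists of the images of [w = (0 1; -1 0)], of a
    symmetric matrix [B] of trace 0, and of [w h], where [h] generates the
    diagonal torus. They generate as soon as the group which they generate has
    two elements which agree on one of the two points of the projective line
    fixed by the torus and not on the other, for then it contains a
    transvection ([over_all]). Such elements exist by counting roots of
    polynomials if [q > 11] or if [q > 2] is even; the other fields need
    individual choices.

    Conversely, two generators of [L_2(q)] are both inverted by conjugation by
    [AB - BA], if [A] and [B] represent them ([L2_pairs_inverted]). For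
    [q = 3] the involutions generate a proper subgroup. For [q = 7] and
    [q = 9] the involutions act as half-turns on the space of matrices of
    trace 0; two commuting ones have perpendicular axes, and there are so few
    squares that the axis of the third one is perpendicular to one of the
    frame so obtained, or all three half-turns are symmetries of a cube or of
    an icosahedron. So the group which they generate permutes fewer than [q]
    lines, which [L_2(q)] does not ([no_small_invariant]). For the remaining
    symmetric and alternating groups of small degree there are only finitely
    many tuples, which are enumerated up to conjugacy: either some permutation
    inverts both members of a pair, where in degree 6 the group acts on ten
    points, or all members preserve a set of tuples or of subsets which the
    alternating group does not preserve. *)

Set Implicit Arguments.
Unset Strict Implicit.
Unset Printing Implicit Defensive.

Import GroupScope GRing.Theory.

Local Open Scope classical_set_scope.
Local Open Scope group_scope.

(** * Subgroups and conjugation *)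

Section SubgroupTheory.
Variable G : groupType.
Implicit Types (A H : set G) (g x y : G).

Lemma subgroup1 H : is_subgroup H -> H 1. Proof. by case. Qed.

Lemma subgroupV H x : is_subgroup H -> H x -> H x^-1.
Proof. by move=> [H1 HB] Hx; rewrite -[x^-1]mul1g; apply: HB. Qed.

Lemma subgroupM H x y : is_subgroup H -> H x -> H y -> H (x * y).
Proof.
move=> sH Hx Hy; have [_ HB] := sH.
by rewrite -[y]invgK; apply: HB => //; apply: subgroupV.
Qed.

Lemma subgroupMr H x y : is_subgroup H -> H y -> H (x * y) -> H x.
Proof. by move=> [_ HB] Hy Hxy; rewrite -(mulgK y x); apply: HB. Qed.

Lemma subgroupMl H x y : is_subgroup H -> H x -> H (x * y) -> H y.
Proof.
move=> sH Hx Hxy; rewrite -(mulKg x y).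
by apply: subgroupM => //; apply: subgroupV.
Qed.

Lemma gen_subgroupP A : is_subgroup (gen_subgroup A).
Proof.
split=> [H sH _|x y Ax Ay H sH sAH]; first exact: subgroup1.
by have [_ HB] := sH; apply: HB; [apply: Ax | apply: Ay].
Qed.

Lemma mem_gen_subgroup A : A `<=` gen_subgroup A.
Proof. by move=> x Ax H _; apply. Qed.

Lemma conj_setM A g h : conj_set (conj_set A g) h = conj_set A (g * h).
Proof.
apply/seteqP; split=> z.
  by case=> _ [x Ax <-] <-; exists x; rewrite ?conjgM.
by case=> x Ax <-; exists (x ^ g); [exists x | rewrite conjgM].
Qed.

Lemma conj_set1 A : conj_set A 1 = A.
Proof.
apply/seteqP; split=> z; first by case=> x Ax <-; rewrite conjg1.
by move=> Az; exists z; rewrite ?conjg1.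
Qed.

Lemma conj_set_sub A g : (forall x, A x -> A (x ^ g)) ->
  (forall x, A x -> A (x ^ g^-1)) -> conj_set A g = A.
Proof.
move=> Ag AgV; apply/seteqP; split=> z; first by case=> x /Ag + <-.
by move=> /AgV Az; exists (z ^ g^-1); rewrite ?conjgKV.
Qed.

Lemma normaliser_subgroup A : is_subgroup (normaliser_of A).
Proof.
split=> [|x y]; rewrite /normaliser_of /=; first exact: conj_set1.
by move=> Ax Ay; rewrite -conj_setM Ax -[in LHS]Ay conj_setM mulgV conj_set1.
Qed.

Lemma normaliser_conj A g :
  normaliser_of (conj_set A g) = conj_set (normaliser_of A) g.
Proof.
apply/seteqP; split=> z; rewrite /normaliser_of /=.
  move=> Az; exists (z ^ g^-1); last by rewrite conjgKV.
  rewrite /= conjgE invgK -!conj_setM -[in RHS](conj_set1 A) -(mulgV g).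
  by rewrite -!conj_setM Az.
case=> x /= Ax <-; rewrite !conj_setM conjgE !mulgA mulgV mul1g.
by rewrite -conj_setM Ax.
Qed.

Lemma normaliserE A g x : normaliser_of A g -> A x -> A (x ^ g).
Proof. by move=> Ag Ax; rewrite -Ag; exists x. Qed.

End SubgroupTheory.

(** * Flags and automorphisms of a map *)

Section MapTheory.
Variable M : gmap.
Implicit Types (x y z : flag M) (g h : Gamma) (f : sym (flag M)).

Lemma map_actMx g h x : map_act M (g * h) x = map_act M h (map_act M g x).
Proof. by rewrite map_actM. Qed.

Lemma map_act1 x : map_act M 1 x = x.
Proof.
have : map_act M 1 * map_act M 1 = map_act M 1 * 1.
  by rewrite -map_actM !mulg1.
by move/mulgI->.
Qed.

Lemma map_actK g x : map_act M g^-1 (map_act M g x) = x.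
Proof. by rewrite -map_actMx mulgV map_act1. Qed.

Lemma map_subgroup_act g x :
  map_subgroup (map_act M g x) = conj_set (map_subgroup x) g.
Proof.
apply/seteqP; split=> h; rewrite /map_subgroup /=.
  move=> hx; exists (h ^ g^-1); rewrite ?conjgKV //= conjgE invgK.
  by rewrite !map_actMx hx map_actK.
by case=> k /= kx <-; rewrite conjgE !map_actMx map_actK kx.
Qed.

Lemma AutP f : Aut_map f <-> forall g x, f (map_act M g x) = map_act M g (f x).
Proof.
split=> [af g x|fM _ [g _ <-]]; last by apply: symP => x /=; rewrite fM.
have /(congr1 (fun p : sym _ => p x)) /= := af _ (ex_intro2 _ _ g I erefl).
by move->.
Qed.

Lemma Aut_subgroup : is_subgroup (@Aut_map M).
Proof.
split; first by apply/AutP.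
move=> f1 f2 /AutP fM /AutP hM; apply/AutP => g x /=.
by rewrite fM -[in LHS](sym_invK f2 (f1 x)) -hM sym_funK.
Qed.

Lemma Aut_eq (f1 f2 : sym (flag M)) y :
  Aut_map f1 -> Aut_map f2 -> f1 y = f2 y -> f1 = f2.
Proof.
move=> /AutP fM /AutP hM fhy; apply: symP => z.
by have [g <-] := map_trans y z; rewrite fM hM fhy.
Qed.

(** A flag and its image under an automorphism have the same stabiliser, so
    the elements of Gamma which move a flag as an automorphism does are those
    which normalise its stabiliser. *)
Lemma Aut_normaliser f g y :
  Aut_map f -> f y = map_act M g y -> normaliser_of (map_subgroup y) g.
Proof.
move=> /AutP fM fy; rewrite /normaliser_of /= -map_subgroup_act -fy.
apply/seteqP; split=> h; rewrite /map_subgroup /= -fM.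
  by move/(can_inj (sym_funK f)).
by move->.
Qed.

(** The flags are the [y h], so [y h -> y n h] is the required automorphism;
    it is well defined because [n] normalises the stabiliser of [y]. *)
Lemma normaliser_Aut n y : normaliser_of (map_subgroup y) n ->
  exists2 f, Aut_map f & f y = map_act M n y.
Proof.
pose p z := sval (cid (map_trans y z)).
have pP z : map_act M (p z) y = z by rewrite /p; case: cid.
pose F m z := map_act M (m * p z) y.
have FE m g : normaliser_of (map_subgroup y) m ->
    F m (map_act M g y) = map_act M (m * g) y.
  move=> Nm; rewrite /F; set h := p _.
  have {}hP : map_act M h y = map_act M g y by rewrite pP.
  have sh : map_subgroup y (h * g^-1).
    by rewrite /map_subgroup /= map_actMx hP map_actK.
  have [_ /(_ _ _ (subgroup1 (normaliser_subgroup _)) Nm)] :=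
    normaliser_subgroup (map_subgroup y).
  rewrite mul1g => /(@normaliserE _ _ _ _)/(_ sh).
  rewrite /map_subgroup /= conjgE invgK => e.
  rewrite -[in RHS]e -map_actMx; congr (map_act M _ y).
  by rewrite !mulgA !mulgVK.
move=> Nn; have Nn' := subgroupV (normaliser_subgroup _) Nn.
have K m : normaliser_of (map_subgroup y) m -> cancel (F m) (F m^-1).
  move=> Nm z; rewrite -(pP z) FE // FE ?mulKg //.
  exact: subgroupV (normaliser_subgroup _) Nm.
have K' : cancel (F n^-1) (F n) by rewrite -[n in X in cancel _ X]invgK; apply: K.
exists (Defs.Sym (K _ Nn) K'); last by rewrite /= -[y in F _ y]map_act1 FE ?mulg1.
apply/AutP => g x /=; rewrite -(pP x) -map_actMx !FE // -map_actMx.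
by rewrite mulgA.
Qed.

End MapTheory.

(** * Automorphism groups as images of normalisers *)

Definition epi_on (G : groupType) (N : set Gamma) (theta : Gamma -> G) :=
  [/\ is_subgroup N,
      forall g h, N g -> N h -> theta (g * h) = theta g * theta h
    & forall x, exists2 n, N n & theta n = x].

Definition ker_on (G : groupType) (N : set Gamma) (theta : Gamma -> G) :=
  [set n | N n /\ theta n = 1].

Section EpiOn.
Variables (G : groupType) (N : set Gamma) (theta : Gamma -> G).
Hypothesis epi : epi_on N theta.

Lemma epi_on1 : theta 1 = 1.
Proof.
have [sN tM _] := epi; have N1 := subgroup1 sN.
by apply: (@mulgI _ (theta 1)); rewrite -tM // !mulg1.
Qed.

Lemma epi_onV g : N g -> theta g^-1 = (theta g)^-1.
Proof.
have [sN tM _] := epi => Ng; apply: (@mulgI _ (theta g)).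
by rewrite -tM ?mulgV ?epi_on1 //; apply: subgroupV.
Qed.

Lemma epi_on_inj g h : N g -> N h -> theta g = theta h ->
  ker_on N theta (g * h^-1).
Proof.
have [sN tM _] := epi => Ng Nh e; have NV := subgroupV sN Nh.
by split; [apply: subgroupM | rewrite tM // epi_onV // e mulgV].
Qed.

Lemma ker_on_subgroup : is_subgroup (ker_on N theta).
Proof.
split; first by split; [case: epi => /subgroup1 | apply: epi_on1].
by move=> x y [Nx tx] [Ny ty]; apply: epi_on_inj; rewrite // tx ty.
Qed.

Lemma ker_on_normal g : N g -> normaliser_of (ker_on N theta) g.
Proof.
have [sN tM _] := epi.
have kJ h k : N h -> ker_on N theta k -> ker_on N theta (k ^ h).
  move=> Nh [Nk tk]; have NV := subgroupV sN Nh.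
  have Nkh : N (k * h) by apply: subgroupM.
  rewrite conjgE; split; first exact: subgroupM.
  by rewrite !tM // tk mul1g epi_onV // mulVg.
move=> Ng; apply: conj_set_sub => k; apply: kJ => //.
exact: subgroupV sN Ng.
Qed.

End EpiOn.

(** Each automorphism of a map is determined by where it sends one flag [y],
    and it may send [y] to the flags [y n] with [n] in the normaliser of the
    stabiliser of [y]; sending [n] to the inverse of the automorphism which
    carries [y] to [y n] is then an epimorphism. *)
Lemma Aut_map_epi (M : gmap) (y : flag M) (G : groupType) :
  isomorphic_to G (@Aut_map M) ->
  exists2 theta : Gamma -> G, epi_on (normaliser_of (map_subgroup y)) theta
    & ker_on (normaliser_of (map_subgroup y)) theta = map_subgroup y.
Proof.
case=> phi [phiM phi_inj phi_im]; set N := normaliser_of _.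
have sN : is_subgroup N by exact: normaliser_subgroup.
have phiA x : Aut_map (phi x) by rewrite -phi_im; exists x.
have phi1 : phi 1 = 1.
  by apply: (@mulgI _ (phi 1)); rewrite -phiM !mulg1.
have ex n : N n -> exists x, phi x y = map_act M n y.
  case/normaliser_Aut=> f + fy; rewrite -phi_im => -[x _ phix].
  by exists x; rewrite phix.
pose th n := if pselect (N n) is left Nn then sval (cid (ex n Nn)) else 1.
have thP n : N n -> phi (th n) y = map_act M n y.
  by rewrite /th; case: pselect => // Nn _; case: cid.
have phi_eq a b : phi a y = phi b y -> a = b.
  by move=> e; apply: phi_inj; apply: (Aut_eq _ _ e).
exists (fun n => (th n)^-1).
  split=> // [g h Ng Nh|x].
    rewrite -invgM; congr _^-1; apply: phi_eq; rewrite phiM /=.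
    rewrite thP //; last exact: subgroupM.
    rewrite (thP h) //; have /AutP-> := phiA (th g).
    by rewrite thP // -map_actMx.
  have [n ny] := map_trans y (phi x^-1 y); exists n.
    exact: Aut_normaliser (phiA x^-1) (esym ny).
  apply: invg_inj; rewrite invgK; apply: phi_eq; rewrite thP ?ny //.
  exact: Aut_normaliser (phiA x^-1) (esym ny).
apply/seteqP; split=> n; rewrite /ker_on /map_subgroup /=.
  by case=> Nn /eqP; rewrite invg_eq1 => /eqP e; rewrite -thP // e phi1.
move=> ny; have Nn : N n.
  by apply: (@Aut_normaliser _ 1); [apply: subgroup1 (Aut_subgroup _) | rewrite ny].
split=> //; apply/eqP; rewrite invg_eq1; apply/eqP.
by apply: phi_eq; rewrite thP // phi1 ny.
Qed.

(** The inverse construction: a value [x] of [theta] determines the elements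
    of the normaliser above it up to the stabiliser of [y], hence the flag
    to which they move [y], hence an automorphism. The inverse in its
    definition makes the map a homomorphism rather than an antihomomorphism. *)
Lemma epi_Aut_map (M : gmap) (y : flag M) (G : groupType) (theta : Gamma -> G) :
  epi_on (normaliser_of (map_subgroup y)) theta ->
  ker_on (normaliser_of (map_subgroup y)) theta = map_subgroup y ->
  isomorphic_to G (@Aut_map M).
Proof.
set N := normaliser_of _ => epi ker; have [sN tM tE] := epi.
pose n x := sval (cid2 (tE x)).
have Nn x : N (n x) by rewrite /n; case: cid2.
have tn x : theta (n x) = x by rewrite /n; case: cid2.
have act_eq g h : N g -> N h -> theta g = theta h -> map_act M g y = map_act M h y.
  move=> Ng Nh e; have : ker_on N theta (g * h^-1) by apply: epi_on_inj.
  rewrite ker /map_subgroup /= => sy.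
  by rewrite -[in RHS]sy -map_actMx mulgVK.
pose f x := sval (cid2 (normaliser_Aut (Nn x^-1))).
have fA x : Aut_map (f x) by rewrite /f; case: cid2.
have fy x : f x y = map_act M (n x^-1) y by rewrite /f; case: cid2.
exists f; split=> [a b|a b ab|].
- apply: (@Aut_eq _ _ _ y) => //.
    by rewrite -[f b]invgK; apply: (proj2 (Aut_subgroup M)) => //;
       apply: subgroupV (fA b); apply: Aut_subgroup.
  have /AutP fM := fA b; rewrite /= !fy fM fy -map_actMx.
  apply: act_eq; [exact: Nn | by apply: subgroupM | ].
  by rewrite tM // !tn invgM.
- have /(congr1 (fun h : sym _ => h y)) := ab; rewrite !fy => e.
  have : ker_on N theta (n a^-1 * (n b^-1)^-1).
    by rewrite ker /map_subgroup /= map_actMx e map_actK.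
  case=> _; rewrite tM ?(epi_onV epi) // ?tn; last exact: subgroupV.
  by rewrite invgK => /(congr1 (mulg a)); rewrite mulgA mulgV mul1g mulg1.
- apply/seteqP; split=> h; first by case=> x _ <-.
  move=> hA; have [g gy] := map_trans y (h y).
  have Ng : N g by apply: Aut_normaliser hA (esym gy).
  exists (theta g)^-1 => //; apply: (@Aut_eq _ _ _ y) => //.
  by rewrite fy -gy; apply: act_eq; rewrite // tn invgK.
Qed.

(** * The map on the cosets of a subgroup *)

Section CosetMap.
Variable K : set Gamma.
Hypothesis sK : is_subgroup K.

Definition rcoset_of (g : Gamma) : set Gamma := [set x | K (x * g^-1)].
Definition cosets := {A : set Gamma | exists g, A = rcoset_of g}.

Definition translate (h : Gamma) (A : set Gamma) : set Gamma :=
  [set x | A (x * h^-1)].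

Lemma translate_rcoset h g : translate h (rcoset_of g) = rcoset_of (g * h).
Proof. by rewrite /translate /rcoset_of; apply/funext=> x /=; rewrite invgM mulgA. Qed.

Lemma translateM g h A : translate (g * h) A = translate h (translate g A).
Proof. by rewrite /translate; apply/funext=> x /=; rewrite invgM mulgA. Qed.

Lemma translate1 A : translate 1 A = A.
Proof. by rewrite /translate; apply/funext=> x /=; rewrite invg1 mulg1. Qed.

Lemma translate_subproof h (A : cosets) :
  exists g, translate h (sval A) = rcoset_of g.
Proof. by case: A => A [g eA]; exists (g * h); rewrite /= eA translate_rcoset. Qed.

Definition coset_act_fun h (A : cosets) : cosets :=
  exist _ (translate h (sval A)) (translate_subproof h A).

Lemma coset_eq (A B : cosets) : sval A = sval B -> A = B.
Proof.
case: A B => [A a] [B b] /= e; case: _ / e in b *.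
by congr exist; exact: Prop_irrelevance.
Qed.

Lemma coset_actK h : cancel (coset_act_fun h) (coset_act_fun h^-1).
Proof. by move=> A; apply: coset_eq; rewrite /= -translateM mulgV translate1. Qed.

Lemma coset_actVK h : cancel (coset_act_fun h^-1) (coset_act_fun h).
Proof. by move=> A; apply: coset_eq; rewrite /= -translateM mulVg translate1. Qed.

Definition coset_act h : sym cosets :=
  Defs.Sym (coset_actK h) (coset_actVK h).

Lemma coset_actM : {morph coset_act : g h / g * h}.
Proof.
by move=> g h; apply: symP => A; apply: coset_eq; rewrite /= translateM.
Qed.

Definition base_coset : cosets := exist _ (rcoset_of 1) (ex_intro _ 1 erefl).

Lemma coset_inhabited : inhabited cosets. Proof. by split; exact: base_coset. Qed.

Lemma coset_trans (x y : cosets) : exists g, coset_act g x = y.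
Proof.
case: x y => [A [g eA]] [B [h eB]]; exists (g^-1 * h); apply: coset_eq => /=.
by rewrite eA eB translate_rcoset mulVKg.
Qed.

Definition coset_map : gmap := GMap coset_actM coset_inhabited coset_trans.

Lemma coset_map_subgroup : map_subgroup (base_coset : flag coset_map) = K.
Proof.
apply/seteqP; split=> g; rewrite /map_subgroup /=.
  move/(congr1 (fun A : cosets => sval A g)) => /=.
  rewrite translate_rcoset mul1g /rcoset_of /= mulgV invg1 mulg1 => <-.
  exact: subgroup1.
move=> Kg; apply: coset_eq; rewrite /= translate_rcoset mul1g.
apply/seteqP; split=> x; rewrite /rcoset_of /= invg1 mulg1.
  by move=> Kx; rewrite -(mulgVK g x); apply: subgroupM.
by move=> Kx; apply: (proj2 sK).
Qed.

End CosetMap.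

(** * Realisation by epimorphisms *)

Definition spans (N : set Gamma) :=
  forall g, exists n e, [/\ N n, E e & g = n * e].

(** Maps with a chosen flag are the same thing as subgroups of [Gamma], by the
    action on cosets, and the automorphisms were identified above.  The edges
    are the E-orbits, so edge-transitivity is the condition [Gamma = N E]. *)
Theorem realisedP (T : map_class) (G : groupType) :
  (forall N, represents T N -> spans N) ->
  realised T G <-> exists N (theta : Gamma -> G),
    [/\ represents T N, epi_on N theta & normaliser_of (ker_on N theta) = N].
Proof.
move=> spanT; split.
  case=> M [[_ [x [N [repN [g conjN]]]]] isoG].
  pose y : flag M := map_act M g x.
  have NE : normaliser_of (map_subgroup y) = N.
    by rewrite map_subgroup_act normaliser_conj.
  have [theta epi ker] := Aut_map_epi y isoG.
  by rewrite NE in epi ker; exists N, theta; split; rewrite // ker.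
case=> N [theta [repN epi normN]].
pose K := ker_on N theta; have sK : is_subgroup K := ker_on_subgroup epi.
pose M := coset_map K; pose y : flag M := base_coset K.
have yK : map_subgroup y = K := coset_map_subgroup sK.
exists M; split; last first.
  by apply: (@epi_Aut_map _ y _ theta); rewrite yK normN.
split; last first.
  by exists y, N; split => //; exists 1; rewrite conj_set1 yK.
have edgeE e z : E e -> edge (map_act M e z) = edge z.
  move=> Ee; have sE : is_subgroup E := gen_subgroupP _.
  apply/seteqP; split=> w [h Eh <-].
    exists (e * h); first exact: (subgroupM sE Ee Eh).
    by rewrite map_actMx.
  exists (e^-1 * h); last by rewrite -map_actMx mulVKg.
  exact: (subgroupM sE (subgroupV sE Ee) Eh).
have edge_y x : exists2 f, Aut_map f & [set f w | w in edge y] = edge x.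
  have [g <-] := map_trans y x; have [n [e [Nn Ee ->]]] := spanT N repN g.
  have : normaliser_of (map_subgroup y) n by rewrite yK normN.
  case/normaliser_Aut=> f fA fy; exists f => //.
  rewrite map_actMx edgeE // -fy; have /AutP fM := fA.
  apply/seteqP; split=> w.
    by case=> _ [h Eh <-] <-; exists h; rewrite // fM.
  by case=> h Eh <-; exists (map_act M h y); [exists h | rewrite fM].
move=> x z; have [f fA fx] := edge_y x; have [h hA hz] := edge_y z.
exists (f^-1 * h).
  have sA := Aut_subgroup M.
  exact: (subgroupM sA (subgroupV sA fA) hA).
rewrite -fx -hz; apply/seteqP; split=> w.
  case=> _ [v yv <-] <-; exists v => //=.
  by rewrite [sym_inv f _](sym_funK f).
case=> v yv <-; exists (f v); first by exists v.
by rewrite /= [sym_inv f _](sym_funK f).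
Qed.

(** * Presentations of the group Gamma *)

Lemma R_sq i : R i * R i = 1.
Proof.
rewrite /R /generator [LHS]pres_mulE; apply/word_classP.
by apply: word_eq_rel; left; exists i.
Qed.

Lemma R02_comm : R o0 * R o2 = R o2 * R o0.
Proof.
have e : R o0 * R o2 * (R o0 * R o2) = 1.
  rewrite /R /generator [X in X * X]pres_mulE [LHS]pres_mulE.
  by apply/word_classP/word_eq_rel; right.
have RV i : (R i)^-1 = R i by apply: mulg1_eq; rewrite R_sq.
by move/mulg1_eq: e; rewrite invgM !RV => ->.
Qed.

Lemma Gamma_ind (P : Gamma -> Prop) :
  P 1 -> (forall g i, P g -> P (g * R i)) -> forall g, P g.
Proof.
move=> P1 PR g; rewrite -(word_class_repr g).
elim/last_ind: (repr g) => [//|w [i b] IHw].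
suff -> : word_class Gamma_rels (rcons w (i, b)) =
          (word_class Gamma_rels w : Gamma) * R i by apply: PR.
rewrite /R /generator [RHS]pres_mulE -cats1; case: b => //.
apply/word_classP/word_eq_cat; first exact: word_eq_refl.
have rr : word_eq Gamma_rels [:: (i, false); (i, false)] [::].
  by apply: word_eq_rel; left; exists i.
have h := @word_eq_cat _ Gamma_rels [:: (i, true)] [:: (i, true)] _ _
            (word_eq_refl _ _) rr.
apply: word_eq_trans (word_eq_sym h) _.
rewrite -[X in word_eq _ _ X]cat0s -[[:: (i, true)] ++ _]/([:: (i, true); (i, false)] ++ [:: (i, false)]).
apply: word_eq_cat; last exact: word_eq_refl.
exact: (@word_eq_cancel _ _ (i, true)).
Qed.

Lemma Gamma_lift (K : groupType) (x0 x1 x2 : K) :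
  x0 * x0 = 1 -> x1 * x1 = 1 -> x2 * x2 = 1 -> x0 * x2 = x2 * x0 ->
  exists f : Gamma -> K,
    [/\ {morph f : g h / g * h}, f (R o0) = x0, f (R o1) = x1 & f (R o2) = x2].
Proof.
move=> x00 x11 x22 x02; pose f (i : 'I_3) := nth 1 [:: x0; x1; x2] i.
have frel r : Gamma_rels r -> word_val f r = 1.
  case=> [[i ->]|->]; rewrite /word_val !big_cons big_nil mulg1 /letter_val /=.
    by case: i => [[|[|[]]]].
  by rewrite /f /= [x2 * (x0 * x2)]mulgA -x02 -mulgA x22 mulg1.
exists (pres_lift f); split; first exact: pres_liftM frel.
- exact: (pres_lift_generator frel o0).
- exact: (pres_lift_generator frel o1).
- exact: (pres_lift_generator frel o2).
Qed.

Lemma E_elements g :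
  E g <-> [\/ g = 1, g = R o0, g = R o2 | g = R o0 * R o2].
Proof.
have sE : is_subgroup E := gen_subgroupP _.
have sAE : [set R o0; R o2] `<=` E := @mem_gen_subgroup _ _.
have E0 : E (R o0) by apply: sAE; left.
have E2 : E (R o2) by apply: sAE; right.
split; last first.
  by case=> -> //; [exact: subgroup1 | exact: (subgroupM sE E0 E2)].
have RV i : (R i)^-1 = R i by apply: mulg1_eq; rewrite R_sq.
pose V4 : set Gamma := [set x | [\/ x = 1, x = R o0, x = R o2 | x = R o0 * R o2]].
have c (x : Gamma) : R o2 * (R o0 * x) = R o0 * (R o2 * x).
  by rewrite !mulgA R02_comm.
have s i (x : Gamma) : R i * (R i * x) = x by rewrite mulgA R_sq mul1g.
have sV : is_subgroup V4.
  split=> [|x y]; first exact: Or41.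
  by case=> ->; case=> ->; rewrite ?invgM ?invg1 ?RV ?mulg1 ?mul1g;
    rewrite -?mulgA /V4 /=
    ?(esym R02_comm, c, s, R_sq, mulg1);
    do ?[exact: Or41 | exact: Or42 | exact: Or43 | exact: Or44].
have V02 : [set R o0; R o2] `<=` V4.
  by move=> x [->|->]; [apply: Or42 | apply: Or43].
by move=> Eg; exact: (Eg V4 sV V02).
Qed.

(** The automorphisms of [Gamma] which permute [R o0], [R o2] and their
    product carry the classes T, T* and T^P to each other.  Any two of these
    three involutions present [Gamma] together with [R o1], and all facts
    about the classes are proved for such a pair. *)
Record frame (a b : Gamma) : Prop := Frame {
  frame_aa : a * a = 1;
  frame_bb : b * b = 1;
  frame_ab : a * b = b * a;
  frame_E : forall g, E g <-> [\/ g = 1, g = a, g = b | g = a * b];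
  frame_ind : forall P : Gamma -> Prop, P 1 ->
    (forall g, P g -> [/\ P (g * a), P (g * b) & P (g * R o1)]) ->
    forall g, P g;
  frame_lift : forall (K : groupType) (x y z : K),
    x * x = 1 -> y * y = 1 -> z * z = 1 -> x * y = y * x ->
    exists f : Gamma -> K,
      [/\ {morph f : g h / g * h}, f a = x, f b = y & f (R o1) = z] }.

Lemma frame02 : frame (R o0) (R o2).
Proof.
split; rewrite ?R_sq ?R02_comm //.
- by move=> g; rewrite -R02_comm; apply: E_elements.
- move=> P P1 PR; apply: Gamma_ind => // g i /PR[Pa Pb P1'].
  have [->|->|->] : [\/ i = o0, i = o1 | i = o2]; rewrite //.
  by case: i => [[|[|[|//]]] i3]; [constructor 1 | constructor 2 | constructor 3];
    apply: val_inj.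
- move=> K x y z xx yy zz xy.
  by have [f [fM f0 f1 f2]] := Gamma_lift xx zz yy xy; exists f.
Qed.

Lemma frame20 : frame (R o2) (R o0).
Proof.
have [aa bb ab EE ind lift] := frame02; split; rewrite ?ab //.
- move=> g; rewrite -ab EE; split; case; do ?by [constructor 1 | constructor 2
  | constructor 3 | constructor 4].
- by move=> P P1 PR; apply: ind => // g /PR[].
- move=> K x y z xx yy zz xy.
  by have [f [fM f0 f1 f2]] := lift K y x z yy xx zz (esym xy); exists f.
Qed.

Lemma frame0P : frame (R o0) (R o0 * R o2).
Proof.
have [aa bb ab EE ind lift] := frame02.
have sq : R o0 * R o2 * (R o0 * R o2) = 1.
  by rewrite {2}ab -mulgA [R o2 * (_ * _)]mulgA bb mul1g aa.
have e2 : R o0 * (R o0 * R o2) = R o2 by rewrite mulgA aa mul1g.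
split=> //.
- by rewrite e2 ab -mulgA aa mulg1.
- move=> g; rewrite EE e2; split; case; do ?by [constructor 1 | constructor 2
  | constructor 3 | constructor 4].
- move=> P P1 PR; apply: ind => // g Pg; have [Pa Pb P1'] := PR _ Pg.
  split=> //; have [_ + _] := PR _ Pa; rewrite mulgA -[g * _ * _]mulgA aa.
  by rewrite mulg1.
- move=> K x y z xx yy zz xy.
  have xyxy : x * y * (x * y) = 1.
    by rewrite {2}xy -mulgA [y * (_ * _)]mulgA yy mul1g.
  have xxy : x * (x * y) = x * y * x by rewrite -mulgA -xy.
  have [f [fM f0 f2 f1]] := lift K x (x * y) z xx xyxy zz xxy.
  by exists f; split; rewrite // fM f0 f2 mulgA xx mul1g.
Qed.

(** * Normalisers of kernels and automorphisms of the image *)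

Definition automorphism (G : groupType) (alpha : G -> G) :=
  {morph alpha : x y / x * y} /\ bijective alpha.

Section Twist.
Variables (G : groupType) (N : set Gamma) (theta : Gamma -> G).
Variables (A : set Gamma) (e : Gamma).
Hypothesis (epi : epi_on N theta) (NA : N = gen_subgroup A).
Hypothesis (ee : e * e = 1) (Ae : forall n, A n -> N (n ^ e)).

Lemma conj_gen n : N n -> N (n ^ e).
Proof.
have [sN _ _] := epi; rewrite NA => /(_ [set m | N m /\ N (m ^ e)]).
suff [sH sAH] : is_subgroup [set m | N m /\ N (m ^ e)] /\
    A `<=` [set m | N m /\ N (m ^ e)].
  by rewrite -NA; case/(_ sH sAH).
split; last by move=> m Am; split; [rewrite NA; apply: mem_gen_subgroup | apply: Ae].
split=> [|x y [Nx Nxe] [Ny Nye]]; first by rewrite /= conj1g; split; apply: subgroup1.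
by split; rewrite ?conjMg ?conjVg; apply: (proj2 sN).
Qed.

(** An involution which normalises [N] normalises the kernel of [theta]
    exactly when conjugation by it induces an automorphism of the image, and
    an automorphism is recognised on generators. *)
Lemma twistP : normaliser_of (ker_on N theta) e <->
  exists2 alpha, automorphism alpha
    & forall n, A n -> alpha (theta n) = theta (n ^ e).
Proof.
have [sN tM tE] := epi.
have eV : e^-1 = e by apply: mulg1_eq.
have eK (n : Gamma) : (n ^ e) ^ e = n by rewrite -conjgM ee conjg1.
split=> [Ke|[alpha [aM _] aA]].
  pose p x := sval (cid2 (tE x)).
  have Np x : N (p x) by rewrite /p; case: cid2.
  have tp x : theta (p x) = x by rewrite /p; case: cid2.
  pose alpha x := theta (p x ^ e).
  have alphaE n : N n -> alpha (theta n) = theta (n ^ e).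
    move=> Nn; have := epi_on_inj epi (Np (theta n)) Nn (tp _).
    move/(normaliserE Ke) => -[_].
    rewrite conjMg conjVg tM ?(epi_onV epi) //; do ?exact: conj_gen.
      by move/(congr1 (fun x => x * theta (n ^ e))); rewrite mulgVK mul1g.
    by apply: subgroupV => //; apply: conj_gen.
  exists alpha; last by move=> n An; apply: alphaE; rewrite NA; apply: mem_gen_subgroup.
  split=> [x y|].
    rewrite -{1}(tp x) -{1}(tp y) -tM // alphaE; last exact: subgroupM.
    by rewrite conjMg tM //; apply: conj_gen.
  exists alpha => x; rewrite -(tp x) !alphaE ?eK //; exact: conj_gen.
have a1 : alpha 1 = 1 by apply: (@mulgI _ (alpha 1)); rewrite -aM !mulg1.
have aV x : alpha x^-1 = (alpha x)^-1.
  by apply: (@mulgI _ (alpha x)); rewrite -aM !mulgV.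
have aN n : N n -> alpha (theta n) = theta (n ^ e).
  move=> Nn; have := Nn; rewrite NA.
  move=> /(_ [set m | N m /\ alpha (theta m) = theta (m ^ e)]) [] //.
    split=> [|x y [Nx ax] [Ny ay]].
      by rewrite /= conj1g (epi_on1 epi); split; first exact: subgroup1.
    have NyV := subgroupV sN Ny.
    have [Nxe Nye] := (conj_gen Nx, conj_gen Ny).
    split; first exact: (proj2 sN _ _ Nx Ny).
    rewrite conjMg conjVg tM // (tM _ _ Nxe (subgroupV sN Nye)).
    by rewrite !(epi_onV epi) // aM aV ax ay.
  by move=> m Am; split; [rewrite NA; apply: mem_gen_subgroup | apply: aA].
apply: conj_set_sub => n; rewrite ?eV => -[Nn tn].
  by split; [apply: conj_gen | rewrite -aN // tn].
by split; [apply: conj_gen | rewrite -aN // tn].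
Qed.

Lemma gen_image : gen_subgroup [set theta n | n in A] = setT.
Proof.
have [sN tM tE] := epi; apply/seteqP; split=> // x _ H sH sAH.
have [n Nn <-] := tE x; move: Nn; rewrite NA.
move=> /(_ [set m | N m /\ H (theta m)]) [] //.
  split=> [|m k [Nm Hm] [Nk Hk]].
    by rewrite /= (epi_on1 epi); split; apply: subgroup1.
  have Nk' := subgroupV sN Nk.
  by split; [apply: (proj2 sN) | rewrite tM ?(epi_onV epi) //; apply: (proj2 sH)].
move=> m Am; split; first by rewrite NA; apply: mem_gen_subgroup.
by apply: sAH; exists m.
Qed.

End Twist.

(** * Epimorphisms given by cocycles *)

(** An action [rho] of [Gamma] on [I] together with a [G]-valued cocycle [V]
    over it; such pairs are the actions of [Gamma] on [G * I] which commute
    with left multiplication by [G]. *)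
Record cocycle (G : groupType) (I : Type)
    (rho : Gamma -> I -> I) (V : Gamma -> I -> G) : Prop := Cocycle {
  cocycle_act1 : forall c, rho 1 c = c;
  cocycle_actM : forall g h c, rho (g * h) c = rho h (rho g c);
  cocycleM : forall g h c, V (g * h) c = V g c * V h (rho g c) }.

Lemma cocycle1 (G : groupType) (I : Type) rho (V : Gamma -> I -> G) :
  cocycle rho V -> forall c, V 1 c = 1.
Proof.
case=> r1 rM VM c; apply: (@mulgI _ (V 1 c)).
by rewrite -[in X in _ * V 1 X](r1 c) -VM !mulg1.
Qed.

(** On the stabiliser of a point the cocycle identity says that the cocycle
    is a homomorphism. *)
Lemma cocycle_epi (G : groupType) (I : Type) rho (V : Gamma -> I -> G)
    (i0 : I) (A : set G) :
  cocycle rho V -> gen_subgroup A = setT ->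
  (forall x, A x -> exists2 n, rho n i0 = i0 & V n i0 = x) ->
  epi_on [set n | rho n i0 = i0] (fun n => V n i0).
Proof.
move=> cV genA surjA; have [r1 rM VM] := cV.
have rV g : rho g i0 = i0 -> rho g^-1 i0 = i0.
  by move=> gi; rewrite -[in LHS]gi -rM mulgV r1.
split=> [|g h gi hi|x].
- by split=> [|g h gi hi] /=; rewrite ?r1 // rM gi rV.
- by rewrite VM gi.
have : gen_subgroup A x by rewrite genA.
move=> /(_ [set x | exists2 n, rho n i0 = i0 & V n i0 = x]); apply=> //.
split=> [|y z [n ni <-] [m mi <-]]; first by exists 1; rewrite ?r1 ?(cocycle1 cV).
exists (n * m^-1); first by rewrite rM ni rV.
rewrite VM ni; congr (_ * _).
apply: (@mulgI _ (V m i0)); rewrite mulgV -[in X in _ * V _ X]mi -VM mulgV.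
exact: cocycle1.
Qed.

(** The values on the three generators define permutations of [G * I]; the
    equations of the hypothesis are the relators, and the universal property
    extends them to [Gamma]. *)
Lemma frame_cocycle a b (G : groupType) (I : Type) (ra rb r1 : I -> I)
    (va vb v1 : I -> G) : frame a b ->
  (forall c, [/\ ra (ra c) = c, rb (rb c) = c, r1 (r1 c) = c
    & ra (rb c) = rb (ra c)]) ->
  (forall c, [/\ va c * va (ra c) = 1, vb c * vb (rb c) = 1,
    v1 c * v1 (r1 c) = 1 & va c * vb (ra c) = vb c * va (rb c)]) ->
  exists rho V, [/\ @cocycle G I rho V,
    rho a =1 ra /\ V a =1 va, rho b =1 rb /\ V b =1 vb
    & rho (R o1) =1 r1 /\ V (R o1) =1 v1].
Proof.
move=> fr rE vE.
pose F (r : I -> I) (v : I -> G) (p : G * I) := (p.1 * v p.2, r p.2).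
have FK r v : (forall c, r (r c) = c) -> (forall c, v c * v (r c) = 1) ->
    cancel (F r v) (F r v).
  by move=> rr vv [g c]; rewrite /F /= rr -mulgA vv mulg1.
have aK : cancel (F ra va) (F ra va) by apply: FK => c; [case: (rE c) | case: (vE c)].
have bK : cancel (F rb vb) (F rb vb) by apply: FK => c; [case: (rE c) | case: (vE c)].
have cK : cancel (F r1 v1) (F r1 v1) by apply: FK => c; [case: (rE c) | case: (vE c)].
have sq r v (rv : cancel (F r v) (F r v)) :
    (Defs.Sym rv rv : sym (G * I)) * Defs.Sym rv rv = 1.
  by apply: symP => p; apply: rv.
have ab : (Defs.Sym aK aK : sym (G * I)) * Defs.Sym bK bK =
          Defs.Sym bK bK * Defs.Sym aK aK.
  apply: symP => -[g c]; rewrite /= /F /=.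
  by case: (rE c) => _ _ _ ->; case: (vE c) => _ _ _; rewrite -!mulgA => ->.
have [f [fM fa fb fc]] := frame_lift fr (sq _ _ aK) (sq _ _ bK) (sq _ _ cK) ab.
have f1 : f 1 = 1 by apply: (@mulgI _ (f 1)); rewrite -fM !mulg1.
have fL g k c : f g (k, c) = (k * (f g (1, c)).1, (f g (1, c)).2).
  move: g k c; apply: (frame_ind fr) => [k c|g IHg]; first by rewrite f1 /= mulg1.
  by split=> k c; rewrite fM /= IHg ?(fa, fb, fc) /= /F /= mulgA.
exists (fun g c => (f g (1, c)).2), (fun g c => (f g (1, c)).1); split.
- split=> [c|g h c|g h c]; first by rewrite f1.
    by rewrite fM /= {1}[f g _]surjective_pairing fL.
  by rewrite fM /= {1}[f g _]surjective_pairing fL.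
- by rewrite fa; split=> c; rewrite /= /F /= ?mul1g.
- by rewrite fb; split=> c; rewrite /= /F /= ?mul1g.
- by rewrite fc; split=> c; rewrite /= /F /= ?mul1g.
Qed.

(** * Criteria by generating tuples *)

Section Criteria.
Variable G : groupType.

Definition generates (A : set G) := gen_subgroup A = setT.

Definition crit1 := exists x y z : G,
  [/\ x * x = 1, y * y = 1, z * z = 1, x * y = y * x
    & generates [set x; y; z]].

(** For the classes 2, 2* and 2^P. With [a] the element of [E] which is
    missing, [N(T)] is the free product of the groups generated by the
    involutions [b], [R1] and [R1^a], and conjugation by [a] fixes the first
    one and exchanges the other two. *)
Definition crit2 := exists x y z : G,
  [/\ x * x = 1, y * y = 1, z * z = 1, generates [set x; y; z]
    & ~ exists2 alpha, automorphism alpha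
        & [/\ alpha x = x, alpha y = z & alpha z = y]].

(** For the classes 2ex, 2*ex and 2^Pex. Here [N(T)] is the free product of
    [<b>] and the infinite cyclic group of [a R1], which conjugation by [a]
    inverts. *)
Definition crit2ex := exists x s : G,
  [/\ x * x = 1, generates [set x; s]
    & ~ exists2 alpha, automorphism alpha & alpha x = x /\ alpha s = s^-1].

(** For the class 3, where [N(T)] is the free product of the groups
    generated by the four conjugates of [R1] under [E], on which [E] acts
    regularly. *)
Definition crit3 := exists w x y z : G,
  [/\ [/\ w * w = 1, x * x = 1, y * y = 1 & z * z = 1],
      generates [set w; x; y; z]
    & ~ exists2 alpha, automorphism alpha
        & [\/ [/\ alpha w = x, alpha x = w, alpha y = z & alpha z = y],
              [/\ alpha w = y, alpha y = w, alpha x = z & alpha z = x]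
            | [/\ alpha w = z, alpha z = w, alpha x = y & alpha y = x]]].

(** For the classes 4, 4* and 4^P. Here [N(T)] is the free product of the
    groups generated by the involutions [R1] and [R1^b] and by [a R1 a b];
    conjugation by [b] exchanges the first two elements and inverts the
    third. *)
Definition crit4 := exists x y s : G,
  [/\ x * x = 1, y * y = 1, generates [set x; y; s]
    & ~ exists2 alpha, automorphism alpha
        & [/\ alpha x = y, alpha y = x & alpha s = s^-1]].

(** For the classes 5, 5* and 5^P. Here [N(T)] is free on [R1 b] and
    [(R1 b)^a]; conjugation by [b] inverts both, [a] exchanges them, and
    [a b] does both. *)
Definition crit5 := exists x y : G,
  generates [set x; y] /\
  ~ exists2 alpha, automorphism alpha
      & [\/ alpha x = x^-1 /\ alpha y = y^-1,
            alpha x = y /\ alpha y = x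
          | alpha x = y^-1 /\ alpha y = x^-1].

End Criteria.

Lemma sq1V (G : groupType) (x : G) : x * x = 1 -> x^-1 = x.
Proof. exact: mulg1_eq. Qed.

Lemma sub_gen_subgroup (G : groupType) (N A : set G) :
  is_subgroup N -> A `<=` N -> (forall x, N x -> gen_subgroup A x) ->
  N = gen_subgroup A.
Proof.
move=> sN sAN NA; apply/seteqP; split=> x; first exact: NA.
by apply.
Qed.

(** * The classes of index 2 *)

Section FrameClasses.
Variables (a b : Gamma) (fr : frame a b) (T : map_class) (G : groupType).

Let aa := frame_aa fr.
Let bb := frame_bb fr.
Let ab := frame_ab fr.
Let cc := R_sq o1.
Let aV : a^-1 = a. Proof. exact: sq1V. Qed.
Let bV : b^-1 = b. Proof. exact: sq1V. Qed.
Let cV : (R o1)^-1 = R o1. Proof. exact: sq1V. Qed.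

Lemma gen_image_set (N : set Gamma) (theta : Gamma -> G) A B :
  epi_on N theta -> N = gen_subgroup A -> (forall n, A n -> B (theta n)) ->
  generates B.
Proof.
move=> epi NA AB; apply/seteqP; split=> // x _ H sH sBH.
have : gen_subgroup [set theta n | n in A] x by rewrite (gen_image epi NA).
by apply=> // _ [n An <-]; apply/sBH/AB.
Qed.

Section IndexTwo.

Lemma index2_out N (c : Gamma) : index2 N -> ~ N c -> forall x, N x \/ N (x * c).
Proof.
move=> [sN [g Ng gN]] Nc x; have [Nx|Nx] := EM (N x); [by left | right].
have cosetV (y : Gamma) : ~ N y -> N (g^-1 * y^-1).
  move=> Ny; case: (gN y^-1) => // /(subgroupV sN).
  by rewrite invgK => /Ny.
have := subgroupM sN (subgroupV sN (cosetV _ Nx)) (cosetV _ Nc).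
rewrite invgM !invgK mulgA mulgK => NxcV; case: (gN (x * c)) => // h.
have NxV : ~ N x^-1 by move/(subgroupV sN); rewrite invgK.
have := cosetV _ NxV; rewrite invgK => gx.
have := subgroupM sN (subgroupV sN gx) h.
by rewrite invgM invgK !mulgA mulgK mulVg mul1g => /Nc.
Qed.

Lemma index2_span N e : index2 N -> E e -> ~ N e -> spans N.
Proof.
move=> iN Ee Ne g; have sE : is_subgroup E := gen_subgroupP _.
have [Ng|Nge] := index2_out iN Ne g.
  by exists g, 1; rewrite mulg1; split=> //; apply: (subgroup1 sE).
by exists (g * e), e^-1; rewrite mulgK; split=> //; apply: (subgroupV sE).
Qed.

Variable rho : Gamma -> bool -> bool.

Lemma index2_stab V : @cocycle G bool rho V -> rho a =1 negb ->
  index2 [set n | rho n false = false].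
Proof.
case=> r1 rM VM ra; split.
  split=> [|g h /= gf hf] /=; first by rewrite r1.
  by rewrite rM gf -[in LHS]hf -rM mulgV r1.
exists a; rewrite /= ?ra // => x; rewrite rM aV ra.
case: (boolP (rho x false)) => [xf|/negbTE]; last by left.
right; apply/negbTE/negP => xt.
suff : rho x^-1 (rho x false) = rho x^-1 (rho x true) by rewrite -!rM mulgV !r1.
by rewrite xf xt.
Qed.

End IndexTwo.

Lemma class2 : (forall N, represents T N <->
    [/\ index2 N, N b, N (R o1) & ~ N a]) ->
  realised T G <-> crit2 G.
Proof.
move=> repT.
have Ea : E a by apply/(frame_E fr); constructor 2.
rewrite realisedP; last by move=> N /repT[iN _ _ Na]; apply: index2_span iN Ea Na.
have genN N : [/\ index2 N, N b, N (R o1) & ~ N a] ->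
    N = gen_subgroup [set b; R o1; R o1 ^ a].
  move=> [iN Nb Nc Na]; have [sN _] := iN.
  have Nca : N (R o1 ^ a).
    have [//|] := index2_out iN Na (R o1 ^ a).
    by rewrite conjgE aV -!mulgA aa mulg1 => /(subgroupMr sN Nc).
  apply: sub_gen_subgroup => // [x|]; first by case=> [[->|->]|->].
  set K := gen_subgroup _ => x; have sK : is_subgroup K := gen_subgroupP _.
  have Kb : K b by apply: mem_gen_subgroup; left; left.
  have Kc : K (R o1) by apply: mem_gen_subgroup; left; right.
  have Kca : K (R o1 ^ a) by apply: mem_gen_subgroup; right.
  have KN y : K y -> N y by apply=> // z; case=> [[->|->]|->].
  have : K x \/ K (x * a).
    elim/(frame_ind fr): x => [|g [Kg|Kga]]; first by left; apply: subgroup1.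
      split; [right | left | left]; do ?exact: (subgroupM sK).
      by rewrite -mulgA aa mulg1.
    split; [by left | right | right].
      by rewrite -mulgA -ab mulgA; apply: (subgroupM sK).
    have := subgroupM sK Kga Kca; rewrite conjgE aV !mulgA.
    by rewrite -[g * a * a]mulgA aa mulg1.
  case=> // /KN Nxa Nx; case: Na; exact: subgroupMl Nx Nxa.
split.
  case=> N [theta [/repT rN epi nK]]; have NA := genN N rN.
  have [iN Nb Nc Na] := rN; have [sN tM tE] := epi.
  have Nca : N (R o1 ^ a) by rewrite NA; apply: mem_gen_subgroup; right.
  exists (theta b), (theta (R o1)), (theta (R o1 ^ a)).
  rewrite -!tM // bb cc -conjMg cc conj1g (epi_on1 epi); split=> //.
    apply: (gen_image_set epi NA) => n; case=> [[->|->]|->]; rewrite /=; tauto.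
  case=> alpha aut [ax ay az]; apply: Na; rewrite -nK.
  have ba : b ^ a = b by rewrite conjgE aV -ab mulgA aa mul1g.
  have caa : (R o1 ^ a) ^ a = R o1 by rewrite -conjgM aa conjg1.
  apply/(twistP epi NA aa).
    by move=> n; case=> [[->|->]|->]; rewrite ?ba ?caa.
  by exists alpha => // n; case=> [[->|->]|->]; rewrite ?ba ?caa.
case=> x [y [z [xx yy zz gen noaut]]].
have [||rho [V [co [ra va] [rb vb] [rc vc]]]] :=
  @frame_cocycle a b G bool negb id id (fun=> 1) (fun=> x)
    (fun c => if c then z else y) fr.
- by move=> c; rewrite ?negbK.
- by case; rewrite !mul1g ?mulg1.
have [r1 rM VM] := co.
pose N := [set n | rho n false = false]; pose theta n := V n false.
have rN : [/\ index2 N, N b, N (R o1) & ~ N a].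
  split; first exact: (index2_stab co).
  - by rewrite /N /= rb.
  - by rewrite /N /= rc.
  - by rewrite /N /= ra.
have NA := genN N rN; have [iN Nb Nc Na] := rN.
have tb : theta b = x by rewrite /theta vb.
have tc : theta (R o1) = y by rewrite /theta vc.
have Nca : N (R o1 ^ a) by rewrite NA; apply: mem_gen_subgroup; right.
have tca : theta (R o1 ^ a) = z.
  by rewrite /theta conjgE aV !VM !(ra, rc) !(va, vc) mul1g mulg1.
have epi : epi_on N theta.
  apply: (cocycle_epi co gen) => w; case=> [[->|->]|->].
  - by exists b.
  - by exists (R o1).
  - by exists (R o1 ^ a).
exists N, theta; split=> //; first exact/repT.
apply/seteqP; split=> g; last exact: ker_on_normal.
move=> Kg; have [//|Nga] := index2_out iN Na g.
have sK : is_subgroup (normaliser_of (ker_on N theta)) by exact: normaliser_subgroup.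
have := subgroupMl sK Kg (ker_on_normal epi Nga).
have ba : b ^ a = b by rewrite conjgE aV -ab mulgA aa mul1g.
have caa : (R o1 ^ a) ^ a = R o1 by rewrite -conjgM aa conjg1.
case/(twistP epi NA aa).
  by move=> n; case=> [[->|->]|->]; rewrite ?ba ?caa.
move=> alpha aut aA; case: noaut; exists alpha => //.
split; first by rewrite -tb aA ?ba //; left; left.
  by rewrite -tc aA ?tca //; left; right.
by rewrite -tca aA ?caa ?tc //; right.
Qed.

Lemma class2ex : (forall N, represents T N <->
    [/\ index2 N, N b, ~ N (R o1) & ~ N a]) ->
  realised T G <-> crit2ex G.
Proof.
move=> repT.
have Ea : E a by apply/(frame_E fr); constructor 2.
rewrite realisedP; last by move=> N /repT[iN _ _ Na]; apply: index2_span iN Ea Na.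
have genN N : [/\ index2 N, N b, ~ N (R o1) & ~ N a] ->
    N = gen_subgroup [set b; a * R o1].
  move=> [iN Nb Nc Na]; have [sN _] := iN.
  have Nac : N (a * R o1) by case: (index2_out iN Nc a).
  apply: sub_gen_subgroup => // [x|]; first by case=> ->.
  set K := gen_subgroup _ => x; have sK : is_subgroup K := gen_subgroupP _.
  have Kb : K b by apply: mem_gen_subgroup; left.
  have Kac : K (a * R o1) by apply: mem_gen_subgroup; right.
  have KN y : K y -> N y by apply=> // z; case=> ->.
  have : K x \/ K (x * a).
    elim/(frame_ind fr): x => [|g [Kg|Kga]]; first by left; apply: subgroup1.
      split; [right | left | right]; do ?exact: (subgroupM sK).
        by rewrite -mulgA aa mulg1.
      have := subgroupM sK Kg (subgroupV sK Kac).
      by rewrite invgM aV cV mulgA.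
    split; [by left | right | left].
      by rewrite -mulgA -ab mulgA; apply: (subgroupM sK).
    have := subgroupM sK Kga Kac; rewrite !mulgA.
    by rewrite -[g * a * a]mulgA aa mulg1.
  case=> // /KN Nxa Nx; case: Na; exact: subgroupMl Nx Nxa.
have ba : b ^ a = b by rewrite conjgE aV -ab mulgA aa mul1g.
have aca : (a * R o1) ^ a = (a * R o1)^-1.
  by rewrite conjgE invgM aV cV !mulgA aa mul1g.
split.
  case=> N [theta [/repT rN epi nK]]; have NA := genN N rN.
  have [iN Nb Nc Na] := rN; have [sN tM tE] := epi.
  have Nac : N (a * R o1) by rewrite NA; apply: mem_gen_subgroup; right.
  exists (theta b), (theta (a * R o1)).
  rewrite -!tM // bb (epi_on1 epi); split=> //.
    apply: (gen_image_set epi NA) => n; case=> ->; rewrite /=; tauto.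
  case=> alpha aut [ax ay]; apply: Na; rewrite -nK.
  apply/(twistP epi NA aa).
    by move=> n; case=> ->; rewrite ?ba ?aca //; apply: subgroupV.
  by exists alpha => // n; case=> ->; rewrite ?ba ?aca ?(epi_onV epi).
case=> x [s [xx gen noaut]].
have [||rho [V [co [ra va] [rb vb] [rc vc]]]] :=
  @frame_cocycle a b G bool negb id negb (fun=> 1) (fun=> x)
    (fun c => if c then s else s^-1) fr.
- by move=> c; rewrite ?negbK.
- by case; rewrite !mul1g ?mulg1 ?mulVg ?mulgV.
have [r1 rM VM] := co.
pose N := [set n | rho n false = false]; pose theta n := V n false.
have rN : [/\ index2 N, N b, ~ N (R o1) & ~ N a].
  split; first exact: (index2_stab co).
  - by rewrite /N /= rb.
  - by rewrite /N /= rc.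
  - by rewrite /N /= ra.
have NA := genN N rN; have [iN Nb Nc Na] := rN.
have tb : theta b = x by rewrite /theta vb.
have Nac : N (a * R o1) by rewrite NA; apply: mem_gen_subgroup; right.
have tac : theta (a * R o1) = s by rewrite /theta VM ra va vc mul1g.
have epi : epi_on N theta.
  apply: (cocycle_epi co gen) => w; case=> ->; first by exists b.
  by exists (a * R o1).
exists N, theta; split=> //; first exact/repT.
apply/seteqP; split=> g; last exact: ker_on_normal.
move=> Kg; have [//|Nga] := index2_out iN Na g.
have sN : is_subgroup N by case: iN.
have sK : is_subgroup (normaliser_of (ker_on N theta)) by exact: normaliser_subgroup.
have := subgroupMl sK Kg (ker_on_normal epi Nga).
case/(twistP epi NA aa).
  by move=> n; case=> ->; rewrite ?ba ?aca //; apply: subgroupV.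
move=> alpha aut aA; case: noaut; exists alpha => //.
split; first by rewrite -tb aA ?ba //; left.
by rewrite -tac aA ?aca ?(epi_onV epi) //; right.
Qed.

End FrameClasses.

(** * The classes of index 4 *)

Lemma epi_on_conj (G : groupType) N (theta : Gamma -> G) h : epi_on N theta ->
  epi_on (conj_set N h) (fun g => theta (g ^ h^-1)) /\
  ker_on (conj_set N h) (fun g => theta (g ^ h^-1)) =
    conj_set (ker_on N theta) h.
Proof.
move=> epi; have [sN tM tE] := epi; split.
  split=> [|_ _ [g Ng <-] [k Nk <-]|x].
  - split=> [|_ _ [g Ng <-] [k Nk <-]].
      by exists 1; rewrite ?conj1g //; apply: subgroup1.
    by exists (g * k^-1); rewrite ?conjMg ?conjVg //; apply: (proj2 sN).
  - by rewrite -conjMg !conjgK tM.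
  - by have [n Nn <-] := tE x; exists (n ^ h); rewrite ?conjgK //; exists n.
apply/seteqP; split=> g.
  by case=> -[n Nn <-]; rewrite conjgK => tn; exists n.
by case=> n [Nn tn] <-; split; [exists n | rewrite conjgK].
Qed.

Section StabiliserClasses.
Variables (a b : Gamma) (fr : frame a b) (T : map_class) (G : groupType).

(** The four points are labelled by pairs of booleans so that [a] and [b]
    negate the two coordinates. *)
Variables (sa sb s1 : 'S_4) (j : bool * bool -> 'I_4).
Variable r1 : bool * bool -> bool * bool.

Hypothesis repT : forall N, represents T N <->
  exists rho : Gamma -> 'S_4,
    [/\ {morph rho : g h / g * h}, rho a = sa, rho b = sb, rho (R o1) = s1
      & exists x, N = [set g | rho g x = x]].
Hypotheses (j_inj : injective j) (j_surj : forall x, exists c, j c = x).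
Hypotheses (ja : forall c, sa (j c) = j (~~ c.1, c.2))
  (jb : forall c, sb (j c) = j (c.1, ~~ c.2))
  (j1 : forall c, s1 (j c) = j (r1 c)).

Let aa := frame_aa fr.
Let bb := frame_bb fr.
Let ab := frame_ab fr.
Let cc := R_sq o1.
Let aV : a^-1 = a. Proof. exact: sq1V. Qed.
Let bV : b^-1 = b. Proof. exact: sq1V. Qed.
Let cV : (R o1)^-1 = R o1. Proof. exact: sq1V. Qed.

(** The class only matters through the action of [Gamma] on four labels,
    which is described here independently of the embedding of the labels
    into [1, ..., 4]. *)
Definition label_stab c0 (N : set Gamma) :=
  exists rho : Gamma -> bool * bool -> bool * bool,
    [/\ [/\ forall c, rho 1 c = c & forall g h c, rho (g * h) c = rho h (rho g c)],
        forall c, rho a c = (~~ c.1, c.2),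
        forall c, rho b c = (c.1, ~~ c.2),
        forall c, rho (R o1) c = r1 c
      & N = [set g | rho g c0 = c0]].

Lemma label_stabP N : represents T N <-> exists c0, label_stab c0 N.
Proof.
split.
  case/repT=> rho [rM ra rb rc [x ->]].
  have [c0 <-] := j_surj x; exists c0.
  pose k x := sval (cid (j_surj x)).
  have kK x' : j (k x') = x' by rewrite /k; case: cid.
  have jK c : k (j c) = c by apply: j_inj; rewrite kK.
  have r1' : rho 1 = 1 by apply: (@mulgI _ (rho 1)); rewrite -rM !mulg1.
  exists (fun g c => k (rho g (j c))); split.
  - by split=> [c|g h c]; rewrite ?r1' ?perm1 ?jK // rM permM kK.
  - by move=> c; rewrite ra ja jK.
  - by move=> c; rewrite rb jb jK.
  - by move=> c; rewrite rc j1 jK.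
  by apply/seteqP; split=> g /=; [move=> -> | move=> {2}<-].
case=> c0 [rho [[r1' rM] ra rb rc ->]]; apply/repT.
have sq (s : 'S_4) r : (forall c, s (j c) = j (r c)) -> (forall c, r (r c) = c) ->
    s * s = 1.
  move=> sr rr; apply/permP=> x; have [c <-] := j_surj x.
  by rewrite permM perm1 !sr rr.
have rr c : r1 (r1 c) = c by rewrite -!rc -rM R_sq r1'.
have [||||f [fM fa fb fc]] := @frame_lift _ _ fr ('S_4 : finGroupType) sa sb s1.
- by apply: (sq _ _ ja) => -[u v]; rewrite /= negbK.
- by apply: (sq _ _ jb) => -[u v]; rewrite /= negbK.
- exact: (sq _ _ j1).
- by apply/permP=> x; have [c <-] := j_surj x; rewrite !permM ja jb jb ja.
exists f; split=> //; exists (j c0).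
have f1 : f 1 = 1 by apply: (@mulgI _ (f 1)); rewrite -fM !mulg1.
have fj g c : f g (j c) = j (rho g c).
  move: g c; apply: (frame_ind fr) => [c|g IHg]; first by rewrite f1 perm1 r1'.
  by split=> c; rewrite fM permM IHg rM ?(fa, fb, fc) ?(ja, jb, j1) ?(ra, rb, rc).
by apply/seteqP; split=> g /=; rewrite fj; [move=> -> | exact: j_inj].
Qed.

Lemma label_stab_facts c0 N : label_stab c0 N ->
  [/\ is_subgroup N, ~ N a, ~ N b, ~ N (a * b)
    & forall g, [\/ N g, N (g * a), N (g * b) | N (g * (a * b))]].
Proof.
case=> rho [[r1' rM] ra rb rc ->]; split.
- split=> [|g h /= gc hc] /=; first by rewrite r1'.
  by rewrite rM gc -[in LHS]hc -rM mulgV r1'.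
- by rewrite /= ra; case: (c0) => -[] [].
- by rewrite /= rb; case: (c0) => -[] [].
- by rewrite /= rM ra rb; case: (c0) => -[] [].
move=> g; have : [\/ rho g c0 = c0, rho g c0 = (~~ c0.1, c0.2),
  rho g c0 = (c0.1, ~~ c0.2) | rho g c0 = (~~ c0.1, ~~ c0.2)].
  by move: (rho g c0) => [[] []]; move: (c0) => [[] []] /=; (do ?by constructor 1);
    (do ?by constructor 2); (do ?by constructor 3); constructor 4.
case=> e; [constructor 1 | constructor 2 | constructor 3 | constructor 4];
  by rewrite /= ?rM e ?ra ?rb //= ?negbK; case: (c0).
Qed.

Lemma stab_span N : represents T N -> spans N.
Proof.
case/label_stabP=> c0 /label_stab_facts[sN _ _ _ H] g.
have EE := frame_E fr.
case: (H g) => Ng.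
- by exists g, 1; rewrite mulg1; split=> //; apply/EE; constructor 1.
- exists (g * a), a; rewrite -mulgA aa mulg1.
  by split=> //; apply/EE; constructor 2.
- exists (g * b), b; rewrite -mulgA bb mulg1.
  by split=> //; apply/EE; constructor 3.
- exists (g * (a * b)), (a * b); split=> //; first by apply/EE; constructor 4.
  by rewrite -!mulgA [b * _]mulgA -ab -mulgA bb mulg1 aa mulg1.
Qed.

Let abK (g : Gamma) : g * (a * b) * (a * b) = g.
Proof. by rewrite -!mulgA [b * _]mulgA -ab -mulgA bb mulg1 aa mulg1. Qed.

Let abab : (a * b) * (a * b) = 1.
Proof. by rewrite -[LHS]mul1g mulgA abK. Qed.

Let abV : (a * b)^-1 = a * b. Proof. exact: sq1V. Qed.

(** Nielsen-Schreier rewriting: a subgroup [K] whose translates by the four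
    elements of [E] are permuted by right multiplication by [R o1]. *)
Lemma coset_closure (K : set Gamma) : is_subgroup K ->
  (forall e, E e -> exists2 e', E e' & K (e * R o1 * e')) ->
  forall g, exists2 e, E e & K (g * e).
Proof.
move=> sK step; have sE : is_subgroup E := gen_subgroupP _.
have Ea : E a by apply/(frame_E fr); constructor 2.
have Eb : E b by apply/(frame_E fr); constructor 3.
apply: (frame_ind fr); first by exists 1; [exact: (subgroup1 sE) | rewrite mulg1; apply: subgroup1].
move=> g [e Ee Kge]; split.
- exists (a * e); first exact: (subgroupM sE).
  by rewrite -[g * a * _]mulgA [a * (a * e)]mulgA aa mul1g.
- exists (b * e); first exact: (subgroupM sE).
  by rewrite -[g * b * _]mulgA [b * (b * e)]mulgA bb mul1g.
have [e' Ee' Ke'] := step _ (subgroupV sE Ee); exists e' => //.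
by have := subgroupM sK Kge Ke'; rewrite !mulgA mulgK.
Qed.

Lemma coset_closure_gen c0 N (A : set Gamma) : label_stab c0 N -> A `<=` N ->
  (forall e, E e -> exists2 e', E e' & gen_subgroup A (e * R o1 * e')) ->
  N = gen_subgroup A.
Proof.
move=> /label_stab_facts[sN Na Nb Nab _] AN step.
apply: sub_gen_subgroup => // x Nx.
have [e /(frame_E fr) Ee Kxe] := coset_closure (gen_subgroupP A) step x.
have Nxe : N (x * e) by apply: Kxe.
by case: Ee Kxe (subgroupMl sN Nx Nxe) => ->; rewrite ?mulg1.
Qed.

Let E1 : E 1. Proof. by apply/(frame_E fr); constructor 1. Qed.
Let Ea : E a. Proof. by apply/(frame_E fr); constructor 2. Qed.
Let Eb : E b. Proof. by apply/(frame_E fr); constructor 3. Qed.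
Let Eab : E (a * b). Proof. by apply/(frame_E fr); constructor 4. Qed.

(** The elements of [E] represent all cosets of [N], so a larger subgroup
    would contain one of the three involutions of [E]. *)
Lemma normaliser_ker c0 N (theta : Gamma -> G) : label_stab c0 N ->
  epi_on N theta ->
  ~ normaliser_of (ker_on N theta) a -> ~ normaliser_of (ker_on N theta) b ->
  ~ normaliser_of (ker_on N theta) (a * b) -> normaliser_of (ker_on N theta) = N.
Proof.
move=> /label_stab_facts[_ _ _ _ Ng] epi Ka Kb Kab.
apply/seteqP; split=> g; last exact: ker_on_normal.
have sK : is_subgroup (normaliser_of (ker_on N theta)) by exact: normaliser_subgroup.
move=> Kg; case: (Ng g) => // /(ker_on_normal epi)/(subgroupMl sK Kg) //.
Qed.

Lemma class3 : (forall c, r1 c = c) -> realised T G <-> crit3 G.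
Proof.
move=> r1E; rewrite realisedP; last exact: stab_span.
pose A : set Gamma := [set R o1; R o1 ^ a; R o1 ^ b; R o1 ^ (a * b)].
have AE n : A n -> exists2 e, E e & n = R o1 ^ e.
  by case=> [[[->|->]|->]|->]; [exists 1; rewrite ?conjg1 | exists a | exists b | exists (a * b)].
have genN c0 N : label_stab c0 N -> N = gen_subgroup A.
  move=> lN; apply: (coset_closure_gen lN) => [_ /AE[e Ee ->]|e Ee].
    case: lN => rho [[r1' rM] ra rb rc ->].
    by rewrite /= conjgE !rM rc r1E -rM mulVg r1'.
  exists e => //; apply: mem_gen_subgroup.
  have eV : e = e^-1 by case/(frame_E fr): Ee => ->; rewrite ?invg1 ?aV ?bV ?abV.
  have -> : e * R o1 * e = R o1 ^ e by rewrite conjgE -eV mulgA.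
  case/(frame_E fr): Ee => ->; rewrite ?conjg1.
  - by left; left; left.
  - by left; left; right.
  - by left; right.
  - by right.
have cA : A (R o1) by left; left; left.
have caA : A (R o1 ^ a) by left; left; right.
have cbA : A (R o1 ^ b) by left; right.
have cabA : A (R o1 ^ (a * b)) by right.
have cJ e : (R o1 ^ e) * (R o1 ^ e) = 1 by rewrite -conjMg cc conj1g.
have Jaa : (R o1 ^ a) ^ a = R o1 by rewrite -conjgM aa conjg1.
have Jbb : (R o1 ^ b) ^ b = R o1 by rewrite -conjgM bb conjg1.
have Jabab : (R o1 ^ (a * b)) ^ (a * b) = R o1 by rewrite -conjgM abab conjg1.
have Jab : (R o1 ^ a) ^ b = R o1 ^ (a * b) by rewrite conjgM.
have Jba : (R o1 ^ b) ^ a = R o1 ^ (a * b) by rewrite ab conjgM.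
have Jaba : (R o1 ^ (a * b)) ^ a = R o1 ^ b by rewrite -Jba -conjgM aa conjg1.
have Jabb : (R o1 ^ (a * b)) ^ b = R o1 ^ a by rewrite -Jab -conjgM bb conjg1.
have Jaab : (R o1 ^ a) ^ (a * b) = R o1 ^ b by rewrite conjgM Jaa.
have Jbab : (R o1 ^ b) ^ (a * b) = R o1 ^ a by rewrite ab conjgM Jbb.
have JN N e : N = gen_subgroup A -> E e -> forall n, A n -> N (n ^ e).
  move=> NA Ee n An; rewrite NA; apply: mem_gen_subgroup.
  case/(frame_E fr): Ee => ->; case: An => [[[->|->]|->]|->];
   rewrite ?conjg1 ?(Jaa, Jbb, Jabab, Jab, Jba, Jaba, Jabb, Jaab, Jbab) //.
split.
  case=> N [theta [/label_stabP[c0 lN] epi nK]]; have NA := genN _ _ lN.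
  have [sN Na Nb Nab _] := label_stab_facts lN; have [_ tM _] := epi.
  have AN n : A n -> N n by move=> An; rewrite NA; apply: mem_gen_subgroup.
  exists (theta (R o1)), (theta (R o1 ^ a)), (theta (R o1 ^ b)), (theta (R o1 ^ (a * b))).
  split.
  - by rewrite -!tM ?cJ ?cc ?(epi_on1 epi) //; apply: AN.
  - by apply: (gen_image_set epi NA) => n; case=> [[[->|->]|->]|->]; rewrite /=; tauto.
  case=> alpha aut [] [e1 e2 e3 e4].
  - apply: Na; rewrite -nK; apply/(twistP epi NA aa (JN _ _ NA Ea)).
    exists alpha => // n; case=> [[[->|->]|->]|->]; by rewrite ?Jaa ?Jba ?Jaba.
  - apply: Nb; rewrite -nK; apply/(twistP epi NA bb (JN _ _ NA Eb)).
    exists alpha => // n; case=> [[[->|->]|->]|->]; by rewrite ?Jbb ?Jab ?Jabb.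
  - apply: Nab; rewrite -nK; apply/(twistP epi NA abab (JN _ _ NA Eab)).
    exists alpha => // n; case=> [[[->|->]|->]|->]; by rewrite ?Jabab ?Jaab ?Jbab.
case=> w [x [y [z [[ww xx yy zz] gen noaut]]]].
have [||rho [V [co [ra va] [rb vb] [rc vc]]]] :=
  @frame_cocycle a b G (bool * bool) (fun c => (~~ c.1, c.2)) (fun c => (c.1, ~~ c.2)) id
    (fun=> 1) (fun=> 1)
    (fun c => if c.1 then if c.2 then z else x else if c.2 then y else w) fr.
- by case=> u v; rewrite /= !negbK.
- by case=> -[] []; rewrite /= !mul1g.
have [r1' rM VM] := co.
pose c0 := (false, false).
pose N := [set n | rho n c0 = c0]; pose theta n := V n c0.
have lN : label_stab c0 N.
  by exists rho; split=> // c; rewrite ?ra ?rb ?rc ?r1E.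
have NA := genN _ _ lN.
have AN n : A n -> N n by move=> An; rewrite NA; apply: mem_gen_subgroup.
have tc : theta (R o1) = w by rewrite /theta vc.
have tca : theta (R o1 ^ a) = x.
  by rewrite /theta conjgE aV !VM !(ra, rc) !(va, vc) /= mul1g mulg1.
have tcb : theta (R o1 ^ b) = y.
  by rewrite /theta conjgE bV !VM !(rb, rc) !(vb, vc) /= mul1g mulg1.
have tcab : theta (R o1 ^ (a * b)) = z.
  by rewrite /theta conjgE abV !(VM, rM) !(ra, rb, rc) !(va, vb, vc) /= !mul1g !mulg1.
have epi : epi_on N theta.
  apply: (cocycle_epi co gen) => u; case=> [[[->|->]|->]|->].
  - by exists (R o1) => //; apply: AN.
  - by exists (R o1 ^ a) => //; apply: AN.
  - by exists (R o1 ^ b) => //; apply: AN.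
  - by exists (R o1 ^ (a * b)) => //; apply: AN.
exists N, theta; split=> //; first by apply/label_stabP; exists c0.
apply: (normaliser_ker lN epi).
- case/(twistP epi NA aa (JN _ _ NA Ea))=> alpha aut aA.
  apply: noaut; exists alpha => //; constructor 1.
  by split; [rewrite -tc aA // tca | rewrite -tca aA // Jaa tc
    | rewrite -tcb aA // Jba tcab | rewrite -tcab aA // Jaba tcb].
- case/(twistP epi NA bb (JN _ _ NA Eb))=> alpha aut aA.
  apply: noaut; exists alpha => //; constructor 2.
  by split; [rewrite -tc aA // tcb | rewrite -tcb aA // Jbb tc
    | rewrite -tca aA // Jab tcab | rewrite -tcab aA // Jabb tca].
- case/(twistP epi NA abab (JN _ _ NA Eab))=> alpha aut aA.
  apply: noaut; exists alpha => //; constructor 3.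
  by split; [rewrite -tc aA // tcab | rewrite -tcab aA // Jabab tc
    | rewrite -tca aA // Jaab tcb | rewrite -tcb aA // Jbab tca].
Qed.

Lemma class5 : (forall c, r1 c = (c.1, ~~ c.2)) -> realised T G <-> crit5 G.
Proof.
move=> r1E; rewrite realisedP; last exact: stab_span.
pose X := R o1 * b; pose Y := X ^ a.
have XV : X^-1 = b * R o1 by rewrite invgM bV cV.
have YE : Y = a * R o1 * (a * b) by rewrite /Y conjgE aV /X !mulgA -mulgA -ab !mulgA.
have YV : Y^-1 = a * b * R o1 * a by rewrite YE !invgM !aV bV cV ab !mulgA.
pose A : set Gamma := [set X; Y].
have genN c0 N : label_stab c0 N -> N = gen_subgroup A.
  move=> lN; apply: (coset_closure_gen lN) => [n|e].
    case: lN => rho [[r1' rM] ra rb rc ->].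
    case=> ->; rewrite /= ?YE /X !rM !(ra, rb, rc, r1E) /= !negbK; by case: (c0).
  have KX : gen_subgroup A X by apply: mem_gen_subgroup; left.
  have KY : gen_subgroup A Y by apply: mem_gen_subgroup; right.
  case/(frame_E fr)=> ->.
  - by exists b => //; rewrite mul1g.
  - by exists (a * b) => //; rewrite -YE.
  - by exists 1 => //; rewrite mulg1 -XV; apply: subgroupV (gen_subgroupP _) KX.
  - by exists a => //; rewrite -YV; apply: subgroupV (gen_subgroupP _) KY.
have Xa : X ^ a = Y by [].
have Ya : Y ^ a = X by rewrite -conjgM aa conjg1.
have Xb : X ^ b = X^-1 by rewrite XV conjgE bV /X -!mulgA bb mulg1.
have Yb : Y ^ b = Y^-1 by rewrite -conjgM ab conjgM Xb conjVg.
have Xab : X ^ (a * b) = Y^-1 by rewrite conjgM Xa Yb.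
have Yab : Y ^ (a * b) = X^-1 by rewrite conjgM Ya Xb.
have JN N e : is_subgroup N -> N = gen_subgroup A -> E e -> forall n, A n -> N (n ^ e).
  move=> sN NA Ee n An.
  have NX : N X by rewrite NA; apply: mem_gen_subgroup; left.
  have NY : N Y by rewrite NA; apply: mem_gen_subgroup; right.
  case/(frame_E fr): Ee => ->; case: An => ->;
   rewrite ?conjg1 ?(Xa, Ya, Xb, Yb, Xab, Yab) //; exact: subgroupV.
split.
  case=> N [theta [/label_stabP[c0 lN] epi nK]]; have NA := genN _ _ lN.
  have [sN Na Nb Nab _] := label_stab_facts lN; have [_ tM _] := epi.
  have NX : N X by rewrite NA; apply: mem_gen_subgroup; left.
  have NY : N Y by rewrite NA; apply: mem_gen_subgroup; right.
  exists (theta X), (theta Y); split.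
    by apply: (gen_image_set epi NA) => n; case=> ->; rewrite /=; tauto.
  case=> alpha aut [] [e1 e2].
  - apply: Nb; rewrite -nK; apply/(twistP epi NA bb (JN _ _ sN NA Eb)).
    by exists alpha => // n; case=> ->; rewrite ?Xb ?Yb (epi_onV epi).
  - apply: Na; rewrite -nK; apply/(twistP epi NA aa (JN _ _ sN NA Ea)).
    by exists alpha => // n; case=> ->; rewrite ?Xa ?Ya.
  - apply: Nab; rewrite -nK; apply/(twistP epi NA abab (JN _ _ sN NA Eab)).
    by exists alpha => // n; case=> ->; rewrite ?Xab ?Yab (epi_onV epi).
case=> x [y [gen noaut]].
have [||rho [V [co [ra va] [rb vb] [rc vc]]]] :=
  @frame_cocycle a b G (bool * bool) (fun c => (~~ c.1, c.2)) (fun c => (c.1, ~~ c.2))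
    (fun c => (c.1, ~~ c.2)) (fun=> 1) (fun=> 1)
    (fun c => if c.1 then if c.2 then y^-1 else y else if c.2 then x^-1 else x) fr.
- by case=> u v; rewrite /= !negbK.
- by case=> -[] []; rewrite /= !mul1g ?mulVg ?mulgV.
have [r1' rM VM] := co.
pose c0 := (false, false).
pose N := [set n | rho n c0 = c0]; pose theta n := V n c0.
have lN : label_stab c0 N.
  by exists rho; split=> // c; rewrite ?ra ?rb ?rc ?r1E.
have NA := genN _ _ lN; have [sN Na Nb Nab _] := label_stab_facts lN.
have NX : N X by rewrite NA; apply: mem_gen_subgroup; left.
have NY : N Y by rewrite NA; apply: mem_gen_subgroup; right.
have tX : theta X = x by rewrite /theta /X !VM !(rc, vc, vb) /= mulg1.
have tY : theta Y = y.
  by rewrite /theta YE !(VM, rM) !(ra, rb, rc, va, vb, vc) /= !mulg1 mul1g.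
have epi : epi_on N theta.
  by apply: (cocycle_epi co gen) => u; case=> ->; [exists X | exists Y].
exists N, theta; split=> //; first by apply/label_stabP; exists c0.
have AX : A X by left.
have AY : A Y by right.
apply: (normaliser_ker lN epi).
- case/(twistP epi NA aa (JN _ _ sN NA Ea))=> alpha aut aA.
  apply: noaut; exists alpha => //; constructor 2.
  by split; [rewrite -tX aA // Xa tY | rewrite -tY aA // Ya tX].
- case/(twistP epi NA bb (JN _ _ sN NA Eb))=> alpha aut aA.
  apply: noaut; exists alpha => //; constructor 1.
  by split; [rewrite -tX aA // Xb (epi_onV epi) | rewrite -tY aA // Yb (epi_onV epi)].
- case/(twistP epi NA abab (JN _ _ sN NA Eab))=> alpha aut aA.
  apply: noaut; exists alpha => //; constructor 3.
  by split; [rewrite -tX aA // Xab (epi_onV epi) // tY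
    | rewrite -tY aA // Yab (epi_onV epi) // tX].
Qed.

(** Only [b] gives a condition: as [R1] and [a R1 a b] lie in [N(T)], a
    normaliser which contains [a] or [a b] also contains [b]. *)
Lemma class4 : (forall c, r1 c = (c.1, c.1 (+) c.2)) -> realised T G <-> crit4 G.
Proof.
move=> r1E; rewrite realisedP; last exact: stab_span.
pose S := a * R o1 * (a * b).
have SV : S^-1 = a * b * R o1 * a by rewrite /S !invgM !aV bV cV ab !mulgA.
pose A : set Gamma := [set R o1; R o1 ^ b; S].
have genN beta N : label_stab (false, beta) N -> N = gen_subgroup A.
  move=> lN; apply: (coset_closure_gen lN) => [n|e].
    case: lN => rho [[r1' rM] ra rb rc ->].
    by case=> [[->|->]|->]; rewrite /= ?conjgE ?bV /S ?rM !(ra, rb, rc, r1E) /= ?negbK.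
  have KR : gen_subgroup A (R o1) by apply: mem_gen_subgroup; left; left.
  have KRb : gen_subgroup A (R o1 ^ b) by apply: mem_gen_subgroup; left; right.
  have KS : gen_subgroup A S by apply: mem_gen_subgroup; right.
  case/(frame_E fr)=> ->.
  - by exists 1 => //; rewrite mul1g mulg1.
  - by exists (a * b).
  - by exists b => //; move: KRb; rewrite conjgE bV mulgA.
  - by exists a => //; rewrite -SV; apply: subgroupV (gen_subgroupP _) KS.
have Rbb : (R o1 ^ b) ^ b = R o1 by rewrite -conjgM bb conjg1.
have Sb : S ^ b = S^-1.
  by rewrite SV conjgE bV /S -!mulgA bb mulg1 !mulgA ab.
have JN N : is_subgroup N -> N = gen_subgroup A -> forall n, A n -> N (n ^ b).
  move=> sN NA n An.
  have NR : N (R o1) by rewrite NA; apply: mem_gen_subgroup; left; left.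
  have NRb : N (R o1 ^ b) by rewrite NA; apply: mem_gen_subgroup; left; right.
  have NS : N S by rewrite NA; apply: mem_gen_subgroup; right.
  by case: An => [[->|->]|->]; rewrite ?(Rbb, Sb) //; apply: subgroupV.
split.
  case=> N0 [theta0 [/label_stabP[c0 lN0] epi0 nK0]].
  have [N [theta [epi nK [beta lN]]]] : exists N theta, [/\ @epi_on G N theta,
      normaliser_of (ker_on N theta) = N & exists beta, label_stab (false, beta) N].
    case: c0 lN0 => [[] beta] lN0; last by exists N0, theta0; split=> //; exists beta.
    have [epi kerE] := epi_on_conj a epi0.
    exists (conj_set N0 a), (fun g => theta0 (g ^ a^-1)); split=> //.
      by rewrite kerE normaliser_conj nK0.
    exists beta; have [rho [[r1' rM] ra rb rc NE]] := lN0.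
    exists rho; split=> //; rewrite NE; apply/seteqP; split=> g /=.
      by case=> n /= ne <-; rewrite conjgE aV !rM (ra (false, beta)) /= ne ra.
    move=> gE; exists (g ^ a); last by rewrite -conjgM aa conjg1.
    by rewrite /= conjgE aV !rM (ra (true, beta)) /= gE ra.
  have NA := genN _ _ lN.
  have [sN Na Nb Nab _] := label_stab_facts lN; have [_ tM _] := epi.
  have AN n : A n -> N n by move=> An; rewrite NA; apply: mem_gen_subgroup.
  have NR : N (R o1) by apply: AN; left; left.
  have NRb : N (R o1 ^ b) by apply: AN; left; right.
  have NS : N S by apply: AN; right.
  exists (theta (R o1)), (theta (R o1 ^ b)), (theta S).
  rewrite -!tM // -conjMg cc conj1g (epi_on1 epi); split=> //.
    by apply: (gen_image_set epi NA) => n; case=> [[->|->]|->]; rewrite /=; tauto.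
  case=> alpha aut [e1 e2 e3].
  apply: Nb; rewrite -nK; apply/(twistP epi NA bb (JN _ sN NA)).
  by exists alpha => // n; case=> [[->|->]|->]; rewrite ?Rbb ?Sb ?(epi_onV epi).
case=> x [y [s [xx yy gen noaut]]].
have [||rho [V [co [ra va] [rb vb] [rc vc]]]] :=
  @frame_cocycle a b G (bool * bool) (fun c => (~~ c.1, c.2)) (fun c => (c.1, ~~ c.2))
    (fun c => (c.1, c.1 (+) c.2)) (fun=> 1) (fun=> 1)
    (fun c => if c.1 then if c.2 then s^-1 else s else if c.2 then y else x) fr.
- by case=> -[] [].
- by case=> -[] []; rewrite /= !mul1g ?mulVg ?mulgV.
have [r1' rM VM] := co.
pose c0 := (false, false).
pose N := [set n | rho n c0 = c0]; pose theta n := V n c0.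
have lN : label_stab c0 N.
  by exists rho; split=> // c; rewrite ?ra ?rb ?rc ?r1E.
have NA := genN _ _ lN; have [sN Na Nb Nab _] := label_stab_facts lN.
have AN n : A n -> N n by move=> An; rewrite NA; apply: mem_gen_subgroup.
have AR : A (R o1) by left; left.
have ARb : A (R o1 ^ b) by left; right.
have AS : A S by right.
have tR : theta (R o1) = x by rewrite /theta vc.
have tRb : theta (R o1 ^ b) = y.
  by rewrite /theta conjgE bV !VM !(rb, rc) !(vb, vc) /= mul1g mulg1.
have tS : theta S = s.
  by rewrite /theta /S !(VM, rM) !(ra, rb, rc, va, vb, vc) /= !mulg1 mul1g.
have epi : epi_on N theta.
  apply: (cocycle_epi co gen) => u; case=> [[->|->]|->].
  - by exists (R o1) => //; apply: AN.
  - by exists (R o1 ^ b) => //; apply: AN.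
  - by exists S => //; apply: AN.
exists N, theta; split=> //; first by apply/label_stabP; exists c0.
have nb : ~ normaliser_of (ker_on N theta) b.
  case/(twistP epi NA bb (JN _ sN NA))=> alpha aut aA.
  apply: noaut; exists alpha => //; split.
  - by rewrite -tR aA // tRb.
  - by rewrite -tRb aA // Rbb tR.
  - by rewrite -tS aA // Sb (epi_onV epi) //; apply: AN.
have sK : is_subgroup (normaliser_of (ker_on N theta)) by exact: normaliser_subgroup.
have KR : normaliser_of (ker_on N theta) (R o1) := ker_on_normal epi (AN _ AR).
have KS : normaliser_of (ker_on N theta) S := ker_on_normal epi (AN _ AS).
have na : ~ normaliser_of (ker_on N theta) a.
  move=> Ka; apply: nb; apply: (subgroupMl sK Ka).
  by apply: (subgroupMl sK (subgroupM sK Ka KR)).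
apply: (normaliser_ker lN epi) => // Kab; apply: na.
apply: (subgroupMr sK KR); apply: (subgroupMr sK Kab KS).
Qed.

End StabiliserClasses.

(** * The criteria for the fourteen classes *)

Section ClassTable.
Variable G : groupType.

Lemma realised1 : realised T1 G <-> crit1 G.
Proof.
have sT : is_subgroup [set: Gamma] by [].
have E1 : E 1 by apply/E_elements; constructor 1.
rewrite realisedP; last by move=> _ -> g; exists g, 1; rewrite mulg1.
pose A : set Gamma := [set R o0; R o2; R o1].
have genA : [set: Gamma] = gen_subgroup A.
  apply: sub_gen_subgroup => // g _; have sA := gen_subgroupP A.
  elim/(frame_ind frame02): g => [|g Ag]; first exact: subgroup1.
  by split; apply: (subgroupM sA) => //; apply: mem_gen_subgroup;
    [left; left | left; right | right].
split.
  case=> _ [theta [-> epi _]]; have [_ tM _] := epi.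
  exists (theta (R o0)), (theta (R o2)), (theta (R o1)).
  rewrite -!tM // !R_sq (epi_on1 epi) R02_comm; split=> //.
  by apply: (gen_image_set epi genA) => n; case=> [[->|->]|->]; rewrite /=; tauto.
case=> x [y [z [xx yy zz xy gen]]].
have [f [fM fx fy fz]] := frame_lift frame02 xx yy zz xy.
have f1 : f 1 = 1 by apply: (@mulgI _ (f 1)); rewrite -fM !mulg1.
have epi : epi_on [set: Gamma] f.
  split=> // w; have : gen_subgroup [set x; y; z] w by rewrite gen.
  move=> /(_ [set w | exists2 n, [set: Gamma] n & f n = w]); apply.
    split=> [|_ _ [g _ <-] [h _ <-]]; first by exists 1.
    exists (g * h^-1) => //; rewrite fM; congr (_ * _).
    by apply: (@mulgI _ (f h)); rewrite -fM !mulgV.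
  by move=> u; case=> [[->|->]|->]; [exists (R o0) | exists (R o2) | exists (R o1)].
exists [set: Gamma], f; split=> //.
by apply/seteqP; split=> // g _; apply: ker_on_normal.
Qed.

Definition mem_iff (N : set Gamma) (A : seq 'I_3) i :=
  if i \in A then N (R i) else ~ N (R i).

Lemma index2_withP A N : index2_with A N <->
  [/\ index2 N, mem_iff N A o0, mem_iff N A o1 & mem_iff N A o2].
Proof.
have mP i : (N (R i) <-> i \in A) <-> mem_iff N A i.
  rewrite /mem_iff; case: (i \in A); split.
  - by case=> _ /(_ isT).
  - by [].
  - by case=> h _ /h.
  - by move=> h; split=> // /h.
split=> [[iN H]|[iN H0 H1 H2]]; first by split=> //; apply/mP.
split=> // i; apply/mP; have [->|->|->] : [\/ i = o0, i = o1 | i = o2]; rewrite //.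
by case: i => [[|[|[|//]]] i3]; [constructor 1 | constructor 2 | constructor 3];
  apply: val_inj.
Qed.

Lemma index2_prod N (x y : Gamma) : index2 N -> ~ N x -> x * x = 1 ->
  (N (x * y) <-> ~ N y).
Proof.
move=> iN Nx xx; have [sN _] := iN; split=> [Nxy Ny|Ny].
  by apply: Nx; apply: subgroupMr Ny Nxy.
by case: (index2_out iN Ny x).
Qed.

Lemma realised2 T : T = T2 \/ T = T2s \/ T = T2P -> realised T G <-> crit2 G.
Proof.
case=> [->|[->|->]].
- apply: (class2 frame02) => N; rewrite [represents _ _]index2_withP /mem_iff /=.
  by split; case=> iN; intuition.
- apply: (class2 frame20) => N; rewrite [represents _ _]index2_withP /mem_iff /=.
  by split; case=> iN; intuition.
apply: (class2 frame0P) => N; rewrite [represents _ _]index2_withP /mem_iff /=.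
split; case=> iN.
  by move=> N0 N1 N2; split=> //; apply/(index2_prod _ iN N0 (R_sq _)).
by move=> N02 N1 N0; split=> //; apply/(index2_prod _ iN N0 (R_sq _)).
Qed.

Lemma realised2ex T :
  T = T2ex \/ T = T2sex \/ T = T2Pex -> realised T G <-> crit2ex G.
Proof.
case=> [->|[->|->]].
- apply: (class2ex frame02) => N; rewrite [represents _ _]index2_withP /mem_iff /=.
  by split; case=> iN; intuition.
- apply: (class2ex frame20) => N; rewrite [represents _ _]index2_withP /mem_iff /=.
  by split; case=> iN; intuition.
apply: (class2ex frame0P) => N; rewrite [represents _ _]index2_withP /mem_iff /=.
split; case=> iN.
  by move=> N0 N1 N2; split=> //; apply/(index2_prod _ iN N0 (R_sq _)).
by move=> N02 N1 N0; split=> //; apply/(index2_prod _ iN N0 (R_sq _)).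
Qed.

Definition s0 : 'S_4 := tperm p1 p2 * tperm p3 p4.
Definition s2 : 'S_4 := tperm p1 p4 * tperm p2 p3.

(** The labels of the four points for the frames [(R o0, R o2)],
    [(R o2, R o0)] and [(R o0, R o0 * R o2)], the base point being fixed by
    [R o1] in the classes 4, 4* and 4^P. *)
Definition label (c : bool * bool) : 'I_4 :=
  if c.1 then if c.2 then p4 else p1 else if c.2 then p3 else p2.
Definition label_s (c : bool * bool) : 'I_4 :=
  if c.1 then if c.2 then p1 else p2 else if c.2 then p4 else p3.
Definition label_P (c : bool * bool) : 'I_4 :=
  if c.1 then if c.2 then p3 else p1 else if c.2 then p4 else p2.

Lemma label_inj : injective label.
Proof. by case=> -[] [] [[] []]. Qed.
Lemma label_s_inj : injective label_s.
Proof. by case=> -[] [] [[] []]. Qed.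
Lemma label_P_inj : injective label_P.
Proof. by case=> -[] [] [[] []]. Qed.

Lemma I4_cases (x : 'I_4) : [\/ x = p1, x = p2, x = p3 | x = p4].
Proof.
by case: x => [[|[|[|[|//]]]] i]; [constructor 1 | constructor 2 | constructor 3
  | constructor 4]; apply: val_inj.
Qed.

Lemma label_surj x : exists c, label c = x.
Proof.
by case: (I4_cases x) => ->; [exists (true, false) | exists (false, false)
  | exists (false, true) | exists (true, true)].
Qed.
Lemma label_s_surj x : exists c, label_s c = x.
Proof.
by case: (I4_cases x) => ->; [exists (true, true) | exists (true, false)
  | exists (false, false) | exists (false, true)].
Qed.
Lemma label_P_surj x : exists c, label_P c = x.
Proof.
by case: (I4_cases x) => ->; [exists (true, false) | exists (false, false)
  | exists (true, true) | exists (false, true)].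
Qed.

Lemma stab02 s1 N : stabiliser_with s1 N <-> exists rho : Gamma -> 'S_4,
  [/\ {morph rho : g h / g * h}, rho (R o0) = s0, rho (R o2) = s2,
      rho (R o1) = s1 & exists x, N = [set g | rho g x = x]].
Proof. by split; case=> rho [? ? ? ? ?]; exists rho. Qed.

Lemma stab20 s1 N : stabiliser_with s1 N <-> exists rho : Gamma -> 'S_4,
  [/\ {morph rho : g h / g * h}, rho (R o2) = s2, rho (R o0) = s0,
      rho (R o1) = s1 & exists x, N = [set g | rho g x = x]].
Proof. by split; case=> rho [? ? ? ? ?]; exists rho. Qed.

Lemma stab0P s1 N : stabiliser_with s1 N <-> exists rho : Gamma -> 'S_4,
  [/\ {morph rho : g h / g * h}, rho (R o0) = s0, rho (R o0 * R o2) = s0 * s2,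
      rho (R o1) = s1 & exists x, N = [set g | rho g x = x]].
Proof.
split; case=> rho [rM e0 e1 e2 st]; exists rho; split=> //.
  by rewrite rM e0 e2.
by move: e1; rewrite rM e0 => /mulgI.
Qed.

Ltac label_tac := case=> -[] []; rewrite /s0 /s2 /label /label_s /label_P /=
  ?permM ?perm1 ?permE /=; do ?[apply: val_inj => //=]; rewrite ?permE /= ?permE //=.

Lemma realised3 : realised T3 G <-> crit3 G.
Proof.
apply: (@class3 _ _ frame02 T3 G s0 s2 _ label (fun c => c) (stab02 _) label_inj label_surj
    _ _ _ (fun=> erefl)); label_tac.
Qed.

Lemma realised4 T : T = T4 \/ T = T4s \/ T = T4P -> realised T G <-> crit4 G.
Proof.
case=> [->|[->|->]].
- apply: (@class4 _ _ frame02 T4 G s0 s2 _ label (fun c => (c.1, c.1 (+) c.2)) (stab02 _) label_inj label_surj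
    _ _ _ (fun=> erefl)); label_tac.
- apply: (@class4 _ _ frame20 T4s G s2 s0 _ label_s (fun c => (c.1, c.1 (+) c.2)) (stab20 _) label_s_inj label_s_surj
    _ _ _ (fun=> erefl)); label_tac.
- apply: (@class4 _ _ frame0P T4P G s0 (s0 * s2) _ label_P (fun c => (c.1, c.1 (+) c.2)) (stab0P _) label_P_inj label_P_surj
    _ _ _ (fun=> erefl)); label_tac.
Qed.

Lemma realised5 T : T = T5 \/ T = T5s \/ T = T5P -> realised T G <-> crit5 G.
Proof.
case=> [->|[->|->]].
- apply: (@class5 _ _ frame02 T5 G s0 s2 _ label (fun c => (c.1, ~~ c.2)) (stab02 _) label_inj label_surj
    _ _ _ (fun=> erefl)); label_tac.
- apply: (@class5 _ _ frame20 T5s G s2 s0 _ label_s (fun c => (c.1, ~~ c.2)) (stab20 _) label_s_inj label_s_surj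
    _ _ _ (fun=> erefl)); label_tac.
- apply: (@class5 _ _ frame0P T5P G s0 (s0 * s2) _ label_P (fun c => (c.1, ~~ c.2)) (stab0P _) label_P_inj label_P_surj
    _ _ _ (fun=> erefl)); label_tac.
Qed.

End ClassTable.

Local Close Scope group_scope.
Local Close Scope classical_set_scope.

Local Open Scope group_scope.

Ltac neq := first [done | by rewrite eq_sym].

(** * Generating alternating groups by 3-cycles *)

Section ThreeCycles.
Variables (T : finType) (H : {group {perm T}}).
Implicit Types x y z w : T.

Definition cyc3 x y z : {perm T} := tperm x y * tperm x z.

Lemma cyc3J x y z (s : {perm T}) : cyc3 x y z ^ s = cyc3 (s x) (s y) (s z).
Proof. by rewrite /cyc3 conjMg !tpermJ. Qed.

Lemma cyc3E x y z : x != y -> x != z -> y != z ->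
  [/\ cyc3 x y z x = y, cyc3 x y z y = z, cyc3 x y z z = x
    & forall w, w != x -> w != y -> w != z -> cyc3 x y z w = w].
Proof.
move=> xy xz yz; rewrite /cyc3 !permM tpermL tpermR tpermL.
rewrite [tperm x y z]tpermD; try neq.
rewrite tpermR tpermD; try neq.
split=> // w wx wy wz.
by rewrite permM !tpermD; try neq.
Qed.

Lemma cyc3V x y z : (cyc3 x y z)^-1 = cyc3 x z y.
Proof. by rewrite /cyc3 invMg !tpermV. Qed.

Lemma cyc3_rot x y z : x != y -> x != z -> y != z -> cyc3 x y z = cyc3 y z x.
Proof.
move=> xy xz yz; have [xE yE zE wE] := cyc3E xy xz yz.
have [yE' zE' xE' wE'] : [/\ cyc3 y z x y = z, cyc3 y z x z = x, cyc3 y z x x = y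
    & forall w, w != y -> w != z -> w != x -> cyc3 y z x w = w].
  by apply: cyc3E; neq.
apply/permP=> w; have [->|wx] := eqVneq w x; first by rewrite xE.
have [->|wy] := eqVneq w y; first by rewrite yE.
have [->|wz] := eqVneq w z; first by rewrite zE.
by rewrite wE ?wE'.
Qed.

(** Being linked is an equivalence relation, and it is invariant under [H];
    so it can be spread from one 3-cycle over all the points. *)
Definition linked x y := x = y \/
  exists z, [/\ x != y, x != z, y != z & cyc3 x y z \in H].

Lemma linked_sym x y : linked x y -> linked y x.
Proof.
case=> [->|[z [xy xz yz Hc]]]; [by left | right; exists z].
split; try neq.
by rewrite -groupV cyc3V cyc3_rot; try neq; rewrite cyc3_rot; try neq.
Qed.

Lemma linked_trans y x z : linked x y -> linked y z -> linked x z.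
Proof.
case=> [->//|[v [xy xv yv Hv]]].
case=> [<-|[u [yz yu zu Hu]]]; first by right; exists v.
have [->|xz] := eqVneq x z; first by left.
have [vz|vz] := eqVneq v z.
  subst v; right; exists y; split; try neq.
  by rewrite -cyc3V groupV.
have [ux|ux] := eqVneq u x.
  subst u; right; exists y; split; try neq.
  by rewrite -groupV cyc3V cyc3_rot; try neq; rewrite -cyc3V groupV -cyc3_rot; try neq.
(* conjugating the first 3-cycle by the second one *)
have := groupJ Hv Hu; rewrite cyc3J.
have [yE zE uE wE] := cyc3E yz yu zu.
have xE : cyc3 y z u x = x by apply: wE; neq.
rewrite yE xE => Hc; right; exists (cyc3 y z u v).
split=> //; first by rewrite -{1}xE (inj_eq perm_inj).
by rewrite -{1}yE (inj_eq perm_inj).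
Qed.

Lemma linked_img x y s : s \in H -> linked x y -> linked (s x) (s y).
Proof.
move=> Hs [->|[z [xy xz yz Hc]]]; [by left | right; exists (s z)].
by rewrite !(inj_eq perm_inj) -cyc3J groupJ.
Qed.

Lemma cyc3_mul x y z w : x != y -> x != z -> y != z -> x != w -> y != w ->
  z != w -> cyc3 x y z * cyc3 x z w = cyc3 x y w.
Proof.
move=> xy xz yz xw yw zw; have [xE yE zE oE] := cyc3E xy xz yz.
have [xE' zE' wE' oE'] := cyc3E xz xw zw.
have [xE2 yE2 wE2 oE2] := cyc3E xy xw yw.
apply/permP=> u; rewrite permM.
have [->|ux] := eqVneq u x; first by rewrite xE xE2 oE'; neq.
have [->|uy] := eqVneq u y; first by rewrite yE yE2 zE'.
have [->|uz] := eqVneq u z; first by rewrite zE xE' oE2; neq.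
rewrite oE //; have [->|uw] := eqVneq u w; first by rewrite wE' wE2.
by rewrite oE' // oE2.
Qed.

(** A 3-cycle [(x y z)] of [H] is changed into [(x y w)] by a 3-cycle which
    moves [z] to [w], unless the supports of the two overlap too much; these
    cases are products of the two 3-cycles. *)
Lemma linked_cyc3 : (forall x y, linked x y) ->
  forall x y z, x != y -> x != z -> y != z -> cyc3 x y z \in H.
Proof.
move=> lk x y w xy xw yw.
case: (lk x y) => [xy'|[z [_ xz yz Hz]]]; first by rewrite xy' eqxx in xy.
have [<-//|zw] := eqVneq z w.
case: (lk z w) => [zw'|[v [_ zv wv Hv]]]; first by rewrite zw' eqxx in zw.
have [vx|vx] := eqVneq v x.
  subst v; rewrite -(cyc3_mul xy xz yz xw yw zw) groupM //.
  by rewrite cyc3_rot; neq.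
have [vy|vy] := eqVneq v y.
  subst v.
  have Hz' : cyc3 z x y \in H by rewrite cyc3_rot; neq.
  have Hw' : cyc3 z y w \in H by rewrite -groupV cyc3V.
  have Hx : cyc3 z x w \in H.
    have <- : cyc3 z x y * cyc3 z y w = cyc3 z x w by apply: cyc3_mul; neq.
    exact: groupM.
  rewrite -(cyc3_mul xy xz yz xw yw zw) groupM //.
  by rewrite -groupV cyc3V cyc3_rot; try neq; rewrite cyc3_rot; neq.
have := groupJ Hz Hv; rewrite cyc3J.
have [zE wE vE oE] := cyc3E zw zv wv.
by rewrite zE !oE //; neq.
Qed.

(** Even permutations are products of pairs of transpositions, and such a
    pair is a product of at most two 3-cycles. *)
Lemma linked_Alt : (forall x y, linked x y) -> 'Alt_T \subset H.
Proof.
move/linked_cyc3 => c3.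
have L1 x y w : x != y -> x != w -> tperm x y * tperm x w \in H.
  move=> xy xw; have [->|yw] := eqVneq y w; last exact: c3.
  by rewrite tperm2 group1.
have L2 x y z w : x != y -> z != w -> tperm x y * tperm z w \in H.
  move=> xy zw; have [xz|xz] := eqVneq x z; first by subst z; apply: L1.
  rewrite -[tperm x y](mulgK (tperm x z)) tpermV -mulgA groupM ?L1 //.
  by rewrite tpermC L1 // eq_sym.
apply/fintype.subsetP=> s; rewrite Alt_even => /negbTE.
have [ts -> tsd] := prod_tpermP s.
elim: {ts}(size ts) {-2}ts (leqnn (size ts)) tsd => [|k IHk] [|t1 [|t2 ts]] //.
- by rewrite big_nil.
- by rewrite big_nil.
- by rewrite /= andbT big_seq1 odd_tperm => _ ->.
move=> sz /and3P[d1 d2 d]; rewrite !big_cons mulgA !odd_permM !odd_tperm.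
have -> : t1.1 != t1.2 = true by exact: d1.
have -> : t2.1 != t2.2 = true by exact: d2.
rewrite /= => ev; rewrite groupM ?L2 //; apply: IHk => //.
by move: sz; rewrite /= ltnS => /ltnW.
Qed.

Lemma Alt_odd_full s : 'Alt_T \subset H -> s \in H -> odd_perm s -> H = finset.setT :> {set _}.
Proof.
move=> AH Hs so; apply/finset.setP=> t; rewrite inE.
have [to|te] := boolP (odd_perm t); last by rewrite (fintype.subsetP AH) // Alt_even.
rewrite -(mulgKV s t) groupM // (fintype.subsetP AH) // Alt_even.
by rewrite odd_permM odd_permV to so.
Qed.

Lemma tperm_full : (forall x y, tperm x y \in H) -> H = finset.setT :> {set _}.
Proof.
move=> tH; apply/finset.setP=> s; rewrite inE; have [ts -> _] := prod_tpermP s.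
by apply: group_prod => t _; apply: tH.
Qed.

End ThreeCycles.

(** * Products of transpositions of natural numbers *)

Definition swapn (p : nat * nat) i :=
  if i == p.1 then p.2 else if i == p.2 then p.1 else i.
Definition run (l : seq (nat * nat)) i := foldl (fun k p => swapn p k) i l.
Definition inside N (l : seq (nat * nat)) :=
  all (fun p => (p.1 <= N) && (p.2 <= N)) l.
Definition mapp (f : nat -> nat) (l : seq (nat * nat)) :=
  [seq (f p.1, f p.2) | p <- l].
Definition pwr k (l : seq (nat * nat)) := flatten (nseq k l).

Lemma run_cat l l' i : run (l ++ l') i = run l' (run l i).
Proof. exact: foldl_cat. Qed.

Section TranspositionLists.
Variable N : nat.
Implicit Types (l : seq (nat * nat)) (i : 'I_N.+1).

(** The product of a list of transpositions of small numbers; [run] is its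
    action on numbers, so that identities between such products can be decided
    by evaluation on the finitely many numbers that occur, whatever [N] is. *)
Definition tl l : 'S_N.+1 := \prod_(p <- l) tperm (inord p.1) (inord p.2).

Lemma inordE k : k <= N -> (inord k : 'I_N.+1) = k :> nat.
Proof. by move=> kN; rewrite inordK. Qed.

Lemma tl_cat l l' : tl (l ++ l') = tl l * tl l'.
Proof. by rewrite /tl big_cat. Qed.

Lemma tl_nil : tl [::] = 1. Proof. by rewrite /tl big_nil. Qed.

Lemma tl_pwr k l : tl (pwr k l) = tl l ^+ k.
Proof.
by elim: k => [|k IHk]; rewrite ?tl_nil // /pwr /= tl_cat -/(pwr k l) IHk expgS.
Qed.

Lemma tl_rev l : tl (rev l) = (tl l)^-1.
Proof.
elim: l => [|p l IHl]; first by rewrite tl_nil invg1.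
rewrite rev_cons -cats1 tl_cat IHl -[p :: l]cat1s tl_cat invMg.
by rewrite /tl big_seq1 tpermV.
Qed.

Lemma runE l i : inside N l -> tl l i = run l i :> nat.
Proof.
move: i; elim/last_ind: l => [|l p IHl] i; first by rewrite /tl big_nil perm1.
rewrite /inside all_rcons => /andP[/andP[p1 p2] lN].
rewrite -cats1 tl_cat permM /tl big_seq1 /run foldl_cat /= -/(run l i).
have := IHl i lN; set u := tl l i => eu; rewrite -eu /swapn.
case: tpermP => [->|->|u1 u2]; rewrite ?inordE // ?eqxx //.
  by case: eqP.
by rewrite !ifF //; apply/eqP => e; [apply: u2 | apply: u1]; apply: val_inj;
  rewrite /= inordE.
Qed.

Lemma run_in l k : inside N l -> k <= N -> run l k <= N.
Proof.
move=> lN kN; have := runE (inord k) lN; rewrite inordE // => <-.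
by rewrite -ltnS.
Qed.

Lemma tl_inord l k : inside N l -> k <= N -> tl l (inord k) = inord (run l k).
Proof.
by move=> lN kN; apply: val_inj; rewrite /= runE // !inordE // run_in.
Qed.

Lemma run_small K l k : all (fun p => (p.1 < K) && (p.2 < K)) l -> K <= k ->
  run l k = k.
Proof.
elim: l => //= p l IHl /andP[/andP[p1 p2] lK] Kk.
by rewrite /run /= -/(run l _) /swapn !ifF ?IHl //; lia.
Qed.

Lemma small_inside K l : K <= N.+1 -> all (fun p => (p.1 < K) && (p.2 < K)) l ->
  inside N l.
Proof. by move=> KN; apply: sub_all => p; lia. Qed.

Lemma tl_eq K l l' : K <= N.+1 -> all (fun p => (p.1 < K) && (p.2 < K)) (l ++ l') ->
  all (fun k => run l k == run l' k) (iota 0 K) -> tl l = tl l'.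
Proof.
move=> KN; rewrite all_cat => /andP[lK lK'] /allP e.
apply/permP=> i; apply: val_inj; rewrite /= !runE ?(small_inside KN) //.
have [iK|Ki] := ltnP i K; first by apply/eqP/e; rewrite mem_iota.
by rewrite !(run_small _ Ki).
Qed.

Lemma tl_neq K k l l' : K <= N.+1 ->
  all (fun p => (p.1 < K) && (p.2 < K)) (l ++ l') ->
  (k < K) && (run l k != run l' k) -> tl l <> tl l'.
Proof.
move=> KN; rewrite all_cat => /andP[lK lK'] /andP[kK /eqP ne] e; apply: ne.
have kN : k <= N by rewrite -ltnS (leq_trans kK).
rewrite -[k in run l k]inordE // -[k in run l' k]inordE // -!runE ?e //.
  exact: small_inside KN lK'.
exact: small_inside KN lK.
Qed.

Lemma tl_conj l (s : 'S_N.+1) f :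
  all (fun p => (s (inord p.1) == inord (f p.1)) && (s (inord p.2) == inord (f p.2))) l ->
  tl l ^ s = tl (mapp f l).
Proof.
elim: l => [|p l IHl] /=; first by rewrite tl_nil conj1g.
case/andP=> /andP[/eqP s1 /eqP s2] /IHl e.
by rewrite /tl !big_cons conjMg tpermJ s1 s2 -!/(tl _) e.
Qed.

Lemma odd_tl l : inside N l -> all (fun p => p.1 != p.2) l ->
  odd_perm (tl l) = odd (size l).
Proof.
elim: l => [|p l IHl] /=; first by rewrite tl_nil odd_perm1.
case/andP=> /andP[p1 p2] lN /andP[pd ld].
rewrite /tl big_cons -/(tl l) odd_permM IHl // odd_tperm.
by rewrite -(inj_eq val_inj) /= !inordE // pd.
Qed.

Lemma cyc3_tl a b c : tl [:: (a, b); (a, c)] = cyc3 (inord a) (inord b) (inord c).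
Proof. by rewrite /tl !big_cons big_nil mulg1. Qed.

End TranspositionLists.

Definition block p q k := [seq (p + i, q - i) | i <- iota 0 k]%N.

Lemma run_block p q k i : p + k.*2 <= q.+1 ->
  run (block p q k) i =
    if (p <= i < p + k) || (q < i + k) && (i <= q) then p + q - i else i.
Proof.
elim: k => [|k IHk] pq.
  by rewrite /block /run /=; case: ifP => //; lia.
rewrite /block -[k.+1]addn1 iotaD map_cat run_cat -/(block p q k).
rewrite IHk; last by lia.
by rewrite /run /= /swapn /=; do ![case: ifP]; lia.
Qed.

Lemma size_block p q k : size (block p q k) = k.
Proof. by rewrite size_map size_iota. Qed.

Lemma block_all (P : pred (nat * nat)) p q k :
  (forall i, i < k -> P (p + i, q - i)%N) -> all P (block p q k).
Proof.
by move=> H; rewrite all_map; apply/allP=> i; rewrite mem_iota => /andP[_]; apply: H.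
Qed.

(** The reflection [i -> c - i] of the regular [m]-gon with vertices
    [e, ..., e + m - 1], the vertices being counted from [e]. *)
Definition refl e c m :=
  block e (e + c) (c.+1)./2 ++ block (e + c.+1) (e + m.-1) ((m - c.+1)./2).

Lemma run_refl e c m i : c < m -> run (refl e c m) i =
  if i < e then i else if i <= e + c then e.*2 + c - i
  else if i < e + m then e.*2 + m + c - i else i.
Proof.
move=> cm; rewrite /refl run_cat !run_block; try lia.
by do ![case: ifP]; lia.
Qed.

Lemma inside_refl N e c m : c < m -> e + m <= N.+1 -> inside N (refl e c m).
Proof.
move=> cm mN; rewrite /inside all_cat.
by apply/andP; split; apply: block_all => i ik /=; lia.
Qed.

Lemma neq_refl e c m : c < m -> all (fun p => p.1 != p.2) (refl e c m).
Proof.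
move=> cm; rewrite all_cat.
by apply/andP; split; apply: block_all => i ik /=; lia.
Qed.

Lemma size_refl e c m : size (refl e c m) = ((c.+1)./2 + (m - c.+1)./2)%N.
Proof. by rewrite size_cat !size_block. Qed.

Local Close Scope group_scope.

Local Open Scope classical_set_scope.
Local Open Scope group_scope.

(** * Relations between the criteria *)

Section CriteriaTheory.
Variable G : groupType.
Implicit Types (x y z s : G) (alpha : G -> G).

Lemma automorphism_id : automorphism (@id G).
Proof. by split=> //; exists id. Qed.

Lemma automorphism1 alpha : automorphism alpha -> alpha 1 = 1.
Proof. by case=> aM _; apply: (@mulgI _ (alpha 1)); rewrite -aM !mulg1. Qed.

Lemma automorphismV alpha x : automorphism alpha -> alpha x^-1 = (alpha x)^-1.
Proof.
move=> aut; apply: (@mulgI _ (alpha x)).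
by rewrite -(proj1 aut) !mulgV automorphism1.
Qed.

Lemma automorphismJ alpha x y : automorphism alpha ->
  alpha (x ^ y) = alpha x ^ alpha y.
Proof. by move=> aut; rewrite !conjgE !(proj1 aut) automorphismV. Qed.

Lemma automorphismX alpha x k : automorphism alpha -> alpha (x ^+ k) = alpha x ^+ k.
Proof.
move=> aut; elim: k => [|k IHk]; first exact: automorphism1.
by rewrite !expgS (proj1 aut) IHk.
Qed.

Lemma eq_generates (A B : set G) : (forall x, A x -> x = 1 \/ B x) ->
  generates A -> generates B.
Proof.
move=> AB genA; apply/seteqP; split=> // x _ H sH BH.
have : gen_subgroup A x by rewrite genA.
by apply=> // y /AB[->|/BH//]; apply: subgroup1.
Qed.

(** The non-commuting pair makes such a triple usable in all the classes 1,
    2, 3 and 4. *)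
Definition strong_crit1 := exists x y z : G,
  [/\ [/\ x * x = 1, y * y = 1 & z * z = 1], x * y = y * x, x * z <> z * x
    & generates [set x; y; z]].

Lemma strong_crit1_crit1 : strong_crit1 -> crit1 G.
Proof. by case=> x [y [z [[? ? ?] ? _ ?]]]; exists x, y, z. Qed.

(** An automorphism which fixes [x] and exchanges [y] and [z] cannot exist
    when [x] commutes with [y] but not with [z]. *)
Lemma strong_crit1_crit2 : strong_crit1 -> crit2 G.
Proof.
case=> x [y [z [[xx yy zz] xy xz gen]]]; exists x, y, z; split=> //.
case=> alpha [aM _] [ax ay az]; apply: xz.
by rewrite -{1}ax -{2}ax -ay -!aM xy.
Qed.

(** With a trivial fourth involution, an automorphism as in the criterion
    for class 3 would make another of the involutions trivial. If this
    already holds, the group is generated by two distinct elements [a] and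
    [b] with square 1, and the tuple [a], [a], [a], [b] is not permuted by
    any double transposition. *)
Lemma crit2_crit3 : crit2 G -> crit3 G.
Proof.
case=> x [y [z [xx yy zz gen noaut]]].
have two (a b : G) : a * a = 1 -> b * b = 1 -> a <> b ->
    generates [set a; b] -> crit3 G.
  move=> a2 b2 ab gab; exists a, a, a, b; split=> //.
    by apply: eq_generates gab => u; rewrite /=; tauto.
  by case=> alpha aut; case=> -[e1 e2 e3 e4]; apply: ab; congruence.
have id_aut := automorphism_id.
have [x1|xN] := EM (x = 1).
  apply: (two y z) => // [yz|]; first by apply: noaut; exists id.
  by apply: eq_generates gen => u; rewrite /= x1; tauto.
have [y1|yN] := EM (y = 1).
  have [xz|xz] := EM (x = z); last first.
    by apply: (two x z) => //; apply: eq_generates gen => u; rewrite /= y1; tauto.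
  apply: (two 1 x) => //; [by rewrite mulg1 | by move/esym |].
  by apply: eq_generates gen => u; rewrite /= y1 -xz; tauto.
have [z1|zN] := EM (z = 1).
  have [xy|xy] := EM (x = y); last first.
    by apply: (two x y) => //; apply: eq_generates gen => u; rewrite /= z1; tauto.
  apply: (two 1 x) => //; [by rewrite mulg1 | by move/esym |].
  by apply: eq_generates gen => u; rewrite /= z1 -xy; tauto.
exists x, y, z, 1; split; first by rewrite mulg1.
  by apply: eq_generates gen => u; rewrite /=; tauto.
case=> alpha aut; have a1 := automorphism1 aut.
by case=> -[e1 e2 e3 e4]; congruence.
Qed.

(** The two new kinds of automorphism carry the involution [x] to [s] or to
    its inverse, so [s^2 = 1], and the identity inverts [s]. *)
Lemma crit2ex_crit5 : crit2ex G -> crit5 G.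
Proof.
case=> x [s [xx gen noaut]]; exists x, s; split=> // -[alpha aut].
have id_aut := automorphism_id.
case=> -[ax as_].
- by apply: noaut; exists alpha; rewrite // ax sq1V.
- have ss : s * s = 1 by rewrite -ax -(proj1 aut) xx automorphism1.
  by apply: noaut; exists id; rewrite // sq1V.
- have ss : s * s = 1.
    by apply: invg_inj; rewrite invMg -ax -(proj1 aut) xx automorphism1 // invg1.
  by apply: noaut; exists id; rewrite // sq1V.
Qed.

(** An automorphism which fixes [x] and inverts [s] would carry the word of
    the first equation to a conjugate of the word of the second one. *)
Lemma chiral_pair x s : x * x = 1 -> generates [set x; s] ->
  (x * x ^ (s ^+ 2) * x ^ (s ^+ 3)) ^+ 6 = 1 ->
  (x ^ (s ^+ 3) * x ^ s * x) ^+ 6 <> 1 -> crit2ex G.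
Proof.
move=> xx gen e ne; exists x, s; split=> // -[alpha aut [ax as_]].
apply: ne; have := congr1 alpha e.
have [aM _] := aut.
rewrite (automorphism1 aut) (automorphismX _ _ aut) 2!aM !(automorphismJ _ _ aut).
rewrite !(automorphismX _ _ aut) ax as_.
move/(congr1 (fun g => g ^ (s ^+ 3))); rewrite conj1g conjXg 2!conjMg.
rewrite -[(x ^ (s^-1 ^+ 2)) ^ _]conjgM -[(x ^ (s^-1 ^+ 3)) ^ _]conjgM.
rewrite !expgVn mulVg conjg1.
by have -> : (s ^+ 2)^-1 * s ^+ 3 = s by rewrite [s ^+ 3]expgSr mulKg.
Qed.

End CriteriaTheory.

(** * Criteria inside a larger group *)

(** Criteria for a group given as a subgroup of a finite group, such as the
    alternating group inside the symmetric group. *)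
Section Embedding.
Variables (G gT : finGroupType) (H : {group gT}) (iota : G -> gT).
Hypotheses (iotaM : {morph iota : x y / x * y}) (iota_inj : injective iota)
  (iotaH : forall x, iota x \in H) (iota_onto : forall y, y \in H -> exists x, iota x = y).

Lemma iota1 : iota 1 = 1.
Proof. by apply: (@mulgI _ (iota 1)); rewrite -iotaM !mulg1. Qed.

Lemma iotaV x : iota x^-1 = (iota x)^-1.
Proof. by apply: (@mulgI _ (iota x)); rewrite -iotaM !mulgV iota1. Qed.

Lemma iotaX x k : iota (x ^+ k) = iota x ^+ k.
Proof. by elim: k => [|k IHk]; rewrite ?expg0 ?iota1 // !expgS iotaM IHk. Qed.

Lemma iotaJ x y : iota (x ^ y) = iota x ^ iota y.
Proof. by rewrite !conjgE !iotaM iotaV. Qed.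

(** The group is finite, so its abstract subgroups are the images of those
    of the finite group type, and generation can be tested on the latter. *)
Lemma generatesP (A : set G) : generates A <->
  forall K : {group gT}, (forall x, A x -> iota x \in K) -> H \subset K.
Proof.
split=> [gen K AK|gen].
  apply/fintype.subsetP=> _ /iota_onto[x <-].
  have : gen_subgroup A x by rewrite gen.
  move=> /(_ [set x | iota x \in K]); apply=> //.
  split=> [|y z /= Ky Kz] /=; first by rewrite iota1.
  by rewrite iotaM iotaV groupM ?groupV.
apply/seteqP; split=> // x _ L sL AL.
pose K := [set y | `[< exists2 x, L x & iota x = y >]]%SET.
have gK : group_set K.
  apply/group_setP; split=> [|y z]; rewrite !inE.
    by exists 1; [apply: subgroup1 | apply: iota1].
  move=> -[u Lu <-] [v Lv <-].
  by exists (u * v); rewrite ?iotaM //; apply: subgroupM.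
have /fintype.subsetP/(_ _ (iotaH x)) : H \subset Group gK.
  by apply: gen => y /AL Ly; rewrite inE; apply/asboolP; exists y.
by rewrite inE => /asboolP[y Ly /iota_inj <-].
Qed.

Lemma emb_strong_crit1 x y z : x \in H -> y \in H -> z \in H ->
  x * x = 1 -> y * y = 1 -> z * z = 1 -> x * y = y * x -> x * z != z * x ->
  (forall K : {group gT}, x \in K -> y \in K -> z \in K -> H \subset K) ->
  strong_crit1 G.
Proof.
move=> /iota_onto[x' <-] /iota_onto[y' <-] /iota_onto[z' <-] xx yy zz xy xz gen.
exists x', y', z'; split.
- by split; apply: iota_inj; rewrite iotaM iota1.
- by apply: iota_inj; rewrite !iotaM.
- by move/(congr1 iota); rewrite !iotaM; apply/eqP.
- by apply/generatesP => K K3; apply: gen; apply: K3; [left; left | left; right | right].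
Qed.

Lemma emb_chiral_pair x s : x \in H -> s \in H -> x * x = 1 ->
  (forall K : {group gT}, x \in K -> s \in K -> H \subset K) ->
  (x * x ^ (s ^+ 2) * x ^ (s ^+ 3)) ^+ 6 = 1 ->
  (x ^ (s ^+ 3) * x ^ s * x) ^+ 6 <> 1 -> crit2ex G.
Proof.
move=> /iota_onto[x' <-] /iota_onto[s' <-] xx gen e ne.
apply: (@chiral_pair _ x' s').
- by apply: iota_inj; rewrite iotaM iota1.
- by apply/generatesP => K K2; apply: gen; apply: K2; [left | right].
- by apply: iota_inj; rewrite iota1 iotaX 2!iotaM !iotaJ !iotaX.
- by move=> h; apply: ne; rewrite -iota1 -h iotaX 2!iotaM !iotaJ !iotaX.
Qed.

End Embedding.

Local Close Scope group_scope.
Local Close Scope classical_set_scope.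

Local Open Scope group_scope.

(** * Reflections of a regular polygon *)

(** The dihedral group of the regular [m]-gon with vertices [e, ..., e + m - 1],
    acting also on the points below [e] through the lists [e0] and [e1]. *)
Section Dihedral.
Variables (N e c m : nat) (e0 e1 : seq (nat * nat)).
Hypotheses (cm : c.+1 < m) (mN : e + m = N.+1).
Hypotheses (e0e : all (fun p => (p.1 < e) && (p.2 < e)) e0)
  (e1e : all (fun p => (p.1 < e) && (p.2 < e)) e1).

Definition flip0 := tl N (e0 ++ refl e c m).
Definition flip1 := tl N (e1 ++ refl e c.+1 m).
Definition rot := flip0 * flip1.

Let inside_small l : all (fun p => (p.1 < e) && (p.2 < e)) l -> inside N l.
Proof. by apply: sub_all => p; lia. Qed.

Let inside0 : inside N (e0 ++ refl e c m).
Proof. by rewrite /inside all_cat -!/(inside N _) inside_small ?inside_refl //; lia. Qed.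

Let inside1 : inside N (e1 ++ refl e c.+1 m).
Proof. by rewrite /inside all_cat -!/(inside N _) inside_small ?inside_refl //; lia. Qed.

Lemma flip0_inord k : k <= N -> flip0 (inord k) = inord (run (e0 ++ refl e c m) k).
Proof. exact: tl_inord. Qed.

Lemma flip1_inord k : k <= N -> flip1 (inord k) = inord (run (e1 ++ refl e c.+1 m) k).
Proof. exact: tl_inord. Qed.

Lemma run_small_lt l k : all (fun p => (p.1 < e) && (p.2 < e)) l -> k < e ->
  run l k < e.
Proof.
elim: l k => //= p l IHl k /andP[/andP[p1 p2] le] ke.
by apply: IHl; rewrite // /swapn; do ![case: ifP].
Qed.

Lemma rot_step k : e <= k -> k.+1 < e + m -> rot (inord k) = inord k.+1.
Proof.
move=> ek km; rewrite permM flip0_inord; last by lia.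
rewrite run_cat (run_small e0e ek) run_refl; last by lia.
set j := (X in inord X).
have [ej jN] : e <= j /\ j <= N by rewrite /j; do ![case: ifP]; lia.
rewrite flip1_inord // run_cat (run_small e1e ej) run_refl //.
by congr inord; rewrite /j; do ![case: ifP]; lia.
Qed.

Lemma rot_back k : e <= k -> k.+1 < e + m -> rot^-1 (inord k.+1) = inord k.
Proof. by move=> ek km; rewrite -(rot_step ek km) permK. Qed.

Lemma rot_small k : k < e -> rot (inord k) = inord (run (e0 ++ e1) k).
Proof.
move=> ke; rewrite permM flip0_inord; last by lia.
have k0 := run_small_lt e0e ke; have k1 := run_small_lt e1e k0.
rewrite run_cat run_refl; last by lia.
rewrite k0 flip1_inord; last by lia.
by rewrite run_cat run_refl // k1 run_cat.
Qed.

Lemma flip0_low k : e <= k -> k <= e + c -> flip0 (inord k) = inord (e.*2 + c - k).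
Proof.
move=> ek kc; rewrite flip0_inord; last by lia.
rewrite run_cat (run_small e0e ek) run_refl; last by lia.
by congr inord; do ?[case: ifP]; lia.
Qed.

Lemma flip0_small k : k < e -> flip0 (inord k) = inord (run e0 k).
Proof.
move=> ke; rewrite flip0_inord; last by lia.
by rewrite run_cat run_refl ?run_small_lt //; lia.
Qed.

Let sq_refl l c' : c' < m -> inside N (l ++ refl e c' m) ->
  all (fun p => (p.1 < e) && (p.2 < e)) l ->
  all (fun k => run (l ++ l) k == k) (iota 0 e) ->
  tl N (l ++ refl e c' m) * tl N (l ++ refl e c' m) = 1.
Proof.
move=> c'm ins le /allP ll; apply/permP=> i; apply: val_inj.
rewrite permM perm1 /= !runE //.
have small k : k < e -> run (l ++ refl e c' m) k = run l k.
  by move=> ke; rewrite run_cat run_refl // run_small_lt.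
have big k : e <= k -> run (l ++ refl e c' m) k = run (refl e c' m) k.
  by move=> ek; rewrite run_cat (run_small le ek).
have [ie|ei] := ltnP i e.
  rewrite !small ?run_small_lt //.
  by have := ll i; rewrite mem_iota ie run_cat => /(_ isT)/eqP.
have iN := ltn_ord i.
rewrite [X in run _ X]big // [X in run _ X]run_refl //; set j := (X in run _ X).
have ej : e <= j by rewrite /j; do ![case: ifP]; lia.
rewrite big // run_refl //.
by rewrite /j; do ![case: ifP]; lia.
Qed.

Lemma flip0_sq : all (fun k => run (e0 ++ e0) k == k) (iota 0 e) -> flip0 * flip0 = 1.
Proof. by apply: sq_refl => //; lia. Qed.

Lemma flip1_sq : all (fun k => run (e1 ++ e1) k == k) (iota 0 e) -> flip1 * flip1 = 1.
Proof. by apply: sq_refl => //; lia. Qed.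

Lemma odd_flip0 : all (fun p => p.1 != p.2) e0 ->
  odd_perm flip0 = odd (size e0 + ((c.+1)./2 + (m - c.+1)./2)).
Proof.
move=> d; rewrite -(size_refl e) -size_cat; apply: odd_tl inside0 _.
by rewrite all_cat d neq_refl //; lia.
Qed.

Lemma odd_flip1 : all (fun p => p.1 != p.2) e1 ->
  odd_perm flip1 = odd (size e1 + ((c.+2)./2 + (m - c.+2)./2)).
Proof.
move=> d; rewrite -(size_refl e) -size_cat; apply: odd_tl inside1 _.
by rewrite all_cat d neq_refl.
Qed.

Lemma flips_ncomm : 2 < m -> flip0 * flip1 != flip1 * flip0.
Proof.
move=> m2; apply/eqP=> /permP/(_ (inord e)); rewrite -/rot rot_step //; last by lia.
have h1 : flip1 (inord e) = inord (e + c.+1).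
  rewrite flip1_inord; last by lia.
  rewrite run_cat (run_small e1e (leqnn e)) run_refl //.
  by congr inord; do ?[case: ifP]; lia.
have h0 : flip0 (inord (e + c.+1)) = inord (e + m.-1).
  rewrite flip0_inord; last by lia.
  rewrite run_cat (run_small e0e) ?leq_addr // run_refl; last by lia.
  by congr inord; do ?[case: ifP]; lia.
rewrite permM h1 h0 => /(congr1 val) /=; rewrite !inordE; lia.
Qed.

(** The effect of the rotation on the points below [e] and on all vertices
    but the last one, which is all that short words in small points need. *)
Definition shiftn k := if k < e then run (e0 ++ e1) k else k.+1.

Lemma tl_rot l : all (fun p => (p.1.+1 < e + m) && (p.2.+1 < e + m)) l ->
  tl N l ^ rot = tl N (mapp shiftn l).
Proof.
move=> le; apply: tl_conj; apply: sub_all le => p /andP[p1 p2].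
by rewrite /shiftn; apply/andP; split;
  (case: ifP => h; [rewrite rot_small | rewrite rot_step]); rewrite //; lia.
Qed.

Variable K : {group 'S_N.+1}.
Hypothesis rK : rot \in K.

(** Conjugation by the rotation carries links to links. *)
Lemma linked_centre w a : rot w = w -> e <= a -> a < e + m ->
  linked K (inord a) w -> forall k, e <= k -> k < e + m -> linked K (inord k) w.
Proof.
move=> rw ea am La.
have up k : e <= k -> k.+1 < e + m -> linked K (inord k) w -> linked K (inord k.+1) w.
  by move=> ek km L; rewrite -(rot_step ek km) -[w]rw; apply: linked_img.
have dn k : e <= k -> k.+1 < e + m -> linked K (inord k.+1) w -> linked K (inord k) w.
  move=> ek km L; have rK' : rot^-1 \in K by rewrite groupV.
  by have := linked_img rK' L; rewrite -(rot_step ek km) permK -[in rot^-1 w]rw permK.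
have L0 : linked K (inord e) w.
  have [d ad] : exists d, a = e + d by exists (a - e); lia.
  move: a ad ea am La => _ ->; elim: d => [|d IHd]; first by rewrite addn0.
  by move=> h1 h2 L; apply: IHd; try lia; apply: dn; rewrite -?addnS //; lia.
move=> k ek; have [d ->] : exists d, k = e + d by exists (k - e); lia.
elim: d => [|d IHd] h; first by rewrite addn0.
by rewrite addnS; apply: up; try lia; apply: IHd; lia.
Qed.

(** The rotation carries the given link to all edges of the polygon, and
    linking is transitive. *)
Lemma linked_path a : e <= a -> a.+1 < e + m ->
  linked K (inord a) (inord a.+1) ->
  forall k, e <= k -> k < e + m -> linked K (inord k) (inord e).
Proof.
move=> ea am La.
have L0 : linked K (inord e) (inord e.+1).
  have [d ad] : exists d, a = e + d by exists (a - e); lia.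
  move: a ad ea am La => _ ->; elim: d => [|d IHd]; first by rewrite addn0.
  move=> h1 h2 L; apply: IHd; try lia.
  have rK' : rot^-1 \in K by rewrite groupV.
  by have := linked_img rK' L; rewrite !addnS !rot_back //; lia.
have L d : e + d.+1 < e + m -> linked K (inord (e + d)) (inord (e + d).+1).
  elim: d => [|d IHd] h; first by rewrite addn0.
  have hd : linked K (inord (e + d)) (inord (e + d).+1) by apply: IHd; lia.
  have := linked_img rK hd; rewrite !rot_step; try lia.
  by rewrite addnS.
move=> k ek; have [d ->] : exists d, k = e + d by exists (k - e); lia.
elim: d => [|d IHd] h; first by rewrite addn0; left.
apply: linked_trans (IHd _); last by lia.
by rewrite addnS; apply/linked_sym/L; lia.
Qed.

End Dihedral.

(** * Generators of symmetric and alternating groups *)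

Definition embedding (G gT : finGroupType) (H : {group gT}) (iota : G -> gT) :=
  [/\ {morph iota : x y / x * y}, injective iota, forall x, iota x \in H
    & forall y, y \in H -> exists x, iota x = y].

Lemma embedding_Sn n : @embedding (Sn n) ('S_n) [set: 'S_n]%G id.
Proof. by split=> // [x|x _]; [rewrite finset.in_setT | exists x]. Qed.

Lemma embedding_An n : @embedding (An n) ('S_n) (Alt_group 'I_n) (@sgval _ _).
Proof.
split=> [x y||x|y Hy]; [exact: sgvalM | exact: val_inj | exact: subgP |].
by exists (subg _ y); rewrite subgK.
Qed.

(** The subgroups generated by an [n]-cycle or an [(n - 1)]-cycle together
    with something else are determined by parity, once they contain the
    alternating group. *)
Definition parity_gen N (H : {group 'S_N.+1}) (s : 'S_N.+1) :=
  H = 'Alt_('I_N.+1) :> {set _} /\ ~~ odd_perm s \/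
  H = [set: 'S_N.+1]%SET :> {set _} /\ odd_perm s.

Lemma parity_mem N (H : {group 'S_N.+1}) s t : parity_gen H s -> ~~ odd_perm t ->
  s \in H /\ t \in H.
Proof. by case=> -[-> so] te; rewrite ?Alt_even ?finset.in_setT. Qed.

Lemma parity_sub N (H K : {group 'S_N.+1}) s : parity_gen H s -> s \in K ->
  'Alt_('I_N.+1) \subset K -> H \subset K.
Proof.
case=> -[-> so] sK AK //.
by rewrite (Alt_odd_full AK sK so).
Qed.

Lemma linked_all N (K : {group 'S_N.+1}) w :
  (forall k, k <= N -> linked K (inord k) w) -> 'Alt_('I_N.+1) \subset K.
Proof.
move=> L; apply: linked_Alt => x y.
apply: (@linked_trans _ _ w); last apply: linked_sym.
- by have := L x; rewrite inord_val; apply; rewrite -ltnS.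
- by have := L y; rewrite inord_val; apply; rewrite -ltnS.
Qed.

Lemma cyc3_linked N (K : {group 'S_N.+1}) a b c l : a <= N -> b <= N -> c <= N ->
  a != b -> a != c -> b != c ->
  tl N l = tl N [:: (a, b); (a, c)] -> tl N l \in K ->
  linked K (inord a) (inord b) /\ linked K (inord a) (inord c).
Proof.
move=> aN bN cN ab ac bc -> ; rewrite cyc3_tl => Kc.
have nq u v : u <= N -> v <= N -> u != v -> (inord u : 'I_N.+1) != inord v.
  by move=> uN vN; apply: contra => /eqP/(congr1 val); rewrite /= !inordE // => ->.
split; right; [exists (inord c) | exists (inord b)]; split; rewrite ?nq // 1?eq_sym //.
by rewrite -groupV cyc3V; rewrite eq_sym in bc.
Qed.

Section Families.
Variables (N : nat) (G : finGroupType) (H : {group 'S_N.+1}) (j : G -> 'S_N.+1).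
Hypothesis emb : embedding H j.

Ltac tl_eval K := apply: (@tl_eq N K); [by lia | by vm_compute | by vm_compute].

(** The involution [(0 1)(2 4)] and the cycle [s = (0 1 ... N)]. The square
    of [x x^(s^3)] is a 3-cycle on [2, 3, 4], which links two neighbours. *)
Lemma chiral_full_cycle : 7 <= N -> parity_gen H (rot N 0 0 N.+1 [::] [::]) ->
  crit2ex G.
Proof.
move=> N7 par; have [iM iI iH iO] := emb; set s := rot _ _ _ _ _ _ in par.
pose x0 := [:: (0, 1); (2, 4)]%N; pose x1 := [:: (1, 2); (3, 5)]%N.
pose x2 := [:: (2, 3); (4, 6)]%N; pose x3 := [:: (3, 4); (5, 7)]%N.
have m1 : 1 < N.+1 by lia.
have m0 : (0 + N.+1 = N.+1)%N by [].
have i0 : all (fun p => (p.1 < 0) && (p.2 < 0)) [::] by [].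
have i1 : all (fun p => (p.1 < 0) && (p.2 < 0)) [::] by [].
have tr := @tl_rot N 0 0 N.+1 [::] [::] m1 m0 i0 i1.
have s1 : tl N x0 ^ s = tl N x1 by rewrite /s tr // /x0 /=; lia.
have s2 : tl N x0 ^ (s ^+ 2) = tl N x2.
  by rewrite expgS expg1 conjgM s1 /s tr // /x0 /=; lia.
have s3 : tl N x0 ^ (s ^+ 3) = tl N x3.
  by rewrite expgSr conjgM s2 /s tr // /x0 /=; lia.
have x0even : ~~ odd_perm (tl N x0) by rewrite odd_tl //= /inside /=; lia.
have [sH xH] := parity_mem par x0even.
apply: (emb_chiral_pair iM iI iH iO xH sH); rewrite ?s1 ?s2 ?s3.
- by rewrite -tl_cat -tl_nil; tl_eval 8.
- move=> K xK sK; apply: (parity_sub par sK).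
  have x3K : tl N x3 \in K by rewrite -s3 groupJ ?groupX.
  have cK : tl N (pwr 2 (x0 ++ x3)) \in K by rewrite tl_pwr tl_cat groupX ?groupM.
  have [_ L] : linked K (inord 2) (inord 4) /\ linked K (inord 2) (inord 3).
    by apply: cyc3_linked cK; rewrite ?(leq_trans _ N7) //; tl_eval 8.
  apply: (@linked_all _ _ (inord 0)) => k kN.
  by apply: (@linked_path N 0 0 N.+1 [::] [::] m1 m0 i0 i1 K sK 2) => //; lia.
- by rewrite -!tl_cat -tl_pwr -tl_nil; tl_eval 8.
rewrite -!tl_cat -tl_pwr -tl_nil.
by apply: (@tl_neq N 8 0); [lia | vm_compute | vm_compute].
Qed.

(** The same with the fixed point [0] of the cycle [s = (1 ... N)] and the
    involution [(1 2)(3 0)]; the 3-cycle now links [3] to the fixed point. *)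
Lemma chiral_long_cycle : 6 <= N -> parity_gen H (rot N 1 0 N [::] [::]) ->
  crit2ex G.
Proof.
move=> N7 par; have [iM iI iH iO] := emb; set s := rot _ _ _ _ _ _ in par.
pose x0 := [:: (1, 2); (3, 0)]%N; pose x1 := [:: (2, 3); (4, 0)]%N.
pose x2 := [:: (3, 4); (5, 0)]%N; pose x3 := [:: (4, 5); (6, 0)]%N.
have m1 : 1 < N by lia.
have m0 : (1 + N = N.+1)%N by [].
have i0 : all (fun p => (p.1 < 1) && (p.2 < 1)) [::] by [].
have i1 : all (fun p => (p.1 < 1) && (p.2 < 1)) [::] by [].
have tr := @tl_rot N 1 0 N [::] [::] m1 m0 i0 i1.
have s1 : tl N x0 ^ s = tl N x1 by rewrite /s tr // /x0 /=; lia.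
have s2 : tl N x0 ^ (s ^+ 2) = tl N x2.
  by rewrite expgS expg1 conjgM s1 /s tr // /x0 /=; lia.
have s3 : tl N x0 ^ (s ^+ 3) = tl N x3.
  by rewrite expgSr conjgM s2 /s tr // /x0 /=; lia.
have x0even : ~~ odd_perm (tl N x0) by rewrite odd_tl //= /inside /=; lia.
have [sH xH] := parity_mem par x0even.
apply: (emb_chiral_pair iM iI iH iO xH sH); rewrite ?s1 ?s2 ?s3.
- by rewrite -tl_cat -tl_nil; tl_eval 7.
- move=> K xK sK; apply: (parity_sub par sK).
  have x3K : tl N x3 \in K by rewrite -s3 groupJ ?groupX.
  have cK : tl N (pwr 2 (x0 ++ x3)) \in K by rewrite tl_pwr tl_cat groupX ?groupM.
  have [L _] : linked K (inord 3) (inord 0) /\ linked K (inord 3) (inord 6).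
    by apply: cyc3_linked cK; rewrite ?(leq_trans _ N7) //; tl_eval 7.
  apply: (@linked_all _ _ (inord 0)) => k kN.
  have [->|k1] := posnP k; first by left.
  apply: (@linked_centre N 1 0 N [::] [::] m1 m0 i0 i1 K sK (inord 0) 3) => //; try lia.
  by rewrite (rot_small m1 m0 i0 i1).
- by rewrite -!tl_cat -tl_pwr -tl_nil; tl_eval 7.
rewrite -!tl_cat -tl_pwr -tl_nil.
by apply: (@tl_neq N 7 1); [lia | vm_compute | vm_compute].
Qed.

(** The reflections [i -> c - i] and [i -> c + 1 - i] generate the dihedral
    group. The involution [tl N l] is symmetric under the first one, hence
    commutes with it, and two reflections of a polygon with at least three
    vertices do not commute; so the triple is [flip0], [tl N l], [flip1]. *)
Lemma dihedral_strong_crit1 e c m e0 l B :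
  0 < c -> c.+1 < m -> (e + m = N.+1)%N -> B <= N.+1 ->
  all (fun p => (p.1 < e) && (p.2 < e)) e0 ->
  all (fun k => run (e0 ++ e0) k == k) (iota 0 e) ->
  all (fun p => (p.1 <= e + c) && (p.2 <= e + c)) l ->
  all (fun p => (p.1 < B) && (p.2 < B)) l ->
  all (fun k => run (l ++ l) k == k) (iota 0 B) ->
  (let f k := (if k < e then run e0 k else e.*2 + c - k)%N in
   all (fun p => (p.1 < B) && (p.2 < B)) (mapp f l) &&
   all (fun k => run (mapp f l) k == run l k) (iota 0 B)) ->
  flip0 N e c m e0 \in H -> flip1 N e c m [::] \in H -> tl N l \in H ->
  (forall K : {group 'S_N.+1}, rot N e c m e0 [::] \in K -> tl N l \in K ->
    H \subset K) ->
  strong_crit1 G.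
Proof.
move=> c0 cm mN BN e0e e0sq lec lB lsq /= /andP[fB fl] f0H f1H lH gen.
have [iM iI iH iO] := emb.
have e1e : all (fun p => (p.1 < e) && (p.2 < e)) [::] by [].
apply: (emb_strong_crit1 iM iI iH iO f0H lH f1H).
- exact: flip0_sq cm mN e0e e1e _.
- rewrite -tl_cat -tl_nil; apply: (@tl_eq N B) => //.
  by rewrite cats0 all_cat lB.
- by apply: (flip1_sq cm mN e0e e1e); apply/allP=> k _; rewrite eqxx.
- set f := (f in mapp f l) in fB fl.
  have : tl N l ^ flip0 N e c m e0 = tl N (mapp f l).
    apply: tl_conj; apply: sub_all lec => p /andP[p1 p2].
    have fE k : k <= e + c -> flip0 N e c m e0 (inord k) == inord (f k).
      rewrite /f => kc; case: ltnP => ke; first by rewrite (flip0_small cm mN e0e e1e).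
      by rewrite (flip0_low cm mN e0e e1e).
    by rewrite !fE.
  rewrite (_ : tl N (mapp f l) = tl N l); last first.
    by apply: (@tl_eq N B); rewrite // all_cat fB.
  by move/(congr1 (mulg (flip0 N e c m e0))); rewrite conjgE mulVKg => ->.
- exact: flips_ncomm cm mN e0e e1e (leq_trans (c0 : 2 < c.+2) cm).
- by move=> K K0 Kl K1; apply: gen; rewrite // /rot groupM.
Qed.

(** For [n = 1] modulo 4 the reflections of the [n]-gon are even. *)
Lemma strong_crit1_1mod4 : 8 <= N -> (N %% 4 = 0)%N -> H = 'Alt_('I_N.+1) :> {set _} ->
  strong_crit1 G.
Proof.
move=> N8 N4 HA; have evenH t : ~~ odd_perm t -> t \in H by rewrite HA Alt_even.
pose l := [:: (0, 5); (2, 3)]%N; pose l1 := [:: (1, 6); (3, 4)]%N.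
have m1 : 6 < N.+1 by lia.
have m0 : (0 + N.+1 = N.+1)%N by [].
have i0 : all (fun p => (p.1 < 0) && (p.2 < 0)) [::] by [].
have i1 : all (fun p => (p.1 < 0) && (p.2 < 0)) [::] by [].
apply: (@dihedral_strong_crit1 0 5 N.+1 [::] l 6) => //; first by lia.
- by apply: evenH; rewrite (odd_flip0 m1 m0 i0 i1) //=; lia.
- by apply: evenH; rewrite (odd_flip1 m1 m0 i0 i1) //=; lia.
- by apply: evenH; rewrite odd_tl //= /inside /=; lia.
move=> K sK lK; rewrite HA; set s := rot _ _ _ _ _ _ in sK.
have l1E : tl N l ^ s = tl N l1 by rewrite /s (tl_rot m1 m0 i0 i1) // /l /=; lia.
have l1K : tl N l1 \in K by rewrite -l1E groupJ.
have cK : tl N (pwr 2 (l ++ l1)) \in K by rewrite tl_pwr tl_cat groupX ?groupM.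
have [L _] : linked K (inord 2) (inord 3) /\ linked K (inord 2) (inord 4).
  by apply: cyc3_linked cK; rewrite ?(leq_trans _ N8) //; tl_eval 7.
apply: (@linked_all _ _ (inord 0)) => k kN.
by apply: (linked_path m1 m0 i0 i1 sK (a := 2)) => //; lia.
Qed.

(** For [n = 2] modulo 4 the reflections of the [(n - 1)]-gon are even; here
    [0] is the point which they fix. *)
Lemma strong_crit1_2mod4 : 9 <= N -> (N %% 4 = 1)%N -> H = 'Alt_('I_N.+1) :> {set _} ->
  strong_crit1 G.
Proof.
move=> N9 N4 HA; have evenH t : ~~ odd_perm t -> t \in H by rewrite HA Alt_even.
pose l := [:: (1, 5); (3, 0)]%N; pose l1 := [:: (2, 6); (4, 0)]%N.
have m1 : 5 < N by lia.
have m0 : (1 + N = N.+1)%N by [].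
have i0 : all (fun p => (p.1 < 1) && (p.2 < 1)) [::] by [].
have i1 : all (fun p => (p.1 < 1) && (p.2 < 1)) [::] by [].
apply: (@dihedral_strong_crit1 1 4 N [::] l 6) => //; first by lia.
- by apply: evenH; rewrite (odd_flip0 m1 m0 i0 i1) //=; lia.
- by apply: evenH; rewrite (odd_flip1 m1 m0 i0 i1) //=; lia.
- by apply: evenH; rewrite odd_tl //= /inside /=; lia.
move=> K sK lK; rewrite HA; set s := rot _ _ _ _ _ _ in sK.
have l1E : tl N l ^ s = tl N l1 by rewrite /s (tl_rot m1 m0 i0 i1) // /l /=; lia.
have l1K : tl N l1 \in K by rewrite -l1E groupJ.
have cK : tl N (pwr 2 (l ++ l1)) \in K by rewrite tl_pwr tl_cat groupX ?groupM.
have [L _] : linked K (inord 3) (inord 0) /\ linked K (inord 3) (inord 4).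
  by apply: cyc3_linked cK; rewrite ?(leq_trans _ N9) //; tl_eval 7.
apply: (@linked_all _ _ (inord 0)) => k kN.
have [->|k1] := posnP k; first by left.
apply: (linked_centre m1 m0 i0 i1 sK _ _ _ L) => //; try lia.
by rewrite (rot_small m1 m0 i0 i1).
Qed.

(** For [n = 3] modulo 4 the [(n - 3)]-gon has odd reflections through
    vertices and even ones through edges. The former are made even by
    exchanging [0] and [1]; the point [2] is fixed by both. *)
Lemma strong_crit1_3mod4 : 10 <= N -> (N %% 4 = 2)%N -> H = 'Alt_('I_N.+1) :> {set _} ->
  strong_crit1 G.
Proof.
move=> N10 N4 HA; have evenH t : ~~ odd_perm t -> t \in H by rewrite HA Alt_even.
pose l := [:: (5, 2); (4, 0); (6, 1); (3, 7)]%N.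
pose l1 := [:: (6, 2); (5, 1); (7, 0); (4, 8)]%N.
pose l2 := [:: (7, 2); (6, 0); (8, 1); (5, 9)]%N.
have m1 : 5 < N - 2 by lia.
have m0 : (3 + (N - 2) = N.+1)%N by lia.
have i0 : all (fun p => (p.1 < 3) && (p.2 < 3)) [:: (0, 1)%N] by [].
have i1 : all (fun p => (p.1 < 3) && (p.2 < 3)) [::] by [].
apply: (@dihedral_strong_crit1 3 4 (N - 2) [:: (0, 1)]%N l 8) => //; try lia.
- by apply: evenH; rewrite (odd_flip0 m1 m0 i0 i1) //=; lia.
- by apply: evenH; rewrite (odd_flip1 m1 m0 i0 i1) //=; lia.
- by apply: evenH; rewrite odd_tl //= /inside /=; lia.
move=> K sK lK; rewrite HA; set s := rot _ _ _ _ _ _ in sK.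
have l1E : tl N l ^ s = tl N l1 by rewrite /s (tl_rot m1 m0 i0 i1) // /l /=; lia.
have l2E : tl N l1 ^ s = tl N l2 by rewrite /s (tl_rot m1 m0 i0 i1) // /l1 /=; lia.
have l1K : tl N l1 \in K by rewrite -l1E groupJ.
have l2K : tl N l2 \in K by rewrite -l2E groupJ.
have cK : tl N (pwr 7 (l ++ l1 ++ l2)) \in K.
  by rewrite tl_pwr !tl_cat groupX ?groupM.
have [L _] : linked K (inord 4) (inord 2) /\ linked K (inord 4) (inord 8).
  by apply: cyc3_linked cK; rewrite ?(leq_trans _ N10) //; tl_eval 10.
have Lk k : 3 <= k -> k <= N -> linked K (inord k) (inord 2).
  move=> k3 kN; apply: (linked_centre m1 m0 i0 i1 sK _ _ _ L) => //; try lia.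
  by rewrite (rot_small m1 m0 i0 i1).
have lE a b : a <= N -> run l a = b -> tl N l (inord a) = inord b.
  by move=> aN <-; rewrite tl_inord //; apply: (@small_inside N 10); first lia.
have L5 : linked K (inord 5) (inord 2) by apply: Lk => //; lia.
have L0 : linked K (inord 0) (inord 5).
  have := linked_img lK (Lk 4 isT (leq_trans _ N10)).
  by rewrite (lE 4 0)%N ?(lE 2 5)%N ?(leq_trans _ N10) //; apply.
have L1 : linked K (inord 1) (inord 5).
  have := linked_img lK (Lk 6 isT (leq_trans _ N10)).
  by rewrite (lE 6 1)%N ?(lE 2 5)%N ?(leq_trans _ N10) //; apply.
apply: (@linked_all _ _ (inord 2)) => k kN.
have [k3|k3] := leqP 3 k; first exact: Lk.
case: k k3 kN => [|[|[|//]]] _ _; last by left.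
- exact: linked_trans L0 L5.
- exact: linked_trans L1 L5.
Qed.

(** For [n = 0] modulo 4 the [(n - 2)]-gon has odd reflections through edges
    and even ones through vertices; the former are made even by exchanging
    [0] and [1]. *)
Lemma strong_crit1_0mod4 : 11 <= N -> (N %% 4 = 3)%N -> H = 'Alt_('I_N.+1) :> {set _} ->
  strong_crit1 G.
Proof.
move=> N11 N4 HA; have evenH t : ~~ odd_perm t -> t \in H by rewrite HA Alt_even.
pose l := [:: (2, 0); (7, 1); (3, 4); (6, 5)]%N.
pose l1 := [:: (3, 1); (8, 0); (4, 5); (7, 6)]%N.
pose l2 := [:: (4, 0); (9, 1); (5, 6); (8, 7)]%N.
pose l3 := [:: (5, 1); (10, 0); (6, 7); (9, 8)]%N.
have m1 : 6 < N.-1 by lia.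
have m0 : (2 + N.-1 = N.+1)%N by lia.
have i0 : all (fun p => (p.1 < 2) && (p.2 < 2)) [:: (0, 1)%N] by [].
have i1 : all (fun p => (p.1 < 2) && (p.2 < 2)) [::] by [].
apply: (@dihedral_strong_crit1 2 5 N.-1 [:: (0, 1)]%N l 8) => //; try lia.
- by apply: evenH; rewrite (odd_flip0 m1 m0 i0 i1) //=; lia.
- by apply: evenH; rewrite (odd_flip1 m1 m0 i0 i1) //=; lia.
- by apply: evenH; rewrite odd_tl //= /inside /=; lia.
move=> K sK lK; rewrite HA; set s := rot _ _ _ _ _ _ in sK.
have l1E : tl N l ^ s = tl N l1 by rewrite /s (tl_rot m1 m0 i0 i1) // /l /=; lia.
have l2E : tl N l1 ^ s = tl N l2 by rewrite /s (tl_rot m1 m0 i0 i1) // /l1 /=; lia.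
have l3E : tl N l2 ^ s = tl N l3 by rewrite /s (tl_rot m1 m0 i0 i1) // /l2 /=; lia.
have l3K : tl N l3 \in K by rewrite -l3E -l2E -l1E !groupJ.
have cK : tl N (pwr 2 (l ++ l3)) \in K.
  by rewrite tl_pwr !tl_cat groupX ?groupM.
have [L _] : linked K (inord 2) (inord 0) /\ linked K (inord 2) (inord 10).
  by apply: cyc3_linked cK; rewrite ?(leq_trans _ N11) //; tl_eval 11.
have s0 : s (inord 0) = inord 1 by rewrite /s (rot_small m1 m0 i0 i1).
have s1 : s (inord 1) = inord 0 by rewrite /s (rot_small m1 m0 i0 i1).
have sE k : 2 <= k -> k < N -> s (inord k) = inord k.+1.
  by move=> k2 kN; rewrite /s (rot_step m1 m0 i0 i1) //; lia.
have Lk d : d.+2 <= N -> linked K (inord d.+2) (inord (if odd d then 1 else 0)%N).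
  elim: d => [|d IHd] dN; first exact: L.
  have := linked_img sK (IHd (ltnW dN)); rewrite sE //=.
  by case: (odd d); rewrite /= ?s0 ?s1.
have lE a b : a <= N -> run l a = b -> tl N l (inord a) = inord b.
  by move=> aN <-; rewrite tl_inord //; apply: (@small_inside N 10); first lia.
(* 3 and 9 are odd, and the involution moves 3 to 4 but fixes 9 *)
have L39 : linked K (inord 3) (inord 9).
  have L31 : linked K (inord 3) (inord 1) by apply: (Lk 1%N); lia.
  by apply: linked_trans L31 _; apply/linked_sym/(Lk 7); lia.
have L49 : linked K (inord 4) (inord 9).
  by have := linked_img lK L39; rewrite (lE 3 4)%N ?(lE 9 9)%N //; lia.
have L10 : linked K (inord 1) (inord 0).
  have L91 : linked K (inord 9) (inord 1) by apply: (Lk 7); lia.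
  have L40 : linked K (inord 4) (inord 0) by apply: (Lk 2); lia.
  apply: linked_trans (linked_sym L91) _.
  exact: linked_trans (linked_sym L49) L40.
apply: (@linked_all _ _ (inord 0)) => -[|[|k]] kN //; first by left.
have := Lk k kN; case: (odd k) => // h; exact: linked_trans h L10.
Qed.

(** An [n]-cycle and a transposition of neighbours generate the symmetric
    group, and the transposition commutes with the reflection which
    exchanges these neighbours. *)
Lemma strong_crit1_Sn : 2 <= N -> H = [set: 'S_N.+1]%SET :> {set _} -> strong_crit1 G.
Proof.
move=> N2 HT; have inH t : t \in H by rewrite HT finset.in_setT.
have m1 : 2 < N.+1 by lia.
have m0 : (0 + N.+1 = N.+1)%N by [].
have i0 : all (fun p => (p.1 < 0) && (p.2 < 0)) [::] by [].
have i1 : all (fun p => (p.1 < 0) && (p.2 < 0)) [::] by [].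
apply: (@dihedral_strong_crit1 0 1 N.+1 [::] [:: (0, 1)]%N 2); rewrite ?inH //; first by lia.
move=> K sK lK.
rewrite HT; set s := rot _ _ _ _ _ _ in sK.
have tE a b : tl N [:: (a, b)] = tperm (inord a) (inord b).
  by rewrite /tl big_seq1.
rewrite tE in lK.
have sE k : k < N -> s (inord k) = inord k.+1.
  by move=> kN; rewrite /s (rot_step m1 m0 i0 i1) //; lia.
have tK k : k < N -> tperm (inord k) (inord k.+1) \in K.
  elim: k => [//|k IHk] kN; have := groupJ (IHk (ltnW kN)) sK.
  by rewrite tpermJ !sE //; lia.
have t0K k : k <= N -> tperm (inord 0) (inord k) \in K.
  elim: k => [|[|k] IHk] kN; [by rewrite tperm1 group1 | exact: tK |].
  have := groupJ (IHk (ltnW kN)) (tK k.+1 kN); rewrite tpermJ tpermL tpermD //.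
    by apply/eqP => /(congr1 val) /=; rewrite !inordE //; exact: ltnW.
  by apply/eqP => /(congr1 val) /=; rewrite !inordE.
suff -> : K = [set: 'S_N.+1]%SET :> {set _} by [].
apply: tperm_full => x y; rewrite -[x]inord_val -[y]inord_val.
have xN : x <= N by rewrite -ltnS.
have yN : y <= N by rewrite -ltnS.
have [x0|x0] := eqVneq (x : nat) 0%N; first by rewrite x0 t0K.
have [y0|y0] := eqVneq (y : nat) 0%N; first by rewrite y0 tpermC t0K.
have [->|xy] := eqVneq x y; first by rewrite tperm1 group1.
have := groupJ (t0K x xN) (t0K y yN); rewrite tpermJ tpermL tpermD 1?tpermC //.
- by apply/eqP=> /(congr1 val); rewrite /= !inordE //; lia.
- by rewrite !inord_val eq_sym.
Qed.

End Families.

(** * Explicit generators in small degrees *)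

Definition evalw (G : groupType) (gs : seq G) (w : seq nat) : G :=
  \prod_(i <- w) nth 1 gs i.

Lemma evalw_morph (G K : groupType) (f : G -> K) gs w :
  {morph f : x y / x * y} -> f (evalw gs w) = evalw (map f gs) w.
Proof.
move=> fM; have f1 : f 1 = 1 by apply: (@mulgI _ (f 1)); rewrite -fM !mulg1.
elim: w => [|i w IHw]; first by rewrite /evalw !big_nil.
rewrite /evalw !big_cons fM -!/(evalw _ w) IHw; congr (_ * _).
have [iG|iG] := ltnP i (size gs); first by rewrite (nth_map 1).
by rewrite !nth_default ?size_map.
Qed.

Definition wordl (ls : seq (seq (nat * nat))) (w : seq nat) : seq (nat * nat) :=
  flatten [seq nth [::] ls i | i <- w].

Lemma evalw_tl N ls w : evalw (map (tl N) ls) w = tl N (wordl ls w).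
Proof.
elim: w => [|i w IHw]; first by rewrite /evalw big_nil tl_nil.
rewrite /evalw big_cons -/(evalw _ w) IHw /wordl /= tl_cat; congr (_ * _).
have [iG|iG] := ltnP i (size ls); first by rewrite (nth_map [::]).
by rewrite !nth_default ?size_map // tl_nil.
Qed.

Definition bounded N l := all (fun p : nat * nat => (p.1 < N.+1) && (p.2 < N.+1)) l.
Definition same_run N l l' := all (fun k => run l k == run l' k) (iota 0 N.+1).
(** A certificate that permutations generate at least the alternating group:
    words whose values are 3-cycles [(0 k c)], every other point being [k]
    or [c] in one of them. *)
Definition alt_certificate N ls (cs : seq (nat * nat * seq nat)) :=
  [&& all (bounded N) ls,
      all (fun c => [&& 0 < c.1.1 <= N, 0 < c.1.2 <= N, c.1.1 != c.1.2
        & same_run N (wordl ls c.2) [:: (0, c.1.1); (0, c.1.2)]%N]) cs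
    & all (fun k => has (fun c => (k == c.1.1) || (k == c.1.2)) cs) (iota 1 N)].

Lemma bounded_wordl N ls w : all (bounded N) ls -> bounded N (wordl ls w).
Proof.
move=> /allP lsN; elim: w => //= i w IHw; rewrite /bounded all_cat.
rewrite -!/(bounded N _) [X in _ && X]IHw andbT.
have [iG|iG] := ltnP i (size ls); last by rewrite nth_default.
exact/lsN/mem_nth.
Qed.

Lemma same_run_tl N l l' : bounded N l -> bounded N l' -> same_run N l l' ->
  tl N l = tl N l'.
Proof. by move=> lN lN'; apply: tl_eq => //; rewrite all_cat; apply/andP. Qed.

Lemma diff_run_tl N l l' : bounded N l -> bounded N l' -> ~~ same_run N l l' ->
  tl N l <> tl N l'.
Proof.
move=> lN lN' /allPn[k]; rewrite mem_iota => /andP[_ kN] ne.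
apply: (@tl_neq N N.+1 k) => //; first by rewrite all_cat; apply/andP.
by rewrite ne andbT.
Qed.

Lemma certificate_Alt N ls cs (K : {group 'S_N.+1}) :
  alt_certificate N ls cs -> (forall l, l \in ls -> tl N l \in K) ->
  'Alt_('I_N.+1) \subset K.
Proof.
case/and3P=> lsN /allP csP /allP cov lsK.
apply: (@linked_all _ _ (inord 0)) => k kN.
have [->|k0] := posnP k; first by left.
have /hasP[[[a b] w] /csP /and4P[/= a0 b0 ab e]] := cov k ltac:(rewrite mem_iota; lia).
have wK : tl N (wordl ls w) \in K.
  rewrite -evalw_tl /evalw; apply: group_prod => i _.
  have [iG|iG] := ltnP i (size ls); last by rewrite nth_default ?size_map // group1.
  by rewrite (nth_map [::]) //; apply/lsK/mem_nth.
have wE : tl N (wordl ls w) = tl N [:: (0, a); (0, b)]%N.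
  apply: same_run_tl e; first exact: bounded_wordl.
  by rewrite /bounded /=; lia.
have [||||||La Lb] := cyc3_linked _ _ _ _ _ _ wE wK; try lia.
by case/orP=> /eqP->; apply: linked_sym.
Qed.

Lemma certificate_Alt2 N la lb cs (K : {group 'S_N.+1}) :
  alt_certificate N [:: la; lb] cs -> tl N la \in K -> tl N lb \in K ->
  'Alt_('I_N.+1) \subset K.
Proof.
move=> cert aK bK; apply: (certificate_Alt cert) => l.
by rewrite !inE => /orP[] /eqP->.
Qed.

Section Concrete.
Variables (N : nat) (G : finGroupType) (H : {group 'S_N.+1}) (j : G -> 'S_N.+1).
Hypothesis emb : embedding H j.

Definition even_list l := [&& bounded N l, all (fun p : nat * nat => p.1 != p.2) l
  & ~~ odd (size l)].

Lemma even_list_odd l : even_list l -> ~~ odd_perm (tl N l).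
Proof.
by case/and3P=> lN ld le; rewrite odd_tl.
Qed.

Lemma involution_tl l : bounded N l -> same_run N (l ++ l) [::] ->
  tl N l * tl N l = 1.
Proof.
move=> lN e; rewrite -tl_cat -tl_nil; apply: same_run_tl => //.
by rewrite /bounded all_cat -!/(bounded _ _) lN.
Qed.

Lemma bounded_pwr k l : bounded N l -> bounded N (pwr k l).
Proof.
by move=> lN; elim: k => //= k IHk; rewrite /bounded /pwr /= all_cat; apply/andP.
Qed.

(** An automorphism preserves the set of words which are trivial in its
    arguments; this gives a test by evaluation of a single word. *)
Lemma no_automorphism (gs gs' : seq G) (ls ls' : seq (seq (nat * nat))) w k :
  map j gs = map (tl N) ls -> map j gs' = map (tl N) ls' ->
  all (bounded N) ls -> all (bounded N) ls' ->
  same_run N (pwr k (wordl ls w)) [::] ->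
  ~~ same_run N (pwr k (wordl ls' w)) [::] ->
  forall alpha, automorphism alpha -> map alpha gs <> gs'.
Proof.
have [jM j_inj _ _] := emb.
move=> gsE gsE' lsN lsN' e ne alpha aut agE.
have eG : evalw gs w ^+ k = 1.
  apply: j_inj; rewrite (iota1 jM) (iotaX jM) evalw_morph // gsE evalw_tl.
  rewrite -tl_pwr -tl_nil; apply: same_run_tl => //.
  exact/bounded_pwr/bounded_wordl.
have := congr1 alpha eG.
rewrite automorphism1 // automorphismX // evalw_morph ?agE; last by case: aut.
move/(congr1 j); rewrite (iota1 jM) (iotaX jM) evalw_morph // gsE' evalw_tl.
rewrite -tl_pwr -tl_nil; apply: diff_run_tl => //.
exact/bounded_pwr/bounded_wordl.
Qed.

Lemma concrete_crit2 lx ly lz w k cs : H = 'Alt_('I_N.+1) :> {set _} ->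
  alt_certificate N [:: lx; ly; lz] cs ->
  all (fun l => even_list l && same_run N (l ++ l) [::]) [:: lx; ly; lz] ->
  same_run N (pwr k (wordl [:: lx; ly; lz] w)) [::] ->
  ~~ same_run N (pwr k (wordl [:: lx; lz; ly] w)) [::] -> crit2 G.
Proof.
move=> HA cert /and4P[/andP[xe xx] /andP[ye yy] /andP[ze zz] _] e ne.
have [jM j_inj jH j_onto] := emb.
have HE l : even_list l -> exists g, j g = tl N l.
  by move=> le; apply: j_onto; rewrite HA Alt_even even_list_odd.
have [x xE] := HE _ xe; have [y yE] := HE _ ye; have [z zE] := HE _ ze.
have sq g l : j g = tl N l -> even_list l -> same_run N (l ++ l) [::] -> g * g = 1.
  move=> gE /and3P[lN _ _] ll; apply: j_inj.
  by rewrite jM gE (iota1 jM) involution_tl.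
exists x, y, z; split; rewrite ?(sq _ _ xE) ?(sq _ _ yE) ?(sq _ _ zE) //.
  apply/(generatesP jM j_inj jH j_onto) => K gK; rewrite HA.
  apply: (certificate_Alt cert) => l; rewrite !inE => /or3P[] /eqP->.
  - by rewrite -xE; apply: gK; left; left.
  - by rewrite -yE; apply: gK; left; right.
  - by rewrite -zE; apply: gK; right.
have [xN _ _] := and3P xe; have [yN _ _] := and3P ye; have [zN _ _] := and3P ze.
case=> alpha aut [ax ay az].
apply: (@no_automorphism [:: x; y; z] [:: x; z; y] _ _ w k _ _ _ _ e ne alpha aut);
  by rewrite /= ?xE ?yE ?zE ?ax ?ay ?az // xN yN zN.
Qed.

Lemma concrete_strong_crit1 lx ly lz cs : H = 'Alt_('I_N.+1) :> {set _} ->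
  alt_certificate N [:: lx; ly; lz] cs ->
  all (fun l => even_list l && same_run N (l ++ l) [::]) [:: lx; ly; lz] ->
  same_run N (lx ++ ly) (ly ++ lx) -> ~~ same_run N (lx ++ lz) (lz ++ lx) ->
  strong_crit1 G.
Proof.
move=> HA cert /and4P[/andP[xe xx] /andP[ye yy] /andP[ze zz] _] e ne.
have [jM j_inj jH j_onto] := emb.
have HE l : even_list l -> tl N l \in H by move=> le; rewrite HA Alt_even even_list_odd.
have [xN _ _] := and3P xe; have [yN _ _] := and3P ye; have [zN _ _] := and3P ze.
have catN l l' : bounded N l -> bounded N l' -> bounded N (l ++ l').
  by move=> ? ?; rewrite /bounded all_cat; apply/andP.
apply: (emb_strong_crit1 jM j_inj jH j_onto (HE _ xe) (HE _ ye) (HE _ ze));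
  rewrite ?involution_tl //.
- by rewrite -!tl_cat; apply: same_run_tl; rewrite ?catN.
- by apply/eqP; rewrite -!tl_cat; apply: diff_run_tl; rewrite ?catN.
move=> K xK yK zK; rewrite HA; apply: (certificate_Alt cert) => l.
by rewrite !inE => /or3P[] /eqP->.
Qed.

End Concrete.

Lemma pred_nat n : 0 < n -> exists N, n = N.+1.
Proof. by case: n => // N _; exists N. Qed.

Definition gen6_x := [:: (0, 1); (2, 3)]%N.
Definition gen6_s := [:: (0, 2); (0, 4); (3, 5)]%N.

Lemma generate_S6 (K : {group 'S_6}) : tl 5 gen6_x \in K -> tl 5 gen6_s \in K ->
  K = [set: 'S_6]%SET :> {set _}.
Proof.
have cert : alt_certificate 5 [:: gen6_x; gen6_s] [:: (4, 2, [:: 1; 1]);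
    (5, 3, [:: 1; 0; 1; 1; 1; 0; 1; 1]);
    (3, 1, [:: 1; 1; 0; 1; 1; 0; 1; 1; 1; 1])]%N by vm_compute.
move=> xK sK; apply: Alt_odd_full (certificate_Alt2 cert xK sK) sK _.
by rewrite odd_tl; vm_compute.
Qed.

(** The cycle has to be odd, which decides between the lengths [n] and
    [n - 1]; the degree 6 is too small for these pairs and has its own one. *)
Lemma crit2ex_Sn n : 6 <= n -> crit2ex (Sn n).
Proof.
move=> n6; have [N nN] := pred_nat (leq_trans (isT : 0 < 6) n6); subst n.
have emb := embedding_Sn N.+1.
have [N5|N5] := eqVneq N 5%N.
  subst N; have [jM j_inj jH j_onto] := emb.
  pose lx := gen6_x; pose ls := gen6_s; exists (tl 5 lx), (tl 5 ls); split.
  - by apply: involution_tl; vm_compute.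
  - apply/(generatesP jM j_inj jH j_onto) => K gK.
    by rewrite (generate_S6 (gK _ (or_introl erefl)) (gK _ (or_intror erefl))).
  case=> alpha aut [ax as_].
  pose L := [:: lx; ls; rev ls]; pose L' := [:: lx; rev ls; ls].
  have bL : all (bounded 5) L by vm_compute.
  have bL' : all (bounded 5) L' by vm_compute.
  (* the word [x s x s^2 x s^-1] has order 5, which it does not keep when [s]
     is inverted *)
  pose w := [:: 0; 1; 0; 1; 1; 0; 2]%N.
  have e : same_run 5 (pwr 5 (wordl L w)) [::] by vm_compute.
  have ne : ~~ same_run 5 (pwr 5 (wordl L' w)) [::] by vm_compute.
  have agE : map alpha (map (tl 5) L) = map (tl 5) L'.
    by rewrite /L /L' /map ax as_ tl_rev (automorphismV _ aut) as_ invgK.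
  exact: (no_automorphism emb (map_id _) (map_id _) bL bL' e ne aut agE).
have [No|Ne] := boolP (odd N).
  apply: (@chiral_full_cycle N _ _ _ emb); first by lia.
  right; split=> //; rewrite /rot odd_permM (@odd_flip0 N 0 0 N.+1 [::] [::]) //;
   try lia.
  by rewrite (@odd_flip1 N 0 0 N.+1 [::] [::]) //=; lia.
apply: (@chiral_long_cycle N _ _ _ emb); first by lia.
right; split=> //; rewrite /rot odd_permM (@odd_flip0 N 1 0 N [::] [::]) //; try lia.
by rewrite (@odd_flip1 N 1 0 N [::] [::]) //=; lia.
Qed.

Lemma crit2ex_An n : 8 <= n -> crit2ex (An n).
Proof.
move=> n8; have [N nN] := pred_nat (leq_trans (isT : 0 < 8) n8); subst n.
have emb := embedding_An N.+1.
have [No|Ne] := boolP (odd N).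
  apply: (@chiral_long_cycle N _ _ _ emb); first by lia.
  left; split=> //; rewrite /rot odd_permM (@odd_flip0 N 1 0 N [::] [::]) //; try lia.
  by rewrite (@odd_flip1 N 1 0 N [::] [::]) //=; lia.
apply: (@chiral_full_cycle N _ _ _ emb); first by lia.
left; split=> //; rewrite /rot odd_permM (@odd_flip0 N 0 0 N.+1 [::] [::]) //;
 try lia.
by rewrite (@odd_flip1 N 0 0 N.+1 [::] [::]) //=; lia.
Qed.

Lemma strong_crit1_Sn3 n : 3 <= n -> strong_crit1 (Sn n).
Proof.
move=> n3; have [N nN] := pred_nat (leq_trans (isT : 0 < 3) n3); subst n.
exact: (strong_crit1_Sn (embedding_Sn N.+1)).
Qed.

Lemma strong_crit1_An9 n : 9 <= n -> strong_crit1 (An n).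
Proof.
move=> n9; have [N nN] := pred_nat (leq_trans (isT : 0 < 9) n9); subst n.
have emb := embedding_An N.+1.
have : [\/ N %% 4 = 0, N %% 4 = 1, N %% 4 = 2 | N %% 4 = 3]%N.
  have := ltn_pmod N (isT : 0 < 4); case: (N %% 4)%N => [|[|[|[|//]]]] _;
    by [constructor 1 | constructor 2 | constructor 3 | constructor 4].
case=> N4.
- exact: (strong_crit1_1mod4 emb).
- by apply: (strong_crit1_2mod4 emb) => //; lia.
- by apply: (strong_crit1_3mod4 emb) => //; lia.
- by apply: (strong_crit1_0mod4 emb) => //; lia.
Qed.

Lemma strong_crit1_A5 : strong_crit1 (An 5).
Proof.
by apply: (@concrete_strong_crit1 4 _ _ _ (embedding_An 5)
  [:: (1, 2); (3, 4)]%N [:: (1, 3); (2, 4)]%N [:: (0, 1); (3, 4)]%N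
  [:: (1, 2, [:: 0; 2]); (3, 4, [:: 0; 1; 2; 1])]%N erefl); vm_compute.
Qed.

Lemma crit2_A6 : crit2 (An 6).
Proof.
by apply: (@concrete_crit2 5 _ _ _ (embedding_An 6)
  [:: (1, 4); (3, 5)]%N [:: (0, 5); (1, 4)]%N [:: (2, 5); (3, 4)]%N [:: 0; 1]%N 3
  [:: (5, 3, [:: 0; 1]); (2, 4, [:: 2; 0; 1; 2]); (2, 1, [:: 0; 2; 0; 1; 2; 0])]%N
  erefl); vm_compute.
Qed.

Lemma crit2_A7 : crit2 (An 7).
Proof.
by apply: (@concrete_crit2 6 _ _ _ (embedding_An 7)
  [:: (0, 4); (1, 5)]%N [:: (0, 5); (3, 6)]%N [:: (2, 6); (3, 4)]%N [:: 0; 1]%N 4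
  [:: (4, 3, [:: 0; 2; 0; 2]); (2, 5, [:: 0; 1; 2; 1; 2; 0; 1]);
      (6, 1, [:: 0; 1; 0; 2; 0; 2; 1; 0])]%N erefl); vm_compute.
Qed.

Lemma crit2_A8 : crit2 (An 8).
Proof.
by apply: (@concrete_crit2 7 _ _ _ (embedding_An 8)
  [:: (0, 6); (2, 3)]%N [:: (0, 4); (1, 6); (2, 7); (3, 5)]%N
  [:: (0, 1); (4, 7)]%N [:: 0; 1]%N 4
  [:: (1, 6, [:: 0; 2; 0; 2]); (1, 4, [:: 0; 1; 0; 2; 0; 2; 1; 0]);
      (3, 2, [:: 1; 0; 2; 0; 1; 2; 0; 2]); (7, 6, [:: 2; 1; 0; 2; 0; 2; 1; 2]);
      (7, 5, [:: 0; 1; 0; 2; 1; 0; 2; 0; 1; 2; 1; 0])]%N erefl); vm_compute.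
Qed.

(** Exchanging the generators, up to inversion, is impossible because [x]
    has order 7 and [y] does not; a word distinguishes the pair from that of
    the inverses. *)
Lemma crit5_A7 : crit5 (An 7).
Proof.
have emb := embedding_An 7; have [jM j_inj jH j_onto] := emb.
pose lx := [:: (0, 3); (0, 1); (0, 5); (0, 2); (0, 4); (0, 6)]%N.
pose ly := [:: (0, 3); (0, 1); (0, 4); (5, 6)]%N.
have cert : alt_certificate 6 [:: lx; ly] [:: (5, 1, [:: 0; 0; 1; 0; 1]);
  (2, 4, [:: 0; 1; 0; 0; 1]); (6, 3, [:: 0; 1; 0; 1; 0; 1; 1; 0; 1])]%N by vm_compute.
have [x xE] : exists x, @sgval _ (Alt_group 'I_7) x = tl 6 lx.
  by apply: j_onto; rewrite Alt_even; apply: even_list_odd; vm_compute.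
have [y yE] : exists y, @sgval _ (Alt_group 'I_7) y = tl 6 ly.
  by apply: j_onto; rewrite Alt_even; apply: even_list_odd; vm_compute.
have xVE : sgval x^-1 = tl 6 (rev lx) by rewrite tl_rev -xE (iotaV jM).
have yVE : sgval y^-1 = tl 6 (rev ly) by rewrite tl_rev -yE (iotaV jM).
exists x, y; split.
  apply/(generatesP jM j_inj jH j_onto) => K gK.
  apply: (certificate_Alt2 cert).
    by rewrite -xE; apply: gK; left.
  by rewrite -yE; apply: gK; right.
have bx : all (bounded 6) [:: lx] by vm_compute.
have by_ : all (bounded 6) [:: ly] by vm_compute.
have byV : all (bounded 6) [:: rev ly] by vm_compute.
have e7 : same_run 6 (pwr 7 (wordl [:: lx] [:: 0]%N)) [::] by vm_compute.
case=> alpha aut; case=> -[ax ay].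
- pose L := [:: lx; ly; rev lx; rev ly]; pose L' := [:: rev lx; rev ly; lx; ly].
  have bL : all (bounded 6) L by vm_compute.
  have bL' : all (bounded 6) L' by vm_compute.
  (* the word [x^2 y x y^-1] is an involution, its image under inversion of
     [x] and [y] is not *)
  pose w := [:: 0; 0; 1; 0; 3]%N.
  have e : same_run 6 (pwr 2 (wordl L w)) [::] by vm_compute.
  have ne : ~~ same_run 6 (pwr 2 (wordl L' w)) [::] by vm_compute.
  have LE : map (@sgval _ _) [:: x; y; x^-1; y^-1] = map (tl 6) L.
    by rewrite /L /map xE yE xVE yVE.
  have LE' : map (@sgval _ _) [:: x^-1; y^-1; x; y] = map (tl 6) L'.
    by rewrite /L' /map xE yE xVE yVE.
  apply: (no_automorphism emb LE LE' bL bL' e ne aut).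
  by rewrite /map !(automorphismV _ aut) ax ay !invgK.
- have ne : ~~ same_run 6 (pwr 7 (wordl [:: ly] [:: 0]%N)) [::] by vm_compute.
  have LE : map (@sgval _ _) [:: x] = map (tl 6) [:: lx] by rewrite /map xE.
  have LE' : map (@sgval _ _) [:: y] = map (tl 6) [:: ly] by rewrite /map yE.
  by apply: (no_automorphism emb LE LE' bx by_ e7 ne aut); rewrite /map ax.
- have ne : ~~ same_run 6 (pwr 7 (wordl [:: rev ly] [:: 0]%N)) [::] by vm_compute.
  have LE : map (@sgval _ _) [:: x] = map (tl 6) [:: lx] by rewrite /map xE.
  have LE' : map (@sgval _ _) [:: y^-1] = map (tl 6) [:: rev ly] by rewrite /map yVE.
  by apply: (no_automorphism emb LE LE' bx byV e7 ne aut); rewrite /map ax.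
Qed.

(** With [y = 1] there is no automorphism because [x] is not trivial. *)
Lemma crit4_A4 : crit4 (An 4).
Proof.
have emb := embedding_An 4; have [jM j_inj jH j_onto] := emb.
pose lx := [:: (0, 1); (2, 3)]%N; pose ls := [:: (0, 1); (0, 2)]%N.
have cert : alt_certificate 3 [:: lx; ls]
  [:: (1, 2, [:: 1]); (2, 3, [:: 0; 1])]%N by vm_compute.
have [x xE] : exists x, @sgval _ (Alt_group 'I_4) x = tl 3 lx.
  by apply: j_onto; rewrite Alt_even; apply: even_list_odd; vm_compute.
have [s sE] : exists s, @sgval _ (Alt_group 'I_4) s = tl 3 ls.
  by apply: j_onto; rewrite Alt_even; apply: even_list_odd; vm_compute.
exists x, 1, s; split; rewrite ?mulg1 //.
- by apply: j_inj; rewrite jM xE (iota1 jM); apply: involution_tl; vm_compute.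
- apply/(generatesP jM j_inj jH j_onto) => K gK.
  apply: (certificate_Alt2 cert).
    by rewrite -xE; apply: gK; left; left.
  by rewrite -sE; apply: gK; right.
case=> alpha aut [_ a1 _]; have := congr1 (@sgval _ _) (automorphism1 aut).
rewrite a1 xE (iota1 jM) -(@tl_nil 3); apply: diff_run_tl; by vm_compute.
Qed.

Local Close Scope group_scope.

Local Open Scope ring_scope.

(** * Two by two matrices and the group L_2 *)

Section TwoByTwo.
Variable F : fieldType.
Implicit Types (A B : 'M[F]_2).

Definition mk (a b c d : F) : 'M[F]_2 :=
  \matrix_(i, j) (if i == 0 then if j == 0 then a else b
                  else if j == 0 then c else d).

Lemma mkE A : A = mk (A 0 0) (A 0 1) (A 1 0) (A 1 1).
Proof.
apply/matrixP=> i j; rewrite mxE.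
have I2 (k : 'I_2) : k = 0 \/ k = 1.
  by case: k => [[|[|//]]] h; [left | right]; apply: val_inj.
by case: (I2 i) => ->; case: (I2 j) => ->.
Qed.

Lemma mk_entries a b c d :
  [/\ mk a b c d 0 0 = a, mk a b c d 0 1 = b, mk a b c d 1 0 = c & mk a b c d 1 1 = d].
Proof. by rewrite !mxE. Qed.

Lemma mk_inj a b c d a' b' c' d' : mk a b c d = mk a' b' c' d' ->
  [/\ a = a', b = b', c = c' & d = d'].
Proof.
move=> e; have [a1 b1 c1 d1] := mk_entries a b c d.
by have [a2 b2 c2 d2] := mk_entries a' b' c' d'; split; congruence.
Qed.

Lemma mulmk a b c d a' b' c' d' : mk a b c d * mk a' b' c' d' =
  mk (a * a' + b * c') (a * b' + b * d') (c * a' + d * c') (c * b' + d * d').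
Proof.
rewrite [LHS]mkE; congr mk; rewrite !mxE !big_ord_recl big_ord0 !mxE addr0 //.
Qed.

Lemma oppmk a b c d : - mk a b c d = mk (- a) (- b) (- c) (- d).
Proof. by rewrite [LHS]mkE; congr mk; rewrite !mxE. Qed.

Lemma addmk a b c d a' b' c' d' : mk a b c d + mk a' b' c' d' =
  mk (a + a') (b + b') (c + c') (d + d').
Proof. by rewrite [LHS]mkE; congr mk; rewrite !mxE. Qed.

Lemma scalemk x a b c d : x *: mk a b c d = mk (x * a) (x * b) (x * c) (x * d).
Proof. by rewrite [LHS]mkE; congr mk; rewrite !mxE. Qed.

Lemma mk1 : 1 = mk 1 0 0 1.
Proof. by rewrite [LHS]mkE; congr mk; rewrite !mxE. Qed.

Lemma mk0 : 0 = mk 0 0 0 0.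
Proof. by rewrite [LHS]mkE; congr mk; rewrite !mxE. Qed.

Lemma det_mk a b c d : \det (mk a b c d) = a * d - b * c.
Proof.
rewrite (expand_det_row _ 0) !big_ord_recl big_ord0 addr0 /cofactor !det_mx11 !mxE /=.
by rewrite expr0 mul1r expr1 mulN1r mulrN.
Qed.

Lemma tr_mk a b c d : \tr (mk a b c d) = a + d.
Proof. by rewrite /mxtrace !big_ord_recl big_ord0 addr0 !mxE. Qed.

End TwoByTwo.

Section Projection.
Variable F : finFieldType.
Implicit Types (A B : 'M[F]_2).

Local Notation SL := (SL2_group F).
Local Notation ZSL := ('Z(SL2_group F))%g.

(** Singular matrices have the default value 1. *)
Definition sl A : {'GL_2[F]} := insubd (1%g : {'GL_2[F]}) A.
Definition pr A : L2 F := subg (SL / ZSL)%g (coset ZSL (sl A)).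

Lemma GLval_inj (g h : {'GL_2[F]}) : GLval g = GLval h -> g = h.
Proof. exact: val_inj. Qed.

Lemma slE A : \det A = 1 -> GLval (sl A) = A.
Proof.
by move=> dA; apply: (insubdK (1%g : {'GL_2[F]})); rewrite -topredE /= unitmxE dA unitr1.
Qed.

Lemma sl_in A : \det A = 1 -> sl A \in SL.
Proof. by move=> dA; rewrite inE slE // dA. Qed.

Lemma slM A B : \det A = 1 -> \det B = 1 -> sl (A * B) = (sl A * sl B)%g.
Proof.
by move=> dA dB; apply: GLval_inj; rewrite GL_ME !slE // det_mulmx dA dB mul1r.
Qed.

Lemma sl_norm A : \det A = 1 -> sl A \in 'N(ZSL)%g.
Proof. by move=> dA; apply: (fintype.subsetP (normal_norm (center_normal SL))); apply: sl_in. Qed.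

Lemma prM A B : \det A = 1 -> \det B = 1 -> pr (A * B) = (pr A * pr B)%g.
Proof.
move=> dA dB; rewrite /pr slM // morphM ?sl_norm //.
by rewrite subgM ?mem_quotient ?sl_in.
Qed.

Lemma sl1 : sl 1 = 1%g.
Proof. by apply: GLval_inj; rewrite slE ?det1. Qed.

Lemma pr1 : pr 1 = 1%g.
Proof. by rewrite /pr sl1 morph1; apply: val_inj; rewrite subgK. Qed.

Lemma pr_onto (x : L2 F) : exists2 A, \det A = 1 & pr A = x.
Proof.
have := subgP x; case/morphimP=> g _ gS xE.
exists (GLval g); first by move: gS; rewrite inE => /eqP.
apply: val_inj; rewrite /pr subgK.
  by rewrite [RHS]xE; congr coset; apply: GLval_inj; rewrite slE //;
     move: gS; rewrite inE => /eqP.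
rewrite mem_quotient // sl_in //; by move: gS; rewrite inE => /eqP.
Qed.

Lemma pr_eq1 A : \det A = 1 ->
  pr A = 1%g <-> forall B, \det B = 1 -> A * B = B * A.
Proof.
move=> dA; have SA := sl_in dA.
have -> : pr A = 1%g <-> sl A \in ZSL.
  split=> [/(congr1 val) /=|AZ].
    rewrite /pr subgK ?mem_quotient // => e.
    exact: coset_idr (sl_norm dA) e.
  by rewrite /pr coset_id //; apply: val_inj; rewrite subgK.
split=> [/centerP[_ AZ] B dB|AZ].
  have := AZ _ (sl_in dB); rewrite /commute -!slM // => /(congr1 (@GLval _ _)).
  by rewrite !slE // det_mulmx dA dB mul1r.
apply/centerP; split=> // g gS; have dg : \det (GLval g) = 1 by move: gS; rewrite inE => /eqP.
have gE : g = sl (GLval g) by apply: GLval_inj; rewrite slE.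
by rewrite /commute gE -!slM // AZ.
Qed.

Lemma det_inv_mk a b c d : a * d - b * c = 1 :> F ->
  mk a b c d * mk d (- b) (- c) a = 1 /\ mk d (- b) (- c) a * mk a b c d = 1.
Proof.
by move=> e; rewrite !mulmk mk1; split; congr mk; rewrite -?e; ring.
Qed.

(** Commuting with one upper and one lower transvection is enough to make a
    matrix scalar. *)
Lemma commutes_scalar (a b c d : F) :
  (forall B, \det B = 1 -> mk a b c d * B = B * mk a b c d) ->
  [/\ b = 0, c = 0 & a = d].
Proof.
move=> comm.
have := comm (mk 1 1 0 1); rewrite det_mk !mulmk => /(_ ltac:(ring))/mk_inj[e1 e2 _ _].
have := comm (mk 1 0 1 1); rewrite det_mk !mulmk => /(_ ltac:(ring))/mk_inj[e3 _ _ _].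
have b0 : b = 0.
  have -> : b = a * 1 + b * 1 - (1 * a + 0 * c) by ring.
  by rewrite e3 subrr.
have c0 : c = 0.
  have -> : c = 1 * a + 1 * c - (a * 1 + b * 0) by ring.
  by rewrite e1 subrr.
split=> //.
have -> : a = a * 1 + b * 1 - b by ring.
by rewrite e2 b0; ring.
Qed.

Lemma pr_eq1P A : \det A = 1 -> pr A = 1%g <-> A = 1 \/ A = - 1.
Proof.
move=> dA; rewrite pr_eq1 //; split; last first.
  by case=> -> B _; rewrite ?mul1r ?mulr1 ?mulN1r ?mulrN1.
rewrite [A]mkE in dA *; move: (A 0 0) (A 0 1) (A 1 0) (A 1 1) dA => a b c d.
rewrite det_mk => dA /commutes_scalar[b0 c0 ad].
have : a * a = 1 by rewrite -dA b0 c0 -ad; ring.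
move/eqP; rewrite -expr2 sqrf_eq1 => /orP[] /eqP a1; [left | right].
  by rewrite mk1 b0 c0 -ad a1.
by rewrite mk1 oppmk b0 c0 -ad a1 oppr0.
Qed.

Lemma prN A : \det A = 1 -> pr (- A) = pr A.
Proof.
move=> dA; have dN : \det (- 1 : 'M[F]_2) = 1.
  by rewrite mk1 oppmk det_mk; ring.
have -> : - A = - 1 * A by rewrite mulN1r.
by rewrite prM // (proj2 (pr_eq1P dN)) ?mul1g //; right.
Qed.

Lemma sl_inv B : \det B = 1 ->
  exists2 C : 'M[F]_2, \det C = 1 & B * C = 1 /\ C * B = 1.
Proof.
rewrite [B]mkE; move: (B 0 0) (B 0 1) (B 1 0) (B 1 1) => a b c d.
rewrite det_mk => e; exists (mk d (- b) (- c) a); last exact: det_inv_mk.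
by rewrite det_mk -e; ring.
Qed.

Lemma pr_eqP A B : \det A = 1 -> \det B = 1 -> pr A = pr B <-> A = B \/ A = - B.
Proof.
move=> dA dB; split=> [e|[->|->]]; rewrite ?prN //.
have [Bm dBm [BBm BmB]] := sl_inv dB.
have : pr (A * Bm) = 1%g by rewrite prM // e -prM // BBm pr1.
rewrite pr_eq1P ?det_mulmx ?dA ?dBm ?mul1r //.
case=> /(congr1 (fun M => M * B)); rewrite -mulrA BmB mulr1 ?mul1r ?mulN1r => ->;
 by [left | right].
Qed.

End Projection.

(** * Squares and polynomials over a finite field *)

Section FiniteField.
Variable F : finFieldType.
Implicit Types (a b c x : F).

Lemma primitive_element : exists2 a, a != 0 & forall x, x != 0 -> exists k, x = a ^+ k.
Proof.
have /cyclicP[u uT] := field_unit_group_cyclic [set: {unit F}]%G.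
exists (FinRing.uval u); first by rewrite -unitfE; exact: (valP u).
move=> x; rewrite -unitfE => xU.
have : FinRing.unit F xU \in [set: {unit F}]%SET by rewrite finset.in_setT.
rewrite uT => /cycleP[k kE]; exists k.
by have /= -> := congr1 val kE; rewrite FinRing.val_unitX.
Qed.

Lemma square_char2 a : 1 + 1 = 0 :> F -> exists b, a = b ^+ 2.
Proof.
move=> two.
have inj : injective (fun b : F => b ^+ 2).
  move=> b c /eqP; rewrite -subr_eq0 => /eqP e.
  have /eqP : (b - c) ^+ 2 = 0.
    have -> : (b - c) ^+ 2 = b ^+ 2 - c ^+ 2 + (1 + 1) * (c ^+ 2 - b * c) by ring.
    by rewrite e two; ring.
  by rewrite expf_eq0 /= subr_eq0 => /eqP.
by have := codom_f (invF inj) a; exists (invF inj a); rewrite (f_invF inj).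
Qed.

(** The squares have index 2 in the cyclic multiplicative group, and [-1]
    lies in the other coset. *)
Lemma square_or_opp : (forall i : F, i ^+ 2 <> -1) ->
  forall x, x != 0 -> exists b, b != 0 /\ (x = b ^+ 2 \/ x = - b ^+ 2).
Proof.
move=> nsq; have [a a0 gen] := primitive_element; move=> x x0.
have [k xE] := gen _ x0.
have [j mE] : exists j, -1 = a ^+ j by apply: gen; rewrite oppr_eq0 oner_neq0.
have jo : odd j.
  apply/negPn/negP => je; apply: (nsq (a ^+ j./2)).
  by rewrite -exprM muln2 even_halfK.
have [ko|ke] := boolP (odd k).
  exists (a ^+ (k + j)./2); split; first exact: expf_neq0.
  right; rewrite -exprM muln2 even_halfK ?oddD ?ko ?jo // exprD -mE -xE.
  by ring.
exists (a ^+ k./2); split; first exact: expf_neq0.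
by left; rewrite -exprM muln2 even_halfK.
Qed.

Lemma nonroot (p : {poly F}) : p != 0 -> (size p <= #|F|)%N -> exists t, p.[t] != 0.
Proof.
move=> p0 ps; apply/existsP; apply: contraLR ps => /existsPn all0.
rewrite -ltnNge cardE; apply: max_poly_roots (enum_uniq _) => //.
by apply/allP => t _; apply/eqP/eqP; rewrite -[_ == _]negbK all0.
Qed.

End FiniteField.

(** * Generating L_2 by a torus and two elements *)

Section GeneratingL2.
Variable F : finFieldType.
Implicit Types (a b c d t : F) (A B P Q : 'M[F]_2).

Definition weyl : 'M[F]_2 := mk 0 1 (-1) 0.
Definition diag a : 'M[F]_2 := mk a 0 0 a^-1.
Definition unip t : 'M[F]_2 := mk 1 t 0 1.

Lemma det_weyl : \det weyl = 1. Proof. by rewrite det_mk; ring. Qed.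
Lemma det_diag a : a != 0 -> \det (diag a) = 1.
Proof. by move=> a0; rewrite det_mk; field. Qed.
Lemma det_unip t : \det (unip t) = 1. Proof. by rewrite det_mk; ring. Qed.

Variable H : set (L2 F).
Hypothesis sH : is_subgroup H.

Definition over A := \det A = 1 /\ H (pr A).

Lemma over1 : over 1.
Proof. by split; rewrite ?det1 // pr1; apply: subgroup1. Qed.

Lemma overM A B : over A -> over B -> over (A * B).
Proof.
move=> [dA HA] [dB HB]; split; first by rewrite det_mulmx dA dB mul1r.
by rewrite prM //; apply: subgroupM.
Qed.

Lemma overN A : over A -> over (- A).
Proof.
move=> [dA HA]; split; last by rewrite prN.
by rewrite -[LHS]/(\det (- A)) -scaleN1r detZ dA; ring.
Qed.

Lemma over_cancel A B : over A -> \det B = 1 -> over (A * B) -> over B.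
Proof.
move=> [dA HA] dB [_ HAB]; split=> //.
have -> : pr B = ((pr A)^-1 * pr (A * B))%g by rewrite prM // mulKg.
by apply: subgroupM => //; apply: subgroupV.
Qed.

Lemma over_divl A B C : over A -> \det B = 1 -> over C -> A * B = C -> over B.
Proof. by move=> oA dB oC e; apply: (over_cancel oA dB); rewrite e. Qed.

Hypotheses (Hw : over weyl) (Hd : forall a, a != 0 -> over (diag a)).

(** The transvections over [H] form an additive group closed under
    multiplication by squares, and the squares generate the field additively. *)
Lemma over_unip t0 : t0 != 0 -> over (unip t0) -> forall t, over (unip t).
Proof.
move=> t00 Ht0.
have sq s : over (unip (s ^+ 2 * t0)).
  have [->|s0] := eqVneq s 0.
    by have := over1; rewrite /unip mk1 expr0n /= mul0r.
  apply: (@over_divl (diag s^-1) _ (unip t0 * diag s^-1)).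
  - by apply: Hd; rewrite invr_eq0.
  - exact: det_unip.
  - by apply: overM => //; apply: Hd; rewrite invr_eq0.
  - by rewrite /unip /diag !mulmk !invrK; congr mk; field.
move=> t; have [two|two] := eqVneq (1 + 1 : F) 0.
  have [s sE] := square_char2 (t / t0) two.
  have -> : t = s ^+ 2 * t0 by rewrite -sE divfK.
  exact: sq.
have := over_divl (sq ((t / t0 - 1) / (1 + 1))) (det_unip t)
  (sq ((t / t0 + 1) / (1 + 1))).
apply; rewrite /unip mulmk; congr mk; field; rewrite ?t00 //.
all: by rewrite -[2]/(1 + 1) two.
Qed.

(** The Bruhat decomposition: a matrix whose lower left entry does not
    vanish is a product [u w h u'] of transvections, [w] and a diagonal
    matrix; the others are brought into this form by [w]. *)
Lemma over_all_unip : (forall t, over (unip t)) -> forall A, \det A = 1 -> over A.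
Proof.
move=> Hu A; rewrite [A]mkE; move: (A 0 0) (A 0 1) (A 1 0) (A 1 1) => a b c d.
rewrite det_mk => e.
have big a' b' c' d' : a' * d' - b' * c' = 1 -> c' != 0 -> over (mk a' b' c' d').
  move=> e' c0.
  have -> : mk a' b' c' d' = - (unip (a' / c') * weyl * diag c' * unip (d' / c')).
    rewrite /unip /weyl /diag !mulmk oppmk; congr mk; try by field.
    have -> : b' = (a' * d' - 1) / c' by rewrite -e'; field.
    by field.
  by apply/overN/overM => //; apply/overM; [apply/overM | apply: Hd].
have [c0|] := eqVneq c 0; last exact: big.
have ad : a * d = 1 by rewrite -e c0; ring.
have a0 : a != 0 by apply: contra_eq_neq ad => ->; rewrite mul0r eq_sym oner_neq0.
apply: (over_cancel Hw); first by rewrite det_mk.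
rewrite /weyl mulmk; apply: big; last by rewrite c0 mulr0 addr0 mulN1r oppr_eq0.
by rewrite -[RHS]e; ring.
Qed.

(** If the elements [P] and [Q] of [H] agree on one of the two points of the
    projective line fixed by the diagonal torus, but not on the other, then
    [Q^-1 P] is triangular and not diagonal, and the torus corrects it to a
    transvection. *)
Lemma over_all a b c d a' b' c' d' :
  over (mk a b c d) -> over (mk a' b' c' d') ->
  a' * c = c' * a -> d' * b != b' * d -> forall x, H x.
Proof.
move=> HP HQ ac bd; have [dP _] := HP; have [dQ _] := HQ.
move: dP dQ; rewrite !det_mk => dP dQ.
pose e := d' * a - b' * c; pose f := d' * b - b' * d.
have f0 : f != 0 by rewrite subr_eq0.
pose g := a' * d - c' * b.
have dT : \det (mk e f 0 g) = 1.
  have -> : 1 = (a' * d' - b' * c') * (a * d - b * c) + f * (a' * c - c' * a).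
    by rewrite dP dQ ac; ring.
  by rewrite det_mk /e /f /g; ring.
have HT : over (mk e f 0 g).
  apply: over_divl HQ dT HP _; rewrite mulmk.
  congr mk.
  - by rewrite -[RHS]mul1r -dQ /e; ring: ac.
  - by rewrite -[RHS]mul1r -dQ /f /g; ring.
  - by rewrite -[RHS]mul1r -dQ /e; ring: ac.
  - by rewrite -[RHS]mul1r -dQ /f /g; ring.
have eg : e * g = 1 by rewrite -dT det_mk; ring.
have e0 : e != 0 by apply: contra_eq_neq eg => ->; rewrite mul0r eq_sym oner_neq0.
have HU : over (unip (f / e)).
  apply: over_divl (Hd e0) (det_unip _) HT _.
  have -> : g = e^-1 by rewrite -[g]mul1r -(mulVf e0) -mulrA eg mulr1.
  by rewrite /unip /diag mulmk; congr mk; field.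
have fe0 : f / e != 0 by rewrite mulf_neq0 ?invr_eq0.
move=> x; have [A dA <-] := pr_onto x.
by case: (over_all_unip (over_unip fe0 HU) dA).
Qed.

End GeneratingL2.

(** * Generating L_2 by three involutions *)

Section Triples.
Variable F : finFieldType.
Implicit Types (a b c d t l m : F) (A B : 'M[F]_2) (x y z : L2 F).

Lemma generates_L2 (A : set (L2 F)) :
  (forall H, is_subgroup H -> (forall x, A x -> H x) -> forall x, H x) ->
  generates A.
Proof. by move=> gen; apply/seteqP; split=> // x _ H sH AH; apply: gen. Qed.

Lemma pr_involution a b c : a * a + b * c = -1 ->
  \det (mk a b c (- a)) = 1 /\ (pr (mk a b c (- a)) * pr (mk a b c (- a)) = 1)%g.
Proof.
move=> e; have dA : \det (mk a b c (- a)) = 1 by rewrite det_mk -[RHS]opprK -e; ring.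
split=> //; rewrite -prM //; apply/pr_eq1P; first by rewrite det_mulmx dA mul1r.
right; rewrite mulmk mk1 oppmk; congr mk; rewrite -?e; ring.
Qed.

Lemma over_diags (H : set (L2 F)) a : is_subgroup H ->
  (forall b, b != 0 -> exists k, b = a ^+ k) -> over H (diag a) ->
  forall b, b != 0 -> over H (diag b).
Proof.
move=> sH prim Ha b /prim[k ->]; elim: k => [|k IHk].
  by have := over1 sH; rewrite /diag expr0 invr1 mk1.
have := overM sH Ha IHk; congr (over _ _).
by rewrite /diag mulmk exprS invfM; congr mk; ring.
Qed.

Lemma over_diag (H : set (L2 F)) a : is_subgroup H -> a != 0 ->
  H (pr (weyl F)) -> H (pr (mk 0 a^-1 (- a) 0)) ->
  over H (weyl F) /\ over H (diag a).
Proof.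
move=> sH a0 Hw HC; have oW : over H (weyl F) by split; rewrite ?det_weyl.
split=> //; apply: (over_divl sH oW); first exact: det_diag.
  by split; last exact: HC; rewrite det_mk; field.
by rewrite /weyl /diag mulmk; congr mk; ring.
Qed.

(** The involutions are [w], the symmetric matrix [B], which anticommutes with
    [w], and [w h(a)], where [a] generates the multiplicative group, so that
    the whole diagonal torus is present. *)
Lemma strong_crit1_L2 l m : m ^+ 2 * (l ^+ 2 + 1) = -1 ->
  (exists2 t : F, t != 0 & t ^+ 4 != 1) ->
  (forall H : set (L2 F), is_subgroup H -> over H (weyl F) ->
     (forall a, a != 0 -> over H (diag a)) -> over H (mk (m * l) m m (- (m * l))) ->
     forall x, H x) ->
  strong_crit1 (L2 F).
Proof.
move=> e [t t0 t4] full; have [a a0 prim] := primitive_element F.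
have a4 : a ^+ 4 != 1.
  apply: contra_neq t4 => a4; have [k ->] := prim _ t0.
  by rewrite exprAC a4 expr1n.
have [dW W2] := @pr_involution 0 1 (-1) ltac:(ring).
have [dB B2] := @pr_involution (m * l) m m ltac:(rewrite -e; ring).
have [dC C2] := @pr_involution 0 a^-1 (- a) ltac:(by field).
rewrite oppr0 in dW W2 dC C2.
exists (pr (weyl F)), (pr (mk (m * l) m m (- (m * l)))), (pr (mk 0 a^-1 (- a) 0)).
split=> //.
- rewrite -!prM //; apply/pr_eqP; rewrite ?det_mulmx ?dW ?dB ?mul1r //.
  by right; rewrite !mulmk oppmk; congr mk; ring.
- rewrite -!prM // => /pr_eqP; rewrite !det_mulmx !dW !dC !mul1r => /(_ erefl erefl) h.
  have : a * a = 1 \/ a * a = -1.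
    case: h; rewrite !mulmk ?oppmk => /mk_inj[e1 _ _ _]; [left|right].
      have -> : a * a = a * (- (0 * 0 + 1 * - a)) by ring.
      by rewrite e1; field.
    have -> : a * a = a * (- (0 * 0 + 1 * - a)) by ring.
    by rewrite e1; field.
  move=> a2; case/eqP: a4; have -> : a ^+ 4 = (a * a) * (a * a) by ring.
  by case: a2 => ->; ring.
apply: generates_L2 => H sH HA.
have [Hw HB HC] : [/\ H (pr (weyl F)), H (pr (mk (m * l) m m (- (m * l))))
    & H (pr (mk 0 a^-1 (- a) 0))].
  by split; apply: HA; [left; left | left; right | right].
have [oW oD] := over_diag sH a0 Hw HC.
apply: full => //; first exact: over_diags oD.
Qed.

Section Conditions.
Variables l m : F.
Hypotheses (e : m ^+ 2 * (l ^+ 2 + 1) = -1) (l0 : l != 0).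

Lemma mu_neq0 : m != 0.
Proof.
apply: contra_eq_neq e => ->; rewrite expr0n mul0r eq_sym oppr_eq0; exact: oner_neq0.
Qed.

Let m0 := mu_neq0.

(** For [t = i / l] the upper left entry [m^2 (l^2 t^2 + 1) / t] of
    [B h(t) B] vanishes, as that of [w] does. *)
Lemma strong_crit1_square (i : F) : i ^+ 2 = -1 -> l ^+ 4 != 1 -> strong_crit1 (L2 F).
Proof.
move=> i2 l4; apply: (strong_crit1_L2 e); first by exists l.
move=> H sH oW oD oB.
have i0 : i != 0.
  by apply: contra_eq_neq i2 => ->; rewrite expr0n eq_sym oppr_eq0 oner_neq0.
have il0 : i / l != 0 by rewrite mulf_neq0 ?invr_eq0.
have oP := overM sH (overM sH oB (oD _ il0)) oB.
rewrite /diag !mulmk invf_div in oP.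
apply: (over_all sH oW oD oP oW).
  rewrite mul0r; apply/esym; apply/eqP; rewrite mulf_eq0; apply/orP; right; apply/eqP.
  transitivity (m ^+ 2 * l / i * (i ^+ 2 + 1)); first by field; rewrite ?i0.
  by rewrite i2 addNr mulr0.
rewrite mul0r eq_sym mul1r.
have -> : (m * (i / l) + - (m * l) * 0) * m + (m * 0 + - (m * l) * (l / i)) * - (m * l) =
  m ^+ 2 / l / i * (i ^+ 2 + l ^+ 4).
  by field; rewrite ?i0 ?l0.
rewrite i2 addrC; rewrite !mulf_neq0 ?invr_eq0 ?subr_eq0 ?expf_neq0 //.
Qed.

(** Now [l^2 t^2 + 1] never vanishes, and [B h(t) B] is compared with
    [h(r) B] or [h(l r) B w], the ratios of whose first columns are [r^2 l]
    and [- r^2 l]. As every element is a square or the opposite of one, [r]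
    can be chosen so that the first columns become proportional; the last
    two hypotheses say that the second columns then do not. *)
Lemma strong_crit1_nonsquare t : (forall i : F, i ^+ 2 <> -1) ->
  t != 0 -> t ^+ 4 != 1 ->
  l ^+ 4 * (t ^+ 2 - 1) ^+ 2 + (l ^+ 2 * t ^+ 2 + 1) * (t ^+ 2 + l ^+ 2) != 0 ->
  (t ^+ 2 - 1) ^+ 2 + (l ^+ 2 * t ^+ 2 + 1) * (t ^+ 2 + l ^+ 2) != 0 ->
  strong_crit1 (L2 F).
Proof.
move=> nsq t0 t4 q1 q2; apply: (strong_crit1_L2 e); first by exists t.
move=> H sH oW oD oB.
have t2 : t ^+ 2 - 1 != 0.
  apply: contra_neq t4 => /eqP; rewrite subr_eq0 => /eqP t2.
  by rewrite -[4%N]/(2 * 2)%N exprM t2 expr1n.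
have oP := overM sH (overM sH oB (oD _ t0)) oB.
have PE : mk (m * l) m m (- (m * l)) * diag t * mk (m * l) m m (- (m * l)) =
  mk (m ^+ 2 / t * (l ^+ 2 * t ^+ 2 + 1)) (m ^+ 2 / t * (l * (t ^+ 2 - 1)))
     (m ^+ 2 / t * (l * (t ^+ 2 - 1))) (m ^+ 2 / t * (t ^+ 2 + l ^+ 2)).
  by rewrite /diag !mulmk; congr mk; field.
rewrite {}PE in oP.
have A0 : l ^+ 2 * t ^+ 2 + 1 != 0.
  by apply/eqP => /eqP; rewrite addr_eq0 -exprMn => /eqP; apply: nsq.
have [|r [r0 rE]] := square_or_opp nsq (x := (l ^+ 2 * t ^+ 2 + 1) / (l * (t ^+ 2 - 1) * l)).
  by rewrite mulf_neq0 // invr_eq0 !mulf_neq0.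
have mt0 : m ^+ 2 / t != 0 by rewrite mulf_neq0 ?invr_eq0 ?expf_neq0.
case: rE => rE.
  have AE : l ^+ 2 * t ^+ 2 + 1 = r ^+ 2 * (l * (t ^+ 2 - 1) * l).
    by rewrite -rE divfK // !mulf_neq0.
  have oQ := overM sH (oD _ r0) oB.
  rewrite /diag mulmk in oQ; apply: (over_all sH oW oD oP oQ).
    by rewrite AE; field; rewrite ?r0 ?t0.
  apply: contra_neq q1 => /eqP; rewrite -subr_eq0 => /eqP h.
  transitivity (- (t * r / m ^+ 3) * (l ^+ 2 * (t ^+ 2 - 1)) * 0); last by rewrite mulr0.
  by rewrite -h AE; field; rewrite ?r0 ?t0 ?m0.
have AE : l ^+ 2 * t ^+ 2 + 1 = - r ^+ 2 * (l * (t ^+ 2 - 1) * l).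
  by rewrite -rE divfK // !mulf_neq0.
have lr0 : l * r != 0 by rewrite mulf_neq0.
have oQ := overM sH (overM sH (oD _ lr0) oB) oW.
rewrite /diag !mulmk in oQ; apply: (over_all sH oW oD oP oQ).
  by rewrite AE; field; rewrite ?r0 ?t0 ?l0.
apply: contra_neq q2 => /eqP; rewrite -subr_eq0 => /eqP h.
transitivity (t * r / m ^+ 3 * (t ^+ 2 - 1) * 0); last by rewrite mulr0.
by rewrite -h AE; field; rewrite ?r0 ?t0 ?m0 ?l0.
Qed.

End Conditions.
End Triples.

(** * The choice of the parameters *)

Section SmallParameters.
Variables (F : finFieldType) (p k : nat).
Hypotheses (pp : prime p) (k0 : (0 < k)%N) (qE : #|F| = (p ^ k)%N).

Lemma char_F : p \in [pchar F].
Proof. exact: (card_finPcharP qE pp). Qed.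

Lemma natF_eq0 n : (n%:R == 0 :> F) = (p %| n)%N.
Proof. by rewrite -(dvdn_pcharf char_F). Qed.

Lemma char_prime_card r : prime r -> (r %| #|F|)%N -> p = r.
Proof. by move=> pr; rewrite qE Euclid_dvdX // k0 andbT dvdn_prime2 // => /eqP. Qed.

(** The product of the polynomials is not zero and has degree less than [q]. *)
Lemma common_nonroot (ss : seq (seq F)) : all (fun s => last 0 s != 0) ss ->
  (\sum_(s <- ss) (size s).-1 < #|F|)%N ->
  exists t, all (fun s => (Poly s).[t] != 0) ss.
Proof.
move=> ss0 small; have P0 s : last 0 s != 0 -> Poly s != 0 :> {poly F}.
  by move=> s0; rewrite -lead_coef_eq0 lead_coefE (@PolyK _ 0) // nth_last.
have [g [g0 gs gt]] : exists g : {poly F}, [/\ g != 0,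
    (size g <= (\sum_(s <- ss) (size s).-1).+1)%N &
    forall t, g.[t] != 0 -> all (fun s => (Poly s).[t] != 0) ss].
  elim: ss ss0 {small} => [_|s ss IHs /= /andP[s0 /IHs[g [g0 gs gt]]]].
    by exists 1; rewrite oner_neq0 size_poly1.
  exists (Poly s * g); split.
  - by rewrite mulf_neq0 // P0.
  - rewrite size_mul ?P0 // big_cons (@PolyK _ 0 _ s0).
    move: gs; move: (\sum_(_ <- _) _)%N => S.
    by case: (s) s0 => [|a s'] /=; rewrite ?eqxx // -addnS leq_add2l.
  - by move=> t; rewrite hornerM mulf_eq0 negb_or => /andP[-> /gt].
have [t /gt ?] := nonroot g0 (leq_trans gs small); by exists t.
Qed.

(** If [-1] is not a square, then [-(l^2+1)] is a nonzero square for some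
    [l != 0]: otherwise [1], [2], [3], ... would all be nonzero squares. *)
Lemma lambda_nonsquare : (forall i : F, i ^+ 2 <> -1) ->
  exists l m : F, l != 0 /\ m ^+ 2 * (l ^+ 2 + 1) = -1.
Proof.
move=> nsq; apply: contrapT => no.
suff all_sq n : exists2 l : F, l != 0 & n.+1%:R = l ^+ 2.
  have [l l0] := all_sq p.-1; rewrite prednK ?prime_gt0 // => /eqP.
  by rewrite (pcharf0 char_F) eq_sym sqrf_eq0 (negPf l0).
elim: n => [|n [l l0 lE]]; first by exists 1; rewrite ?oner_neq0 // expr1n.
have n0 : l ^+ 2 + 1 != 0 by rewrite addr_eq0; apply/eqP/nsq.
have [b [b0 bE]] := square_or_opp nsq n0.
rewrite -natr1 lE; case: bE => bE; first by exists b.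
case: no; exists l, b^-1; split=> //; rewrite bE.
by field.
Qed.

(** In characteristic 2 the polynomial [l^2 + 1] is the square of [l + 1],
    so [m = 1 / (l + 1)] for any [l] other than [0] and [1]. *)
Lemma strong_crit1_even : p = 2%N -> (2 < #|F|)%N -> strong_crit1 (L2 F).
Proof.
move=> p2 q2; have two : 1 + 1 = 0 :> F by have := pcharf0 char_F; rewrite p2.
have oppE (x : F) : - x = x.
  by apply/eqP; rewrite -subr_eq0 -opprD oppr_eq0 -[x]mul1r -mulrDl two mul0r.
have [l /and3P[]] := @common_nonroot [:: [:: 0; 1]; [:: 1; 1]]
  ltac:(by rewrite /= oner_neq0) ltac:(by rewrite unlock).
rewrite !horner_Poly /= !mul0r !add0r mul1r addr0 => l0 l1 _.
have sq1 (x : F) : x ^+ 2 + 1 = (x + 1) ^+ 2.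
  have -> : (x + 1) ^+ 2 = x ^+ 2 + 1 + (1 + 1) * x by ring.
  by rewrite two mul0r addr0.
apply: (@strong_crit1_square _ l (l + 1)^-1 _ l0 1).
- by rewrite sq1 oppE; field.
- by rewrite oppE expr1n.
- rewrite -subr_eq0 oppE -[4%N]/(2 * 2)%N exprM !sq1.
  by rewrite !expf_neq0.
Qed.

(** With [l = (e - 1/e) / 2] the element [l^2 + 1] is the square of
    [(e + 1/e) / 2], which gives [m]. The polynomials which [e] has to avoid
    say that [e], [l], [m^-1] do not vanish and that [l^4] is not 1; their
    degrees add up to 9. *)
Lemma strong_crit1_L2_1mod4 i : i ^+ 2 = -1 :> F -> odd p -> (9 < #|F|)%N ->
  strong_crit1 (L2 F).
Proof.
move=> i2 po q9.
have n2 : 2%:R != 0 :> F by rewrite natF_eq0 dvdn_prime2 //; apply: contraTneq po => ->.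
have [e /and4P[]] := @common_nonroot
  [:: [:: 0; 1]; [:: -1; 0; 0; 0; 1]; [:: 1; 0; -6%:R; 0; 1]]
  ltac:(by rewrite /= oner_neq0) ltac:(by rewrite unlock).
rewrite !horner_Poly /= => h1 h2 h3 _.
have e0 : e != 0 by apply: contra_neq h1 => ->; ring.
have e1 : e ^+ 2 - 1 != 0.
  by apply: contra_neq h2 => h; transitivity ((e ^+ 2 - 1) * (e ^+ 2 + 1)); [ring | rewrite h mul0r].
have e2 : e ^+ 2 + 1 != 0.
  by apply: contra_neq h2 => h; transitivity ((e ^+ 2 - 1) * (e ^+ 2 + 1)); [ring | rewrite h mulr0].
have nu0 : (e ^+ 2 + 1) / e / 2%:R != 0 by rewrite !mulf_neq0 ?invr_eq0.
have l0 : (e ^+ 2 - 1) / e / 2%:R != 0 by rewrite !mulf_neq0 ?invr_eq0.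
apply: (@strong_crit1_square _ ((e ^+ 2 - 1) / e / 2%:R) (i / ((e ^+ 2 + 1) / e / 2%:R)) _ l0 i) => //.
- rewrite expr_div_n i2.
  by field; rewrite e0 e2 n2.
- rewrite -subr_eq0.
  pose h := ((((0 * e + 1) * e + 0) * e - 6%:R) * e + 0) * e + 1.
  have -> : ((e ^+ 2 - 1) / e / 2%:R) ^+ 4 - 1 =
    ((e ^+ 2 + 1) / e / 2%:R) ^+ 2 * h / e ^+ 2 / 2%:R ^+ 2.
    rewrite /h; field; rewrite e0 n2 !andbT.
    have -> : 4%:R = 2%:R * 2%:R :> F by ring.
    by rewrite mulf_neq0.
  by rewrite !mulf_neq0 ?invr_eq0 ?expf_neq0.
Qed.

(** The polynomials in [t] which have to be avoided have total degree 11. *)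
Lemma strong_crit1_L2_3mod4 : (forall i : F, i ^+ 2 <> -1) -> (11 < #|F|)%N ->
  strong_crit1 (L2 F).
Proof.
move=> nsq q11; have [l [m [l0 lm]]] := lambda_nonsquare nsq.
have l2 : l ^+ 2 + 1 != 0 by rewrite addr_eq0; apply/eqP/nsq.
have c0 : l ^+ 4 + l ^+ 2 != 0.
  have -> : l ^+ 4 + l ^+ 2 = l ^+ 2 * (l ^+ 2 + 1) by ring.
  by rewrite mulf_neq0 ?expf_neq0.
have [t /and5P[]] := @common_nonroot [:: [:: 0; 1]; [:: -1; 0; 1];
    [:: l ^+ 4 + l ^+ 2; 0; 1 + l ^+ 4 - l ^+ 4 *+ 2; 0; l ^+ 4 + l ^+ 2];
    [:: 1 + l ^+ 2; 0; l ^+ 4 + 1 - 2%:R; 0; l ^+ 2 + 1]]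
  ltac:(by rewrite /= oner_neq0 c0 l2) ltac:(by rewrite unlock).
rewrite !horner_Poly /= => h1 h2 h3 h4 _.
have t0 : t != 0 by apply: contra_neq h1 => ->; ring.
have t4 : t ^+ 4 != 1.
  apply: contra_neq h2 => t4; have /eqP : (t ^+ 2 - 1) * (t ^+ 2 + 1) = 0.
    by transitivity (t ^+ 4 - 1); [ring | rewrite t4 subrr].
  rewrite mulf_eq0 => /orP[] /eqP e; last by case: (nsq t); apply/eqP; rewrite -addr_eq0 e.
  by rewrite -[RHS]e; ring.
apply: (strong_crit1_nonsquare lm l0 nsq t0 t4).
- by apply: contra_neq h3 => h; rewrite -[RHS]h; ring.
- by apply: contra_neq h4 => h; rewrite -[RHS]h; ring.
Qed.

(** The field is too small for counting roots, but [l = 1], [m = 4] and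
    [t = 2] satisfy the conditions. *)
Lemma strong_crit1_q11 : #|F| = 11%N -> strong_crit1 (L2 F).
Proof.
move=> q11; have p11 : p = 11%N by apply: char_prime_card; rewrite // q11.
have nz n : (0 < n < 11)%N -> n%:R != 0 :> F.
  by move=> nr; rewrite natF_eq0 p11; apply/negP => /dvdn_leq; lia.
have e11 : 11%:R = 0 :> F by apply/eqP; rewrite natF_eq0 p11.
have nsq (i : F) : i ^+ 2 <> -1.
  move=> i2; have i0 : i != 0.
    by apply: contra_eq_neq i2 => ->; rewrite expr0n eq_sym oppr_eq0 oner_neq0.
  have : i ^+ 10 = 1.
    by apply: (mulfI i0); rewrite -exprS mulr1 -{2}[i]expf_card q11.
  rewrite -[10%N]/(2 * 5)%N exprM i2 => /eqP; rewrite -subr_eq0 => /eqP e.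
  have /eqP[] := nz 2 isT; rewrite -[RHS]oppr0 -e; ring.
apply: (@strong_crit1_nonsquare _ 1 4%:R _ (oner_neq0 _) 2%:R nsq).
- apply/eqP; rewrite -subr_eq0; apply/eqP.
  by transitivity (3%:R * 11%:R : F); [ring | rewrite e11 mulr0].
- exact: nz.
- rewrite -subr_eq0; have -> : 2%:R ^+ 4 - 1 = 4%:R + 11%:R :> F by ring.
  by rewrite e11 addr0 nz.
- have -> : 1 ^+ 4 * (2%:R ^+ 2 - 1) ^+ 2 + (1 ^+ 2 * 2%:R ^+ 2 + 1) * (2%:R ^+ 2 + 1 ^+ 2)
    = 3%:R * 11%:R + 1%:R :> F by ring.
  by rewrite e11 mulr0 add0r nz.
- have -> : (2%:R ^+ 2 - 1) ^+ 2 + (1 ^+ 2 * 2%:R ^+ 2 + 1) * (2%:R ^+ 2 + 1 ^+ 2)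
    = 3%:R * 11%:R + 1%:R :> F by ring.
  by rewrite e11 mulr0 add0r nz.
Qed.

End SmallParameters.

(** * The groups L_2 over small fields *)

Section CriteriaByOrders.
Variable G : groupType.
Implicit Types x y z : G.
Local Open Scope group_scope.

(** An automorphism which fixes [x] and exchanges [y] and [z] would exchange
    [x y] and [x z]. *)
Lemma crit2_order k x y z : x * x = 1 -> y * y = 1 -> z * z = 1 ->
  generates [set x; y; z] -> (x * y) ^+ k = 1 -> (x * z) ^+ k <> 1 -> crit2 G.
Proof.
move=> xx yy zz gen e ne; exists x, y, z; split=> // -[alpha aut [ax ay az]].
apply: ne; have := congr1 alpha e.
by rewrite automorphism1 // automorphismX // (proj1 aut) ax ay.
Qed.

(** With [s = x], an automorphism as in the criterion for class 4 would fix [x]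
    and exchange [y] and [z]. *)
Lemma crit2_crit4 : crit2 G -> crit4 G.
Proof.
case=> x [y [z [xx yy zz gen no]]]; exists y, z, x; split=> //.
  by apply: eq_generates gen => u; rewrite /=; tauto.
by case=> alpha aut [ay az ax]; apply: no; exists alpha; rewrite // ax sq1V.
Qed.

End CriteriaByOrders.

Section SmallFields.
Variable F : finFieldType.

Lemma over_unitriangular (H : set (L2 F)) (i : F) : is_subgroup H -> over H (weyl F) ->
  (forall a, a != 0 -> over H (diag a)) -> over H (mk i 1 0 (- i)) -> forall x, H x.
Proof.
move=> sH oW oD oP; have := over1 sH; rewrite mk1 => oI.
by apply: (over_all sH oW oD oP oI); [ring | rewrite mul1r mul0r oner_neq0].
Qed.

(** The torus is generated by the involution [diag(i, -i)] itself, which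
    commutes with [w] modulo the scalars; this happens for 2 and 5 elements. *)
Lemma strong_crit1_primitive_i (i : F) : i ^+ 2 = -1 ->
  (forall b, b != 0 -> exists k, b = i ^+ k) -> strong_crit1 (L2 F).
Proof.
move=> i2 prim.
have i0 : i != 0.
  by apply: contra_eq_neq i2 => ->; rewrite expr0n eq_sym oppr_eq0 oner_neq0.
have iV : i^-1 = - i by apply: (mulfI i0); rewrite divff // mulrN -expr2 i2 opprK.
have [dW W2] := @pr_involution F 0 1 (-1) ltac:(ring).
have [dY Y2] := @pr_involution F i 0 0 ltac:(rewrite -i2; ring).
have [dZ Z2] := @pr_involution F i 1 0 ltac:(rewrite -i2; ring).
rewrite oppr0 in dW W2.
exists (pr (weyl F)), (pr (mk i 0 0 (- i))), (pr (mk i 1 0 (- i))); split=> //.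
- rewrite -!prM //; apply/pr_eqP; rewrite ?det_mulmx ?dW ?dY ?mul1r //.
  by right; rewrite !mulmk oppmk; congr mk; ring.
- rewrite -!prM // => /pr_eqP; rewrite !det_mulmx !dW !dZ !mul1r => /(_ erefl erefl).
  have one0 : 1 <> 0 :> F by apply/eqP/oner_neq0.
  case; rewrite !mulmk ?oppmk => /mk_inj[e _ _ _]; apply: one0.
    transitivity (- (i * 0 + 1 * -1)); first by ring.
    by rewrite -e; ring.
  transitivity (- (i * 0 + 1 * -1)); first by ring.
  by rewrite -e; ring.
apply: generates_L2 => H sH HA.
have oW : over H (weyl F) by split; rewrite ?det_weyl //; apply: HA; left; left.
have oY : over H (mk i 0 0 (- i)) by split=> //; apply: HA; left; right.
have oZ : over H (mk i 1 0 (- i)) by split=> //; apply: HA; right.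
apply: (over_unitriangular sH oW _ oZ); apply: (over_diags sH prim).
by rewrite /diag iV.
Qed.

Variables (p k : nat).
Hypotheses (pp : prime p) (k0 : (0 < k)%N) (qE : #|F| = (p ^ k)%N).

Lemma strong_crit1_q2 : #|F| = 2%N -> strong_crit1 (L2 F).
Proof.
move=> q2; have p2 : p = 2%N by apply: (char_prime_card pp k0 qE); rewrite // q2.
have two : 1 + 1 = 0 :> F by have := pcharf0 (char_F pp qE); rewrite p2.
apply: (@strong_crit1_primitive_i 1).
  by apply/eqP; rewrite -subr_eq0 opprK expr1n two.
move=> b b0; exists 0%N; apply: (mulfI b0).
by rewrite expr0 mulr1 -expr2 -[RHS]expf_card q2.
Qed.

Lemma strong_crit1_q5 : #|F| = 5%N -> strong_crit1 (L2 F).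
Proof.
move=> q5; have p5 : p = 5%N by apply: (char_prime_card pp k0 qE); rewrite // q5.
have e5 : 5%:R = 0 :> F by apply/eqP; rewrite (natF_eq0 pp qE) p5.
apply: (@strong_crit1_primitive_i 2%:R).
  by apply/eqP; rewrite -subr_eq0 -e5; apply/eqP; ring.
move=> b b0; have b4 : b ^+ 4 = 1.
  by apply: (mulfI b0); rewrite -exprS mulr1 -[RHS]expf_card q5.
have /eqP : (b - 1) * (b + 1) * (b - 2%:R) * (b + 2%:R) = 0.
  transitivity (b ^+ 4 - 1 + 5%:R * (1 - b ^+ 2)); first by ring.
  by rewrite b4 e5; ring.
rewrite !mulf_eq0 ?subr_eq0 ?addr_eq0 => /orP[/orP[/orP[]|]|] /eqP->.
- by exists 0%N.
- exists 2%N; apply/eqP; rewrite -subr_eq0 -oppr_eq0 -e5; apply/eqP; ring.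
- by exists 1%N.
- exists 3%N; apply/eqP; rewrite -subr_eq0 -oppr_eq0; apply/eqP.
  by transitivity (5%:R * 2%:R : F); [ring | rewrite e5 mul0r].
Qed.

(** The involutions are [w], [Z = (i 1; 0 -i)] and [w h(a)]. The product
    [w Z] has order 3, but [w w h(a)] does not, since [a] has order 8. *)
Lemma crit2_q9 : #|F| = 9%N -> crit2 (L2 F).
Proof.
move=> q9; have [t /and3P[]] := @common_nonroot F [:: [:: 0; 1]; [:: -1; 0; 0; 0; 1]]
  ltac:(by rewrite /= oner_neq0) ltac:(by rewrite unlock q9).
rewrite !horner_Poly /= => h1 h2 _.
have t0 : t != 0 by apply: contra_neq h1 => ->; ring.
have t4 : t ^+ 4 - 1 != 0 by apply: contra_neq h2 => h; rewrite -[RHS]h; ring.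
have pow8 b : b != 0 -> b ^+ 8 = 1 :> F.
  by move=> b0; apply: (mulfI b0); rewrite -exprS mulr1 -[RHS]expf_card q9.
pose i := t ^+ 2; have i2 : i ^+ 2 = -1.
  apply/eqP; rewrite -addr_eq0; apply/eqP; apply: (mulfI t4); rewrite mulr0.
  by transitivity (t ^+ 8 - 1); [rewrite /i; ring | rewrite pow8 ?subrr].
have [a a0 prim] := primitive_element F.
have a6 : a ^+ 6 != 1.
  apply: contra_neq t4 => a6; have [j ->] := prim _ t0.
  have a2 : a ^+ 2 = 1 by rewrite -[LHS]mul1r -a6 -exprD pow8.
  by rewrite exprAC -[4%N]/(2 * 2)%N exprM a2 !expr1n subrr.
have [dW W2] := @pr_involution F 0 1 (-1) ltac:(ring).
have [dC C2] := @pr_involution F 0 a^-1 (- a) ltac:(by field).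
have [dZ Z2] := @pr_involution F i 1 0 ltac:(rewrite -i2; ring).
rewrite oppr0 in dW W2 dC C2.
apply: (@crit2_order _ 3 (pr (weyl F)) (pr (mk i 1 0 (- i))) (pr (mk 0 a^-1 (- a) 0))) => //.
- apply: generates_L2 => H sH HA.
  have [Hw HZ HC] : [/\ H (pr (weyl F)), H (pr (mk i 1 0 (- i)))
      & H (pr (mk 0 a^-1 (- a) 0))].
    by split; apply: HA; [left; left | left; right | right].
  have [oW oD] := over_diag sH a0 Hw HC.
  by apply: (over_unitriangular sH oW _ (conj dZ HZ)); apply: over_diags oD.
- rewrite expgS expg2 -!prM //; rewrite ?det_mulmx ?dW ?dZ ?mul1r //.
  have -> : weyl F * mk i 1 0 (- i) * (weyl F * mk i 1 0 (- i) * (weyl F * mk i 1 0 (- i))) = 1.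
    rewrite /weyl !mulmk mk1; congr mk.
    + transitivity (- i ^+ 2); [ring | by rewrite i2 opprK].
    + transitivity (- i * (i ^+ 2 + 1)); [ring | by rewrite i2 addNr mulr0].
    + transitivity (- i * (i ^+ 2 + 1)); [ring | by rewrite i2 addNr mulr0].
    + transitivity (- 2%:R * i ^+ 2 - 1); [ring | rewrite i2; ring].
  exact: pr1.
- rewrite expgS expg2 -!prM //; rewrite ?det_mulmx ?dW ?dC ?mul1r // => /pr_eq1P.
  rewrite !det_mulmx dW dC !mul1r => /(_ erefl) h; case/eqP: a6.
  have -> : a ^+ 6 = (a ^+ 3) ^+ 2 by rewrite -exprM.
  have : a ^+ 3 = 1 \/ a ^+ 3 = -1.
    case: h; rewrite /weyl !mulmk mk1 ?oppmk => /mk_inj[e _ _ _]; [right | left].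
      by rewrite -e; ring.
    by rewrite -[RHS]opprK -e; ring.
  by case=> ->; ring.
Qed.

(** The involutions are [w], [w h(3)], where 3 generates the multiplicative
    group, and [Z = (1 1; -2 -1)]. The product of the first two has order 3,
    but [w Z] does not. *)
Lemma crit2_q7 : #|F| = 7%N -> crit2 (L2 F).
Proof.
move=> q7; have p7 : p = 7%N by apply: (char_prime_card pp k0 qE); rewrite // q7.
have e7 : 7%:R = 0 :> F by apply/eqP; rewrite (natF_eq0 pp qE) p7.
have nz n : (0 < n < 7)%N -> n%:R != 0 :> F.
  by move=> nr; rewrite (natF_eq0 pp qE) p7; apply/negP => /dvdn_leq; lia.
have mod7 c (x y : F) : x - y = c * 7%:R -> x = y.
  by rewrite e7 mulr0 => /eqP; rewrite subr_eq0 => /eqP.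
have prim (b : F) : b != 0 -> exists j, b = 3%:R ^+ j.
  move=> b0; have b6 : b ^+ 6 = 1.
    by apply: (mulfI b0); rewrite -exprS mulr1 -[RHS]expf_card q7.
  have /eqP : (b - 1) * (b + 1) * ((b - 2%:R) * (b - 4%:R)) * ((b - 3%:R) * (b - 5%:R)) = 0.
    transitivity (b ^+ 6 - 1 + 7%:R * (- 2%:R * b ^+ 5 + 10%:R * b ^+ 4 - 20%:R * b ^+ 3
      + 7%:R * b ^+ 2 + 22%:R * b - 17%:R)); first by ring.
    by rewrite b6 e7; ring.
  rewrite !mulf_eq0 ?subr_eq0 ?addr_eq0.
  case/orP=> [/orP[/orP[]|/orP[]]|/orP[]] /eqP->.
  - by exists 0%N.
  - by exists 3%N; apply: (@mod7 (- 4%:R)); ring.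
  - by exists 2%N; apply: (@mod7 (- 1)); ring.
  - by exists 4%N; apply: (@mod7 (- 11%:R)); ring.
  - by exists 1%N.
  - by exists 5%N; apply: (@mod7 (- 34%:R)); ring.
have a0 : 3%:R != 0 :> F by apply: nz.
have aV : 3%:R^-1 = 5%:R :> F.
  by apply: (mulfI a0); rewrite divff //; apply: (@mod7 (- 2%:R)); ring.
have [dW W2] := @pr_involution F 0 1 (-1) ltac:(ring).
have [dC C2] := @pr_involution F 0 3%:R^-1 (- 3%:R) ltac:(by field).
have [dZ Z2] := @pr_involution F 1 1 (- 2%:R) ltac:(ring).
rewrite oppr0 in dW W2 dC C2.
apply: (@crit2_order _ 3 (pr (weyl F)) (pr (mk 0 3%:R^-1 (- 3%:R) 0))
  (pr (mk 1 1 (- 2%:R) (- 1)))) => //.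
- apply: generates_L2 => H sH HA.
  have [Hw HC HZ] : [/\ H (pr (weyl F)), H (pr (mk 0 3%:R^-1 (- 3%:R) 0))
      & H (pr (mk 1 1 (- 2%:R) (- 1)))].
    by split; apply: HA; [left; left | left; right | right].
  have [oW oD] := over_diag sH a0 Hw HC; have oZ := conj dZ HZ.
  have oP := overM sH (overM sH oZ oD) oZ.
  rewrite /diag !mulmk aV in oP; apply: (over_all sH oW _ oP oW).
  + exact: over_diags oD.
  + by apply: (@mod7 (- 1)); ring.
  + apply: contra_neq (nz 1%N isT) => h; transitivity (- (1 * ((-2%:R * 3%:R + -1 * 0) * 1 + (-2%:R * 0 + -1 * 5%:R) * -1)) : F).
      by ring.
    by rewrite -h; ring.
- rewrite expgS expg2 -!prM //; rewrite ?det_mulmx ?dW ?dC ?mul1r //.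
  apply/pr_eq1P; first by rewrite !det_mulmx dW dC !mul1r.
  left; rewrite /weyl aV !mulmk mk1; congr mk.
  + by apply: (@mod7 (- 4%:R)); ring.
  + by ring.
  + by ring.
  + by apply: (@mod7 (- 18%:R)); ring.
- rewrite expgS expg2 -!prM //; rewrite ?det_mulmx ?dW ?dZ ?mul1r // => /pr_eq1P.
  rewrite !det_mulmx dW dZ !mul1r => /(_ erefl) h.
  have : -8%:R = 0 :> F.
    case: h; rewrite /weyl !mulmk mk1 ?oppmk => /mk_inj[_ e _ _].
      by rewrite -[RHS]e; ring.
    by rewrite -[RHS]oppr0 -[RHS]e; ring.
  have -> : -8%:R = - (7%:R + 1) :> F by ring.
  by rewrite e7 add0r => /eqP; rewrite oppr_eq0 oner_eq0.
Qed.

End SmallFields.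

(** * Inverting pairs of generators *)

Section Inverted.
Variable G : groupType.
Local Open Scope group_scope.
Local Open Scope classical_set_scope.

Definition pairs_inverted := forall x y : G, generates [set x; y] ->
  exists2 alpha, automorphism alpha & alpha x = x^-1 /\ alpha y = y^-1.

Lemma pairs_inverted_crit5 : pairs_inverted -> ~ crit5 G.
Proof.
move=> inv [x [y [gen no]]]; apply: no; have [alpha aut [ax ay]] := inv _ _ gen.
by exists alpha => //; constructor 1.
Qed.

Lemma pairs_inverted_crit2ex : pairs_inverted -> ~ crit2ex G.
Proof. by move=> inv /crit2ex_crit5; exact: pairs_inverted_crit5. Qed.

Lemma commuting_generators (x y u v : G) : generates [set x; y] -> x * y = y * x ->
  u * v = v * u.
Proof.
move=> gen xy.
have cent (w : G) : is_subgroup [set z | commute z w].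
  split=> [|a b /= ca cb]; first exact/commute_sym/commute1.
  by apply/commute_sym/commuteM; [apply: commute_sym | apply/commuteV/commute_sym].
have all (w z : G) : commute x w -> commute y w -> commute z w.
  move=> cx cy; have : gen_subgroup [set x; y] z by rewrite gen.
  by move=> /(_ [set z | commute z w] (cent w)); apply; move=> _ [->|->].
have cx w : commute x w := esym (all x w erefl (esym xy)).
have cy w : commute y w := esym (all y w xy erefl).
exact: all.
Qed.

End Inverted.

(** * Positive results for L_2 *)

Section Positive.
Variables (F : finFieldType) (q p k : nat).
Hypotheses (pp : prime p) (k0 : (0 < k)%N) (qE : q = (p ^ k)%N) (cF : #|F| = q).

Let FE : #|F| = (p ^ k)%N. Proof. by rewrite cF. Qed.

Lemma L2_strong_crit1 : q <> 3%N -> q <> 7%N -> q <> 9%N -> strong_crit1 (L2 F).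
Proof.
move=> n3 n7 n9; have q1 : (1 < #|F|)%N := card_finNzRing_gt1 F.
have [p2|p2] := eqVneq p 2%N.
  have [q2|q2] := eqVneq #|F| 2%N; first exact: (strong_crit1_q2 pp k0 FE).
  by apply: (strong_crit1_even pp FE p2); lia.
have po : odd p by case: (even_prime pp) => // /eqP; rewrite (negPf p2).
have qo : odd q by rewrite qE oddX po orbT.
have [q5|q5] := eqVneq #|F| 5%N; first exact: (strong_crit1_q5 pp k0 FE).
have [q11|q11] := eqVneq #|F| 11%N; first exact: (strong_crit1_q11 pp k0 FE).
have q9 : (9 < #|F|)%N.
  by rewrite cF in q1 q5 *; lia.
have [[i i2]|nsq] := EM (exists i : F, i ^+ 2 = -1).
  exact: (strong_crit1_L2_1mod4 pp FE i2).
have nsq' (i : F) : i ^+ 2 <> -1 by move=> i2; apply: nsq; exists i.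
apply: (strong_crit1_L2_3mod4 pp FE) => //.
by move: q9 q11 qo; rewrite -cF; lia.
Qed.

Lemma L2_crit2 : q <> 3%N -> crit2 (L2 F).
Proof.
move=> n3; have [q7|n7] := EM (q = 7%N); first by apply: (crit2_q7 pp k0 FE); rewrite cF.
have [q9|n9] := EM (q = 9%N); first by apply: crit2_q9; rewrite cF.
exact/strong_crit1_crit2/L2_strong_crit1.
Qed.

(** For [q = 3] the generators are [w] and a transvection of order 3. With
    [y = 1] there is no automorphism because [w] is not trivial. *)
Lemma L2_crit4 : crit4 (L2 F).
Proof.
have [q3|n3] := EM (q = 3%N); last exact/crit2_crit4/L2_crit2.
have pm (b : F) : b != 0 -> b = 1 \/ b = -1.
  move=> b0; have : b ^+ 2 = 1.
    by apply: (mulfI b0); rewrite -exprS mulr1 -[RHS]expf_card cF q3.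
  by move/eqP; rewrite sqrf_eq1 => /orP[] /eqP; tauto.
have [dW W2] := @pr_involution F 0 1 (-1) ltac:(ring).
rewrite oppr0 in dW W2.
exists (pr (weyl F)), 1%g, (pr (unip (1 : F))); split=> //; first by rewrite mulg1.
  apply: generates_L2 => H sH HA.
  have oW : over H (weyl F) by split=> //; apply: HA; left; left.
  have oU : over H (unip (1 : F)).
    by split; [apply: det_unip | apply: HA; right].
  have oD a : a != 0 -> over H (diag a).
    case/pm=> ->; have := over1 sH; first by rewrite /diag invr1 mk1.
    by move/overN; rewrite /diag invrN1 mk1 oppmk oppr0.
  have := over1 sH; rewrite mk1 => oI; apply: (over_all sH oW oD oU oI).
    by ring.
  by rewrite mulr1 mul0r oner_neq0.
case=> alpha aut [_ a1 _]; have := automorphism1 aut; rewrite a1.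
move/pr_eq1P => /(_ (det_weyl F)); rewrite /weyl mk1 ?oppmk.
by case=> /mk_inj[_ + _ _]; rewrite ?oppr0; apply/eqP/oner_neq0.
Qed.

End Positive.

(** * Pairs of generators of L_2 *)

Section Conjugation.
Variable F : finFieldType.
Implicit Types (A B : 'M[F]_2) (x y : L2 F).

Definition adj2 A := mk (A 1 1) (- A 0 1) (- A 1 0) (A 0 0).

Lemma adj2_mk (a b c d : F) : adj2 (mk a b c d) = mk d (- b) (- c) a.
Proof. by rewrite /adj2 !mxE. Qed.

Lemma pr_adj A : \det A = 1 -> pr (adj2 A) = (pr A)^-1%g.
Proof.
rewrite [A]mkE adj2_mk; move: (A 0 0) (A 0 1) (A 1 0) (A 1 1) => a b c d.
move=> dA; have e : a * d - b * c = 1 by rewrite -dA det_mk.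
have [AB BA] := det_inv_mk e.
apply: (mulgI (pr (mk a b c d))); rewrite mulgV -prM ?AB ?pr1 // det_mk -[RHS]e; ring.
Qed.

(** Trace 0 makes [C] its own inverse up to a scalar, so conjugation by [C]
    is [A -> - C A C / det C], an involution. *)
Lemma conjugation_automorphism (e f g : F) : - (e * e + f * g) != 0 ->
  let C := mk e f g (- e) in
  exists2 alpha : L2 F -> L2 F, automorphism alpha &
    forall A B, \det A = 1 -> \det B = 1 -> C * A = B * C -> alpha (pr A) = pr B.
Proof.
have [D DE] : exists D, D = - (e * e + f * g) by eexists.
rewrite -DE => D0 C; pose cj A := (- D^-1) *: (C * A * C).
have CC : C * C = (- D) *: 1.
  by rewrite /C mulmk mk1 scalemk; congr mk; rewrite ?DE; ring.
have dC : \det C = D by rewrite det_mk DE; ring.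
have cjM A B : cj (A * B) = cj A * cj B.
  rewrite /cj -scalerAl -scalerAr scalerA.
  have -> : C * A * C * (C * B * C) = C * A * (C * C) * B * C by rewrite !mulrA.
  rewrite CC -scalerAr mulr1 -!scalerAl scalerA !mulrA; congr (_ *: _).
  by field.
have cjN A : cj (- A) = - cj A by rewrite /cj mulrN mulNr scalerN.
have dcj A : \det A = 1 -> \det (cj A) = 1.
  by move=> dA; rewrite /cj detZ !det_mulmx dC dA; field.
have cjK A : cj (cj A) = A.
  rewrite /cj -scalerAr -scalerAl scalerA.
  have -> : C * (C * A * C) * C = (C * C) * A * (C * C) by rewrite !mulrA.
  rewrite CC -scalerAr mulr1 -scalerAl mul1r !scalerA.
  by rewrite (_ : _ * _ = 1) ?scale1r //; field.
have cjE A B : C * A = B * C -> cj A = B.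
  by move=> e1; rewrite /cj e1 -mulrA CC -scalerAr mulr1 scalerA mulrNN mulVf ?scale1r.
pose lift x : 'M[F]_2 := s2val (cid2 (pr_onto x)).
have dl x : \det (lift x) = 1 by rewrite /lift; case: cid2.
have prl x : pr (lift x) = x by rewrite /lift; case: cid2.
pose alpha x := pr (cj (lift x)).
have aE A : \det A = 1 -> alpha (pr A) = pr (cj A).
  move=> dA; have /pr_eqP : pr (lift (pr A)) = pr A by rewrite prl.
  case/(_ (dl _) dA); rewrite /alpha => ->; rewrite ?cjN ?prN //; exact: dcj.
have aK x : alpha (alpha x) = x.
  by rewrite [alpha x]/alpha aE ?cjK ?prl // dcj.
exists alpha; last by move=> A B dA dB e1; rewrite aE // (cjE _ _ e1).
split; last by exists alpha.
move=> x y; rewrite -{1}[x]prl -{1}[y]prl -prM // aE ?cjM ?prM ?dcj //.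
by rewrite det_mulmx !dl mul1r.
Qed.

(** The matrices with a given row eigenvector represent a proper subgroup. *)
Lemma reducible_not_generate (v1 v2 : F) A B : (v1, v2) != (0, 0) ->
  \det A = 1 -> \det B = 1 ->
  (forall M, M = A \/ M = B -> exists l, v1 * M 0 0 + v2 * M 1 0 = l * v1 /\
     v1 * M 0 1 + v2 * M 1 1 = l * v2) ->
  ~ generates [set pr A; pr B]%classic.
Proof.
move=> v0 dA dB eig gen.
pose eigen (M : 'M[F]_2) := exists l, v1 * M 0 0 + v2 * M 1 0 = l * v1 /\
     v1 * M 0 1 + v2 * M 1 1 = l * v2.
pose H : set (L2 F) := [set x | exists M, [/\ \det M = 1, pr M = x & eigen M]]%classic.
have eigE a b c d : eigen (mk a b c d) <-> exists l, v1 * a + v2 * c = l * v1 /\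
     v1 * b + v2 * d = l * v2 by rewrite /eigen !mxE.
have sH : is_subgroup H.
  split; first by exists 1; rewrite det1 pr1 mk1; split=> //; apply/eigE; exists 1; split; ring.
  move=> _ _ [M [dM <- eM]] [N [dN <- eN]].
  exists (M * adj2 N); rewrite [M]mkE [N]mkE in dM dN eM eN *.
  move: (M 0 0) (M 0 1) (M 1 0) (M 1 1) dM eM => a b c d dM eM.
  move: (N 0 0) (N 0 1) (N 1 0) (N 1 1) dN eN => a' b' c' d' dN eN.
  have dN' : \det (adj2 (mk a' b' c' d')) = 1.
    by rewrite adj2_mk det_mk -[RHS]dN det_mk; ring.
  split; first by rewrite det_mulmx dM dN' mul1r.
    by rewrite prM // pr_adj.
  move/eigE: eM => [l [l1 l2]]; move/eigE: eN => [m [m1 m2]].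
  rewrite det_mk in dN; have m0 : m != 0.
    apply: contra_neq v0 => m0; rewrite m0 !mul0r in m1 m2.
    congr pair; rewrite -[LHS]mulr1 -dN.
      transitivity ((v1 * a' + v2 * c') * d' - (v1 * b' + v2 * d') * c'); first by ring.
      by rewrite m1 m2; ring.
    transitivity ((v1 * b' + v2 * d') * a' - (v1 * a' + v2 * c') * b'); first by ring.
    by rewrite m1 m2; ring.
  rewrite adj2_mk mulmk; apply/eigE; exists (l / m).
  have w1 : v1 * d' - v2 * c' = v1 / m.
    apply: (mulIf m0); rewrite divfK //.
    transitivity (d' * (m * v1) - c' * (m * v2)); first by ring.
    by rewrite -m1 -m2 -[RHS]mulr1 -dN; ring.
  have w2 : - v1 * b' + v2 * a' = v2 / m.
    apply: (mulIf m0); rewrite divfK //.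
    transitivity (- b' * (m * v1) + a' * (m * v2)); first by ring.
    by rewrite -m1 -m2 -[RHS]mulr1 -dN; ring.
  split.
    transitivity ((v1 * a + v2 * c) * d' - (v1 * b + v2 * d) * c'); first by ring.
    rewrite l1 l2; transitivity (l * (v1 * d' - v2 * c')); first by ring.
    by rewrite w1; ring.
  transitivity (- (v1 * a + v2 * c) * b' + (v1 * b + v2 * d) * a'); first by ring.
  rewrite l1 l2; transitivity (l * (- v1 * b' + v2 * a')); first by ring.
  by rewrite w2; ring.
have all M : \det M = 1 -> eigen M.
  move=> dM; have : gen_subgroup [set pr A; pr B]%classic (pr M) by rewrite gen.
  move/(_ H sH) => []; last first.
    move=> N [dN /(pr_eqP dN dM)[->//|->]] [l [l1 l2]]; exists (- l).
    by move: l1 l2; rewrite !mxE => l1 l2; split; rewrite mulNr -?l1 -?l2; ring.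
  by move=> _ [->|->]; [exists A | exists B]; split=> //; apply: eig; tauto.
have := all (mk 1 1 0 1); rewrite det_mk => /(_ ltac:(ring)) /eigE[l [l1 l2]].
have := all (mk 1 0 1 1); rewrite det_mk => /(_ ltac:(ring)) /eigE[m [m1 m2]].
have z1 : v1 * v1 = 0.
  by transitivity ((v1 * 1 + v2 * 1) * v1 - (v1 * 1 + v2 * 0) * v2); [ring | rewrite l1 l2; ring].
have z2 : v2 * v2 = 0.
  by transitivity ((v1 * 1 + v2 * 1) * v2 - (v1 * 0 + v2 * 1) * v1); [ring | rewrite m1 m2; ring].
move: v0; move/eqP: z1; move/eqP: z2; rewrite !mulf_eq0 !orbb => /eqP-> /eqP->.
by rewrite eqxx.
Qed.

End Conjugation.

Section Nonabelian.
Variable F : finFieldType.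
Implicit Types (A B : 'M[F]_2) (x y : L2 F).

Lemma L2_noncommuting : (pr (weyl F) * pr (unip 1%R) <> pr (unip 1%R) * pr (weyl F))%g.
Proof.
have [dW dU] := (det_weyl F, @det_unip F 1).
rewrite -!prM // => /pr_eqP; rewrite !det_mulmx dW dU !mul1r => /(_ erefl erefl).
have one0 : 1 <> 0 :> F by apply/eqP/oner_neq0.
rewrite /weyl /unip !mulmk oppmk; case=> /mk_inj[e _ _ _]; apply: one0.
  transitivity (- (1 * 0 + 1 * -1) : F); first by ring.
  by rewrite -e; ring.
transitivity (- (1 * 0 + 1 * -1) : F); first by ring.
by rewrite -e; ring.
Qed.

Lemma commuting_not_generate x y : (x * y = y * x)%g -> ~ generates [set x; y]%classic.
Proof. by move=> xy gen; apply: L2_noncommuting; exact: commuting_generators gen xy. Qed.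

Lemma proportional (v1 v2 u1 u2 : F) : (v1, v2) != (0, 0) -> u1 * v2 = u2 * v1 ->
  exists l, u1 = l * v1 /\ u2 = l * v2.
Proof.
move=> v0 e; have [v10|v10] := eqVneq v1 0; last first.
  exists (u1 / v1); split; first by rewrite divfK.
  by rewrite mulrAC e mulfK.
have v20 : v2 != 0 by apply: contra_neq v0 => ->; rewrite v10.
exists (u2 / v2); split; last by rewrite divfK.
by rewrite mulrAC -e mulfK.
Qed.

(** Let [C = AB - BA].  Then [CA = A^-1 C] and [CB = B^-1 C].  If [C] is
    invertible, conjugation by [C] inverts both elements; if it is nilpotent,
    its kernel is a common eigenspace; if it is zero, the elements commute. *)
Lemma L2_pairs_inverted : pairs_inverted (L2 F).
Proof.
move=> x y; have [A dA <-] := pr_onto x; have [B dB <-] := pr_onto y => gen.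
have AE := mkE A; have BE := mkE B.
move: (A 0 0) (A 0 1) (A 1 0) (A 1 1) AE => a b c d AE.
move: (B 0 0) (B 0 1) (B 1 0) (B 1 1) BE => a' b' c' d' BE.
subst A B; pose e := b * c' - b' * c.
pose f := a * b' + b * d' - a' * b - b' * d.
pose g := c * a' + d * c' - c' * a - d' * c.
have dA' : \det (adj2 (mk a b c d)) = 1 by rewrite adj2_mk det_mk -[RHS]dA det_mk; ring.
have dB' : \det (adj2 (mk a' b' c' d')) = 1 by rewrite adj2_mk det_mk -[RHS]dB det_mk; ring.
have [D0|D0] := eqVneq (- (e * e + f * g)) 0; last first.
  have [alpha aut aE] := conjugation_automorphism D0; exists alpha => //.
  split; rewrite -pr_adj //; apply: aE => //; rewrite adj2_mk !mulmk /e /f /g;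
    congr mk; ring.
have {}D0 : e * e = - (f * g).
  by apply/eqP; rewrite -addr_eq0 -oppr_eq0 D0.
have tA : e * a + f * c + g * b - e * d = 0 by rewrite /e /f /g; ring.
have tB : e * a' + f * c' + g * b' - e * d' = 0 by rewrite /e /f /g; ring.
have red (v1 v2 : F) : (v1, v2) != (0, 0) ->
    (v1 * a + v2 * c) * v2 = (v1 * b + v2 * d) * v1 ->
    (v1 * a' + v2 * c') * v2 = (v1 * b' + v2 * d') * v1 -> False.
  move=> v0 eA eB; apply: (reducible_not_generate v0 dA dB) gen => M.
  by case=> ->; rewrite !mxE /=; apply: proportional.
have [e0f0|ef] := eqVneq (e, f) (0, 0); last first.
  exfalso; apply: (red e f ef); apply/eqP; rewrite -subr_eq0; apply/eqP.
    transitivity (f * (e * a + f * c + g * b - e * d) - b * (e * e + f * g)); first by ring.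
    by rewrite tA D0; ring.
  transitivity (f * (e * a' + f * c' + g * b' - e * d') - b' * (e * e + f * g)); first by ring.
  by rewrite tB D0; ring.
have [e0g0|eg] := eqVneq (g, - e) (0, 0); last first.
  exfalso; apply: (red g (- e) eg); apply/eqP; rewrite -subr_eq0; apply/eqP.
    transitivity (- g * (e * a + f * c + g * b - e * d) + c * (e * e + f * g)); first by ring.
    by rewrite tA D0; ring.
  transitivity (- g * (e * a' + f * c' + g * b' - e * d') + c' * (e * e + f * g)); first by ring.
  by rewrite tB D0; ring.
exfalso; apply: commuting_not_generate gen.
move: e0f0 e0g0; rewrite /e /f /g => -[e0 f0] [g0 _].
rewrite -!prM //; congr pr; rewrite !mulmk; congr mk; apply/eqP; rewrite -subr_eq0; apply/eqP.
- by rewrite -[RHS]e0; ring.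
- by rewrite -[RHS]f0; ring.
- by rewrite -[RHS]g0; ring.
- by transitivity (- (b * c' - b' * c)); [ring | rewrite e0 oppr0].
Qed.

Lemma involution_lift x : 2%:R != 0 :> F -> (x * x = 1)%g ->
  x = 1%g \/ exists a b c, a * a + b * c = -1 /\ pr (mk a b c (- a)) = x.
Proof.
move=> n2; have [A dA <-] := pr_onto x; rewrite -prM //.
move/pr_eq1P; rewrite det_mulmx dA mul1r => /(_ erefl).
have dA' := dA; have AE := mkE A.
move: (A 0 0) (A 0 1) (A 1 0) (A 1 1) AE => a b c d AE; subst A.
rewrite det_mk in dA'; rewrite mulmk mk1 oppmk; case=> /mk_inj[e1 e2 e3 e4].
  left; apply/pr_eq1P => //.
  have t0 : a + d != 0.
    apply: contra_neq n2 => t0; transitivity (a * (a + d)); last by rewrite t0 mulr0.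
    by transitivity (a * a + b * c + (a * d - b * c)); [rewrite e1 dA' | ring].
  have b0 : b = 0 by apply: (mulIf t0); rewrite mul0r -[RHS]e2; ring.
  have c0 : c = 0 by apply: (mulIf t0); rewrite mul0r -[RHS]e3; ring.
  have ad : a = d.
    apply: (mulIf t0); transitivity (a * a + b * c + (a * d - b * c)); first by ring.
    by rewrite e1 -e4; ring.
  have : a * a = 1 by rewrite -[RHS]dA' b0 -ad; ring.
  move/eqP; rewrite -expr2 sqrf_eq1 mk1 oppmk b0 c0 -ad oppr0.
  by case/orP=> /eqP->; [left | right].
right; exists a, b, c; split=> //; congr (pr (mk _ _ _ _)); apply/eqP.
rewrite eq_sym -addr_eq0 addrC; apply/negPn/negP => t0.
have a0 : a = 0.
  apply: (mulIf t0); rewrite mul0r.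
  by transitivity (a * a + b * c + (a * d - b * c)); [ring | rewrite e1 dA' addNr].
have b0 : b = 0 by apply: (mulIf t0); rewrite mul0r -[RHS]oppr0 -[RHS]e2; ring.
by move/eqP: dA'; rewrite a0 b0 !mul0r subrr eq_sym oner_eq0.
Qed.

End Nonabelian.

(** * Involutions which form a subgroup *)

Section InvolutionsSubgroup.
Variable G : groupType.
Local Open Scope group_scope.
Local Open Scope classical_set_scope.

Lemma involutions_not_generate (A : set G) (u : G) :
  (forall x y : G, x * x = 1 -> y * y = 1 -> (x * y) * (x * y) = 1) -> u * u <> 1 ->
  (forall x, A x -> x * x = 1) -> ~ generates A.
Proof.
move=> inv uu A2 gen; apply: uu; have : gen_subgroup A u by rewrite gen.
move=> /(_ [set x | x * x = 1]); apply=> //.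
split=> [|x y /= xx yy] /=; first by rewrite mulg1.
by apply: inv => //; rewrite -invMg yy invg1.
Qed.

(** If the elements of order at most 2 form a proper subgroup, no generating
    tuple consists of involutions. *)
Lemma involutions_subgroup_crit (u : G) :
  (forall x y : G, x * x = 1 -> y * y = 1 -> (x * y) * (x * y) = 1) -> u * u <> 1 ->
  [/\ ~ crit1 G, ~ crit2 G & ~ crit3 G].
Proof.
move=> inv uu; split.
- case=> x [y [z [xx yy zz _]]]; apply: (involutions_not_generate inv uu).
  by move=> _ [[->|->]|->].
- case=> x [y [z [xx yy zz gen _]]]; apply: (involutions_not_generate inv uu) gen.
  by move=> _ [[->|->]|->].
case=> w [x [y [z [[ww xx yy zz] gen _]]]]; apply: (involutions_not_generate inv uu) gen.
by move=> _ [[[->|->]|->]|->].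
Qed.

End InvolutionsSubgroup.

Section FieldOfThree.
Variable F : finFieldType.

Lemma product_involution (a b c a' b' c' : F) :
  a * a + b * c = -1 -> a' * a' + b' * c' = -1 -> a * a' + b * c' + (c * b' + a * a') = 0 ->
  let x := pr (mk a b c (- a)) in let y := pr (mk a' b' c' (- a')) in
  (x * y * (x * y) = 1)%g.
Proof.
move=> e e' t; have [dA _] := pr_involution e; have [dB _] := pr_involution e'.
move=> x y; rewrite /x /y -prM // mulmk.
have -> : c * b' + - a * - a' = - (a * a' + b * c').
  by apply/eqP; rewrite -addr_eq0 -[X in _ == X]t; apply/eqP; ring.
have p2 : (a * a' + b * c') * (a * a' + b * c') +
    (a * b' + b * - a') * (c * a' + - a * c') = -1.
  transitivity (- ((a * a + b * c) * (a' * a' + b' * c')) +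
     (a * a' + b * c') * (a * a' + b * c' + (c * b' + a * a'))); first by ring.
  by rewrite e e' t; ring.
by case: (pr_involution p2).
Qed.

(** For [q = 3] the involutions and the identity form a four-group: two
    matrices of trace 0 and determinant 1 are equal up to sign or
    anticommute. *)
Lemma L2_three_involutions : #|F| = 3%N -> [/\ ~ crit1 (L2 F), ~ crit2 (L2 F) & ~ crit3 (L2 F)].
Proof.
move=> q3; have ch : 3%N \in [pchar F] by apply: (@card_finPcharP _ _ 1).
have e3 : 3%:R = 0 :> F := pcharf0 ch.
have n2 : 2%:R != 0 :> F by rewrite -(dvdn_pcharf ch).
have pm (b : F) : b != 0 -> b = 1 \/ b = -1.
  move=> b0; have : b ^+ 2 = 1.
    by apply: (mulfI b0); rewrite -exprS mulr1 -[RHS]expf_card q3.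
  by move/eqP; rewrite sqrf_eq1 => /orP[] /eqP; tauto.
have sq (b : F) : b != 0 -> b * b = 1 by case/pm=> ->; ring.
have eqpm (b b' : F) : b != 0 -> b' != 0 -> b' = b \/ b' = - b.
  by move=> /pm[->|->] /pm[->|->]; rewrite ?opprK; tauto.
have entries (a b c : F) : a * a + b * c = -1 -> b != 0 /\ c = - (1 + a * a) * b.
  move=> e; have b0 : b != 0.
    apply/eqP => b0; move: e; rewrite b0 mul0r addr0.
    have [->|/sq->] := eqVneq a 0; move/eqP; rewrite -subr_eq0 opprK.
      by rewrite mul0r add0r oner_eq0.
    by rewrite (negPf n2).
  split=> //; apply: (mulfI b0).
  transitivity (- (1 + a * a) * (b * b)); last by ring.
  by rewrite (sq b) // mulr1 opprD -e; ring.
apply: (@involutions_subgroup_crit _ (pr (unip (1 : F)))).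
  move=> x y xx yy; have [x1|[a [b [c [e xE]]]]] := involution_lift n2 xx.
    by rewrite x1 !mul1g.
  have [y1|[a' [b' [c' [e' yE]]]]] := involution_lift n2 yy; first by rewrite y1 !mulg1.
  have same : y = x -> (x * y * (x * y) = 1)%g by move=> ->; rewrite xx mulg1.
  have opp : a' = - a -> b' = - b -> c' = - c -> (x * y * (x * y) = 1)%g.
    move=> ea eb ec; apply: same; rewrite -xE -yE -[in RHS]prN.
      by rewrite oppmk ea eb ec.
    by case: (pr_involution e).
  have prod : a * a' + b * c' + (c * b' + a * a') = 0 -> (x * y * (x * y) = 1)%g.
    by move=> t; rewrite -xE -yE; apply: product_involution.
  have [b0 cE] := entries _ _ _ e; have [b0' cE'] := entries _ _ _ e'.
  have three (t : F) : a * a' + b * c' + (c * b' + a * a') = 3%:R * t ->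
      (x * y * (x * y) = 1)%g by rewrite e3 mul0r; exact: prod.
  have [a0|a0] := eqVneq a 0; have [a0'|a0'] := eqVneq a' 0.
  - have [bE|bE] := eqpm _ _ b0 b0'.
      by apply: same; rewrite -xE -yE cE cE' a0 a0' bE.
    by apply: opp; rewrite ?cE ?cE' ?a0 ?a0' ?bE; ring.
  - by apply: (three (- (b * b'))); rewrite cE cE' a0 (sq a') //; ring.
  - by apply: (three (- (b * b'))); rewrite cE cE' a0' (sq a) //; ring.
  have [aE|aE] := eqpm _ _ a0 a0'; have [bE|bE] := eqpm _ _ b0 b0'.
  - by apply: same; rewrite -xE -yE cE cE' aE bE.
  - apply: (three 2%:R); rewrite cE cE' aE bE.
    transitivity (2%:R * (a * a) + 2%:R * (1 + a * a) * (b * b)); first by ring.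
    by rewrite (sq a) // (sq b) //; ring.
  - apply: (three (- 2%:R)); rewrite cE cE' aE bE.
    transitivity (- 2%:R * (a * a) - 2%:R * (1 + a * a) * (b * b)); first by ring.
    by rewrite (sq a) // (sq b) //; ring.
  - by apply: opp; rewrite ?cE ?cE' ?aE ?bE //; ring.
rewrite -prM ?det_unip // => /pr_eq1P; rewrite det_mulmx det_unip mulr1 => /(_ erefl).
rewrite /unip mulmk mk1 oppmk; case=> /mk_inj[_ e _ _]; case/eqP: n2.
  by rewrite -[RHS]e; ring.
by rewrite -[RHS]oppr0 -[RHS]e; ring.
Qed.

End FieldOfThree.

(** * Small invariant sets of lines *)

Section SmallInvariants.
Variable F : finFieldType.
Hypothesis n2 : 2%:R != 0 :> F.
Implicit Types (A B X Y Z v w : 'M[F]_2) (Om : seq 'M[F]_2).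

(** The equation [A v = l w A] says that conjugation by [A] carries the line
    of [v] to the line of [w]; it needs no inverse of [A]. *)
Definition line_invariant Om A :=
  forall v, v \in Om -> exists2 w, w \in Om & exists l, A * v = l *: (w * A).

Lemma line_invariantM Om A B : line_invariant Om A -> line_invariant Om B ->
  line_invariant Om (A * B).
Proof.
move=> iA iB v /iB[w /iA[u uO [l e1]] [m e2]]; exists u => //; exists (m * l).
by rewrite -mulrA e2 -scalerAr (mulrA A) e1 -scalerAl scalerA -mulrA.
Qed.

Lemma line_invariantN Om A : line_invariant Om A -> line_invariant Om (- A).
Proof.
move=> iA v /iA[w wO [l e]]; exists w => //; exists l.
by rewrite mulNr e mulrN scalerN.
Qed.

Lemma adj2K A : adj2 (adj2 A) = A.
Proof. by rewrite [A in LHS]mkE !adj2_mk !opprK -mkE. Qed.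

Lemma adj2M A B : adj2 (A * B) = adj2 B * adj2 A.
Proof. by rewrite [A]mkE [B]mkE mulmk !adj2_mk mulmk; congr mk; ring. Qed.

Lemma det_adj2 A : \det (adj2 A) = \det A.
Proof. by rewrite [A]mkE adj2_mk !det_mk; ring. Qed.

Lemma adj2_traceless A : \tr A = 0 -> adj2 A = - A.
Proof.
rewrite [A]mkE tr_mk adj2_mk oppmk => /eqP; rewrite addr_eq0 => /eqP->.
by rewrite opprK.
Qed.

(** A transvection acts as a unipotent element with a single Jordan block on
    the space of matrices of trace 0, so it fixes only one line there. *)
Lemma transvection_normal (s l : F) v : s != 0 -> \tr v = 0 ->
  unip s * v = l *: (v * unip s) -> exists g, v = mk 0 g 0 0.
Proof.
move=> s0; rewrite [v]mkE tr_mk; move: (v 0 0) (v 0 1) (v 1 0) (v 1 1) => e g h k.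
rewrite addrC => /eqP; rewrite addr_eq0 => /eqP->.
rewrite /unip !mulmk scalemk => /mk_inj[e1 e2 e3 e4].
have e3' : h = l * h by transitivity (0 * e + 1 * h); [ring | rewrite e3; ring].
have e1' : e + s * h = l * e by transitivity (1 * e + s * h); [ring | rewrite e1; ring].
have e4' : - e = l * (s * h - e) by transitivity (0 * g + 1 * - e); [ring | rewrite e4; ring].
have e2' : g - s * e = l * (e * s + g).
  by transitivity (1 * g + s * - e); [ring | rewrite e2; ring].
have h0 : h = 0.
  apply/eqP/negPn/negP => h0.
  have l1 : l = 1 by apply: (mulIf h0); rewrite mul1r -e3'.
  case/eqP: h0; apply: (mulfI s0); apply: (addrI e).
  by rewrite e1' l1 mulr0; ring.
have e0 : e = 0.
  apply/eqP/negPn/negP => e0.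
  have l1 : l = 1 by apply: (mulIf e0); rewrite mul1r -e1' h0; ring.
  case/eqP: e0; apply: (mulfI n2); apply: (mulfI s0); rewrite !mulr0.
  transitivity (1 * (e * s + g) - (g - s * e)); first by ring.
  by rewrite e2' l1 subrr.
by exists g; rewrite h0 e0 oppr0.
Qed.

(** A set of fewer than [q] lines in the space of matrices of trace 0 is not
    invariant under the whole group. By the pigeonhole principle two of the
    [q] upper transvections would carry a given line of the set to the same
    line, so that their quotient would fix it; hence the set would consist
    of the single line fixed by the upper transvections, which [w] moves. *)
Lemma no_small_invariant Om (S : seq 'M[F]_2) : (0 < size Om < #|F|)%N ->
  (forall v, v \in Om -> v != 0 /\ \tr v = 0) ->
  (forall A, A \in S -> [/\ \det A = 1, \tr A = 0 & line_invariant Om A]) ->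
  ~ generates [set x | exists2 A, A \in S & pr A = x]%classic.
Proof.
move=> /andP[Om0 Omq] OmP SP gen.
pose H : set (L2 F) := [set x | exists A, [/\ \det A = 1, pr A = x,
  line_invariant Om A & line_invariant Om (adj2 A)]]%classic.
have sH : is_subgroup H.
  split.
    have iv1 : line_invariant Om 1.
      by move=> v vO; exists v => //; exists 1; rewrite mul1r mulr1 scale1r.
    by exists 1; rewrite det1 pr1; split; rewrite // mk1 adj2_mk oppr0 -mk1.
  move=> _ _ [A [dA <- iA iA']] [B [dB <- iB iB']]; exists (A * adj2 B).
  rewrite det_mulmx det_adj2 dA dB mulr1 prM ?det_adj2 // pr_adj //; split=> //.
    exact: line_invariantM.
  by rewrite adj2M adj2K; apply: line_invariantM.
have all A : \det A = 1 -> line_invariant Om A.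
  move=> dA; have : gen_subgroup [set x | exists2 A, A \in S & pr A = x]%classic (pr A).
    by rewrite gen.
  move/(_ H sH); case.
    move=> _ [B /SP[dB tB iB] <-]; exists B; split=> //.
    by rewrite adj2_traceless //; apply: line_invariantN.
  by move=> B [dB /(pr_eqP dB dA)[->//|->] iB _]; rewrite -[A]opprK; apply: line_invariantN.
have shape v : v \in Om -> exists g, v = mk 0 g 0 0.
  move=> vO; pose f t : 'M[F]_2 := s2val (cid2 (all _ (det_unip t) v vO)).
  have fO t : f t \in Om by rewrite /f; case: cid2.
  have fE t : exists l, unip t * v = l *: (f t * unip t) by rewrite /f; case: cid2.
  have [t [t' [tt' ft]]] : exists t t', t != t' /\ f t = f t'.
    apply: contrapT => no.
    have inj : injective (fun t => SeqSub (fO t)).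
      move=> t t' /(congr1 val) /= e; apply/eqP/negPn/negP => tt'; apply: no.
      by exists t, t'.
    have := leq_card _ inj; rewrite leqNgt => /negP[]; apply: leq_ltn_trans Omq.
    rewrite cardE -(size_map val); apply: uniq_leq_size.
      by rewrite map_inj_uniq ?enum_uniq //; apply: val_inj.
    by move=> u /mapP[w _ ->]; apply: valP.
  have [l lE] := fE t; have [l' lE'] := fE t'; rewrite -ft in lE'.
  have [v0 tv] := OmP _ vO.
  have uK : unip (- t) * unip t = 1 by rewrite /unip mulmk mk1; congr mk; ring.
  have l0 : l != 0.
    apply: contra_neq v0 => l0; rewrite l0 scale0r in lE.
    by rewrite -[v]mul1r -uK -mulrA lE mulr0.
  have st : t' - t != 0 by rewrite subr_eq0 eq_sym.
  apply: (@transvection_normal _ (l' / l) _ st tv).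
  have uD : unip t * unip (t' - t) = unip t' by rewrite /unip mulmk; congr mk; ring.
  have e1 : f t * unip t = l^-1 *: (unip t * v) by rewrite lE scalerA mulVf ?scale1r.
  have e2 : unip t * (unip (t' - t) * v) = unip t * ((l' / l) *: (v * unip (t' - t))).
    rewrite mulrA uD lE' -uD mulrA e1 -!scalerAl -scalerAr scalerA.
    by rewrite mulrA.
  by rewrite -[LHS]mul1r -uK -mulrA e2 mulrA uK mul1r.
have [v vO] : exists v, v \in Om.
  by case: (Om) Om0 => // v s _; exists v; rewrite mem_head.
have [g vE] := shape _ vO; have [v0 _] := OmP _ vO.
have [w wO [l e]] := all _ (det_weyl F) _ vO; have [g' wE] := shape _ wO.
move: e; rewrite vE wE /weyl !mulmk scalemk => /mk_inj[_ _ _ e].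
case/eqP: v0; rewrite vE mk0; congr mk; rewrite -[LHS]opprK.
transitivity (- (- 1 * g + 0 * 0)); first by ring.
by rewrite e; ring.
Qed.

End SmallInvariants.

(** * Half-turns *)

Section Quaternions.
Variable F : finFieldType.
Hypothesis n2 : 2%:R != 0 :> F.
Implicit Types (A B Z v w : 'M[F]_2) (p q r l a b c : F) (Om : seq (F * F * F)).

Lemma traceless_anticommutator A B : \tr A = 0 -> \tr B = 0 ->
  A * B + B * A = \tr (A * B) *: 1.
Proof.
rewrite [A]mkE [B]mkE !tr_mk; move: (A 0 0) (A 0 1) (A 1 0) (A 1 1) => a b c d.
move: (B 0 0) (B 0 1) (B 1 0) (B 1 1) => a' b' c' d'.
rewrite addrC => /eqP; rewrite addr_eq0 => /eqP->.
rewrite addrC => /eqP; rewrite addr_eq0 => /eqP->.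
by rewrite !mulmk tr_mk mk1 addmk scalemk; congr mk; ring.
Qed.

Variables X Y W : 'M[F]_2.
Hypotheses (XX : X * X = -1) (YY : Y * Y = -1) (XY : X * Y = W) (YX : Y * X = - W).
Hypotheses (dX : \det X = 1) (dY : \det Y = 1).
Hypotheses (tX : \tr X = 0) (tY : \tr Y = 0) (tW : \tr W = 0).

Lemma XW : X * W = - Y. Proof. by rewrite -XY mulrA XX mulN1r. Qed.
Lemma WY : W * Y = - X. Proof. by rewrite -XY -mulrA YY mulrN1. Qed.
Lemma WX : W * X = Y. Proof. by rewrite -[W]opprK -YX mulNr -mulrA XX mulrN1 opprK. Qed.
Lemma YW : Y * W = X. Proof. by rewrite -[W]opprK -YX mulrN mulrA YY mulN1r opprK. Qed.
Lemma WW : W * W = -1. Proof. by rewrite -{1}XY -mulrA YW XX. Qed.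

Definition vec p q r : 'M[F]_2 := p *: X + q *: Y + r *: W.

Lemma mulvec p q r p' q' r' : vec p q r * vec p' q' r' =
  - (p * p' + q * q' + r * r') *: 1 +
    vec (q * r' - r * q') (r * p' - p * r') (p * q' - q * p').
Proof.
rewrite /vec !mulrDl !mulrDr -!scalerAl -!scalerAr !scalerA XX XY XW YX YY YW WX WY WW.
by apply/matrixP=> i j; rewrite !mxE; ring.
Qed.

Lemma trvec p q r : \tr (vec p q r) = 0.
Proof. by rewrite /vec !mxtraceD !mxtraceZ tX tY tW !mulr0 !addr0. Qed.

Lemma vec_inj p q r : vec p q r = 0 -> (p, q, r) = (0, 0, 0).
Proof.
move=> v0; have tr1 : \tr (1 : 'M[F]_2) = 2%:R by rewrite mxtrace1.
have dot a b c : p * a + q * b + r * c = 0.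
  have : vec p q r * vec a b c = 0 by rewrite v0 mul0r.
  rewrite mulvec => /(congr1 mxtrace); rewrite mxtraceD trvec mxtraceZ tr1 addr0 mxtrace0.
  by move/eqP; rewrite mulf_eq0 (negPf n2) orbF oppr_eq0 => /eqP.
by congr (_, _, _); [rewrite -[RHS](dot 1 0 0)|rewrite -[RHS](dot 0 1 0)|rewrite -[RHS](dot 0 0 1)];
  ring.
Qed.

(** If [A] is [X], [Y] or [XY] then [A Z A = t A + Z] with [t] the trace of
    [A Z]. As [XY] acts as the product of the actions of [X] and [Y], up to
    sign, comparing the three equations yields [2 Z] as a combination of the
    three matrices. *)
Lemma vec_span Z : \tr Z = 0 -> exists a b c, Z = vec a b c.
Proof.
move=> tZ; have swap A t : \tr A = 0 -> A * A = -1 -> t = \tr (A * Z) -> A * Z * A = t *: A + Z.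
  move=> tA AA tE; have := traceless_anticommutator tA tZ; rewrite -tE => e.
  have -> : A * Z = t *: 1 - Z * A by rewrite -e addrK.
  by rewrite mulrBl -mulrA AA mulrN1 opprK -scalerAl mul1r.
have sX := swap _ _ tX XX erefl; have sY := swap _ _ tY YY erefl.
have sW := swap _ _ tW WW erefl.
move: (\tr (X * Z)) (\tr (Y * Z)) (\tr (W * Z)) sX sY sW => t1 t2 t3 sX sY sW.
have e : t3 *: W + Z = - (t2 *: Y + t1 *: X + Z).
  rewrite -sW -{2}[W]opprK -YX -{1}XY mulrN; congr (- _).
  transitivity (X * (Y * Z * Y) * X); first by rewrite !mulrA.
  by rewrite sY mulrDr mulrDl -scalerAr -scalerAl XY WX sX addrA.
exists (- t1 / 2%:R), (- t2 / 2%:R), (- t3 / 2%:R).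
apply: (can_inj (scalerK n2)); rewrite /vec !scalerDr !scalerA.
have h (t : F) : 2%:R * (- t / 2%:R) = - t by rewrite mulrC divfK.
rewrite !h; move/matrixP: e => e; apply/matrixP=> i j; have := e i j; rewrite !mxE => eij.
transitivity (t3 * W i j + Z i j + Z i j - t3 * W i j); first by ring.
by rewrite eij; ring.
Qed.

(** The squared length of [(a, b, c)] is 1, and the half-turn about this
    vector [u] sends [v] to [2 (v . u) u - v]. *)
Lemma half_turn p q r a b c : a ^+ 2 + b ^+ 2 + c ^+ 2 = 1 ->
  let d := 2%:R * (p * a + q * b + r * c) in
  vec a b c * vec p q r = vec (d * a - p) (d * b - q) (d * c - r) * vec a b c.
Proof.
move=> e d; rewrite !mulvec; congr (_ *: _ + vec _ _ _).
- transitivity (- (d * (a ^+ 2 + b ^+ 2 + c ^+ 2) - (a * p + b * q + c * r))).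
    by rewrite e /d; ring.
  by ring.
- by ring.
- by ring.
- by ring.
Qed.

End Quaternions.

(** * Small invariant sets of axes *)

Section Axes.
Variable F : finFieldType.
Hypothesis n2 : 2%:R != 0 :> F.
Implicit Types (p q r l a b c : F) (Om : seq (F * F * F)).

Definition on_line Om (v : F * F * F) := exists2 w, w \in Om
  & exists l, v = (l * w.1.1, l * w.1.2, l * w.2).

Definition turn a b c (v : F * F * F) :=
  let d := 2%:R * (v.1.1 * a + v.1.2 * b + v.2 * c) in
  (d * a - v.1.1, d * b - v.1.2, d * c - v.2).

Definition reflect1 (v : F * F * F) := (- v.1.1, v.1.2, v.2).
Definition cycle3 (v : F * F * F) := (v.2, v.1.1, v.1.2).

(** Lines permuted by the half-turns about the coordinate axes and about
    [(a, b, c)]; on lines, the former act as the reflections in the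
    coordinate planes. *)
Definition small_axes a b c := exists Om : seq (F * F * F),
  [/\ (0 < size Om < #|F|)%N, (0, 0, 0) \notin Om &
      forall v, v \in Om ->
        [/\ on_line Om (reflect1 v), on_line Om (v.1.1, - v.1.2, v.2),
            on_line Om (v.1.1, v.1.2, - v.2) & on_line Om (turn a b c v)]].

Lemma small_axes_cycle a b c : small_axes a b c -> small_axes c a b.
Proof.
case=> Om [sz z inv]; exists (map cycle3 Om); rewrite size_map; split=> //.
  by apply: contra z => /mapP[[[p q] r] vO [e1 e2 e3]]; rewrite -e1 -e2 -e3 in vO.
have lift v : on_line Om v -> on_line (map cycle3 Om) (cycle3 v).
  case=> w wO [l ->]; exists (cycle3 w); first exact: map_f.
  by exists l.
move=> _ /mapP[[[p q] r] /inv[i1 i2 i3 i4] ->]; split.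
- exact: (lift _ i3).
- exact: (lift _ i1).
- exact: (lift _ i2).
have := lift _ i4; congr on_line; rewrite /turn /cycle3 /=.
by congr (_, _, _); ring.
Qed.

Lemma small_axes_opp a b c : small_axes (- a) b c -> small_axes a b c.
Proof.
case=> Om [sz z inv]; exists (map reflect1 Om); rewrite size_map; split=> //.
  apply: contra z => /mapP[[[p q] r] vO [/esym/eqP e1 e2 e3]].
  by move: e1; rewrite oppr_eq0 => /eqP e1; rewrite e1 -e2 -e3 in vO.
have lift v : on_line Om v -> on_line (map reflect1 Om) (reflect1 v).
  case=> w wO [l ->]; exists (reflect1 w); first exact: map_f.
  by exists l; rewrite /reflect1 /= mulrN.
move=> _ /mapP[[[p q] r] /inv[i1 i2 i3 i4] ->]; split.
- exact: (lift _ i1).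
- exact: (lift _ i2).
- exact: (lift _ i3).
have := lift _ i4; congr on_line; rewrite /turn /reflect1 /=.
by congr (_, _, _); ring.
Qed.

Lemma small_axes_sqr a a' b c : a ^+ 2 = a' ^+ 2 -> small_axes a' b c -> small_axes a b c.
Proof.
by move/eqP; rewrite eqf_sqr => /orP[] /eqP-> // ?; apply: small_axes_opp; rewrite opprK.
Qed.

Lemma small_axes_sqr3 a b c a' b' c' : a ^+ 2 = a' ^+ 2 -> b ^+ 2 = b' ^+ 2 ->
  c ^+ 2 = c' ^+ 2 -> small_axes a' b' c' -> small_axes a b c.
Proof.
move=> ea eb ec h; apply: (small_axes_sqr ea); apply: small_axes_cycle.
apply: (small_axes_sqr eb); apply: small_axes_cycle.
by apply: (small_axes_sqr ec); apply: small_axes_cycle.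
Qed.

(** The half-turn about a vector perpendicular to a coordinate axis reverses
    this axis. *)
Lemma small_axes_plane b c : small_axes 0 b c.
Proof.
exists [:: (1, 0, 0)]; split.
- by rewrite /= (card_finNzRing_gt1 F).
- by rewrite inE; apply/eqP => -[/esym/eqP]; rewrite oner_eq0.
move=> _ /[!inE]/eqP->; rewrite /reflect1 /turn /=.
have on l (v : F * F * F) : v = (l, 0, 0) -> on_line [:: (1, 0, 0)] v.
  by move=> ->; exists (1, 0, 0); rewrite ?mem_head //; exists l; rewrite /= mulr1 mulr0.
split; [apply: (on (-1)) | apply: (on 1) | apply: (on 1) | apply: (on (-1))];
  by congr (_, _, _); ring.
Qed.

(** The lines are three perpendicular axes of a cube, and the axis
    [(a, a, c)] is halfway between the first two. *)
Lemma small_axes_cube a c : (3 < #|F|)%N -> 2%:R * c ^+ 2 = 1 -> 4%:R * a ^+ 2 = 1 ->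
  small_axes a a c.
Proof.
move=> q3 c2 a2; pose Om : seq (F * F * F) := [:: (0, 0, 1); (1, 1, 0); (1, - 1, 0)].
have one0 : (1 == 0 :> F) = false by exact: oner_eq0.
exists Om; split=> //.
  by rewrite !inE !xpair_eqE !eqxx /= ![0 == 1]eq_sym !one0.
have on w l (v : F * F * F) : w \in Om -> v = (l * w.1.1, l * w.1.2, l * w.2) -> on_line Om v.
  by move=> wO ->; exists w => //; exists l.
have [m1 m2 m3] : [/\ (0, 0, 1) \in Om, (1, 1, 0) \in Om & (1, - 1, 0) \in Om].
  by rewrite !inE !eqxx ?orbT.
move=> _ /[!inE]/or3P[] /eqP->; rewrite /reflect1 /turn /=; split.
- by apply: (on _ 1 _ m1); congr (_, _, _) => /=; ring.
- by apply: (on _ 1 _ m1); congr (_, _, _) => /=; ring.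
- by apply: (on _ (-1) _ m1); congr (_, _, _) => /=; ring.
- apply: (on _ (2%:R * a * c) _ m2); congr (_, _, _) => /=; try ring.
  by transitivity (2%:R * c ^+ 2 - 1); [ring | rewrite c2; ring].
- by apply: (on _ (-1) _ m3); congr (_, _, _) => /=; ring.
- by apply: (on _ 1 _ m3); congr (_, _, _) => /=; ring.
- by apply: (on _ 1 _ m2); congr (_, _, _) => /=; ring.
- apply: (on _ (4%:R * a * c) _ m1); congr (_, _, _) => /=; last by ring.
    by transitivity (4%:R * a ^+ 2 - 1); [ring | rewrite a2; ring].
  by transitivity (4%:R * a ^+ 2 - 1); [ring | rewrite a2; ring].
- by apply: (on _ (-1) _ m2); congr (_, _, _) => /=; ring.
- by apply: (on _ 1 _ m2); congr (_, _, _) => /=; ring.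
- by apply: (on _ 1 _ m3); congr (_, _, _) => /=; ring.
- by apply: (on _ (-1) _ m3); congr (_, _, _) => /=; ring.
Qed.

(** The lines are the six axes of order 5 of an icosahedron, and
    [(1, f, 1/f) / 2] is one of its axes of order 2; in characteristic 3
    this is the given vector up to sign. *)
Lemma small_axes_icosahedron f : (6 < #|F|)%N -> 3%:R = 0 :> F -> f ^+ 2 = f + 1 ->
  small_axes 1 f (f - 1).
Proof.
move=> q6 e3 f2; pose Om : seq (F * F * F) :=
  [:: (0, f, 1); (0, f, - 1); (1, 0, f); (- 1, 0, f); (f, 1, 0); (f, - 1, 0)].
have one0 : (1 == 0 :> F) = false by exact: oner_eq0.
have N10 : (- 1 == 0 :> F) = false by rewrite oppr_eq0.
exists Om; split=> //.
  by rewrite !inE !xpair_eqE !eqxx /= ![0 == 1]eq_sym ![0 == -1]eq_sym !one0 !N10 !andbF.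
have on w l (v : F * F * F) : w \in Om -> v = (l * w.1.1, l * w.1.2, l * w.2) -> on_line Om v.
  by move=> wO ->; exists w => //; exists l.
have [m1 m2 m3] : [/\ (0, f, 1) \in Om, (0, f, - 1) \in Om & (1, 0, f) \in Om].
  by rewrite !inE !eqxx ?orbT.
have [m4 m5 m6] : [/\ (- 1, 0, f) \in Om, (f, 1, 0) \in Om & (f, - 1, 0) \in Om].
  by rewrite !inE !eqxx ?orbT.
have red (x y u t : F) : x - y = u * (f ^+ 2 - f - 1) + 3%:R * t -> x = y.
  by rewrite f2 e3 => e; apply/eqP; rewrite -subr_eq0 e; apply/eqP; ring.
move=> _ /[!inE]/or4P[/eqP->|/eqP->|/eqP->|/or3P[]/eqP->]; rewrite /reflect1 /turn /=; split.
- by apply: (on _ 1 _ m1); congr (_, _, _) => /=; ring.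
- by apply: (on _ (-1) _ m2); congr (_, _, _) => /=; ring.
- by apply: (on _ 1 _ m2); congr (_, _, _) => /=; ring.
- apply: (on _ (1) _ m5); congr (_, _, _) => /=.
  + by apply: (@red _ _ (2%:R) (1%:R * f)); ring.
  + by apply: (@red _ _ (4%:R + 2%:R * f) (1%:R + 1%:R * f)); ring.
  + by apply: (@red _ _ (2%:R + 2%:R * f) (1%:R)); ring.
- by apply: (on _ 1 _ m2); congr (_, _, _) => /=; ring.
- by apply: (on _ (-1) _ m1); congr (_, _, _) => /=; ring.
- by apply: (on _ 1 _ m1); congr (_, _, _) => /=; ring.
- apply: (on _ (1) _ m3); congr (_, _, _) => /=.
  + by apply: (@red _ _ (2%:R) (1%:R)); ring.
  + by apply: (@red _ _ (2%:R * f) (1%:R * f)); ring.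
  + by apply: (@red _ _ ((- 2%:R) + 2%:R * f) ((- 1%:R) + 1%:R * f)); ring.
- by apply: (on _ 1 _ m4); congr (_, _, _) => /=; ring.
- by apply: (on _ 1 _ m3); congr (_, _, _) => /=; ring.
- by apply: (on _ (-1) _ m4); congr (_, _, _) => /=; ring.
- apply: (on _ (1) _ m2); congr (_, _, _) => /=.
  + by apply: (@red _ _ (2%:R) (1%:R)); ring.
  + by apply: (@red _ _ (2%:R * f) (1%:R * f)); ring.
  + by apply: (@red _ _ ((- 2%:R) + 2%:R * f) ((- 1%:R) + 1%:R * f)); ring.
- by apply: (on _ 1 _ m3); congr (_, _, _) => /=; ring.
- by apply: (on _ 1 _ m4); congr (_, _, _) => /=; ring.
- by apply: (on _ (-1) _ m3); congr (_, _, _) => /=; ring.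
- apply: (on _ (-1) _ m4); congr (_, _, _) => /=.
  + by apply: (@red _ _ (2%:R) 0); ring.
  + by apply: (@red _ _ (2%:R * f) 0); ring.
  + by apply: (@red _ _ ((- 2%:R) + 2%:R * f) 0); ring.
- by apply: (on _ (-1) _ m6); congr (_, _, _) => /=; ring.
- by apply: (on _ 1 _ m6); congr (_, _, _) => /=; ring.
- by apply: (on _ 1 _ m5); congr (_, _, _) => /=; ring.
- apply: (on _ (1) _ m1); congr (_, _, _) => /=.
  + by apply: (@red _ _ 0 (1%:R * f)); ring.
  + by apply: (@red _ _ (4%:R) (1%:R + 1%:R * f)); ring.
  + by apply: (@red _ _ (4%:R) (1%:R)); ring.
- by apply: (on _ (-1) _ m5); congr (_, _, _) => /=; ring.
- by apply: (on _ 1 _ m5); congr (_, _, _) => /=; ring.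
- by apply: (on _ 1 _ m6); congr (_, _, _) => /=; ring.
- apply: (on _ (-1) _ m6); congr (_, _, _) => /=.
  + by apply: (@red _ _ 0 0); ring.
  + by apply: (@red _ _ 0 0); ring.
  + by apply: (@red _ _ 0 0); ring.
Qed.

End Axes.

(** * Triples of involutions in L_2 *)

Section NoThreeInvolutions.
Variable F : finFieldType.
Hypothesis n2 : 2%:R != 0 :> F.
Implicit Types (a b c p q r l : F) (x y z : L2 F).

Lemma trN (A : 'M[F]_2) : \tr (- A) = - \tr A.
Proof. exact: raddfN. Qed.

(** The half-turn about a coordinate axis differs by the central inversion
    from the reflection in the perpendicular plane, so the two permute the
    same axes. *)
Lemma axes_not_generate (X Y : 'M[F]_2) a b c :
  X * X = -1 -> Y * Y = -1 -> Y * X = - (X * Y) -> \det X = 1 -> \det Y = 1 ->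
  \tr X = 0 -> \tr Y = 0 -> \tr (X * Y) = 0 ->
  let Z := vec X Y (X * Y) a b c in
  \det Z = 1 -> a ^+ 2 + b ^+ 2 + c ^+ 2 = 1 -> small_axes a b c ->
  ~ generates [set pr X; pr Y; pr Z]%classic.
Proof.
move=> XX YY YX dX dY tX tY tW Z dZ e [Om [szO zO inv]] gen.
have turnE := half_turn XX YY erefl YX.
pose m (v : F * F * F) := vec X Y (X * Y) v.1.1 v.1.2 v.2.
have mZ l w : vec X Y (X * Y) (l * w.1.1) (l * w.1.2) (l * w.2) = l *: m w.
  by rewrite /m /vec !scalerDr !scalerA.
have turn_inv p q r : p ^+ 2 + q ^+ 2 + r ^+ 2 = 1 ->
    (forall v, v \in Om -> on_line Om (turn p q r v)) ->
    line_invariant (map m Om) (vec X Y (X * Y) p q r).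
  move=> epqr i4 _ /mapP[v vO ->]; have [w wO [l]] := i4 v vO.
  rewrite /turn => -[e1 e2 e3]; exists (m w); first exact: map_f.
  by exists l; rewrite /m turnE // e1 e2 e3 mZ -scalerAl.
have on_opp v : on_line Om v -> on_line Om (- v.1.1, - v.1.2, - v.2).
  by case=> w wO [l ->]; exists w => //; exists (- l); rewrite /= !mulNr.
have XE : X = vec X Y (X * Y) 1 0 0 by rewrite /vec !scale0r !addr0 scale1r.
have YE : Y = vec X Y (X * Y) 0 1 0 by rewrite /vec !scale0r add0r addr0 scale1r.
apply: (@no_small_invariant _ n2 (map m Om) [:: X; Y; Z]).
- by rewrite size_map.
- move=> _ /mapP[v vO ->]; split; last by rewrite /m trvec.
  apply: contra zO => /eqP/(vec_inj n2 XX YY erefl YX tX tY tW).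
  by case: v vO => -[v1 v2] v3 /= vO [e1 e2 e3]; rewrite e1 e2 e3 in vO.
- move=> A; rewrite !inE => /or3P[] /eqP->; split=> //.
  + rewrite XE; apply: turn_inv => [|v /inv[i1 _ _ _]]; first by ring.
    have := on_opp _ i1; congr on_line; rewrite /turn /reflect1 /=.
    by congr (_, _, _); ring.
  + rewrite YE; apply: turn_inv => [|v /inv[_ i2 _ _]]; first by ring.
    have := on_opp _ i2; congr on_line; rewrite /turn /=.
    by congr (_, _, _); ring.
  + exact: trvec.
  + by apply: turn_inv => // v /inv[].
apply: (eq_generates _ gen) => _ [[->|->]|->]; right; [exists X|exists Y|exists Z];
  by rewrite // !inE eqxx ?orbT.
Qed.

(** Two involutions generate a dihedral group: the line of [YZ - ZY] is
    invariant. *)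
Lemma two_involutions_not_generate y z : (y * y = 1)%g -> (z * z = 1)%g ->
  ~ generates [set y; z]%classic.
Proof.
move=> yy zz gen; have nc yz := commuting_not_generate yz gen.
have [y1|[a [b [c [e yE]]]]] := involution_lift n2 yy.
  by apply: nc; rewrite y1 mulg1 mul1g.
have [z1|[a' [b' [c' [e' zE]]]]] := involution_lift n2 zz.
  by apply: nc; rewrite z1 mulg1 mul1g.
move: yE zE; set Y := mk a b c _; set Z := mk a' b' c' _ => yE zE.
have [dY _] := pr_involution e; have [dZ _] := pr_involution e'.
have sqr1 (u v w : F) : u * u + v * w = -1 ->
    mk u v w (- u) * mk u v w (- u) = -1.
  by move=> e1; rewrite mulmk mk1 oppmk; congr mk; rewrite -?e1; ring.
have YY : Y * Y = -1 := sqr1 _ _ _ e; have ZZ : Z * Z = -1 := sqr1 _ _ _ e'.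
have [N0|N0] := eqVneq (Y * Z - Z * Y) 0.
  by apply: nc; rewrite -yE -zE -!prM //; congr pr; apply/eqP; rewrite -subr_eq0 N0.
apply: (@no_small_invariant _ n2 [:: Y * Z - Z * Y] [:: Y; Z]).
- exact: (card_finNzRing_gt1 F).
- move=> v /[!inE]/eqP->; split=> //.
  by rewrite mxtraceD (trN (Z * Y)) mxtrace_mulC subrr.
- move=> A; rewrite !inE => /orP[] /eqP->; split=> //; rewrite ?tr_mk ?subrr //.
    move=> v /[!inE]/eqP->; exists (Y * Z - Z * Y); rewrite ?mem_head //; exists (-1).
    by rewrite scaleN1r mulrBr mulrBl (mulrA Y Y) YY -(mulrA Z Y Y) YY mulN1r mulrN1
      !mulrA opprK opprD addrC.
  move=> v /[!inE]/eqP->; exists (Y * Z - Z * Y); rewrite ?mem_head //; exists (-1).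
  by rewrite scaleN1r mulrBr mulrBl (mulrA Z Z) ZZ -(mulrA Y Z Z) ZZ mulN1r mulrN1
    !mulrA opprB !opprK.
apply: (eq_generates _ gen) => _ [->|->]; right; [exists Y|exists Z];
  by rewrite // !inE eqxx ?orbT.
Qed.

(** Two commuting involutions are represented by anticommuting matrices [X]
    and [Y] of trace 0, unless they are equal; then [X], [Y], [XY] is an
    orthonormal frame, in which the third involution has an axis [(a, b, c)]
    of length 1. Degenerate triples consist of at most two involutions,
    which do not generate either. *)
Lemma not_crit1 : (forall a b c, a ^+ 2 + b ^+ 2 + c ^+ 2 = 1 -> small_axes a b c) ->
  ~ crit1 (L2 F).
Proof.
move=> small [x [y [z [xx yy zz xy gen]]]].
have two := two_involutions_not_generate.
have [x1|[a [b [c [e xE]]]]] := involution_lift n2 xx.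
  apply: (two _ _ yy zz); apply: eq_generates gen => u.
  by rewrite x1 /=; tauto.
have [y1|[a' [b' [c' [e' yE]]]]] := involution_lift n2 yy.
  apply: (two _ _ xx zz); apply: eq_generates gen => u.
  by rewrite y1 /=; tauto.
have [z1|[a'' [b'' [c'' [e'' zE]]]]] := involution_lift n2 zz.
  apply: (two _ _ xx yy); apply: eq_generates gen => u.
  by rewrite z1 /=; tauto.
have [xyE|xny] := EM (x = y).
  apply: (two _ _ yy zz); apply: eq_generates gen => u.
  by rewrite xyE /=; tauto.
have sqr1 (u v w : F) : u * u + v * w = -1 ->
    mk u v w (- u) * mk u v w (- u) = -1.
  by move=> e1; rewrite mulmk mk1 oppmk; congr mk; rewrite -?e1; ring.
have [dX _] := pr_involution e; have [dY _] := pr_involution e'.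
have [dZ _] := pr_involution e''.
have XX := sqr1 _ _ _ e; have YY := sqr1 _ _ _ e'; have ZZ := sqr1 _ _ _ e''.
have tX : \tr (mk a b c (- a)) = 0 by rewrite tr_mk subrr.
have tY : \tr (mk a' b' c' (- a')) = 0 by rewrite tr_mk subrr.
have tZ : \tr (mk a'' b'' c'' (- a'')) = 0 by rewrite tr_mk subrr.
move: (mk a b c (- a)) (mk a' b' c' (- a')) (mk a'' b'' c'' (- a'')) xE yE zE
  dX dY dZ XX YY ZZ tX tY tZ => X Y Z xE yE zE dX dY dZ XX YY ZZ tX tY tZ.
have ac := traceless_anticommutator tX tY.
have tW : \tr (X * Y) = 0.
  have : pr (X * Y) = pr (Y * X) by rewrite !prM // xE yE.
  case/pr_eqP; rewrite ?det_mulmx ?dX ?dY ?mul1r // => XYE; last first.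
    move: ac; rewrite XYE addNr => /(congr1 mxtrace).
    rewrite mxtrace0 mxtraceZ mxtrace1 => /esym/eqP.
    by rewrite -XYE mulf_eq0 (negPf n2) orbF => /eqP.
  case: xny; rewrite -xE -yE.
  have {}ac : X * Y = (\tr (X * Y) / 2%:R) *: 1.
    apply: (can_inj (scalerK n2)); rewrite scalerA mulrC divfK // -ac -XYE.
    by rewrite scaler_nat mulr2n.
  have YE : Y = - (\tr (X * Y) / 2%:R) *: X.
    have : X * (X * Y) = X * ((\tr (X * Y) / 2%:R) *: 1) by rewrite -ac.
    rewrite mulrA XX mulN1r -scalerAr mulr1 => /(congr1 -%R).
    by rewrite opprK -scaleNr.
  move: (- _) YE => t YE; have : t * t = 1.
    by move: dY; rewrite YE detZ dX mulr1 expr2.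
  move/eqP; rewrite -expr2 sqrf_eq1 YE => /orP[] /eqP->; first by rewrite scale1r.
  by rewrite scaleN1r prN.
have YX : Y * X = - (X * Y).
  by apply/eqP; rewrite -addr_eq0 addrC ac tW scale0r.
have [p [q [r ZE]]] := vec_span n2 XX YY erefl YX tX tY tW tZ.
have pqr : p ^+ 2 + q ^+ 2 + r ^+ 2 = 1.
  have := congr1 mxtrace ZZ; rewrite ZE (mulvec XX YY erefl YX) mxtraceD trvec // addr0.
  rewrite mxtraceZ (trN 1) mxtrace1 => /eqP.
  rewrite mulNr eqr_opp -subr_eq0 -{2}[2%:R]mul1r -mulrBl mulf_eq0 (negPf n2) orbF.
  by rewrite subr_eq0 => /eqP <-; ring.
move: gen; rewrite -xE -yE -zE ZE.
apply: axes_not_generate => //; last exact: small.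
by rewrite -ZE.
Qed.

End NoThreeInvolutions.

Section SevenAndNine.
Variable F : finFieldType.
Implicit Types (a b c : F).

(** The nonzero squares are 1, 2 and 4, and the only three of them with sum
    1 are 2, 2 and 4, which are the squares of 3, 3 and 2. *)
Lemma L2_seven : #|F| = 7%N -> ~ crit1 (L2 F).
Proof.
move=> q7; have ch : 7%N \in [pchar F] by apply: (@card_finPcharP _ _ 1).
have e7 : 7%:R = 0 :> F := pcharf0 ch.
have n2 : 2%:R != 0 :> F by rewrite -(dvdn_pcharf ch).
have mod7 c (x y : F) : x - y = c * 7%:R -> x = y.
  by rewrite e7 mulr0 => /eqP; rewrite subr_eq0 => /eqP.
apply: not_crit1 => // a b c e.
have squares x : x = 0 \/ exists s, s \in [:: 1; 2; 4]%N /\ x ^+ 2 = s%:R :> F.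
  have [->|x0] := eqVneq x 0; [by left | right].
  have x6 : x ^+ 6 = 1.
    by apply: (mulfI x0); rewrite -exprS mulr1 -[RHS]expf_card q7.
  have /eqP : (x ^+ 2 - 1%:R) * (x ^+ 2 - 2%:R) * (x ^+ 2 - 4%:R) = 0.
    transitivity (x ^+ 6 - 1 + 7%:R * (- x ^+ 4 + 2%:R * x ^+ 2 - 1)); first by ring.
    by rewrite x6 e7; ring.
  rewrite !mulf_eq0 !subr_eq0 => /orP[/orP[]|] /eqP->.
  - by exists 1%N.
  - by exists 2%N.
  - by exists 4%N.
have cube : small_axes 3%:R 3%:R (2%:R : F).
  by apply: small_axes_cube; rewrite ?q7 //; [apply: (@mod7 1) | apply: (@mod7 5%:R)]; ring.
have [a0|[s [sS aE]]] := squares a; first by rewrite a0; apply: small_axes_plane.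
have [b0|[t [tS bE]]] := squares b.
  by rewrite b0; apply: small_axes_cycle; apply: small_axes_plane.
have [c0|[u [uS cE]]] := squares c.
  by rewrite c0; do 2 apply: small_axes_cycle; apply: small_axes_plane.
have : (7 %| s + t + u + 6)%N.
  rewrite (dvdn_pcharf ch) !natrD -aE -bE -cE e; apply/eqP.
  by transitivity (7%:R : F); [ring | rewrite e7].
have n3 : 2%:R = 3%:R ^+ 2 :> F by apply: (@mod7 (- 1)); ring.
have n4 : 4%:R = 2%:R ^+ 2 :> F by ring.
move: sS tS uS aE bE cE; rewrite !inE.
case/or3P=> /eqP-> /or3P[] /eqP-> /or3P[] /eqP-> // aE bE cE _; rewrite ?n3 ?n4 in aE bE cE.
- by apply: small_axes_sqr3 aE bE cE _.
- by apply: small_axes_sqr3 aE bE cE _; do 2 apply: small_axes_cycle.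
- by apply: small_axes_sqr3 aE bE cE _; apply: small_axes_cycle.
Qed.

Lemma sqrt_opp1_nine : #|F| = 9%N -> exists i : F, i ^+ 2 = -1.
Proof.
move=> q9; have [t /and3P[]] := @common_nonroot F [:: [:: 0; 1]; [:: -1; 0; 0; 0; 1]]
  ltac:(by rewrite /= oner_neq0) ltac:(by rewrite unlock q9).
rewrite !horner_Poly /= => h1 h2 _.
have t0 : t != 0 by apply: contra_neq h1 => ->; ring.
have t4 : t ^+ 4 - 1 != 0 by apply: contra_neq h2 => h; rewrite -[RHS]h; ring.
have t8 : t ^+ 8 = 1 by apply: (mulfI t0); rewrite -exprS mulr1 -[RHS]expf_card q9.
exists (t ^+ 2); apply/eqP; rewrite -addr_eq0; apply/eqP; apply: (mulfI t4); rewrite mulr0.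
by transitivity (t ^+ 8 - 1); [ring | rewrite t8 subrr].
Qed.

(** The nonzero squares are [1], [-1], [i] and [-i], and three of them with
    sum 1 are either [1], [1], [-1] or [1], [i], [-i]. The first case is the
    cube. In the second one the axis is [(1, f, g)], where [f^2 = i] and
    [g^2 = -i] solve [f^2 = f + 1], the equation of the golden ratio, and
    [g] is [f - 1] up to sign. *)
Lemma L2_nine : #|F| = 9%N -> ~ crit1 (L2 F).
Proof.
move=> q9; have ch : 3%N \in [pchar F] by apply: (@card_finPcharP _ _ 2).
have e3 : 3%:R = 0 :> F := pcharf0 ch.
have n2 : 2%:R != 0 :> F by rewrite -(dvdn_pcharf ch).
have mod3 c (x y : F) : x - y = c * 3%:R -> x = y.
  by rewrite e3 mulr0 => /eqP; rewrite subr_eq0 => /eqP.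
have [i i2] := sqrt_opp1_nine q9.
apply: not_crit1 => // a b c e.
have squares x : x = 0 \/ exists s, s \in [:: (1, 0); (2, 0); (0, 1); (0, 2)]%N /\
    x ^+ 2 = s.1%:R + s.2%:R * i.
  have [->|x0] := eqVneq x 0; [by left | right].
  have x8 : x ^+ 8 = 1.
    by apply: (mulfI x0); rewrite -exprS mulr1 -[RHS]expf_card q9.
  have /eqP : (x ^+ 2 - 1) * (x ^+ 2 + 1) * (x ^+ 2 - i) * (x ^+ 2 + i) = 0.
    transitivity ((x ^+ 4 - 1) * (x ^+ 4 - i ^+ 2)); first by ring.
    by rewrite i2; transitivity (x ^+ 8 - 1); [ring | rewrite x8 subrr].
  rewrite !mulf_eq0 !subr_eq0 !addr_eq0 => /orP[/orP[/orP[]|]|] /eqP->.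
  - by exists (1, 0)%N; split; rewrite ?inE //=; ring.
  - by exists (2, 0)%N; split; rewrite ?inE //=; apply: (@mod3 (- 1)); ring.
  - by exists (0, 1)%N; split; rewrite ?inE //=; ring.
  - by exists (0, 2)%N; split; rewrite ?inE //=; apply: (@mod3 (- i)); ring.
have cube : small_axes 1 1 i.
  apply: small_axes_cube; rewrite ?q9 //; last by apply: (@mod3 1); ring.
  by rewrite i2; apply: (@mod3 (- 1)); ring.
have [a0|[s [sS aE]]] := squares a; first by rewrite a0; apply: small_axes_plane.
have [b0|[t [tS bE]]] := squares b.
  by rewrite b0; apply: small_axes_cycle; apply: small_axes_plane.
have [c0|[u [uS cE]]] := squares c.
  by rewrite c0; do 2 apply: small_axes_cycle; apply: small_axes_plane.
have : (3 %| (s.1 + t.1 + u.1 + 2) ^ 2 + (s.2 + t.2 + u.2) ^ 2)%N.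
  rewrite (dvdn_pcharf ch) natrD !natrX !natrD.
  move: e; rewrite aE bE cE => e.
  have h : s.1%:R + t.1%:R + u.1%:R + 2%:R = - ((s.2%:R + t.2%:R + u.2%:R) * i) :> F.
    apply: (@mod3 1); rewrite mul1r.
    transitivity (s.1%:R + s.2%:R * i + (t.1%:R + t.2%:R * i) + (u.1%:R + u.2%:R * i) + 2%:R).
      by ring.
    by rewrite e; ring.
  rewrite h sqrrN exprMn i2; apply/eqP; ring.
have sq1 : 1%:R + 0%:R * i = 1 ^+ 2 by ring.
have sqN : 2%:R + 0%:R * i = i ^+ 2 by rewrite i2; apply: (@mod3 1); ring.
pose f := i - 1; pose g := - (1 + i).
have f2 : f ^+ 2 = f + 1.
  apply: (@mod3 (- i)); rewrite /f; transitivity (i ^+ 2 + 1 - 3%:R * i); first by ring.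
  by rewrite i2; ring.
have g2 : g ^+ 2 = g + 1.
  apply: (@mod3 i); rewrite /g; transitivity (i ^+ 2 + 1 + 3%:R * i); first by ring.
  by rewrite i2; ring.
have sqi : 0%:R + 1%:R * i = f ^+ 2 by rewrite f2 /f; ring.
have sqi' : 0%:R + 2%:R * i = g ^+ 2.
  by rewrite g2 /g; apply: (@mod3 i); ring.
have fg : (f - 1) ^+ 2 = g ^+ 2.
  rewrite g2 /f /g; apply: (@mod3 (1 - i)); transitivity (i ^+ 2 + 4%:R - 3%:R * i); first by ring.
  by rewrite i2; ring.
have gf : (g - 1) ^+ 2 = f ^+ 2.
  rewrite f2 /f /g; apply: (@mod3 (1 + i)); transitivity (i ^+ 2 + 4%:R + 3%:R * i); first by ring.
  by rewrite i2; ring.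
have ico1 : small_axes 1 f g.
  apply: (small_axes_sqr3 (erefl _) (erefl _) (esym fg)).
  by apply: small_axes_icosahedron; rewrite ?q9.
have ico2 : small_axes 1 g f.
  apply: (small_axes_sqr3 (erefl _) (erefl _) (esym gf)).
  by apply: small_axes_icosahedron; rewrite ?q9.
move: sS tS uS aE bE cE; rewrite !inE.
have fin a' b' c' : a ^+ 2 = a' ^+ 2 -> b ^+ 2 = b' ^+ 2 -> c ^+ 2 = c' ^+ 2 ->
    small_axes a' b' c' -> small_axes a b c by exact: small_axes_sqr3.
case/or4P=> /eqP-> /or4P[] /eqP-> /or4P[] /eqP-> //=; rewrite ?sq1 ?sqN ?sqi ?sqi' => aE bE cE _;
  apply: fin aE bE cE _; first [done | by apply: small_axes_cycle
    | by do 2 apply: small_axes_cycle].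
Qed.

End SevenAndNine.

Local Close Scope ring_scope.

Local Open Scope group_scope.

(** * Evaluation of permutations *)

(** Permutations are handled through their lists of images, on which
    products can be evaluated. *)
Section Codes.
Variable N : nat.
Implicit Types (g h : 'S_N.+1) (c : seq nat).

Definition code g : seq nat := [seq val (g i) | i <- enum 'I_N.+1].
Definition move_by c t : seq nat := [seq nth 0%N c k | k <- t].
Definition all_codes := permutations (iota 0 N.+1).

Lemma size_code g : size (code g) = N.+1.
Proof. by rewrite size_map size_enum_ord. Qed.

Lemma nth_code g k : k <= N -> nth 0%N (code g) k = g (inord k).
Proof.
move=> kN; rewrite (nth_map (inord k)) ?size_enum_ord //; congr (val (g _)).
by apply: val_inj; rewrite /= nth_enum_ord // inordE.
Qed.

Lemma code_inj : injective code.
Proof.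
move=> g h e; apply/permP=> i; apply: val_inj.
have := congr1 (fun c => nth 0%N c i) e; rewrite !nth_code ?inord_val //; last by rewrite -ltnS.
by rewrite -ltnS.
Qed.

Lemma codeM g h : code (g * h) = move_by (code h) (code g).
Proof.
rewrite /move_by /code -map_comp; apply: eq_map => i /=.
by rewrite -/(code h) permM nth_code ?inord_val // -ltnS.
Qed.

Lemma code1 : code 1 = iota 0 N.+1.
Proof. by rewrite -val_enum_ord; apply: eq_map => i; rewrite perm1. Qed.

Lemma code_all g : code g \in all_codes.
Proof.
rewrite mem_permutations; apply: uniq_perm; rewrite ?iota_uniq //.
  by rewrite map_inj_uniq ?enum_uniq //; apply: inj_comp; [apply: val_inj | apply: perm_inj].
move=> k; rewrite mem_iota /= add0n; apply/mapP/idP => [[i _ ->]|kN]; first exact: ltn_ord.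
by exists (g^-1 (Ordinal kN)); rewrite ?mem_enum ?permKV.
Qed.

Lemma all_codes_onto c : c \in all_codes -> exists g, code g = c.
Proof.
rewrite mem_permutations => cP; have cs : size c = N.+1 by rewrite (perm_size cP) size_iota.
have cu : uniq c by rewrite (perm_uniq cP) iota_uniq.
have cN k : k < N.+1 -> nth 0%N c k <= N.
  move=> kN; have : nth 0%N c k \in c by rewrite mem_nth ?cs.
  by rewrite (perm_mem cP) mem_iota.
have inj : injective (fun i : 'I_N.+1 => inord (nth 0%N c i) : 'I_N.+1).
  move=> i j /(congr1 val); rewrite /= !inordE ?cN // => /eqP.
  by rewrite nth_uniq ?cs // => /eqP/val_inj.
exists (perm inj); apply: (@eq_from_nth _ 0%N); rewrite ?size_code ?cs // => k kN.
by rewrite nth_code // permE /= inordE ?inordE ?cN.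
Qed.

Lemma code_tl l : inside N l -> code (tl N l) = [seq run l k | k <- iota 0 N.+1].
Proof.
by move=> lN; rewrite -val_enum_ord -map_comp; apply: eq_map => i /=; rewrite runE.
Qed.

Lemma move_byM g h t : all (fun k => k <= N) t ->
  move_by (code (g * h)) t = move_by (code h) (move_by (code g) t).
Proof.
move=> /allP tN; rewrite /move_by -map_comp; apply/eq_in_map => k /tN kN /=.
by rewrite !nth_code ?permM ?inord_val // -ltnS.
Qed.

Lemma move_by1 t : all (fun k => k <= N) t -> move_by (code 1) t = t.
Proof.
by move=> /allP tN; apply: map_id_in => k /tN kN; rewrite nth_code // perm1 inordE.
Qed.

End Codes.

(** * Orbits of tuples *)

(** Depth-first search; the fuel bounds the number of visited tuples, and
    running out of it gives no result. *)
Fixpoint orbit_search (gens : seq (seq nat)) fuel (todo seen : seq (seq nat)) :=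
  if fuel is f.+1 then
    if todo is t :: ts then
      if t \in seen then orbit_search gens f ts seen
      else orbit_search gens f ([seq move_by c t | c <- gens] ++ ts) (t :: seen)
    else Some seen
  else None.

Lemma orbit_searchP gens fuel todo seen Om :
  orbit_search gens fuel todo seen = Some Om ->
  (forall t c, t \in seen -> c \in gens -> move_by c t \in seen ++ todo) ->
  {subset todo ++ seen <= Om} /\ forall t c, t \in Om -> c \in gens -> move_by c t \in Om.
Proof.
elim: fuel todo seen => // fuel IH [|t ts] seen /=.
  by case=> <- inv; split=> // t c /inv h /h; rewrite cats0.
case: ifP => [tS /IH h inv|_ /IH h inv].
  case: h => [u c uS cg|sub cl].
    by have := inv u c uS cg; rewrite !mem_cat inE => /or3P[->|/eqP->|->]; rewrite ?tS ?orbT.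
  split=> // u; rewrite inE => /orP[/eqP->|uT]; last exact: sub.
  by apply: sub; rewrite mem_cat tS orbT.
case: h => [u c|sub cl].
  rewrite inE mem_cat in_cons => /orP[/eqP->|uS] cg.
    have ct : move_by c t \in [seq move_by c' t | c' <- gens] by apply/mapP; exists c.
    by rewrite !mem_cat ct ?orbT.
  by have := inv u c uS cg; rewrite !mem_cat inE => /or3P[->|->|->]; rewrite ?orbT.
split=> // u uT; apply: sub; rewrite !mem_cat in_cons.
by move: uT; rewrite inE mem_cat => /or3P[->|->|->]; rewrite ?orbT.
Qed.

(** The alternating group of degree [n] is [(n - 2)]-transitive, so
    permutations which do not carry [0 1 ... m-1] to all tuples of length
    [m <= n - 2] do not generate it. *)
Definition not_transitive m (targets gens : seq (seq nat)) : bool :=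
  if orbit_search gens 1000 [:: iota 0 m] [::] is Some orb
  then has (fun t : seq nat => t \notin orb) targets else false.

Definition is_tuple N m t := [&& uniq t, size t == m & all (fun k => k <= N) t].

Definition tuples N m := [seq t <- iter m (fun ts => [seq k :: t | k <- iota 0 N.+1, t <- ts]) [:: [::]]
  | uniq t].

Section NonGeneration.
Variable N : nat.
Implicit Types (g h : 'S_N.+1) (K : {group 'S_N.+1}).

Lemma tuplesP m t : t \in tuples N m -> is_tuple N m t.
Proof.
rewrite mem_filter => /andP[tu tt]; rewrite /is_tuple tu.
suff [-> ->] : size t = m /\ all (fun k => k <= N) t by rewrite eqxx.
elim: m t {tu} tt => [|m IHm] t; first by rewrite inE => /eqP->.
case/allpairsPdep=> k [u] [kN /IHm[<- uN] ->].
by rewrite /= uN andbT; move: kN; rewrite mem_iota.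
Qed.

(** At least two points lie outside the tuple; exchanging them changes the
    parity. *)
Lemma Alt_tuple_transitive m t : m + 2 <= N.+1 -> is_tuple N m t ->
  exists2 h, h \in 'Alt_('I_N.+1) & move_by (code h) (iota 0 m) = t.
Proof.
move=> mN /and3P[tu /eqP ts tN].
pose c := t ++ [seq k <- iota 0 N.+1 | k \notin t].
have cP : c \in all_codes N.
  rewrite mem_permutations; apply: uniq_perm; rewrite ?iota_uniq //.
    rewrite cat_uniq tu filter_uniq ?iota_uniq // andbT.
    by apply/hasPn => k; rewrite mem_filter => /andP[].
  move=> k; rewrite mem_cat mem_filter mem_iota /= add0n; case: (boolP (k \in t)) => // kt.
  by have := allP tN _ kt; rewrite ltnS => ->.
have [h hc] := all_codes_onto cP.
have ht : move_by (code h) (iota 0 m) = t.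
  rewrite hc /move_by; apply: (@eq_from_nth _ 0%N); rewrite size_map size_iota ?ts // => k km.
  by rewrite (nth_map 0%N) ?size_iota // nth_iota // nth_cat ts km.
have [ho|he] := boolP (odd_perm h); last by exists h; rewrite // Alt_even.
pose u : 'S_N.+1 := tperm (inord N.-1) (inord N).
have uN : inord N.-1 != inord N :> 'I_N.+1.
  by apply/eqP => /(congr1 val); rewrite /= !inordE //; lia.
exists (u * h); first by rewrite Alt_even odd_permM odd_tperm uN ho.
rewrite -ht /move_by; apply/eq_in_map => k; rewrite mem_iota add0n => /andP[_ km].
rewrite !nth_code ?permM; try lia.
congr (val (h _)); rewrite tpermD //; apply/eqP => /(congr1 val); rewrite /= !inordE; lia.
Qed.

Lemma not_transitive_group m gens (gs : seq 'S_N.+1) : m + 2 <= N.+1 ->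
  gens = map (@code N) gs -> not_transitive m (tuples N m) gens ->
  exists K : {group 'S_N.+1}, (forall g, g \in gs -> g \in K) /\ ~~ ('Alt_('I_N.+1) \subset K).
Proof.
move=> mN ->; rewrite /not_transitive; case e: orbit_search => [Om|//] /hasP[t tt tO].
have [//|sub cl] := orbit_searchP e.
pose small t := all (fun k => k <= N) t.
have sm g u : small u -> small (move_by (code g) u).
  move=> /allP uN; apply/allP => _ /mapP[k /uN kN ->].
  by rewrite nth_code // -ltnS.
pose K := [set g : 'S_N.+1 | all (fun u => small u ==> (move_by (code g) u \in Om)) Om]%SET.
have gK : group_set K.
  apply/group_setP; split=> [|g h]; rewrite ?inE.
    by apply/allP => u uO; apply/implyP => us; rewrite move_by1.
  move=> /allP gO /allP hO; apply/allP => u uO; apply/implyP => us.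
  have := gO u uO; rewrite us /= => guO; have := hO _ guO; rewrite sm //=.
  by rewrite move_byM.
exists (Group gK); split.
  move=> g gg; rewrite inE; apply/allP => u uO; apply/implyP => _.
  by apply: cl => //; apply: map_f.
apply/negP => /fintype.subsetP AK.
have [h hA ht] := Alt_tuple_transitive mN (tuplesP tt).
have := AK h hA; rewrite inE => /allP/(_ (iota 0 m)).
rewrite sub ?mem_head // => /(_ isT); rewrite ht.
have -> : small (iota 0 m) by apply/allP => k; rewrite mem_iota; lia.
by rewrite (negPf tO).
Qed.

End NonGeneration.

(** * Automorphisms induced by conjugation *)

Section InducedAutomorphism.
Variables (G K : groupType) (theta : G -> K).
Hypotheses (thetaM : {morph theta : x y / x * y}) (theta_inj : injective theta).

(** If conjugation by [s] inverts the images of two generators, then it maps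
    the image of the whole group onto itself. The element [s] itself need
    not lie in this image. *)
Lemma inverting_conjugation x y s : generates [set x; y]%classic ->
  theta x ^ s = (theta x)^-1 -> theta y ^ s = (theta y)^-1 ->
  exists2 alpha, automorphism alpha & alpha x = x^-1 /\ alpha y = y^-1.
Proof.
move=> gen ex ey.
have theta1 : theta 1 = 1 by apply: (@mulgI _ (theta 1)); rewrite -thetaM !mulg1.
have thetaV z : theta z^-1 = (theta z)^-1.
  by apply: (@mulgI _ (theta z)); rewrite -thetaM !mulgV theta1.
have gen_all (P : G -> Prop) : is_subgroup P -> P x -> P y -> forall z, P z.
  move=> sP Px Py z; have : gen_subgroup [set x; y]%classic z by rewrite gen.
  by apply=> // _ [->|->].
have ex_alpha z : exists h, theta h = theta z ^ s.
  apply: (gen_all (fun z => exists h, theta h = theta z ^ s)).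
  - split=> [|a b [h hE] [k kE]]; first by exists 1; rewrite theta1 conj1g.
    by exists (h * k^-1); rewrite !thetaM !thetaV hE kE conjMg conjVg.
  - by exists x^-1; rewrite thetaV ex.
  - by exists y^-1; rewrite thetaV ey.
pose alpha z := projT1 (cid (ex_alpha z)).
have aE z : theta (alpha z) = theta z ^ s by rewrite /alpha; case: cid.
have aM : {morph alpha : a b / a * b}.
  by move=> a b; apply: theta_inj; rewrite thetaM !aE thetaM conjMg.
have ax : alpha x = x^-1 by apply: theta_inj; rewrite aE thetaV.
have ay : alpha y = y^-1 by apply: theta_inj; rewrite aE thetaV.
have a1 : alpha 1 = 1 by apply: theta_inj; rewrite aE theta1 conj1g.
have aV z : alpha z^-1 = (alpha z)^-1 by apply: theta_inj; rewrite aE !thetaV aE conjVg.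
exists alpha; last by split.
split=> //.
have a_onto z : exists h, alpha h = z.
  apply: (gen_all (fun z => exists h, alpha h = z)).
  - split=> [|a b [h <-] [k <-]]; first by exists 1.
    by exists (h * k^-1); rewrite aM aV.
  - by exists x^-1; rewrite aV ax invgK.
  - by exists y^-1; rewrite aV ay invgK.
have betaK z : alpha (projT1 (cid (a_onto z))) = z := projT2 (cid (a_onto z)).
exists (fun z => projT1 (cid (a_onto z))) => z; last exact: betaK.
by apply: theta_inj; apply: (@conjg_inj _ s); rewrite -!aE betaK.
Qed.

End InducedAutomorphism.

Section PairsOfPermutations.
Variable N : nat.
Implicit Types (a b g s : 'S_N.+1).

Definition inverted_pair a b := exists s, a ^ s = a^-1 /\ b ^ s = b^-1.
Definition small_pair a b :=
  exists K : {group 'S_N.+1}, [/\ a \in K, b \in K & ~~ ('Alt_('I_N.+1) \subset K)].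

Lemma small_pairJ a b g : small_pair (a ^ g) (b ^ g) -> small_pair a b.
Proof.
case=> K [aK bK AK]; exists (K :^ g^-1)%G; rewrite !mem_conjgV; split=> //.
apply: contra AK; rewrite -sub_conjg; suff /normP-> : g \in 'N('Alt_('I_N.+1)) by [].
exact: (fintype.subsetP (normal_norm (Alt_normal 'I_N.+1)) _ (finset.in_setT g)).
Qed.

Lemma inverted_pairJ a b g : inverted_pair (a ^ g) (b ^ g) -> inverted_pair a b.
Proof.
case=> s [ea eb]; exists (s ^ g^-1).
have J c : (c ^ g) ^ s = (c ^ g)^-1 -> c ^ (s ^ g^-1) = c^-1.
  move=> e; apply: (@conjg_inj _ g); rewrite conjVg -e.
  by rewrite -!conjgM; congr (_ ^ _); rewrite conjgE invgK !mulgA mulgKV.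
by split; apply: J.
Qed.

Variables (G : finGroupType) (H : {group 'S_N.+1}) (j : G -> 'S_N.+1).
Hypotheses (emb : embedding H j) (AH : 'Alt_('I_N.+1) \subset H).

Lemma small_pair_not_generate x y : small_pair (j x) (j y) -> ~ generates [set x; y]%classic.
Proof.
have [jM j_inj jH j_onto] := emb; case=> K [xK yK AK].
move=> /(generatesP jM j_inj jH j_onto)/(_ K) HK; case/negP: AK.
suff HsK : H \subset K by apply: fintype.subset_trans HsK.
by apply: HK => _ [->|->].
Qed.

Lemma pairs_inverted_perm : (forall a b, a \in H -> b \in H ->
  inverted_pair a b \/ small_pair a b) -> pairs_inverted G.
Proof.
have [jM j_inj jH j_onto] := emb; move=> good x y gen.
case: (good (j x) (j y) (jH x) (jH y)) => [[s [ex ey]]|/small_pair_not_generate//].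
exact: (@inverting_conjugation G 'S_N.+1 j jM j_inj x y s gen ex ey).
Qed.

End PairsOfPermutations.

(** * Conjugating to a standard permutation *)

Definition mulc (c d : seq nat) := move_by d c.

Fixpoint cycle_from (c : seq nat) start k fuel : seq nat :=
  k :: (if fuel is f.+1 then
          let k' := nth 0%N c k in if k' == start then [::] else cycle_from c start k' f
        else [::]).

Definition cycles_of c : seq (seq nat) :=
  foldl (fun acc k => if k \in flatten acc then acc
                      else cycle_from c k k (size c) :: acc) [::] (iota 0 (size c)).

(** The standard permutation of a given cycle type permutes consecutive numbers
    in cycles of decreasing lengths; a permutation is conjugated to it by
    listing its cycles in this order. *)
Definition sorted_cycles c := sort (fun s t => size t <= size s) (cycles_of c).
Definition conjugator c := flatten (sorted_cycles c).

Fixpoint standard_list k (lens : seq nat) : seq (nat * nat) :=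
  if lens is m :: ms then [seq (k, i) | i <- iota k.+1 m.-1] ++ standard_list (k + m) ms
  else [::].

Definition standard N lens := [seq run (standard_list 0 lens) k | k <- iota 0 N.+1].

Definition valid_type N lens :=
  all (fun p : nat * nat => (p.1 <= N) && (p.2 <= N)) (standard_list 0 lens) &&
  all (fun p : nat * nat => p.1 != p.2) (standard_list 0 lens).

Definition has_type N c lens := let g := conjugator c in
  if perm_eq g (iota 0 N.+1) then mulc (standard N lens) g == mulc g c else false.

Definition types_check N types :=
  all (valid_type N) types &&
  all (fun c => let lens := map size (sorted_cycles c) in
         (lens \in types) && has_type N c lens) (all_codes N).

Lemma mulcE N (g h : 'S_N.+1) : mulc (code g) (code h) = code (g * h).
Proof. by rewrite codeM. Qed.

Lemma has_typeP N lens (s : 'S_N.+1) : valid_type N lens -> has_type N (code s) lens ->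
  exists g, s ^ g = tl N (standard_list 0 lens).
Proof.
case/andP=> lN _; rewrite /has_type; case: ifP => // gP /eqP e.
have [g gE] : exists g : 'S_N.+1, code g = conjugator (code s).
  by apply: all_codes_onto; rewrite mem_permutations.
exists g^-1; move: e; rewrite -gE /standard -code_tl // !mulcE => /code_inj e.
by rewrite conjgE invgK mulgA -e mulgK.
Qed.

Lemma types_checkP N types (s : 'S_N.+1) : types_check N types ->
  exists2 lens, lens = map size (sorted_cycles (code s)) &
    [/\ lens \in types, valid_type N lens
      & exists g, s ^ g = tl N (standard_list 0 lens)].
Proof.
case/andP=> /allP vt /allP/(_ _ (code_all s))/andP[].
move: (map size _) => lens lT hl; exists lens => //.
by split; rewrite ?vt //; apply: has_typeP => //; apply: vt.
Qed.

Lemma standardE N lens : valid_type N lens ->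
  code (tl N (standard_list 0 lens)) = standard N lens.
Proof. by case/andP=> lN _; rewrite code_tl. Qed.

Definition even_type lens := ~~ odd (size (standard_list 0 lens)).

Lemma type_parity N lens (s g : 'S_N.+1) : valid_type N lens ->
  s ^ g = tl N (standard_list 0 lens) -> odd_perm s = ~~ even_type lens.
Proof.
case/andP=> lN ld e; rewrite -(odd_permJ s g) e odd_tl // negbK //.
Qed.

(** The equation [c s c = s] says that [s] inverts [c], without computing
    inverses. *)
Definition inverting c := [pred s | mulc (mulc c s) c == s].

Lemma invertingE N (a s : 'S_N.+1) : (code s \in inverting (code a)) = (a ^ s == a^-1).
Proof.
rewrite inE !mulcE (inj_eq (@code_inj N)) conjgE; apply/eqP/eqP => e.
  by apply: (@mulIg _ a); rewrite mulVg -mulgA e mulVg.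
by rewrite -[a * s](mulKVg s) e mulgKV.
Qed.

(** Both properties are invariant under conjugation, so that the first
    permutation needs to run only through representatives of the cycle
    types. *)
Definition pairs_check N m types :=
  let codes := all_codes N in let ts := tuples N m in
  types_check N types &&
  all (fun lens => let r := standard N lens in
    let sr := [seq s <- codes | s \in inverting r] in
    all (fun y => if has (fun s => s \in inverting y) sr then true
      else not_transitive m ts [:: r; y]) codes) types.

Lemma pairs_checkP N m types (a b : 'S_N.+1) : m + 2 <= N.+1 -> pairs_check N m types ->
  inverted_pair a b \/ small_pair a b.
Proof.
move=> mN /andP[cc /allP pc]; have [lens _ [lT lv [g gE]]] := types_checkP a cc.
have /allP/(_ _ (code_all (b ^ g))) := pc _ lT; rewrite -standardE // -gE.
case: ifP => [/hasP[s]|_] nt; last first.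
  right; apply: (@small_pairJ _ a b g).
  have [K [KP AK]] := @not_transitive_group N m _ [:: a ^ g; b ^ g] mN erefl nt.
  by exists K; rewrite !KP ?inE ?eqxx ?orbT.
move: nt; rewrite mem_filter => /andP[sa /all_codes_onto[t tE]] sb _; left.
apply: (@inverted_pairJ _ a b g); exists t.
by move: sa sb; rewrite -tE !invertingE => /eqP-> /eqP->.
Qed.

Lemma pairs_inverted_check N m types (G : finGroupType) (H : {group 'S_N.+1})
    (j : G -> 'S_N.+1) : embedding H j -> 'Alt_('I_N.+1) \subset H ->
  m + 2 <= N.+1 -> pairs_check N m types -> pairs_inverted G.
Proof.
move=> emb AH mN pc; apply: (pairs_inverted_perm emb AH) => a b _ _.
exact: pairs_checkP mN pc.
Qed.

Definition types5 := [:: [:: 5]; [:: 4; 1]; [:: 3; 2]; [:: 3; 1; 1]; [:: 2; 2; 1];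
  [:: 2; 1; 1; 1]; [:: 1; 1; 1; 1; 1]]%N.
Definition types4 := [:: [:: 4]; [:: 3; 1]; [:: 2; 2]; [:: 2; 1; 1]; [:: 1; 1; 1; 1]]%N.
Definition types3 := [:: [:: 3]; [:: 2; 1]; [:: 1; 1; 1]]%N.
Definition types2 := [:: [:: 2]; [:: 1; 1]]%N.

Lemma check5 : pairs_check 4 3 types5. Proof. by vm_compute. Qed.
Lemma check4 : pairs_check 3 2 types4. Proof. by vm_compute. Qed.
Lemma check3 : pairs_check 2 1 types3. Proof. by vm_compute. Qed.
Lemma check2 : pairs_check 1 0 types2. Proof. by vm_compute. Qed.

Lemma pairs_inverted_SnAn n : (2 <= n <= 5)%N -> pairs_inverted (Sn n) /\ pairs_inverted (An n).
Proof.
move=> n25; suff [N [m [types [nN mN chk]]]] : exists N m types, [/\ n = N.+1, m + 2 <= N.+1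
    & pairs_check N m types].
  subst n; split; [apply: (pairs_inverted_check (embedding_Sn _) _ mN chk)
                  |apply: (pairs_inverted_check (embedding_An _) _ mN chk)] => //.
  exact: finset.subsetT.
have : [\/ n = 2, n = 3, n = 4 | n = 5] by clear -n25; case: n n25 => [|[|[|[|[|[|//]]]]]]
  // _; [constructor 1|constructor 2|constructor 3|constructor 4].
case=> ->.
- exists 1%N, 0%N, types2; split; [by []|by []|exact: check2].
- exists 2, 1%N, types3; split; [by []|by []|exact: check3].
- exists 3, 2, types4; split; [by []|by []|exact: check4].
- exists 4, 3, types5; split; [by []|by []|exact: check5].
Qed.

(** * Invariant families of subsets *)

(** Subsets are represented by sorted lists. *)
Fixpoint insert k (s : seq nat) : seq nat :=
  if s is x :: s' then if k <= x then k :: s else x :: insert k s' else [:: k].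
Definition isort (s : seq nat) := foldr insert [::] s.

Lemma perm_insert k s : perm_eq (insert k s) (k :: s).
Proof.
elim: s => //= x s IHs; case: ifP => // _.
by rewrite -(perm_cons x) in IHs; rewrite (perm_trans IHs) // (perm_catCA [:: x] [:: k]).
Qed.

Lemma perm_isort s : perm_eq (isort s) s.
Proof.
elim: s => //= x s IHs; apply: perm_trans (perm_insert x _) _.
by rewrite perm_cons.
Qed.

Lemma isort_sorted s : sorted leq (isort s).
Proof.
elim: s => //= x s; elim: (isort s) => //= y t IHt yt.
case: (leqP x y) => [xy|/ltnW yx] /=; first by rewrite xy.
have := IHt (path_sorted yt); case: t yt {IHt} => [|z t] /=; first by rewrite yx.
by case/andP=> yz zt; case: ifP => /= _ h; rewrite ?yx ?yz.
Qed.

Lemma isort_perm (s t : seq nat) : perm_eq s t -> isort s = isort t.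
Proof.
move=> st; apply: (sorted_eq leq_trans anti_leq); rewrite ?isort_sorted //.
by rewrite (perm_trans (perm_isort s)) // (perm_trans st) // perm_sym perm_isort.
Qed.

Definition preserves c (F : seq (seq nat)) := all (fun L => isort (move_by c L) \in F) F.

Fixpoint subsets m (P : seq nat) : seq (seq nat) :=
  match m, P with
  | 0, _ => [:: [::]]
  | _.+1, [::] => [::]
  | m'.+1, p :: ps => [seq p :: L | L <- subsets m' ps] ++ subsets m ps
  end.

(** The alternating group of degree [n] is transitive on the subsets of size
    [m <= n - 2], so it does not preserve a family which contains some of
    them and not all. *)
Definition proper_family N (F : seq (seq nat)) :=
  if F is L :: _ then
    [&& is_tuple N (size L) L, size L + 2 <= N.+1,
      all (fun M => (isort M == M) && all (fun k => k <= N) M) F &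
      has (fun t => (isort t \notin F) && is_tuple N (size L) t)
        (subsets (size L) (iota 0 N.+1))]
  else false.

Lemma proper_family_group N F (gs : seq 'S_N.+1) : proper_family N F ->
  (forall g, g \in gs -> preserves (code g) F) ->
  exists K : {group 'S_N.+1}, (forall g, g \in gs -> g \in K) /\ ~~ ('Alt_('I_N.+1) \subset K).
Proof.
case: F => [//|L F']; set F := L :: F' => /and4P[LT Ls /allP FN /hasP[t _ /andP[tF tT]]] gsF.
pose K := [set g : 'S_N.+1 | preserves (code g) F]%SET.
have gK : group_set K.
  apply/group_setP; split=> [|g h]; rewrite !inE.
    by apply/allP => M MF; have /andP[/eqP Ms MN] := FN M MF; rewrite move_by1 // Ms.
  move=> /allP gF /allP hF; apply/allP => M MF.
  have /andP[_ MN] := FN M MF; rewrite move_byM //.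
  rewrite (_ : isort _ = isort (move_by (code h) (isort (move_by (code g) M)))).
    exact/hF/gF.
  by apply/isort_perm/perm_map; rewrite perm_sym perm_isort.
exists (Group gK); split=> [g /gsF|]; first by rewrite inE.
apply/negP => /fintype.subsetP AK.
have [h hA hE] := Alt_tuple_transitive Ls LT; have [k kA kE] := Alt_tuple_transitive Ls tT.
have := AK (h^-1 * k) (groupM (groupVr hA) kA).
have /andP[_ LN] := FN L (mem_head _ _).
have iN m : m + 2 <= N.+1 -> all (fun k => k <= N) (iota 0 m).
  by move=> mN; apply/allP => i; rewrite mem_iota; lia.
have hV : move_by (code h^-1) L = iota 0 (size L).
  by rewrite -{1}hE -move_byM ?iN // mulgV move_by1 ?iN.
by rewrite inE => /allP/(_ L (mem_head _ _)); rewrite move_byM // hV kE (negPf tF).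
Qed.

(** * Involutions as products of disjoint transpositions *)

Fixpoint involutions fuel (P : seq nat) : seq (seq (nat * nat)) :=
  match fuel, P with
  | f.+1, p :: ps => involutions f ps ++
      flatten [seq [seq (p, q) :: l | l <- involutions f (rem q ps)] | q <- ps]
  | _, _ => [:: [::]]
  end.

Section Involutions.
Variable N : nat.

Lemma involutions_complete fuel P (s : 'S_N.+1) : size P <= fuel -> uniq P ->
  all (fun k => k <= N) P -> s * s = 1 ->
  (forall k, k <= N -> k \notin P -> s (inord k) = inord k) ->
  exists l, [/\ l \in involutions fuel P, s = tl N l, inside N l
    & all (fun p => p.1 != p.2) l].
Proof.
have base (t : 'S_N.+1) : (forall k, k <= N -> k \notin [::] -> t (inord k) = inord k) ->
    exists l, [/\ l \in [:: [::]], t = tl N l, inside N l & all (fun p => p.1 != p.2) l].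
  move=> fix_t; exists [::]; split; rewrite ?mem_head // tl_nil; apply/permP=> i.
  by rewrite perm1 -[i]inord_val fix_t // -ltnS.
elim: fuel P s => [|fuel IH] [|p ps] s //=.
- by move=> _ _ _ _; apply: base.
- by move=> _ _ _ _; apply: base.
rewrite ltnS => sz /andP[pps ups] /andP[pN psN] ss fix_s.
have sK x : s (s x) = x by rewrite -permM ss perm1.
have [q qN qE] : exists2 q, q <= N & inord q = s (inord p).
  by exists (s (inord p)); [rewrite -ltnS ltn_ord | rewrite inord_val].
have [qp|qp] := eqVneq q p.
  have [k kN|l [lI sE lN ld]] := IH ps s sz ups psN ss.
    have [->|kp] := eqVneq k p; first by rewrite -qE qp.
    by move=> kps; apply: fix_s => //; rewrite inE negb_or kp.
  by exists l; rewrite mem_cat lI.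
have qps : q \in ps.
  have : q \in p :: ps.
    apply/negPn/negP => /(fix_s q qN); rewrite {1}qE sK => /(congr1 val).
    by rewrite /= !inordE // => e; case/eqP: qp.
  by rewrite inE (negPf qp).
pose t : 'S_N.+1 := tperm (inord p) (inord q).
have tJ : t ^ s = t by rewrite /t tpermJ qE sK tpermC.
have tt : t * t = 1 by rewrite /t tperm2.
have ts : t * s = s * t by rewrite conjgC tJ.
have [||||k kN kr|l [lI sE lN ld]] := IH (rem q ps) (t * s).
- by rewrite size_rem //; case: (ps) sz qps => //= ? ?; lia.
- exact: rem_uniq.
- by apply/allP => k /mem_rem; apply: (allP psN).
- by rewrite {1}ts mulgA -(mulgA s) tt mulg1 ss.
- rewrite permM /t; have [->|kp] := eqVneq k p; first by rewrite tpermL qE sK.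
  have [->|kq] := eqVneq k q; first by rewrite tpermR -qE.
  rewrite tpermD; last 2 first.
  + by apply/eqP => /(congr1 val); rewrite /= !inordE // => e; rewrite e eqxx in kp.
  + by apply/eqP => /(congr1 val); rewrite /= !inordE // => e; rewrite e eqxx in kq.
  apply: fix_s => //; rewrite inE negb_or kp; apply: contra kr.
  by rewrite mem_rem_uniq // inE kq.
exists ((p, q) :: l); split.
- rewrite mem_cat; apply/orP; right; apply/flattenP.
  exists [seq (p, q) :: l | l <- involutions fuel (rem q ps)]; first by apply/mapP; exists q.
  by apply/mapP; exists l.
- by rewrite -cat1s tl_cat -sE /tl big_seq1 mulgA tt mul1g.
- by rewrite /inside /= pN qN.
- by rewrite /= eq_sym qp.
Qed.

Definition even_involutions : seq (seq nat) :=
  [seq [seq run l k | k <- iota 0 N.+1]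
     | l <- involutions N.+1 (iota 0 N.+1) & ~~ odd (size l)].

Lemma even_involutionsP (s : 'S_N.+1) : s * s = 1 -> s \in 'Alt_('I_N.+1) ->
  code s \in even_involutions.
Proof.
move=> ss; rewrite Alt_even => se.
have iN : all (fun k => k <= N) (iota 0 N.+1).
  by apply/allP => k; rewrite mem_iota; lia.
have [|k kN|l [lI sE lN ld]] := @involutions_complete N.+1 (iota 0 N.+1) s _ (iota_uniq _ _) iN ss.
- by rewrite size_iota.
- by rewrite mem_iota add0n ltnS kN.
apply/mapP; exists l; last by rewrite sE code_tl.
by rewrite mem_filter lI andbT -(odd_tl lN ld) -sE.
Qed.

End Involutions.

(** * Families of subsets *)

(** A group which preserves a family of one set is intransitive; a matching
    or a partition into two halves is a system of blocks of imprimitivity. *)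
Definition single_sets N : seq (seq (seq nat)) :=
  [seq [:: L] | L <- flatten [seq subsets m (iota 0 N.+1) | m <- iota 1 4 & m + 2 <= N.+1]].

Definition matchings N : seq (seq (seq nat)) :=
  [seq [seq isort [:: p.1; p.2] | p <- l]
     | l <- involutions N.+1 (iota 0 N.+1) & (size l).*2 == N.+1].

Definition halves N : seq (seq (seq nat)) :=
  [seq [:: L; [seq k <- iota 0 N.+1 | k \notin L]]
     | L <- subsets (N.+1)./2 (iota 0 N.+1) & (~~ odd N.+1) && (0%N \in L)].

(** If the stabiliser of the family is doubly transitive, the permutations
    which fix [0] and [1] give all its images. *)
Definition images N (F : seq (seq nat)) : seq (seq (seq nat)) :=
  [seq [seq isort (move_by [:: 0, 1 & c]%N L) | L <- F] | c <- permutations (iota 2 N.-1)].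

(** An orbit of the group [PSL_2(5)] on the 3-subsets of the projective line. *)
Definition projective_triples : seq (seq nat) :=
  [:: [:: 0; 1; 2]; [:: 0; 1; 4]; [:: 0; 2; 5]; [:: 0; 3; 4]; [:: 0; 3; 5];
      [:: 1; 2; 3]; [:: 1; 3; 5]; [:: 1; 4; 5]; [:: 2; 3; 4]; [:: 2; 4; 5]]%N.

(** The stabiliser is the group [PSL_3(2)], which is primitive of degree 7. *)
Definition fano_lines : seq (seq nat) :=
  [:: [:: 0; 1; 3]; [:: 1; 2; 4]; [:: 2; 3; 5]; [:: 3; 4; 6]; [:: 0; 4; 5];
      [:: 1; 5; 6]; [:: 0; 2; 6]]%N.

Definition families6 := single_sets 5 ++ matchings 5 ++ halves 5 ++ images 5 projective_triples.
Definition families7 := single_sets 6 ++ images 6 fano_lines.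
Definition families8 := single_sets 7 ++ matchings 7 ++ halves 7.

(** * Three involutions *)

(** The first involution [r] is taken up to conjugacy, the second up to
    conjugacy under some elements [gs] of the centraliser of [r], which leaves
    only the representatives [ys]. *)
Definition triples_check N fams (config : seq (seq nat * seq (seq nat) * seq (seq nat))) :=
  let ev := even_involutions N in
  let idc := iota 0 N.+1 in
  all (proper_family N) fams &&
  all (fun d => valid_type N d.1.1) config &&
  all (fun c => if c == idc then true
         else let lens := map size (sorted_cycles c) in
              (lens \in map (fun d => d.1.1) config) && has_type N c lens) ev &&
  all (fun d => let: (lens, gs, ys) := d in let r := standard N lens in
    let F1 := [seq F <- fams | preserves r F] in
    all (fun y => perm_eq y idc) ys &&
    all (fun g => perm_eq g idc && (mulc r g == mulc g r)) gs &&
    all (fun y => has (fun g => has (fun y' => mulc y g == mulc g y') ys) gs)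
      [seq y <- ev | mulc r y == mulc y r] &&
    all (fun y => let F2 := [seq F <- F1 | preserves y F] in
       all (fun z => has (preserves z) F2) ev) ys) config.

Section Triples.
Variable N : nat.
Implicit Types (a b c g : 'S_N.+1).

Definition small_triple a b c := exists K : {group 'S_N.+1},
  [/\ a \in K, b \in K, c \in K & ~~ ('Alt_('I_N.+1) \subset K)].

Lemma small_tripleJ a b c g : small_triple (a ^ g) (b ^ g) (c ^ g) -> small_triple a b c.
Proof.
case=> K [aK bK cK AK]; exists (K :^ g^-1)%G; rewrite !mem_conjgV; split=> //.
apply: contra AK; rewrite -sub_conjg; suff /normP-> : g \in 'N('Alt_('I_N.+1)) by [].
exact: (fintype.subsetP (normal_norm (Alt_normal 'I_N.+1)) _ (finset.in_setT g)).
Qed.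

Lemma AltJ a g : (a ^ g \in 'Alt_('I_N.+1)) = (a \in 'Alt_('I_N.+1)).
Proof. by rewrite !Alt_even odd_permJ. Qed.

Lemma sqJ a g : a * a = 1 -> a ^ g * a ^ g = 1.
Proof. by move=> aa; rewrite -conjMg aa conj1g. Qed.

Lemma commJ a b g : a * b = b * a -> a ^ g * b ^ g = b ^ g * a ^ g.
Proof. by move=> ab; rewrite -!conjMg ab. Qed.

Lemma triples_checkP fams config a b c : triples_check N fams config ->
  a != 1 -> a * a = 1 -> b * b = 1 -> c * c = 1 -> a * b = b * a ->
  a \in 'Alt_('I_N.+1) -> b \in 'Alt_('I_N.+1) -> c \in 'Alt_('I_N.+1) ->
  small_triple a b c.
Proof.
case/andP=> /andP[/andP[/allP fP /allP vP] /allP tP] /allP chk a1 aa bb cc ab aA bA cA.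
have := tP _ (even_involutionsP aa aA); rewrite -code1 (inj_eq (@code_inj N)) (negPf a1).
case/andP=> /mapP[[[lens gs] ys] dC ->] /(has_typeP (vP _ dC))[g gE].
have /andP[/andP[/andP[/allP yN /allP gsP] /allP ysP] /allP zP] := chk _ dC.
have rE : standard N lens = code (a ^ g) by rewrite gE standardE ?(vP _ dC).
apply: (@small_tripleJ a b c g).
move: (sqJ g aa) (sqJ g bb) (sqJ g cc) (commJ g ab) => {}aa {}bb {}cc {}ab.
rewrite -(AltJ a g) in aA; rewrite -(AltJ b g) in bA; rewrite -(AltJ c g) in cA.
move: (a ^ g) (b ^ g) (c ^ g) rE aa bb cc ab aA bA cA => {a1 gE}r y z rE rr yy zz ry rA yA zA.
have /ysP/hasP[h hG /hasP[y' yY /eqP e]] : code y \in [seq y <- even_involutions N |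
    mulc (standard N lens) y == mulc y (standard N lens)].
  by rewrite mem_filter even_involutionsP // rE !mulcE ry eqxx.
have /andP[hP /eqP rh] := gsP _ hG.
have [k kE] : exists k : 'S_N.+1, code k = h by apply: all_codes_onto; rewrite mem_permutations.
rewrite -kE rE !mulcE in rh; have {}rh := code_inj rh.
apply: (@small_tripleJ r y z k).
have rk : r ^ k = r by rewrite conjgE rh mulKg.
have y'E : y' = code (y ^ k).
  have [u uE] : exists u : 'S_N.+1, code u = y'.
    by apply: all_codes_onto; rewrite mem_permutations; apply: yN.
  by move: e; rewrite -kE -uE !mulcE => /code_inj e; rewrite conjgE e mulKg.
have := zP _ yY; rewrite y'E => /allP/(_ _ (even_involutionsP (sqJ k zz) _))/hasP[|F].
  by rewrite AltJ.
rewrite !mem_filter rE => /and3P[Fy Fr FF] Fz.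
have [K [KP AK]] := @proper_family_group N F [:: r; y ^ k; z ^ k] (fP _ FF) ltac:(by
  move=> u; rewrite !inE => /or3P[] /eqP->).
by rewrite rk; exists K; rewrite !KP ?inE ?eqxx ?orbT.
Qed.

End Triples.

Definition config6 := [:: ([:: 2; 2; 1; 1], [:: [:: 0; 1; 2; 3; 4; 5]; [:: 2; 3; 1; 0; 4; 5]], [:: [:: 0; 1;
    2; 3; 4; 5]; [:: 0; 1; 3; 2; 5; 4]; [:: 1; 0; 3; 2; 4; 5]; [:: 2; 3; 0; 1; 4; 5]])]%N.
Definition config7 := [:: ([:: 2; 2; 1; 1; 1], [:: [:: 0; 1; 2; 3; 4; 5; 6]; [:: 0; 1; 3; 2; 5; 4; 6]; [:: 0;
    1; 2; 3; 5; 6; 4]; [:: 2; 3; 0; 1; 4; 5; 6]; [:: 2; 3; 0; 1; 5; 4; 6]; [:: 2; 3; 0;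
    1; 5; 6; 4]], [:: [:: 0; 1; 2; 3; 4; 5; 6]; [:: 0; 1; 3; 2; 4; 6; 5]; [:: 1; 0; 3; 2;
    4; 5; 6]; [:: 2; 3; 0; 1; 4; 5; 6]])]%N.
Definition config8 := [:: ([:: 2; 2; 1; 1; 1; 1], [:: [:: 0; 1; 2; 3; 4; 5; 6; 7]; [:: 0; 1; 3; 2; 4; 6; 5;
    7]; [:: 0; 1; 2; 3; 4; 6; 7; 5]; [:: 0; 1; 2; 3; 6; 4; 7; 5]; [:: 0; 1; 3; 2; 6; 4;
    5; 7]; [:: 0; 1; 3; 2; 6; 7; 4; 5]; [:: 2; 3; 0; 1; 4; 5; 6; 7]; [:: 2; 3; 0; 1; 4;
    6; 5; 7]; [:: 2; 3; 0; 1; 4; 6; 7; 5]; [:: 2; 3; 0; 1; 6; 4; 5; 7]; [:: 2; 3; 0; 1;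
    6; 4; 7; 5]; [:: 2; 3; 0; 1; 6; 7; 4; 5]], [:: [:: 0; 1; 2; 3; 4; 5; 6; 7]; [:: 0; 1;
    2; 3; 5; 4; 7; 6]; [:: 0; 1; 3; 2; 4; 5; 7; 6]; [:: 1; 0; 3; 2; 4; 5; 6; 7]; [:: 1;
    0; 3; 2; 5; 4; 7; 6]; [:: 2; 3; 0; 1; 4; 5; 6; 7]; [:: 2; 3; 0; 1; 5; 4; 7; 6]]);
    ([:: 2; 2; 2; 2], [:: [:: 0; 1; 2; 3; 4; 5; 6; 7]; [:: 0; 1; 4; 5; 2; 3; 6; 7]; [::
    0; 1; 4; 5; 6; 7; 2; 3]; [:: 4; 5; 0; 1; 2; 3; 7; 6]; [:: 4; 5; 0; 1; 6; 7; 3; 2];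
    [:: 4; 5; 6; 7; 0; 1; 3; 2]; [:: 0; 1; 3; 2; 4; 5; 7; 6]; [:: 0; 1; 4; 5; 3; 2; 7;
    6]; [:: 0; 1; 4; 5; 7; 6; 2; 3]; [:: 4; 5; 0; 1; 7; 6; 2; 3]; [:: 4; 5; 7; 6; 0; 1;
    2; 3]; [:: 4; 5; 0; 1; 2; 3; 6; 7]; [:: 0; 1; 4; 5; 7; 6; 3; 2]], [:: [:: 0; 1; 2; 3;
    4; 5; 6; 7]; [:: 0; 1; 2; 3; 5; 4; 7; 6]; [:: 0; 1; 2; 3; 6; 7; 4; 5]; [:: 1; 0; 3;
    2; 5; 4; 7; 6]; [:: 1; 0; 3; 2; 6; 7; 4; 5]; [:: 2; 3; 0; 1; 6; 7; 4; 5]])]%N.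

Lemma triples_check6 : triples_check 5 families6 config6. Proof. by vm_compute. Qed.
Lemma triples_check7 : triples_check 6 (single_sets 6) config7. Proof. by vm_compute. Qed.
Lemma triples_check8 : triples_check 7 families8 config8. Proof. by vm_compute. Qed.

Lemma Alt_nontrivial N : 2 <= N -> ~~ ('Alt_('I_N.+1) \subset (1%G : {group 'S_N.+1})).
Proof.
move=> N2; apply/negP => /trivgP AT; have := @card_Alt 'I_N.+1.
rewrite AT cards1 card_ord muln1 => /(_ (leqW N2)); rewrite factS.
by have := fact_geq N; nia.
Qed.

(** The enumeration takes the first involution to be nontrivial; if it is
    trivial, the roles of the three can be exchanged. *)
Lemma triples_not_crit1 N fams config : 2 <= N -> triples_check N fams config ->
  ~ crit1 (An N.+1).
Proof.
move=> N2 chk [x [y [z [xx yy zz xy gen]]]].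
have [jM j_inj jH j_onto] := embedding_An N.+1.
pose j := @sgval _ (Alt_group 'I_N.+1).
have j2 (u : An N.+1) : u * u = 1 -> j u * j u = 1.
  by move=> uu; rewrite -jM uu (iota1 jM).
have no_small : ~ small_triple (j x) (j y) (j z).
  case=> K [xK yK zK /negP[]].
  by move/(generatesP jM j_inj jH j_onto): gen; apply=> _ [[->|->]|->].
apply: no_small; have tri := triples_checkP chk.
have jA u : j u \in 'Alt_('I_N.+1) := jH u.
have jxy : j x * j y = j y * j x by rewrite -!jM xy.
have [jx|jx] := eqVneq (j x) 1; last by apply: tri; rewrite ?j2 ?jA.
have [jy|jy] := eqVneq (j y) 1; last first.
  have [K [yK xK zK AK]] := tri _ _ _ jy (j2 _ yy) (j2 _ xx) (j2 _ zz) (esym jxy)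
    (jA _) (jA _) (jA _).
  by exists K.
have [jz|jz] := eqVneq (j z) 1; last first.
  have jzx : j z * j x = j x * j z by rewrite jx mulg1 mul1g.
  have [K [zK xK yK AK]] := tri _ _ _ jz (j2 _ zz) (j2 _ xx) (j2 _ yy) jzx
    (jA _) (jA _) (jA _).
  by exists K.
by exists 1%G; rewrite jx jy jz group1 Alt_nontrivial.
Qed.

Lemma A6_not_crit1 : ~ crit1 (An 6).
Proof. exact: (triples_not_crit1 _ triples_check6). Qed.
Lemma A7_not_crit1 : ~ crit1 (An 7).
Proof. exact: (triples_not_crit1 _ triples_check7). Qed.
Lemma A8_not_crit1 : ~ crit1 (An 8).
Proof. exact: (triples_not_crit1 _ triples_check8). Qed.

(** * An involution and another permutation *)

(** The search for inverting permutations is needed only for the few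
    involutions which share no invariant family with the standard
    permutation. *)
Definition involution_pairs_check N fams types :=
  let ev := even_involutions N in let codes := all_codes N in
  all (proper_family N) fams && types_check N types &&
  all (fun lens => let r := standard N lens in
    let F1 := [seq F <- fams | preserves r F] in
    let rest := [seq x <- ev | ~~ has (preserves x) F1] in
    if nilp rest then true else
    let sr := [seq s <- codes | s \in inverting r] in
    all (fun x => has (fun s => s \in inverting x) sr) rest)
  [seq lens <- types | even_type lens].

Lemma involution_pairs_checkP N fams types (a b : 'S_N.+1) :
  involution_pairs_check N fams types -> a * a = 1 ->
  a \in 'Alt_('I_N.+1) -> b \in 'Alt_('I_N.+1) -> inverted_pair a b \/ small_pair a b.
Proof.
case/andP=> /andP[/allP fP tc] /allP chk aa aA bA.
have [lens _ [lT lv [g gE]]] := types_checkP b tc.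
have le : even_type lens.
  by have := type_parity lv gE; move: bA; rewrite Alt_even => /negbTE-> /esym/negbFE.
have gE' : standard N lens = code (b ^ g) by rewrite gE standardE.
have := chk lens; rewrite mem_filter le lT => /(_ isT) /=; rewrite gE'.
set rest := filter _ (even_involutions N) => chk_r.
have aE : code (a ^ g) \in even_involutions N.
  by apply: even_involutionsP; rewrite ?AltJ ?sqJ.
have [/hasP[F]|aF] := boolP (has (preserves (code (a ^ g))) [seq F <- fams | preserves (code (b ^ g)) F]).
  rewrite mem_filter => /andP[Fb FF] Fa; right; apply: (@small_pairJ _ a b g).
  have [K [KP AK]] := @proper_family_group N F [:: a ^ g; b ^ g] (fP _ FF) ltac:(by
    move=> u; rewrite !inE => /orP[] /eqP->).
  by exists K; rewrite !KP ?inE ?eqxx ?orbT.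
have ar : code (a ^ g) \in rest by rewrite mem_filter aF.
move: chk_r; case: ifP => [/nilP r0|_ /allP/(_ _ ar)/hasP[s]]; first by rewrite r0 in ar.
rewrite mem_filter => /andP[sb /all_codes_onto[t tE]] sa; left.
apply: (@inverted_pairJ _ a b g); exists t.
by move: sa sb; rewrite -tE !invertingE => /eqP-> /eqP->.
Qed.

Definition types7 := [:: [:: 7]; [:: 6; 1]; [:: 5; 2]; [:: 5; 1; 1]; [:: 4; 3]; [:: 4; 2; 1];
  [:: 4; 1; 1; 1]; [:: 3; 3; 1]; [:: 3; 2; 2]; [:: 3; 2; 1; 1]; [:: 3; 1; 1; 1; 1];
  [:: 2; 2; 2; 1]; [:: 2; 2; 1; 1; 1]; [:: 2; 1; 1; 1; 1; 1]; [:: 1; 1; 1; 1; 1; 1; 1]]%N.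

Lemma involution_pairs_check7 : involution_pairs_check 6 families7 types7.
Proof. by vm_compute. Qed.

(** A generating pair is inverted by a permutation, and inverting an
    involution fixes it. *)
Lemma A7_not_crit2ex : ~ crit2ex (An 7).
Proof.
have emb := embedding_An 7; have [jM j_inj jH j_onto] := emb.
case=> x [s [xx gen]]; apply.
have jxx : sgval x * sgval x = 1 by rewrite -jM xx (iota1 jM).
have [[t [tx ts]]|] := involution_pairs_checkP involution_pairs_check7 jxx (jH x) (jH s).
  have [alpha aut [ax as_]] := inverting_conjugation jM j_inj gen tx ts.
  by exists alpha; rewrite // ax sq1V.
by move/(small_pair_not_generate emb (fintype.subxx _))/(_ gen).
Qed.

(** * The action of the symmetric group of degree 6 on ten points *)

(** A partition of [{0, ..., 5}] into two triples is represented by the triple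
    which contains 0. *)
Definition ten_points := [seq t <- subsets 3 (iota 0 6) | 0%N \in t].

Definition ten_index (t : seq nat) :=
  let u := isort t in
  index (if 0%N \in u then u else [seq k <- iota 0 6 | k \notin u]) ten_points.

Definition theta_code c := [seq ten_index (move_by c t) | t <- ten_points].

(** The identity is checked for all first factors and for second factors
    which generate; the elements for which it holds form a subgroup. *)
Definition theta_hom_check gens :=
  all (fun g => all (fun c => theta_code (mulc c g) == mulc (theta_code c) (theta_code g))
    (all_codes 5)) gens.

Definition theta_inj_check :=
  all (fun c => let d := theta_code c in
    perm_eq d (iota 0 10) && ((d == iota 0 10) ==> (c == iota 0 6))) (all_codes 5).

Lemma theta_hom_checked :
  theta_hom_check [seq [seq run l k | k <- iota 0 6] | l <- [:: gen6_x; gen6_s]].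
Proof. by vm_compute. Qed.

Lemma theta_inj_checked : theta_inj_check. Proof. by vm_compute. Qed.

Lemma theta_codeM (g h : 'S_6) :
  theta_code (code (g * h)) = mulc (theta_code (code g)) (theta_code (code h)).
Proof.
pose K := [set h : 'S_6 | all (fun c =>
  theta_code (mulc c (code h)) == mulc (theta_code c) (theta_code (code h))) (all_codes 5)]%SET.
have ten_codes (c : seq nat) : c \in all_codes 5 -> exists g : 'S_6, code g = c by apply: all_codes_onto.
have KP u : reflect (forall v : 'S_6, theta_code (code (v * u)) =
    mulc (theta_code (code v)) (theta_code (code u))) (u \in K).
  rewrite inE; apply: (iffP allP) => [uK v|uK c /ten_codes[v <-]].
    by rewrite -mulcE; apply/eqP/uK/code_all.
  by rewrite mulcE uK.
have tenE (u : 'S_6) : exists d : 'S_10, code d = theta_code (code u).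
  have := allP theta_inj_checked _ (code_all u) => /andP[dP _].
  by apply: all_codes_onto; rewrite mem_permutations.
have gK : group_set K.
  apply/group_setP; split=> [|u v /KP uK /KP vK]; apply/KP => w.
    have [d dE] := tenE w.
    rewrite mulg1 (_ : theta_code (code 1) = iota 0 10); last by rewrite code1; vm_compute.
    by rewrite -dE -(code1 9) mulcE mulg1.
  have [[[d dE] [e eE]] [f fE]] := (tenE w, tenE u, tenE v).
  by rewrite mulgA !vK uK -dE -eE -fE !mulcE mulgA.
suff /setP/(_ h) : Group gK = [set: 'S_6]%SET :> {set _}.
  by rewrite finset.in_setT => /KP.
have gen l : inside 5 l -> l \in [:: gen6_x; gen6_s] -> tl 5 l \in K.
  move=> lN lG; rewrite inE code_tl {lN}//.
  exact: (allP theta_hom_checked _ (map_f (fun l => [seq run l k | k <- iota 0 6]) lG)).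
apply: generate_S6; apply: gen.
- by vm_compute.
- by rewrite mem_head.
- by vm_compute.
- by rewrite in_cons mem_head orbT.
Qed.

Lemma theta_exists : exists2 theta : 'S_6 -> 'S_10, {morph theta : g h / g * h} &
  injective theta /\ forall g, code (theta g) = theta_code (code g).
Proof.
have tenE (u : 'S_6) : exists d : 'S_10, code d = theta_code (code u).
  have := allP theta_inj_checked _ (code_all u) => /andP[dP _].
  by apply: all_codes_onto; rewrite mem_permutations.
have [theta thetaE] : exists theta : 'S_6 -> 'S_10, forall u,
    code (theta u) = theta_code (code u).
  by exists (fun u => projT1 (cid (tenE u))) => u; exact: (projT2 (cid (tenE u))).
have thetaM : {morph theta : g h / g * h}.
  move=> g h; apply: code_inj; rewrite -(mulcE (theta g) (theta h)).
  by rewrite (thetaE (g * h)) (thetaE g) (thetaE h) theta_codeM.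
exists theta => //; split=> // g h e.
have theta1 : theta 1 = 1 by apply: (@mulgI _ (theta 1)); rewrite -thetaM !mulg1.
have e1 : theta (g * h^-1) = 1.
  by apply: (@mulIg _ (theta h)); rewrite -thetaM mulgKV mul1g.
have /andP[_ /implyP] := allP theta_inj_checked _ (code_all (g * h^-1)).
rewrite -thetaE e1 code1 eqxx => /(_ isT)/eqP; rewrite -(code1 5) => /code_inj gh.
by rewrite -(mulgKV h g) gh mul1g.
Qed.

(** * Pairs in the alternating group of degree 6 *)

Definition types6 := [:: [:: 6]; [:: 5; 1]; [:: 4; 2]; [:: 4; 1; 1]; [:: 3; 3]; [:: 3; 2; 1];
  [:: 3; 1; 1; 1]; [:: 2; 2; 2]; [:: 2; 2; 1; 1]; [:: 2; 1; 1; 1; 1]; [:: 1; 1; 1; 1; 1; 1]]%N.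

(** For each even cycle type, permutations of the ten points which invert
    the image of the standard permutation of this type. They are listed
    rather than searched for, because the symmetric group of degree 10 is
    too large. *)
Definition inverters6 : seq (seq nat * seq (seq nat)) :=
  [:: ([:: 5; 1],
    [:: [:: 6; 7; 5; 8; 9; 2; 0; 1; 3; 4];
     [:: 8; 9; 4; 5; 2; 3; 7; 6; 0; 1];
     [:: 5; 2; 1; 4; 3; 0; 9; 8; 7; 6];
     [:: 1; 0; 8; 6; 7; 9; 3; 4; 2; 5];
     [:: 4; 3; 6; 1; 0; 7; 2; 5; 9; 8];
     [:: 0; 8; 9; 7; 5; 4; 6; 3; 1; 2];
     [:: 7; 5; 2; 9; 4; 1; 8; 0; 6; 3];
     [:: 2; 1; 0; 3; 6; 8; 4; 9; 5; 7];
     [:: 9; 4; 3; 2; 1; 6; 5; 7; 8; 0];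
     [:: 3; 6; 7; 0; 8; 5; 1; 2; 4; 9]]);
   ([:: 4; 2],
    [:: [:: 0; 9; 7; 8; 4; 6; 5; 2; 3; 1];
     [:: 1; 0; 2; 3; 9; 6; 5; 8; 7; 4];
     [:: 4; 1; 8; 7; 0; 6; 5; 3; 2; 9];
     [:: 7; 3; 9; 1; 8; 6; 5; 0; 4; 2];
     [:: 8; 2; 1; 9; 7; 6; 5; 4; 0; 3];
     [:: 9; 4; 3; 2; 1; 6; 5; 7; 8; 0];
     [:: 2; 7; 0; 4; 3; 6; 5; 1; 9; 8];
     [:: 3; 8; 4; 0; 2; 6; 5; 9; 1; 7]]);
   ([:: 3; 3],
    [:: [:: 0; 2; 1; 3; 8; 9; 7; 6; 4; 5];
     [:: 0; 3; 2; 1; 7; 8; 9; 4; 5; 6];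
     [:: 0; 1; 3; 2; 9; 7; 8; 5; 6; 4];
     [:: 0; 4; 6; 5; 1; 3; 2; 8; 7; 9];
     [:: 0; 6; 5; 4; 3; 2; 1; 9; 8; 7];
     [:: 0; 5; 4; 6; 2; 1; 3; 7; 9; 8];
     [:: 0; 8; 9; 7; 5; 4; 6; 3; 1; 2];
     [:: 0; 7; 8; 9; 6; 5; 4; 1; 2; 3];
     [:: 0; 9; 7; 8; 4; 6; 5; 2; 3; 1]]);
   ([:: 3; 1; 1; 1],
    [:: [:: 0; 6; 5; 4; 3; 2; 1; 9; 8; 7];
     [:: 0; 5; 4; 6; 2; 1; 3; 7; 9; 8];
     [:: 0; 4; 6; 5; 1; 3; 2; 8; 7; 9];
     [:: 0; 3; 2; 1; 7; 8; 9; 4; 5; 6];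
     [:: 0; 2; 1; 3; 8; 9; 7; 6; 4; 5];
     [:: 0; 1; 3; 2; 9; 7; 8; 5; 6; 4];
     [:: 0; 7; 8; 9; 6; 5; 4; 1; 2; 3];
     [:: 0; 8; 9; 7; 5; 4; 6; 3; 1; 2];
     [:: 0; 9; 7; 8; 4; 6; 5; 2; 3; 1]]);
   ([:: 2; 2; 1; 1],
    [:: [:: 8; 7; 3; 2; 5; 4; 9; 1; 0; 6];
     [:: 7; 8; 3; 2; 6; 9; 4; 0; 1; 5];
     [:: 6; 5; 3; 2; 8; 1; 0; 9; 4; 7];
     [:: 5; 6; 3; 2; 7; 0; 1; 4; 9; 8]]);
   ([:: 1; 1; 1; 1; 1; 1], [::])]%N.

Definition mapped_pairs_check N M (tcode : seq nat -> seq nat) fams types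
    (inverters : seq (seq nat * seq (seq nat))) :=
  let ys := [seq y <- all_codes N | even_type (map size (sorted_cycles y))] in
  types_check N types && all (proper_family N) fams &&
  all (fun lens => if even_type lens then lens \in map fst inverters else true) types &&
  all (fun d => let r := standard N d.1 in let tr := tcode r in
    let F1 := [seq F <- fams | preserves r F] in
    all (fun s => perm_eq s (iota 0 M.+1) && (s \in inverting tr)) d.2 &&
    all (fun y => if has (preserves y) F1 then true
      else let ty := tcode y in has (fun s => s \in inverting ty) d.2) ys) inverters.

Section MappedPairs.
Variables (N M : nat) (tcode : seq nat -> seq nat) (theta : 'S_N.+1 -> 'S_M.+1).
Hypotheses (thetaM : {morph theta : g h / g * h})
  (thetaE : forall g, code (theta g) = tcode (code g)).
Implicit Types a b g : 'S_N.+1.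

Lemma mapped_pairs_checkP fams types inverters a b :
  mapped_pairs_check N M tcode fams types inverters ->
  a \in 'Alt_('I_N.+1) -> b \in 'Alt_('I_N.+1) ->
  inverted_pair (theta a) (theta b) \/ small_pair a b.
Proof.
case/andP=> /andP[/andP[tc /allP fP] /allP ev] /allP chk aA bA.
have theta1 : theta 1 = 1 by apply: (@mulgI _ (theta 1)); rewrite -thetaM !mulg1.
have thetaV z : theta z^-1 = (theta z)^-1.
  by apply: (@mulgI _ (theta z)); rewrite -thetaM !mulgV theta1.
have thetaJ u g : theta (u ^ g) = theta u ^ theta g by rewrite !conjgE !thetaM thetaV.
have even_of (s h : 'S_N.+1) l : s \in 'Alt_('I_N.+1) -> valid_type N l ->
    s ^ h = tl N (standard_list 0 l) -> even_type l.
  rewrite Alt_even => se lv /(type_parity lv) e.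
  by move: se; rewrite e negbK.
have [lens _ [lT lv [g gE]]] := types_checkP a tc.
have := ev _ lT; rewrite (even_of _ _ _ aA lv gE) => /mapP[[l sig] dI lE].
have {lE}lE : lens = l := lE; subst l.
have /andP[/allP sigP /allP ysP] := chk _ dI.
have rE : standard N lens = code (a ^ g) by rewrite gE standardE.
have yE : code (b ^ g) \in [seq y <- all_codes N | even_type (map size (sorted_cycles y))].
  rewrite mem_filter code_all andbT.
  have [l lE [_ lv' [h hE]]] := types_checkP (b ^ g) tc.
  by rewrite -lE; apply: (even_of (b ^ g) h l _ lv' hE); rewrite AltJ.
have := ysP _ yE; case: ifP => [/hasP[F]|_ /hasP[s sS sy]].
  rewrite mem_filter => /andP[Fx FF] Fy; right; apply: (@small_pairJ _ a b g).
  have Fx' : preserves (code (a ^ g)) F by rewrite -rE.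
  have [K [KP AK]] := @proper_family_group N F [:: a ^ g; b ^ g] (fP _ FF) ltac:(by
    move=> u; rewrite !inE => /orP[] /eqP->).
  by exists K; rewrite !KP ?inE ?eqxx ?orbT.
have /andP[sP sx] := sigP _ sS.
have [t tE] : exists t : 'S_M.+1, code t = s by apply: all_codes_onto; rewrite mem_permutations.
left; apply: (@inverted_pairJ _ _ _ (theta g)); exists t; rewrite -!thetaJ.
have {}sx : s \in inverting (tcode (standard N lens)) := sx.
move: sx sy; rewrite rE -tE -(thetaE (a ^ g)) -(thetaE (b ^ g)) !invertingE.
by move=> /eqP-> /eqP->.
Qed.

End MappedPairs.

Lemma pairs_checked6 : mapped_pairs_check 5 9 theta_code families6 types6 inverters6.
Proof. by vm_compute. Qed.

(** The automorphism which inverts two generators of the alternating group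
    of degree 6 need not be a conjugation in the symmetric group of degree
    6. On the ten points, where the group acts as [PSL_2(9)] on the
    projective line, it becomes a conjugation. *)
Lemma A6_pairs_inverted : pairs_inverted (An 6).
Proof.
have emb := embedding_An 6; have [jM j_inj jH j_onto] := emb.
have [theta thetaM [theta_inj thetaE]] := theta_exists.
move=> x y gen.
have [[t [tx ty]]|] := mapped_pairs_checkP thetaM thetaE pairs_checked6 (jH x) (jH y).
  apply: (@inverting_conjugation (An 6) 'S_10 (fun u => theta (sgval u)) _ _ x y t gen tx ty).
    by move=> u v; rewrite jM thetaM.
  by move=> u v /theta_inj/j_inj.
by move/(small_pair_not_generate emb (fintype.subxx _))/(_ gen).
Qed.

(** * Groups of very small degree *)

Section Trivial.
Variable G : groupType.
Hypothesis triv : forall x : G, x = 1.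

Lemma trivial_crit1 : crit1 G.
Proof.
exists 1, 1, 1; split; rewrite ?mulg1 //.
by apply/seteqP; split=> // x _ H sH _; rewrite (triv x); apply: subgroup1.
Qed.

Lemma trivial_not_crit2 : ~ crit2 G.
Proof.
case=> x [y [z [_ _ _ _]]]; apply; exists id; first exact: automorphism_id.
by rewrite (triv y) (triv z).
Qed.

Lemma trivial_not_crit3 : ~ crit3 G.
Proof.
case=> w [x [y [z [_ _]]]]; apply; exists id; first exact: automorphism_id.
by rewrite (triv w) (triv x) (triv y) (triv z); constructor 1.
Qed.

Lemma trivial_not_crit4 : ~ crit4 G.
Proof.
case=> x [y [s [_ _ _]]]; apply; exists id; first exact: automorphism_id.
by rewrite (triv x) (triv y) (triv s) invg1.
Qed.

Lemma trivial_pairs_inverted : pairs_inverted G.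
Proof.
move=> x y _; exists id; first exact: automorphism_id.
by rewrite (triv x) (triv y) invg1.
Qed.

End Trivial.

Lemma S1_trivial (x : Sn 1) : x = 1.
Proof. by apply/permP=> i; rewrite perm1 !ord1. Qed.

Definition involutions_product_check N :=
  let ev := even_involutions N in
  all (fun a => all (fun b => mulc (mulc a b) (mulc a b) == iota 0 N.+1) ev) ev.

(** In the alternating groups of degree 3 and 4 the involutions and the
    identity form a subgroup. *)
Lemma An_three_involutions N : 2 <= N -> involutions_product_check N ->
  [/\ ~ crit1 (An N.+1), ~ crit2 (An N.+1) & ~ crit3 (An N.+1)].
Proof.
move=> N2 /allP chk; have [jM j_inj jH j_onto] := embedding_An N.+1.
have j2 (u : An N.+1) : u * u = 1 -> sgval u * sgval u = 1.
  by move=> uu; rewrite -jM uu (iota1 jM).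
have lN : inside N [:: (0, 1); (0, 2)]%N by rewrite /inside /=; lia.
have [u uE] : exists u : An N.+1, sgval u = tl N [:: (0, 1); (0, 2)]%N.
  by apply: j_onto; rewrite Alt_even odd_tl.
apply: (@involutions_subgroup_crit _ u).
  move=> x y xx yy; apply: j_inj; rewrite !jM (iota1 jM); apply: code_inj.
  have xe := even_involutionsP (j2 _ xx) (jH x); have ye := even_involutionsP (j2 _ yy) (jH y).
  by have /allP/(_ _ ye)/eqP := chk _ xe; rewrite !mulcE code1.
move=> uu; have := j2 _ uu; rewrite uE -tl_cat -(@tl_nil N); apply: (@tl_neq N N.+1 0 _ _) => //.
by rewrite /= andbT; lia.
Qed.

Lemma A3_three_involutions : [/\ ~ crit1 (An 3), ~ crit2 (An 3) & ~ crit3 (An 3)].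
Proof. by apply: An_three_involutions => //; vm_compute. Qed.
Lemma A4_three_involutions : [/\ ~ crit1 (An 4), ~ crit2 (An 4) & ~ crit3 (An 4)].
Proof. by apply: An_three_involutions => //; vm_compute. Qed.

(** There are no involutions, so the group is generated by [s], which an
    automorphism inverts. *)
Lemma A3_not_crit4 : ~ crit4 (An 3).
Proof.
case=> x [y [s [xx yy gen]]]; apply.
have [jM j_inj jH j_onto] := embedding_An 3.
have one (u : An 3) : u * u = 1 -> u = 1.
  move=> uu; apply: j_inj; rewrite (iota1 jM); apply: code_inj.
  have juu : sgval u * sgval u = 1 by rewrite -jM uu (iota1 jM).
  have := even_involutionsP juu (jH u).
  have -> : even_involutions 2 = [:: iota 0 3] by vm_compute.
  by rewrite inE code1 => /eqP.
have [_ inv] := @pairs_inverted_SnAn 3 isT.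
have [|alpha aut [as_ a1]] := inv s 1.
  by apply: eq_generates gen => u; rewrite /= (one x) // (one y) //; tauto.
by exists alpha; rewrite // (one x) // (one y) // a1 invg1.
Qed.

Lemma S2_elements (g : 'S_2) : g = 1 \/ g = tl 1 [:: (0, 1)]%N.
Proof.
have := code_all g.
have -> : all_codes 1 = [:: code (1 : 'S_2); code (tl 1 [:: (0, 1)]%N)].
  by rewrite code1 code_tl; vm_compute.
by rewrite !inE !(inj_eq (@code_inj 1)) => /orP[] /eqP; tauto.
Qed.

Lemma A12_trivial n (x : An n) : 0 < n <= 2 -> x = 1.
Proof.
have [jM j_inj jH j_onto] := embedding_An n.
case: n x jM j_inj jH {j_onto} => [|[|[|//]]] // x jM j_inj jH _; apply: j_inj;
  rewrite (iota1 jM); first by apply/permP=> i; rewrite perm1 !ord1.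
have [//|xE] := S2_elements (sgval x); have := jH x.
by rewrite xE Alt_even odd_tl.
Qed.

Lemma S2_generators : exists2 t : Sn 2, t * t = 1 & t != 1 /\ generates [set t]%classic.
Proof.
have t1 : tl 1 [:: (0, 1)]%N != 1.
  by apply/eqP; rewrite -(@tl_nil 1); apply: (@tl_neq 1 2 0).
have tt : tl 1 [:: (0, 1)]%N * tl 1 [:: (0, 1)]%N = 1.
  by rewrite /tl big_seq1 tperm2.
exists (tl 1 [:: (0, 1)]%N) => //; split=> //.
apply/seteqP; split=> // g _ H sH /(_ _ erefl) tH.
by have [->|->] := S2_elements g; first exact: subgroup1.
Qed.

Lemma S2_crit1 : crit1 (Sn 2).
Proof.
have [t tt [_ gen]] := S2_generators; exists 1, 1, t; split; rewrite ?mulg1 //.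
by apply: eq_generates gen => u ->; right; right.
Qed.

Lemma S2_crit2 : crit2 (Sn 2).
Proof.
have [t tt [t1 gen]] := S2_generators; exists 1, 1, t; split; rewrite ?mulg1 //.
  by apply: eq_generates gen => u ->; right; right.
by case=> alpha aut [_ at_ _]; case/eqP: t1; rewrite -at_ automorphism1.
Qed.

Local Close Scope group_scope.

Local Open Scope nat_scope.

(** * The criteria for all degrees and fields *)

Section Degrees.
Variable n : nat.
Hypothesis n1 : 1 <= n.

Lemma Sn_crit1 : crit1 (Sn n).
Proof.
have [n3|n3] := leqP 3 n; first exact/strong_crit1_crit1/strong_crit1_Sn3.
have [->|n2] := eqVneq n 2; first exact: S2_crit1.
have -> : n = 1 by lia.
exact: trivial_crit1 S1_trivial.
Qed.

Lemma Sn_crit2 : 2 <= n -> crit2 (Sn n).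
Proof.
have [n3 _|n3 n2] := leqP 3 n; first exact/strong_crit1_crit2/strong_crit1_Sn3.
have -> : n = 2 by lia.
exact: S2_crit2.
Qed.

Lemma Sn_trivial : ~ 2 <= n -> [/\ ~ crit2 (Sn n), ~ crit3 (Sn n) & ~ crit4 (Sn n)].
Proof.
move=> n2; have -> : n = 1 by lia.
have t := S1_trivial.
by split; [apply: trivial_not_crit2 | apply: trivial_not_crit3 | apply: trivial_not_crit4].
Qed.

Lemma Sn_pairs_inverted : ~ 6 <= n -> pairs_inverted (Sn n).
Proof.
move=> n6; have [n2|n2] := leqP 2 n.
  by have [|] := @pairs_inverted_SnAn n; first by lia.
have -> : n = 1 by lia.
exact: trivial_pairs_inverted S1_trivial.
Qed.

Lemma An_crit1 : n = 1 \/ n = 2 \/ n = 5 \/ 9 <= n -> crit1 (An n).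
Proof.
have t : n <= 2 -> crit1 (An n).
  by move=> n2; apply: trivial_crit1 => x; apply: A12_trivial; rewrite n1.
case=> [e|[e|[->|n9]]]; [apply: t; lia | apply: t; lia | |].
  exact: strong_crit1_crit1 strong_crit1_A5.
exact/strong_crit1_crit1/strong_crit1_An9.
Qed.

Lemma An_not_crit1 : ~ (n = 1 \/ n = 2 \/ n = 5 \/ 9 <= n) -> ~ crit1 (An n).
Proof.
move=> nn; have : n = 3 \/ n = 4 \/ n = 6 \/ n = 7 \/ n = 8 by lia.
case=> [->|[->|[->|[->|->]]]].
- by case: A3_three_involutions.
- by case: A4_three_involutions.
- exact: A6_not_crit1.
- exact: A7_not_crit1.
- exact: A8_not_crit1.
Qed.

Lemma An_crit2 : 5 <= n -> crit2 (An n).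
Proof.
move=> n5; have [n9|n9] := leqP 9 n; first exact/strong_crit1_crit2/strong_crit1_An9.
have : n = 5 \/ n = 6 \/ n = 7 \/ n = 8 by lia.
case=> [->|[->|[->|->]]].
- exact: strong_crit1_crit2 strong_crit1_A5.
- exact: crit2_A6.
- exact: crit2_A7.
- exact: crit2_A8.
Qed.

Lemma An_not_crit23 : ~ 5 <= n -> ~ crit2 (An n) /\ ~ crit3 (An n).
Proof.
move=> n5; have [n2|n2] := leqP n 2.
  have t (x : An n) : x = 1%g by apply: A12_trivial; rewrite n1.
  by split; [apply: trivial_not_crit2 | apply: trivial_not_crit3].
have : n = 3 \/ n = 4 by lia.
case=> ->; [have [] := A3_three_involutions | have [] := A4_three_involutions]; by [].
Qed.

Lemma An_crit4 : 4 <= n -> crit4 (An n).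
Proof.
have [n5 _|n5 n4] := leqP 5 n; first exact/crit2_crit4/An_crit2.
have -> : n = 4 by lia.
exact: crit4_A4.
Qed.

Lemma An_not_crit4 : ~ 4 <= n -> ~ crit4 (An n).
Proof.
move=> n4; have [n2|n2] := leqP n 2.
  by apply: trivial_not_crit4 => x; apply: A12_trivial; rewrite n1.
have -> : n = 3 by lia.
exact: A3_not_crit4.
Qed.

Lemma An_pairs_inverted : ~ 7 <= n -> pairs_inverted (An n).
Proof.
move=> n7; have [->|n6] := eqVneq n 6; first exact: A6_pairs_inverted.
have [n2|n2] := leqP 2 n.
  by have [|] := @pairs_inverted_SnAn n; first by lia.
by apply: trivial_pairs_inverted => x; apply: A12_trivial; lia.
Qed.

Lemma An_not_crit2ex : ~ 8 <= n -> ~ crit2ex (An n).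
Proof.
move=> n8; have [->|n7] := eqVneq n 7; first exact: A7_not_crit2ex.
by apply/pairs_inverted_crit2ex/An_pairs_inverted; lia.
Qed.

Lemma An_crit5 : 7 <= n -> crit5 (An n).
Proof.
have [n8 _|n8 n7] := leqP 8 n; first exact/crit2ex_crit5/crit2ex_An.
have -> : n = 7 by lia.
exact: crit5_A7.
Qed.

End Degrees.

Lemma L2_not_crit1 (F : finFieldType) : crit1 (L2 F) ->
  #|F| <> 3 /\ #|F| <> 7 /\ #|F| <> 9.
Proof.
move=> c; split; [|split] => q; move: c.
- by have [] := L2_three_involutions q.
- exact: L2_seven.
- exact: L2_nine.
Qed.

Theorem theorem1p1 (T : map_class) (n q p k : nat) (F : finFieldType)
    (hn : 1 <= n) (hp : prime p) (hk : 0 < k) (hq : q = p ^ k)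
    (hF : #|F| = q) :
  (T = T1 ->
     [/\ realised T (Sn n),
         realised T (An n) <-> (n = 1 \/ n = 2 \/ n = 5 \/ 9 <= n) &
         realised T (L2 F) <-> (q <> 3 /\ q <> 7 /\ q <> 9)]) /\
  (T = T2 \/ T = T2s \/ T = T2P ->
     [/\ realised T (Sn n) <-> 2 <= n,
         realised T (An n) <-> 5 <= n &
         realised T (L2 F) <-> q <> 3]) /\
  (T = T2ex \/ T = T2sex \/ T = T2Pex ->
     [/\ realised T (Sn n) <-> 6 <= n,
         realised T (An n) <-> 8 <= n &
         ~ realised T (L2 F)]) /\
  (T = T3 ->
     [/\ realised T (Sn n) <-> 2 <= n,
         realised T (An n) <-> 5 <= n &
         realised T (L2 F) <-> q <> 3]) /\
  (T = T4 \/ T = T4s \/ T = T4P ->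
     [/\ realised T (Sn n) <-> 2 <= n,
         realised T (An n) <-> 4 <= n &
         realised T (L2 F)]) /\
  (T = T5 \/ T = T5s \/ T = T5P ->
     [/\ realised T (Sn n) <-> 6 <= n,
         realised T (An n) <-> 7 <= n &
         ~ realised T (L2 F)]).
Proof.
have iffN (P Q : Prop) : (Q -> P) -> (~ Q -> ~ P) -> (P <-> Q).
  by move=> QP nQP; split=> // p0; apply: contrapT => nq; exact: nQP nq p0.
have L2_2 := L2_crit2 hp hk hq hF.
have L2_4 := L2_crit4 hp hk hq hF.
have L2_inv := @L2_pairs_inverted F.
have L2_three : ~ q <> 3 -> ~ crit2 (L2 F) /\ ~ crit3 (L2 F).
  by move/contrapT=> q3; have [|_ ? ?] := @L2_three_involutions F; first by rewrite hF.
split; [|split; [|split; [|split; [|split]]]] => hT.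
- subst T; split; rewrite ?realised1; first exact: Sn_crit1 hn.
    by apply: iffN; [apply: An_crit1 hn | apply: An_not_crit1 hn].
  split=> [/L2_not_crit1|[n3 [n7 n9]]]; first by rewrite hF.
  exact/strong_crit1_crit1/(L2_strong_crit1 hp hk hq hF).
- split; rewrite (realised2 _ hT); apply: iffN.
  + exact: Sn_crit2 hn.
  + by case/(Sn_trivial hn).
  + exact: An_crit2 hn.
  + by case/(An_not_crit23 hn).
  + exact: L2_2.
  + by case/L2_three.
- split; rewrite (realised2ex _ hT).
  + apply: iffN; first exact: crit2ex_Sn.
    by move/(Sn_pairs_inverted hn)/pairs_inverted_crit2ex.
  + by apply: iffN; [apply: crit2ex_An | apply: An_not_crit2ex hn].
  + exact: pairs_inverted_crit2ex.
- subst T; split; rewrite realised3; apply: iffN.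
  + by move/(Sn_crit2 hn)/crit2_crit3.
  + by case/(Sn_trivial hn).
  + by move/(An_crit2 hn)/crit2_crit3.
  + by case/(An_not_crit23 hn).
  + by move/L2_2/crit2_crit3.
  + by case/L2_three.
- split; rewrite (realised4 _ hT).
  + apply: iffN; first by move/(Sn_crit2 hn)/crit2_crit4.
    by case/(Sn_trivial hn).
  + by apply: iffN; [apply: An_crit4 hn | apply: An_not_crit4 hn].
  + exact: L2_4.
- split; rewrite (realised5 _ hT).
  + apply: iffN; first by move/crit2ex_Sn/crit2ex_crit5.
    by move/(Sn_pairs_inverted hn)/pairs_inverted_crit5.
  + apply: iffN; first exact: An_crit5 hn.
    by move/(An_pairs_inverted hn)/pairs_inverted_crit5.
  + exact: pairs_inverted_crit5.
Qed.
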